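(* Let $c(n)$, $n\ge 0$, be the Fourier coefficients of the modular invariant $j$, and let $r(n)=\frac{c(n+1)}{c(n)}$. For $n\ge 1$ put $$h(n)=1+\frac{2\pi}{n^{1/2}}+\frac{-\frac34+2\pi^2}{n}+\frac{\frac{3}{64\pi}-2\pi+\frac{4\pi^3}{3}}{n^{3/2}}+\frac{\frac34+\frac{3}{256\pi^2}-\frac{5\pi^2}{2}+\frac{2\pi^4}{3}}{n^2},$$ $$f(n)=h(n)+\frac{25.9592}{n^{5/2}}-\frac{1.78935}{n^3}-\frac{18.3114}{n^{7/2}}-\frac{11.5407}{n^4},\qquad g(n)=h(n)+\frac{25.9593}{n^{5/2}}-\frac{0.78879}{n^3}.$$ Then for all integers $n\ge 1$, $f(n)\le r(n)\le g(n)$.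
   Context: The modular invariant $j$ is defined for $\tau$ in the upper half-plane, with $q=e^{2\pi i\tau}$, by $$j(\tau)=\frac{\left(1+240\sum_{n\ge 1}\sigma_3(n)q^n\right)^3}{q\prod_{n\ge 1}(1-q^n)^{24}}=q^{-1}+\sum_{n\ge 0}c(n)q^n=q^{-1}+744+196884q+21493760q^2+\cdots,$$ where $\sigma_3(n)=\sum_{d\mid n}d^3$. This defines the integers $c(n)$, $n\ge 0$. The decimal constants in the statement are exact decimal numbers. *)

(* Defs.v *)
From Stdlib Require Import Reals ZArith List.
From Coquelicot Require Import Coquelicot.

Open Scope R_scope.

(* Limits in C are taken componentwise, and [Lim_seq] is total: the value is
   meaningful only for convergent sequences, which is the case for the two
   limits below as soon as |q| < 1. *)
Definition CLim_seq (u : nat -> C) : C :=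
  (real (Lim_seq (fun n => Re (u n))), real (Lim_seq (fun n => Im (u n)))).

Definition CSeries (a : nat -> C) : C := CLim_seq (sum_n a).

Fixpoint Cprod_n (a : nat -> C) (n : nat) : C :=
  match n with
  | O => a O
  | S m => (Cprod_n a m * a (S m))%C
  end.

Definition CInfProd (a : nat -> C) : C := CLim_seq (Cprod_n a).

Definition Cexp (z : C) : C :=
  (exp (Re z) * cos (Im z), exp (Re z) * sin (Im z)).

Definition nome (tau : C) : C := Cexp (RtoC 2 * RtoC PI * Ci * tau)%C.

Definition sigma3 (n : nat) : nat :=
  list_sum (map (fun d => (d ^ 3)%nat)
                (filter (fun d => Nat.eqb (n mod d) 0) (seq 1 n))).

(* Sums and products over n >= 1 are indexed from 0 through [S n]. *)
Definition j_invariant (tau : C) : C :=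
  let q := nome tau in
  (Cpow (RtoC 1 + RtoC 240 * CSeries (fun n =>
           RtoC (INR (sigma3 (S n))) * Cpow q (S n))) 3
   / (q * CInfProd (fun n => Cpow (RtoC 1 - Cpow q (S n)) 24)))%C.

(* j(tau) = q^-1 + sum_(n >= 0) c(n) q^n on the whole upper half-plane. *)
Definition j_fourier_coefficients (c : nat -> Z) : Prop :=
  forall tau : C, 0 < Im tau ->
    is_series (fun n : nat => (RtoC (IZR (c n)) * Cpow (nome tau) n)%C)
              (j_invariant tau - / nome tau)%C.

Definition ratio (c : nat -> Z) (n : nat) : R := IZR (c (S n)) / IZR (c n).

Definition h_fun (n : nat) : R :=
  let x := INR n in
  1 + 2 * PI / Rpower x (1 / 2)
  + (- (3 / 4) + 2 * PI ^ 2) / x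
  + (3 / (64 * PI) - 2 * PI + 4 * PI ^ 3 / 3) / Rpower x (3 / 2)
  + (3 / 4 + 3 / (256 * PI ^ 2) - 5 * PI ^ 2 / 2 + 2 * PI ^ 4 / 3) / x ^ 2.

Definition f_fun (n : nat) : R :=
  let x := INR n in
  h_fun n + 25.9592 / Rpower x (5 / 2) - 1.78935 / x ^ 3
  - 18.3114 / Rpower x (7 / 2) - 11.5407 / x ^ 4.

Definition g_fun (n : nat) : R :=
  let x := INR n in
  h_fun n + 25.9593 / Rpower x (5 / 2) - 0.78879 / x ^ 3.

(* Main.v *)
(** The modularity of [j = E_4^3 / Delta] under tau -> -1/tau is derived from the partial
    fractions of the cotangent: they give Lipschitz's formula, hence the transformation
    of E_4 and, up to the usual correction term, of E_2, which is the logarithmic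
    derivative of Delta. Comparing j near the cusp 0 with the inverted principal part on
    the line Im tau = 1 / sqrt n (the mean over many points of that line isolates the
    n-th coefficient), c(n) equals (2 PI / sqrt n) I_1(4 PI sqrt n) up to an exponentially
    smaller error. The quotient of two Bessel values is enclosed by quotients of truncated
    asymptotic expansions, whose last coefficient is perturbed so that a Wronskian is
    monotone. In the variable u = 1 / (4 PI sqrt n) the claim then becomes two polynomial
    inequalities whose first five coefficients vanish identically, while the remaining
    part is positive by interval arithmetic. This covers n >= 100; the smaller n are
    settled by computing c(n) from E_4^3 prod (1 - q^k)^(-24). *)

Require Import Defs.
From Stdlib Require Import Reals ZArith QArith Qreals Ratan Machin Lia Lra Psatz List.
From Coquelicot Require Import Coquelicot.
From Stdlib Require Import ssreflect.

Open Scope R_scope.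

(** * Series of complex numbers *)

Fixpoint bigs (f : nat -> C) (n : nat) : C :=
  match n with O => RtoC 0 | S m => (bigs f m + f m)%C end.

Definition Clim (u : nat -> C) (l : C) : Prop :=
  is_lim_seq (fun n => Re (u n)) (Re l) /\ is_lim_seq (fun n => Im (u n)) (Im l).

Definition is_cs (a : nat -> C) (l : C) : Prop :=
  is_series (fun n => Re (a n)) (Re l) /\ is_series (fun n => Im (a n)) (Im l).

Definition cabs (a : nat -> C) : Prop := ex_series (fun n => Cmod (a n)).

Lemma C_eq (z w : C) : Re z = Re w -> Im z = Im w -> z = w.
Proof. destruct z, w; simpl; intros -> ->; reflexivity. Qed.

Lemma RtoC_m1 : RtoC (-1) = (- RtoC 1)%C.
Proof. apply C_eq; simpl; ring. Qed.

Lemma im_le_Cmod (c : C) : Rabs (Im c) <= Cmod c.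
Proof.
  apply Rle_trans with (2 := Rmax_Cmod c). apply Rmax_r.
Qed.

Lemma Cmod_le_re_im (c : C) : Cmod c <= Rabs (Re c) + Rabs (Im c).
Proof.
  have {1}-> : c = (RtoC (Re c) + Ci * RtoC (Im c))%C.
  { apply C_eq; simpl; ring. }
  apply Rle_trans with (1 := Cmod_triangle _ _).
  rewrite Cmod_mult Cmod_Ci !Cmod_R. lra.
Qed.

Lemma Re_sum_n (a : nat -> C) (n : nat) :
  Re (sum_n a n) = sum_n (fun k => Re (a k)) n.
Proof. elim: n => [|n IH]; [by rewrite !sum_O|by rewrite !sum_Sn -IH]. Qed.

Lemma Im_sum_n (a : nat -> C) (n : nat) :
  Im (sum_n a n) = sum_n (fun k => Im (a k)) n.
Proof. elim: n => [|n IH]; [by rewrite !sum_O|by rewrite !sum_Sn -IH]. Qed.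

Lemma sum_n_bigs (a : nat -> C) (n : nat) : sum_n a n = bigs a (S n).
Proof.
  elim: n => [|n IH]; first by rewrite sum_O /= Cplus_0_l.
  by rewrite sum_Sn IH.
Qed.

Lemma CSeries_eq (a : nat -> C) :
  CSeries a = (Series (fun n => Re (a n)), Series (fun n => Im (a n))).
Proof.
  rewrite /CSeries /CLim_seq /Series. f_equal; f_equal; apply Lim_seq_ext => n.
  - apply Re_sum_n.
  - apply Im_sum_n.
Qed.

Lemma CSeries_ext (a b : nat -> C) : (forall n, a n = b n) -> CSeries a = CSeries b.
Proof.
  move=> H; rewrite !CSeries_eq; f_equal; apply Series_ext => n; by rewrite H.
Qed.

Lemma is_cs_unique a l : is_cs a l -> CSeries a = l.
Proof.
  move=> [H1 H2]. rewrite CSeries_eq.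
  rewrite (is_series_unique _ _ H1) (is_series_unique _ _ H2). by destruct l.
Qed.

Lemma is_cs_ext a b l : (forall n, a n = b n) -> is_cs a l -> is_cs b l.
Proof.
  move=> H [H1 H2]; split.
  - eapply is_series_ext; [|exact H1] => n /=; by rewrite H.
  - eapply is_series_ext; [|exact H2] => n /=; by rewrite H.
Qed.

Lemma Clim_unique u l l' : Clim u l -> Clim u l' -> l = l'.
Proof.
  move=> [H1 H2] [H3 H4]; apply C_eq.
  - have := is_lim_seq_unique _ _ H3. rewrite (is_lim_seq_unique _ _ H1). congruence.
  - have := is_lim_seq_unique _ _ H4. rewrite (is_lim_seq_unique _ _ H2). congruence.
Qed.

Lemma Clim_ext u v l : (forall n, u n = v n) -> Clim u l -> Clim v l.
Proof.
  move=> H [H1 H2]; split.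
  - eapply is_lim_seq_ext; [|exact H1] => n /=; by rewrite H.
  - eapply is_lim_seq_ext; [|exact H2] => n /=; by rewrite H.
Qed.

Lemma Clim_ext_loc u v l : eventually (fun n => u n = v n) -> Clim u l -> Clim v l.
Proof.
  move=> H [H1 H2]; split.
  - eapply is_lim_seq_ext_loc; [|exact H1]. apply: filter_imp H => n /= H. by rewrite H.
  - eapply is_lim_seq_ext_loc; [|exact H2]. apply: filter_imp H => n /= H. by rewrite H.
Qed.

Lemma Clim_const c : Clim (fun _ => c) c.
Proof. split; apply is_lim_seq_const. Qed.

Lemma Clim_plus u v a b : Clim u a -> Clim v b -> Clim (fun n => u n + v n)%C (a + b)%C.
Proof.
  move=> [H1 H2] [H3 H4]; split; rewrite ?re_plus ?im_plus.
  - apply: (is_lim_seq_ext (fun n => Re (u n) + Re (v n))) => [n|]; first by [].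
    by apply: is_lim_seq_plus'.
  - apply: (is_lim_seq_ext (fun n => Im (u n) + Im (v n))) => [n|]; first by [].
    by apply: is_lim_seq_plus'.
Qed.

Lemma Clim_mult u v a b : Clim u a -> Clim v b -> Clim (fun n => u n * v n)%C (a * b)%C.
Proof.
  move=> [H1 H2] [H3 H4]; split; rewrite ?re_mult ?im_mult.
  - apply: (is_lim_seq_ext (fun n => Re (u n) * Re (v n) - Im (u n) * Im (v n))) => [n|].
    by [].
    apply: is_lim_seq_minus'; by apply: is_lim_seq_mult'.
  - apply: (is_lim_seq_ext (fun n => Re (u n) * Im (v n) + Im (u n) * Re (v n))) => [n|].
    by [].
    apply: is_lim_seq_plus'; by apply: is_lim_seq_mult'.
Qed.

Lemma Clim_scal c u a : Clim u a -> Clim (fun n => c * u n)%C (c * a)%C.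
Proof. move=> H. apply: Clim_mult => //. apply Clim_const. Qed.

Lemma Clim_opp u a : Clim u a -> Clim (fun n => - u n)%C (- a)%C.
Proof.
  move=> H. apply: (Clim_ext (fun n => RtoC (-1) * u n)%C) => [n|].
  - rewrite RtoC_m1. ring.
  - rewrite (_ : (- a = RtoC (-1) * a)%C); last by rewrite RtoC_m1; ring.
    by apply: Clim_scal.
Qed.

Lemma Clim_minus u v a b : Clim u a -> Clim v b -> Clim (fun n => u n - v n)%C (a - b)%C.
Proof. move=> H1 H2. apply: Clim_plus => //. by apply: Clim_opp. Qed.

Lemma is_lim_seq_sq (u : nat -> R) (l : R) :
  is_lim_seq u l -> is_lim_seq (fun n => u n ^ 2) (l ^ 2).
Proof.
  move=> H. do 2 (apply: is_lim_seq_mult' => //). apply: is_lim_seq_const.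
Qed.

Lemma C_nz_sq (z : C) : z <> RtoC 0 -> Re z ^ 2 + Im z ^ 2 <> 0.
Proof.
  move=> H. rewrite -Cmod2_alt. apply pow_nonzero.
  move/Cmod_gt_0: H. lra.
Qed.

Lemma Clim_inv u a : a <> RtoC 0 -> Clim u a -> Clim (fun n => / u n)%C (/ a)%C.
Proof.
  move=> Ha [H1 H2].
  have Hd : is_lim_seq (fun n => Re (u n) ^ 2 + Im (u n) ^ 2) (Re a ^ 2 + Im a ^ 2).
  { by apply: is_lim_seq_plus'; apply: is_lim_seq_sq. }
  have Hn := C_nz_sq _ Ha.
  split.
  - apply: (is_lim_seq_ext (fun n => Re (u n) / (Re (u n) ^ 2 + Im (u n) ^ 2))).
    + move=> n. by [].
    + by apply: is_lim_seq_div'.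
  - apply: (is_lim_seq_ext (fun n => - Im (u n) / (Re (u n) ^ 2 + Im (u n) ^ 2))).
    + move=> n. by [].
    + apply: is_lim_seq_div' => //. exact: (proj1 (is_lim_seq_opp (fun n => Im (u n)) (Finite (Im a))) H2).
Qed.

Lemma Clim_Cmod u l : Clim u l -> is_lim_seq (fun n => Cmod (u n)) (Cmod l).
Proof.
  move=> [H1 H2].
  apply: (is_lim_seq_continuous sqrt (fun n => Re (u n) ^ 2 + Im (u n) ^ 2)).
  - apply: continuity_pt_sqrt. nra.
  - by apply: is_lim_seq_plus'; apply: is_lim_seq_sq.
Qed.

Lemma Clim_squeeze u l (e : nat -> R) :
  (forall n, Cmod (u n - l) <= e n) -> is_lim_seq e 0 -> Clim u l.
Proof.
  move=> H He. split.
  - rewrite -(Rplus_0_l (Re l)).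
    apply: (is_lim_seq_ext (fun n => (Re (u n) - Re l) + Re l)) => [n|]; first ring.
    apply: is_lim_seq_plus'; last by apply is_lim_seq_const.
    apply/is_lim_seq_abs_0. apply: is_lim_seq_le_le (is_lim_seq_const 0) He => n.
    split; first by apply Rabs_pos.
    apply: Rle_trans (H n). rewrite -(_ : Re (u n - l) = Re (u n) - Re l) //. apply re_le_Cmod.
  - rewrite -(Rplus_0_l (Im l)).
    apply: (is_lim_seq_ext (fun n => (Im (u n) - Im l) + Im l)) => [n|]; first ring.
    apply: is_lim_seq_plus'; last by apply is_lim_seq_const.
    apply/is_lim_seq_abs_0. apply: is_lim_seq_le_le (is_lim_seq_const 0) He => n.
    split; first by apply Rabs_pos.
    apply: Rle_trans (H n). rewrite -(_ : Im (u n - l) = Im (u n) - Im l) //. apply im_le_Cmod.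
Qed.

Lemma Clim_subseq u l (phi : nat -> nat) :
  filterlim phi eventually eventually -> Clim u l -> Clim (fun n => u (phi n)) l.
Proof.
  move=> H [H1 H2]; split.
  - by apply: (is_lim_seq_subseq (fun n => Re (u n))).
  - by apply: (is_lim_seq_subseq (fun n => Im (u n))).
Qed.

Lemma Clim_incr_1 u l : Clim u l <-> Clim (fun n => u (S n)) l.
Proof.
  rewrite /Clim. rewrite (is_lim_seq_incr_1 (fun n => Re (u n))).
  by rewrite (is_lim_seq_incr_1 (fun n => Im (u n))).
Qed.

Lemma is_cs_Clim a l : is_cs a l <-> Clim (bigs a) l.
Proof.
  rewrite /is_cs /Clim /is_series.
  rewrite (is_lim_seq_incr_1 (fun n => Re (bigs a n))).
  rewrite (is_lim_seq_incr_1 (fun n => Im (bigs a n))).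
  split; move=> [H1 H2]; split.
  - apply: (is_lim_seq_ext (sum_n (fun n => Re (a n)))) => // n. by rewrite -sum_n_bigs Re_sum_n.
  - apply: (is_lim_seq_ext (sum_n (fun n => Im (a n)))) => // n. by rewrite -sum_n_bigs Im_sum_n.
  - refine (is_lim_seq_ext _ (sum_n (fun n => Re (a n))) _ _ H1) => n.
    by rewrite -sum_n_bigs Re_sum_n.
  - refine (is_lim_seq_ext _ (sum_n (fun n => Im (a n))) _ _ H2) => n.
    by rewrite -sum_n_bigs Im_sum_n.
Qed.

Lemma is_series_C_cs (a : nat -> C) (l : C) :
  @is_series C_AbsRing C_NormedModule a l <-> is_cs a l.
Proof.
  rewrite /is_series /is_cs /is_series. split.
  - move=> H; split.
    + apply: (filterlim_ext (fun n => Re (sum_n a n))); first by move=> n; apply Re_sum_n.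
      apply: (filterlim_comp _ _ _ _ _ _ _ _ H).
      move=> P [e HP]. exists e => y [Hy _]. by apply: HP.
    + apply: (filterlim_ext (fun n => Im (sum_n a n))); first by move=> n; apply Im_sum_n.
      apply: (filterlim_comp _ _ _ _ _ _ _ _ H).
      move=> P [e HP]. exists e => y [_ Hy]. by apply: HP.
  - move=> [H1 H2] P [e HP].
    have K1 := H1 (ball (Re l) e) (locally_ball _ _).
    have K2 := H2 (ball (Im l) e) (locally_ball _ _).
    rewrite /filtermap /= in K1 K2 |- *.
    apply: filter_imp (filter_and _ _ K1 K2) => n [L1 L2].
    apply: HP. split.
    + by rewrite -Re_sum_n in L1.
    + by rewrite -Im_sum_n in L2.
Qed.

Lemma cabs_re a : cabs a -> ex_series (fun n => Re (a n)).
Proof.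
  move=> H. apply: ex_series_Rabs. apply: (ex_series_le _ (fun n => Cmod (a n))) => // n.
  rewrite /norm /= /abs /= Rabs_Rabsolu. apply re_le_Cmod.
Qed.

Lemma cabs_im a : cabs a -> ex_series (fun n => Im (a n)).
Proof.
  move=> H. apply: ex_series_Rabs. apply: (ex_series_le _ (fun n => Cmod (a n))) => // n.
  rewrite /norm /= /abs /= Rabs_Rabsolu. apply im_le_Cmod.
Qed.

Lemma cabs_is a : cabs a -> is_cs a (CSeries a).
Proof.
  move=> H. rewrite CSeries_eq. split; apply Series_correct.
  - by apply cabs_re.
  - by apply cabs_im.
Qed.

Lemma cabs_Clim a : cabs a -> Clim (bigs a) (CSeries a).
Proof. move=> H. by apply/is_cs_Clim; apply cabs_is. Qed.

Lemma cabs_le a (b : nat -> R) : (forall n, Cmod (a n) <= b n) -> ex_series b -> cabs a.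
Proof.
  move=> H Hb. apply: (ex_series_le _ b) => // n.
  rewrite /norm /= /abs /= Rabs_pos_eq //. apply Cmod_ge_0.
Qed.

Lemma cabs_ext a b : (forall n, a n = b n) -> cabs a -> cabs b.
Proof. move=> H. apply: ex_series_ext => n. by rewrite H. Qed.

Lemma cabs_plus a b : cabs a -> cabs b -> cabs (fun n => a n + b n)%C.
Proof.
  move=> Ha Hb. apply: (cabs_le _ (fun n => Cmod (a n) + Cmod (b n))).
  - move=> n. apply Cmod_triangle.
  - by apply: (ex_series_plus (fun n => Cmod (a n))).
Qed.

Lemma cabs_scal c a : cabs a -> cabs (fun n => c * a n)%C.
Proof.
  move=> Ha. apply: (ex_series_ext (fun n => Cmod c * Cmod (a n))).
  - move=> n. by rewrite Cmod_mult.
  - by apply: (ex_series_scal (Cmod c) (fun n => Cmod (a n))).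
Qed.

Lemma cabs_incr_1 a : cabs a <-> cabs (fun n => a (S n)).
Proof. apply: (ex_series_incr_1 (fun n => Cmod (a n))). Qed.

Lemma is_cs_plus a b la lb : is_cs a la -> is_cs b lb -> is_cs (fun n => a n + b n)%C (la + lb)%C.
Proof.
  move=> [H1 H2] [H3 H4]; split.
  - by apply: (is_series_plus (fun n => Re (a n)) (fun n => Re (b n))).
  - by apply: (is_series_plus (fun n => Im (a n)) (fun n => Im (b n))).
Qed.

Lemma bigs_scal c a n : bigs (fun k => c * a k)%C n = (c * bigs a n)%C.
Proof. elim: n => [|n IH] /=; first by ring. rewrite IH; ring. Qed.

Lemma bigs_ext a b n : (forall k, (k < n)%nat -> a k = b k) -> bigs a n = bigs b n.
Proof.
  elim: n => [|n IH] //= H. rewrite IH; last by move=> k Hk; apply: H; lia.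
  by rewrite H //; lia.
Qed.

Lemma bigs_plus a b n : bigs (fun k => a k + b k)%C n = (bigs a n + bigs b n)%C.
Proof. elim: n => [|n IH] /=; first by ring. rewrite IH; ring. Qed.

Lemma bigs_add a n m : bigs a (n + m) = (bigs a n + bigs (fun k => a (n + k)%nat) m)%C.
Proof.
  elim: m => [|m IH] /=; first by rewrite Nat.add_0_r; ring.
  rewrite Nat.add_succ_r /= IH; ring.
Qed.

Lemma bigs_zero a n : (forall k, (k < n)%nat -> a k = RtoC 0) -> bigs a n = RtoC 0.
Proof.
  elim: n => [|n IH] //= H. rewrite IH; last by move=> k Hk; apply: H; lia.
  rewrite H; [ring|lia].
Qed.

Lemma bigs_rev a n : bigs a n = bigs (fun k => a (n - 1 - k)%nat) n.
Proof.
  elim: n => [|n IH] //.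
  rewrite (bigs_add (fun k => a (S n - 1 - k)%nat) 1 n) /=.
  have -> : bigs (fun k => a (n - 0 - S k)%nat) n = bigs a n.
  { rewrite IH. apply: bigs_ext => k Hk. f_equal. lia. }
  rewrite !Nat.sub_0_r. ring.
Qed.

Lemma Cmod_bigs_le a n : Cmod (bigs a (S n)) <= sum_n (fun k => Cmod (a k)) n.
Proof.
  elim: n => [|n IH]; first by rewrite sum_O /= Cplus_0_l; apply Rle_refl.
  rewrite sum_Sn. apply: Rle_trans (Cmod_triangle _ _) _.
  apply: Rplus_le_compat IH (Rle_refl _).
Qed.

Lemma is_cs_scal c a l : is_cs a l -> is_cs (fun n => c * a n)%C (c * l)%C.
Proof.
  move/is_cs_Clim => H. apply/is_cs_Clim.
  apply: (Clim_ext (fun n => c * bigs a n)%C) => [n|]; first by rewrite bigs_scal.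
  by apply: Clim_scal.
Qed.

Lemma is_cs_minus a b la lb : is_cs a la -> is_cs b lb -> is_cs (fun n => a n - b n)%C (la - lb)%C.
Proof.
  move=> H1 H2. rewrite (_ : (la - lb = la + RtoC (-1) * lb)%C); last by rewrite RtoC_m1; ring.
  apply: (is_cs_ext (fun n => a n + RtoC (-1) * b n)%C).
  - move=> n. rewrite RtoC_m1. ring.
  - apply: is_cs_plus => //. by apply: is_cs_scal.
Qed.

Lemma is_cs_incr_1 a l : is_cs a l <-> is_cs (fun n => a (S n)) (l - a O)%C.
Proof.
  have E : forall n, bigs a (S n) = (a O + bigs (fun n => a (S n)) n)%C.
  { move=> n. rewrite (bigs_add a 1 n) /=. ring. }
  rewrite !is_cs_Clim (Clim_incr_1 (bigs a)). split => H.
  - apply: (Clim_ext (fun n => bigs a (S n) - a O)%C).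
    + move=> n. rewrite E. ring.
    + apply: Clim_minus => //. apply Clim_const.
  - apply: (Clim_ext (fun n => a O + bigs (fun n => a (S n)) n)%C).
    + move=> n. by rewrite E.
    + rewrite (_ : l = (a O + (l - a O))%C); last by ring.
      apply: Clim_plus => //. apply Clim_const.
Qed.

Lemma CSeries_plus a b : cabs a -> cabs b ->
  CSeries (fun n => a n + b n)%C = (CSeries a + CSeries b)%C.
Proof. move=> Ha Hb. apply: is_cs_unique. by apply: is_cs_plus; apply: cabs_is. Qed.

Lemma CSeries_scal c a : cabs a -> CSeries (fun n => c * a n)%C = (c * CSeries a)%C.
Proof. move=> Ha. apply: is_cs_unique. by apply: is_cs_scal; apply: cabs_is. Qed.

Lemma CSeries_minus a b : cabs a -> cabs b ->
  CSeries (fun n => a n - b n)%C = (CSeries a - CSeries b)%C.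
Proof. move=> Ha Hb. apply: is_cs_unique. by apply: is_cs_minus; apply: cabs_is. Qed.

Lemma CSeries_incr_1 a : cabs a -> CSeries a = (a O + CSeries (fun n => a (S n)))%C.
Proof.
  move=> Ha.
  have H := cabs_is _ Ha. move/is_cs_incr_1/is_cs_unique: H => ->. ring.
Qed.

Lemma Cmod_CSeries_le a : cabs a -> Cmod (CSeries a) <= Series (fun n => Cmod (a n)).
Proof.
  move=> Ha.
  have H1 := Clim_Cmod _ _ (cabs_Clim _ Ha).
  have H2 : is_lim_seq (sum_n (fun n => Cmod (a n))) (Series (fun n => Cmod (a n))).
  { apply: Series_correct Ha. }
  move/is_lim_seq_incr_1: H1 => H1.
  apply: (is_lim_seq_le _ _ (Finite _) (Finite _) _ H1 H2) => n. apply Cmod_bigs_le.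
Qed.

Lemma ex_series_zero : ex_series (fun _ : nat => 0).
Proof.
  have H : is_lim_seq (sum_n (fun _ : nat => 0)) 0.
  { apply: (is_lim_seq_ext (fun _ => 0)); last by apply is_lim_seq_const.
    move=> n. rewrite sum_n_const. ring. }
  by exists 0.
Qed.

Lemma cabs_sum_n (a : nat -> nat -> C) n :
  (forall k, cabs (fun i => a i k)) -> cabs (fun i => bigs (a i) n).
Proof.
  move=> H. elim: n => [|n IH] /=.
  - apply: (cabs_le _ (fun _ => 0)); first by move=> n; rewrite Cmod_0; apply Rle_refl.
    apply ex_series_zero.
  - by apply: cabs_plus.
Qed.

Lemma CSeries_bigs (a : nat -> nat -> C) n :
  (forall k, cabs (fun i => a i k)) ->
  CSeries (fun i => bigs (a i) n) = bigs (fun k => CSeries (fun i => a i k)) n.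
Proof.
  move=> H. elim: n => [|n IH] /=.
  - apply: is_cs_unique. apply/is_cs_Clim.
    apply: (Clim_ext (fun _ => RtoC 0)); last by apply Clim_const.
    move=> n. by rewrite bigs_zero.
  - rewrite CSeries_plus //; [by rewrite IH|by apply: cabs_sum_n].
Qed.

Lemma Rtannery (a : nat -> nat -> R) (l b : nat -> R) :
  ex_series b ->
  (forall k, is_lim_seq (fun N => a N k) (l k)) ->
  eventually (fun N => forall k, Rabs (a N k) <= b k) ->
  ex_series l /\ is_lim_seq (fun N => Series (a N)) (Series l).
Proof.
  move=> Hb Hl Hd.
  have Hlb : forall k, Rabs (l k) <= b k.
  { move=> k.
    have H1 : is_lim_seq (fun N => Rabs (a N k)) (Rabs (l k)).
    { apply: (is_lim_seq_abs _ (l k)); apply Hl. }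
    apply: (is_lim_seq_le_loc _ _ (Finite _) (Finite _) _ H1 (is_lim_seq_const (b k))).
    by apply: filter_imp Hd. }
  have Hbp : forall k, 0 <= b k by move=> k; apply: Rle_trans (Rabs_pos _) (Hlb k).
  have Hle : forall (u : nat -> R), (forall k, Rabs (u k) <= b k) -> ex_series u.
  { move=> u Hu. by apply: (ex_series_le _ b). }
  have Hel := Hle _ Hlb.
  split => //.
  apply/is_lim_seq_Reals => e He.
  have He3 : 0 < e / 3 by lra.
  have [N HN] : exists N, Series (fun k => b (S N + k)%nat) < e / 3.
  { have Hs := Series_correct _ Hb.
    have := Hs (ball (Series b) (mkposreal _ He3)) (locally_ball _ _).
    move=> [N HN]. exists N. have := HN N (le_n _).
    rewrite /ball /= /AbsRing_ball /abs /minus /plus /opp /=.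
    rewrite (Series_incr_n b (S N) (Nat.lt_0_succ _) Hb). move=> /Rabs_def2 [_ H].
    rewrite sum_n_Reals in H. simpl in H |- *. lra. }
  have Htail : forall u, (forall k, Rabs (u k) <= b k) ->
     Rabs (Series u - sum_f_R0 u N) < e / 3.
  { move=> u Hu. rewrite (Series_incr_n u (S N) (Nat.lt_0_succ _) (Hle _ Hu)).
    have -> : sum_f_R0 u (pred (S N)) + Series (fun k => u (S N + k)%nat) - sum_f_R0 u N = Series (fun k => u (S N + k)%nat) by simpl; ring.
    apply: Rle_lt_trans HN.
    have Hx : ex_series (fun k => b (S N + k)%nat) by exact: (proj1 (ex_series_incr_n b (S N)) Hb).
    apply: Rle_trans (Series_Rabs _ _) _.
    - apply: (ex_series_le _ (fun k => b (S N + k)%nat)) => // n.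
      rewrite /norm /= /abs /= Rabs_Rabsolu. apply: Hu.
    - apply: Series_le => // n. split; [apply Rabs_pos|apply Hu]. }
  have Hfin : is_lim_seq (fun n => sum_f_R0 (a n) N) (sum_f_R0 l N).
  { clear -Hl. elim: N => [|N IH] /=; first by apply Hl. apply: is_lim_seq_plus' => //. }
  move/is_lim_seq_Reals/(_ _ He3): Hfin => [N1 HN1].
  move: Hd => [N2 HN2].
  exists (N1 + N2)%nat => n Hn. rewrite /R_dist /Rdist.
  have H1 := HN1 n ltac:(lia). rewrite /R_dist /Rdist in H1.
  have H2 := Htail (a n) (HN2 n ltac:(lia)). have H3 := Htail l Hlb.
  move/Rabs_def2: H1 => [H1 H1']. move/Rabs_def2: H2 => [H2 H2']. move/Rabs_def2: H3 => [H3 H3'].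
  apply: Rabs_def1; lra.
Qed.

Lemma tannery (a : nat -> nat -> C) (l : nat -> C) (b : nat -> R) :
  ex_series b ->
  (forall k, Clim (fun N => a N k) (l k)) ->
  eventually (fun N => forall k, Cmod (a N k) <= b k) ->
  cabs l /\ Clim (fun N => CSeries (a N)) (CSeries l).
Proof.
  move=> Hb Hl Hd. split.
  - apply: (proj1 (Rtannery (fun N k => Cmod (a N k)) (fun k => Cmod (l k)) b Hb
      (fun k => Clim_Cmod _ _ (Hl k)) _)).
    apply: filter_imp Hd => N Hd k. rewrite Rabs_pos_eq //. apply Cmod_ge_0.
  - rewrite CSeries_eq. split.
    + apply: (is_lim_seq_ext (fun N => Series (fun k => Re (a N k)))).
      { move=> n. by rewrite CSeries_eq. }
      apply: (proj2 (Rtannery (fun N k => Re (a N k)) (fun k => Re (l k)) b Hb _ _)).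
      * move=> k. apply Hl.
      * apply: filter_imp Hd => N Hd k. apply: Rle_trans (re_le_Cmod _) (Hd k).
    + apply: (is_lim_seq_ext (fun N => Series (fun k => Im (a N k)))).
      { move=> n. by rewrite CSeries_eq. }
      apply: (proj2 (Rtannery (fun N k => Im (a N k)) (fun k => Im (l k)) b Hb _ _)).
      * move=> k. apply Hl.
      * apply: filter_imp Hd => N Hd k. apply: Rle_trans (im_le_Cmod _) (Hd k).
Qed.

Lemma ex_series_bounded (b : nat -> R) (B : R) :
  (forall n, 0 <= b n) -> (forall n, sum_n b n <= B) -> ex_series b.
Proof.
  move=> H0 HB.
  have [l Hl] : ex_finite_lim_seq (sum_n b).
  { apply: (ex_finite_lim_seq_incr _ B) => // n. rewrite sum_Sn /plus /=. move: (H0 (S n)); lra. }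
  by exists l.
Qed.

Lemma Series_pos_ge_sum (b : nat -> R) n :
  (forall n, 0 <= b n) -> ex_series b -> sum_n b n <= Series b.
Proof.
  move=> H0 Hb.
  have H : is_lim_seq (sum_n b) (Series b) by apply: Series_correct Hb.
  apply: (is_lim_seq_incr_compare _ _ H) => k. rewrite sum_Sn /plus /=. move: (H0 (S k)); lra.
Qed.

Lemma Series_pos_ge_term (b : nat -> R) n :
  (forall n, 0 <= b n) -> ex_series b -> b n <= Series b.
Proof.
  move=> H0 Hb. apply: Rle_trans (Series_pos_ge_sum b n H0 Hb).
  case: n => [|n]; first by rewrite sum_O; apply Rle_refl.
  rewrite sum_Sn /plus /=.
  have : 0 <= sum_n b n.
  { elim: n => [|n IH]; first by rewrite sum_O. rewrite sum_Sn /plus /=. move: (H0 (S n)). lra. }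
  lra.
Qed.

Lemma Series_pos (b : nat -> R) : (forall n, 0 <= b n) -> ex_series b -> 0 <= Series b.
Proof.
  move=> H0 Hb. apply: Rle_trans (H0 O) _. by apply Series_pos_ge_term.
Qed.

Lemma Rfubini_pos (b : nat -> nat -> R) :
  (forall i k, 0 <= b i k) ->
  (forall i, ex_series (b i)) ->
  ex_series (fun i => Series (b i)) ->
  (forall k, ex_series (fun i => b i k)) /\ ex_series (fun k => Series (fun i => b i k)).
Proof.
  move=> H0 H1 H2.
  have Hc : forall k, ex_series (fun i => b i k).
  { move=> k. apply: (ex_series_le _ (fun i => Series (b i))) => // i.
    rewrite /norm /= /abs /= Rabs_pos_eq //. by apply Series_pos_ge_term. }
  split => //.
  have Hs : forall n, ex_series (fun i => sum_n (b i) n) /\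
     Series (fun i => sum_n (b i) n) = sum_n (fun k => Series (fun i => b i k)) n.
  { elim=> [|n [IH1 IH2]].
    - split.
      + apply: (ex_series_ext (fun i => b i O)) => // i. by rewrite sum_O.
      + rewrite sum_O. apply: Series_ext => i. by rewrite sum_O.
    - split.
      + apply: (ex_series_ext (fun i => sum_n (b i) n + b i (S n))).
        { move=> i. by rewrite sum_Sn. }
        by apply: (ex_series_plus (fun i => sum_n (b i) n)).
      + rewrite sum_Sn -IH2 /plus /=. rewrite -Series_plus //. apply: Series_ext => i.
        by rewrite sum_Sn. }
  apply: (ex_series_bounded _ (Series (fun i => Series (b i)))).
  - move=> k. by apply: Series_pos.
  - move=> n. rewrite -(proj2 (Hs n)). apply: Series_le => // i. split.
    + elim: n => [|n IH]; rewrite ?sum_O ?sum_Sn //. rewrite /plus /=. move: (H0 i (S n)). lra.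
    + by apply: Series_pos_ge_sum.
Qed.

Lemma fubini (a : nat -> nat -> C) :
  (forall i, cabs (a i)) ->
  ex_series (fun i => Series (fun k => Cmod (a i k))) ->
  cabs (fun i => CSeries (a i)) /\
  (forall k, cabs (fun i => a i k)) /\
  ex_series (fun k => Series (fun i => Cmod (a i k))) /\
  cabs (fun k => CSeries (fun i => a i k)) /\
  CSeries (fun i => CSeries (a i)) = CSeries (fun k => CSeries (fun i => a i k)).
Proof.
  move=> H1 H2.
  have [H3 H4] := Rfubini_pos (fun i k => Cmod (a i k)) (fun i k => Cmod_ge_0 _) H1 H2.
  have H5 : cabs (fun k => CSeries (fun i => a i k)).
  { apply: (cabs_le _ (fun k => Series (fun i => Cmod (a i k)))) => // k. exact: (Cmod_CSeries_le _ (H3 k)). }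
  have H6 : cabs (fun i => CSeries (a i)).
  { apply: (cabs_le _ (fun k => Series (fun i => Cmod (a k i)))) => // k. exact: (Cmod_CSeries_le _ (H1 k)). }
  do 4 (split => //).
  have Ht : Clim (fun N => CSeries (fun i => bigs (a i) N)) (CSeries (fun i => CSeries (a i))).
  { apply: (proj2 (tannery (fun N i => bigs (a i) N) (fun i => CSeries (a i))
     (fun i => Series (fun k => Cmod (a i k))) H2 (fun i => cabs_Clim _ (H1 i)) _)).
    exists O => n _ k. case: n => [|n].
    - rewrite /= Cmod_0. apply: Series_pos; [move=> i; apply Cmod_ge_0|exact: H1].
    - apply: Rle_trans (Cmod_bigs_le _ _) _. apply: (Series_pos_ge_sum (fun i => Cmod (a k i))); [move=> i; apply Cmod_ge_0|exact: H1]. }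
  apply: Clim_unique Ht _.
  apply: (Clim_ext (bigs (fun k => CSeries (fun i => a i k)))).
  { move=> n. by rewrite CSeries_bigs. }
  by apply: cabs_Clim.
Qed.

(** * Exponential, derivatives and power series *)

Ltac Rring := match goal with |- @eq _ ?a ?b => change (@eq R a b); ring end.

Lemma Cexp_add (z w : C) : Cexp (z + w)%C = (Cexp z * Cexp w)%C.
Proof.
  rewrite /Cexp re_plus im_plus exp_plus cos_plus sin_plus. apply C_eq; simpl; ring.
Qed.

Lemma Cexp_0 : Cexp (RtoC 0) = RtoC 1.
Proof. rewrite /Cexp /= exp_0 cos_0 sin_0. apply C_eq; simpl; ring. Qed.

Lemma Cmod_Cexp (z : C) : Cmod (Cexp z) = exp (Re z).
Proof.
  have H : Cmod (Cexp z) ^ 2 = exp (Re z) ^ 2.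
  { rewrite Cmod2_alt /Cexp /=. have := sin2_cos2 (Im z). rewrite /Rsqr. nra. }
  have := Cmod_ge_0 (Cexp z). have := exp_pos (Re z). nra.
Qed.

Lemma Cexp_nz (z : C) : Cexp z <> RtoC 0.
Proof. apply/Cmod_gt_0. rewrite Cmod_Cexp. apply exp_pos. Qed.

Lemma Cexp_opp (z : C) : Cexp (- z)%C = (/ Cexp z)%C.
Proof.
  have H := Cexp_nz z. have : (Cexp (- z) * Cexp z = RtoC 1)%C.
  { rewrite -Cexp_add (_ : (- z + z = RtoC 0)%C); [exact Cexp_0|ring]. }
  move=> E. rewrite -(Cmult_1_l (/ Cexp z)%C) -E. field. exact H.
Qed.

Lemma Cexp_pow (z : C) (n : nat) : Cexp (RtoC (INR n) * z)%C = Cpow (Cexp z) n.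
Proof.
  elim: n => [|n IH].
  - rewrite (_ : (RtoC (INR 0) * z)%C = RtoC 0); [exact Cexp_0|simpl; ring].
  - rewrite S_INR RtoC_plus Cmult_plus_distr_r Cexp_add IH Cmult_1_l Cpow_S. ring.
Qed.

Lemma Cexp_RtoC (x : R) : Cexp (RtoC x) = RtoC (exp x).
Proof. rewrite /Cexp /= cos_0 sin_0. apply C_eq; simpl; ring. Qed.

Lemma Cexp_2PIi : Cexp (RtoC 2 * RtoC PI * Ci)%C = RtoC 1.
Proof.
  rewrite /Cexp /=. rewrite (_ : (2 * PI - 0 * 0) * 0 - (2 * 0 + 0 * PI) * 1 = 0); last ring.
  rewrite (_ : (2 * PI - 0 * 0) * 1 + (2 * 0 + 0 * PI) * 0 = 2 * PI); last ring.
  rewrite exp_0 cos_2PI sin_2PI. apply C_eq; simpl; ring.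
Qed.

Lemma Cexp_PIi : Cexp (RtoC PI * Ci)%C = RtoC (-1).
Proof.
  rewrite /Cexp /=. rewrite (_ : PI * 0 - 0 * 1 = 0); last ring.
  rewrite (_ : PI * 1 + 0 * 0 = PI); last ring.
  rewrite exp_0 cos_PI sin_PI. apply C_eq; simpl; ring.
Qed.

Lemma exp_is_series (x : R) : is_series (fun n => x ^ n / INR (fact n)) (exp x).
Proof.
  have H := is_exp_Reals x. move/is_pseries_R: H.
  apply: is_series_ext => n. rewrite /Rdiv. Rring.
Qed.

Lemma INR_fact_pos n : 0 < INR (fact n).
Proof. apply lt_0_INR. apply lt_O_fact. Qed.

Lemma RtoC_nz (x : R) : x <> 0 -> RtoC x <> RtoC 0.
Proof. move=> H E. apply H. by apply RtoC_inj. Qed.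

Lemma Cmod_pos_R (x : R) : 0 <= x -> Cmod (RtoC x) = x.
Proof. move=> H. rewrite Cmod_R. by apply Rabs_pos_eq. Qed.

Lemma Cmod_exp_term (z : C) n :
  Cmod (Cpow z n / RtoC (INR (fact n)))%C = Cmod z ^ n / INR (fact n).
Proof.
  have H := INR_fact_pos n.
  rewrite Cmod_div; last by apply RtoC_nz; lra.
  rewrite Cmod_pow Cmod_pos_R //. lra.
Qed.

Lemma Cexps_abs (z : C) : cabs (fun n => Cpow z n / RtoC (INR (fact n)))%C.
Proof.
  exists (exp (Cmod z)). apply: is_series_ext (exp_is_series (Cmod z)) => n.
  by rewrite Cmod_exp_term.
Qed.

(* Derivatives with a quadratic remainder: the functions used are analytic, and the explicit bound keeps the chain rule elementary. *)
Definition Cder (f : C -> C) (z l : C) : Prop :=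
  exists d K : R, 0 < d /\ 0 <= K /\ forall h, Cmod h < d ->
    Cmod (f (z + h) - f z - l * h)%C <= K * Cmod h ^ 2.

Lemma Cder_ext f g z l : (forall w, f w = g w) -> Cder f z l -> Cder g z l.
Proof.
  move=> E [d [K [Hd [HK H]]]]. exists d, K. do 2 (split => //). move=> h Hh.
  rewrite -!E. by apply H.
Qed.

Lemma Cder_const c z : Cder (fun _ => c) z (RtoC 0).
Proof.
  exists 1, 0. split; first lra. split; first lra. move=> h _.
  rewrite (_ : (c - c - RtoC 0 * h = RtoC 0)%C); last ring. rewrite Cmod_0. lra.
Qed.

Lemma Cder_id z : Cder (fun w => w) z (RtoC 1).
Proof.
  exists 1, 0. split; first lra. split; first lra. move=> h _.
  rewrite (_ : (z + h - z - RtoC 1 * h = RtoC 0)%C); last ring. rewrite Cmod_0. lra.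
Qed.

Lemma Cder_plus f g z a b : Cder f z a -> Cder g z b -> Cder (fun w => f w + g w)%C z (a + b)%C.
Proof.
  move=> [d1 [K1 [Hd1 [HK1 H1]]]] [d2 [K2 [Hd2 [HK2 H2]]]].
  exists (Rmin d1 d2), (K1 + K2). split; first by apply Rmin_pos. split; first lra.
  move=> h Hh. have H3 := Rmin_l d1 d2. have H4 := Rmin_r d1 d2.
  rewrite (_ : (_ - _ - _ = (f (z + h) - f z - a * h) + (g (z + h) - g z - b * h))%C); last ring.
  apply: Rle_trans (Cmod_triangle _ _) _.
  have := H1 h ltac:(lra). have := H2 h ltac:(lra). lra.
Qed.

Lemma Cder_lip f z l : Cder f z l -> exists d L : R, 0 < d /\ 0 <= L /\ forall h, Cmod h < d ->
    Cmod (f (z + h) - f z)%C <= L * Cmod h.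
Proof.
  move=> [d [K [Hd [HK H]]]]. exists (Rmin d 1), (K + Cmod l).
  split; first by apply Rmin_pos; lra.
  have Hl := Cmod_ge_0 l. split; first lra.
  move=> h Hh. have H3 := Rmin_l d 1. have H4 := Rmin_r d 1.
  rewrite (_ : (_ - _ = (f (z + h) - f z - l * h) + l * h)%C); last ring.
  apply: Rle_trans (Cmod_triangle _ _) _. rewrite Cmod_mult.
  have := H h ltac:(lra). have := Cmod_ge_0 h. move=> P1 P2.
  have P3 : Cmod h ^ 2 <= Cmod h by nra.
  have := Rmult_le_compat_l _ _ _ HK P3. lra.
Qed.

Lemma Cder_mult f g z a b : Cder f z a -> Cder g z b ->
  Cder (fun w => f w * g w)%C z (a * g z + f z * b)%C.
Proof.
  move=> Hf Hg.
  have [e1 [L1 [He1 [HL1 F1]]]] := Cder_lip _ _ _ Hf.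
  have [e2 [L2 [He2 [HL2 F2]]]] := Cder_lip _ _ _ Hg.
  move: Hf Hg => [d1 [K1 [Hd1 [HK1 H1]]]] [d2 [K2 [Hd2 [HK2 H2]]]].
  have Hfz := Cmod_ge_0 (f z). have Hgz := Cmod_ge_0 (g z).
  exists (Rmin (Rmin d1 d2) (Rmin e1 e2)), (K1 * Cmod (g z) + Cmod (f z) * K2 + L1 * L2).
  split; first by do 2 apply Rmin_pos => //; apply Rmin_pos.
  split; first by nra.
  move=> h Hh.
  have A1 := Rmin_l (Rmin d1 d2) (Rmin e1 e2). have A2 := Rmin_r (Rmin d1 d2) (Rmin e1 e2).
  have A3 := Rmin_l d1 d2. have A4 := Rmin_r d1 d2. have A5 := Rmin_l e1 e2. have A6 := Rmin_r e1 e2.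
  rewrite (_ : (_ - _ - _ = (f (z + h) - f z - a * h) * g z + f z * (g (z + h) - g z - b * h)
     + (f (z + h) - f z) * (g (z + h) - g z))%C); last ring.
  have T1 := Cmod_triangle ((f (z + h) - f z - a * h) * g z + f z * (g (z + h) - g z - b * h))%C
      ((f (z + h) - f z) * (g (z + h) - g z))%C.
  have T2 := Cmod_triangle ((f (z + h) - f z - a * h) * g z)%C (f z * (g (z + h) - g z - b * h))%C.
  rewrite !Cmod_mult in T1 T2.
  have B1 := H1 h ltac:(lra). have B2 := H2 h ltac:(lra).
  have B3 := F1 h ltac:(lra). have B4 := F2 h ltac:(lra).
  have C1 := Cmod_ge_0 (f (z + h) - f z)%C. have C2 := Cmod_ge_0 (g (z + h) - g z)%C.
  have C3 := Cmod_ge_0 h.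
  have D1 : Cmod (f (z + h) - f z)%C * Cmod (g (z + h) - g z)%C <= (L1 * Cmod h) * (L2 * Cmod h).
  { apply Rmult_le_compat => //. }
  have D2 := Rmult_le_compat_r _ _ _ Hgz B1.
  have D3 := Rmult_le_compat_l _ _ _ Hfz B2.
  nra.
Qed.

Lemma Cder_scal c f z a : Cder f z a -> Cder (fun w => c * f w)%C z (c * a)%C.
Proof.
  move=> H. rewrite (_ : (c * a = RtoC 0 * f z + c * a)%C); last ring.
  apply: Cder_mult => //. apply Cder_const.
Qed.

Lemma Cder_comp f g z a b : Cder g z b -> Cder f (g z) a -> Cder (fun w => f (g w)) z (a * b)%C.
Proof.
  move=> Hg Hf.
  have [e2 [L2 [He2 [HL2 F2]]]] := Cder_lip _ _ _ Hg.
  move: Hf Hg => [d1 [K1 [Hd1 [HK1 H1]]]] [d2 [K2 [Hd2 [HK2 H2]]]].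
  have Ha := Cmod_ge_0 a.
  have Hp : 0 < d1 / (L2 + 1) by apply Rdiv_lt_0_compat; lra.
  exists (Rmin (Rmin d2 e2) (d1 / (L2 + 1))), (K1 * L2 ^ 2 + Cmod a * K2).
  split; first by apply Rmin_pos => //; apply Rmin_pos.
  split; first by nra.
  move=> h Hh.
  have A1 := Rmin_l (Rmin d2 e2) (d1 / (L2 + 1)). have A2 := Rmin_r (Rmin d2 e2) (d1 / (L2 + 1)).
  have A3 := Rmin_l d2 e2. have A4 := Rmin_r d2 e2.
  have B4 := F2 h ltac:(lra). have B2 := H2 h ltac:(lra). have C3 := Cmod_ge_0 h.
  set k := (g (z + h) - g z)%C in B4.
  have Hk : Cmod k < d1.
  { apply: Rle_lt_trans B4 _.
    have : Cmod h * (L2 + 1) < d1.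
    { apply: (Rlt_le_trans _ (d1 / (L2 + 1) * (L2 + 1))); last by right; field; lra.
      apply Rmult_lt_compat_r; lra. }
    nra. }
  have B1 := H1 k Hk.
  have Ek : (g z + k)%C = g (z + h)%C by rewrite /k; ring.
  rewrite Ek in B1.
  rewrite (_ : (_ - _ - _ = (f (g (z + h)) - f (g z) - a * k) + a * (g (z + h) - g z - b * h))%C);
    last by rewrite /k; ring.
  apply: Rle_trans (Cmod_triangle _ _) _. rewrite Cmod_mult.
  have D1 := Rmult_le_compat_l _ _ _ Ha B2.
  have Hk0 := Cmod_ge_0 k.
  have D2 : Cmod k ^ 2 <= (L2 * Cmod h) ^ 2 by apply pow_incr.
  nra.
Qed.

Lemma Cder_inv z : z <> RtoC 0 -> Cder (fun w => / w)%C z (- / (z * z))%C.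
Proof.
  move=> Hz. have Hp : 0 < Cmod z by apply/Cmod_gt_0.
  exists (Cmod z / 2), (2 / Cmod z ^ 3). split; first lra.
  split; first by apply Rlt_le, Rdiv_lt_0_compat; [lra|apply pow_lt].
  move=> h Hh.
  have Hzh : Cmod z / 2 <= Cmod (z + h).
  { have := Cmod_triangle (z + h) (- h). rewrite (_ : (z + h + - h = z)%C); last ring.
    rewrite Cmod_opp. lra. }
  have Hn : (z + h)%C <> RtoC 0 by apply/Cmod_gt_0; lra.
  rewrite (_ : (_ - _ - _ = h * h / (z * z * (z + h)))%C); last by field.
  have Hm : (z * z)%C <> RtoC 0 by apply Cmult_neq_0.
  rewrite Cmod_div; last by apply Cmult_neq_0.
  rewrite !Cmod_mult.
  rewrite (_ : 2 / Cmod z ^ 3 * Cmod h ^ 2 = Cmod h * Cmod h / (Cmod z * Cmod z * (Cmod z / 2)));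
    last by field; lra.
  rewrite /Rdiv. apply Rmult_le_compat_l; first by have := Cmod_ge_0 h; nra.
  apply Rinv_le_contravar; first by repeat apply Rmult_lt_0_compat; lra.
  apply Rmult_le_compat_l; [nra|lra].
Qed.

Lemma Cder_val f z l l' : l = l' -> Cder f z l -> Cder f z l'.
Proof. by move=> ->. Qed.

Lemma Cder_zero_const f (z w : C) :
  (forall t, 0 <= t <= 1 -> Cder f (z + RtoC t * (w - z))%C (RtoC 0)) -> f w = f z.
Proof.
  move=> H.
  have Hk : forall (pr : C -> R), (forall a b, pr (a - b)%C = pr a - pr b) ->
     (forall a, Rabs (pr a) <= Cmod a) ->
     pr (f (z + RtoC 0 * (w - z))%C) = pr (f (z + RtoC 1 * (w - z))%C).
  { move=> pr Hpr Hle.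
    apply: (eq_is_derive (fun t => pr (f (z + RtoC t * (w - z))%C))); last lra.
    move=> t Ht. have [d [K [Hd [HK HH]]]] := H t Ht.
    split; first by apply: is_linear_scal_l.
    move=> x Hx. have <- : t = x by apply: is_filter_lim_locally_unique Hx.
    move=> e.
    set D := Cmod (w - z)%C. have HD : 0 <= D by apply Cmod_ge_0.
    have P1 : 0 < d / (D + 1) by apply Rdiv_lt_0_compat; lra.
    have P2 : 0 < e / (K * D ^ 2 + 1).
    { apply Rdiv_lt_0_compat; first by apply cond_pos. nra. }
    exists (mkposreal _ (Rmin_pos _ _ P1 P2)) => y Hy.
    rewrite /ball /= /AbsRing_ball /abs /minus /plus /opp /= in Hy.
    have Hy1 := Rlt_le_trans _ _ _ Hy (Rmin_l _ _). have Hy2 := Rlt_le_trans _ _ _ Hy (Rmin_r _ _).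
    rewrite /norm /= /abs /minus /plus /opp /scal /= /mult /=.
    have He : (z + RtoC y * (w - z) = z + RtoC t * (w - z) + RtoC (y - t) * (w - z))%C.
    { rewrite RtoC_minus. ring. }
    have Hm : Cmod (RtoC (y - t) * (w - z))%C = Rabs (y - t) * D by rewrite Cmod_mult Cmod_R.
    have Hb : Cmod (RtoC (y - t) * (w - z))%C < d.
    { rewrite Hm. apply: (Rle_lt_trans _ (Rabs (y + - t) * (D + 1))).
      - have := Rabs_pos (y - t). rewrite /Rminus. nra.
      - apply: (Rlt_le_trans _ (d / (D + 1) * (D + 1))); last by right; field; lra.
        apply Rmult_lt_compat_r => //. lra. }
    have HB := HH _ Hb. rewrite -He in HB.
    rewrite (_ : (_ - _ - _ = f (z + RtoC y * (w - z)) - f (z + RtoC t * (w - z)))%C) in HB; last ring.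
    have := Rle_trans _ _ _ (Hle _) HB. rewrite Hpr Hm => HB2.
    change (Rabs (pr (f (z + RtoC y * (w - z))%C) + - pr (f (z + RtoC t * (w - z))%C) + - ((y + - t) * 0)) <= e * Rabs (y + - t)).
    rewrite Rmult_0_r Ropp_0 Rplus_0_r.
    apply: Rle_trans HB2 _.
    have Ha := Rabs_pos (y + - t). rewrite /Rminus in Ha |- *.
    have : K * D ^ 2 * Rabs (y + - t) <= e.
    { apply: (Rle_trans _ ((K * D ^ 2 + 1) * (e / (K * D ^ 2 + 1)))); last by right; field; nra.
      have Hq : 0 <= K * D ^ 2 by apply Rmult_le_pos => //; apply pow2_ge_0.
      have Hy3 : Rabs (y + - t) < e / (K * D ^ 2 + 1) := Hy2.
      apply Rmult_le_compat => //; lra. }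
    nra. }
  have E0 : (z + RtoC 0 * (w - z) = z)%C by ring.
  have E1 : (z + RtoC 1 * (w - z) = w)%C by ring.
  rewrite E0 E1 in Hk.
  apply: C_eq; symmetry; apply: Hk.
  - by move=> a b.
  - apply re_le_Cmod.
  - by move=> a b.
  - apply im_le_Cmod.
Qed.

Definition CPS (a : nat -> R) (q : C) : C := CSeries (fun n => RtoC (a n) * Cpow q n)%C.

Definition rad1 (a : nat -> R) : Prop := forall r, 0 <= r < 1 -> ex_series (fun n => Rabs (a n) * r ^ n).

Lemma CPS_abs a q : rad1 a -> Cmod q < 1 -> cabs (fun n => RtoC (a n) * Cpow q n)%C.
Proof.
  move=> H Hq. have := H (Cmod q) (conj (Cmod_ge_0 _) Hq).
  apply: ex_series_ext => n. by rewrite Cmod_mult Cmod_R Cmod_pow.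
Qed.

Lemma rad1_scal_n a : rad1 a -> rad1 (fun n => INR n * a n).
Proof.
  move=> H r Hr.
  set s := (r + 1) / 2.
  have Hs : r < s < 1 by rewrite /s; lra.
  (* n r^n <= s^n * (s/(s-r)) *)
  apply: (ex_series_le _ (fun n => (s / (s - r)) * (Rabs (a n) * s ^ n))); last first.
  { apply: (ex_series_scal (s / (s - r))). apply H. lra. }
  move=> n. rewrite /norm /= /abs /= Rabs_pos_eq; last first.
  { apply Rmult_le_pos; [apply Rabs_pos|apply pow_le; lra]. }
  rewrite Rabs_mult (Rabs_pos_eq (INR n)); last apply pos_INR.
  have Hk : INR n * r ^ n <= s / (s - r) * s ^ n.
  { have Hg : forall n, INR n * r ^ n * (s - r) <= s * s ^ n.
    { elim=> [|m IH]; first by rewrite /=; nra.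
      rewrite S_INR -!tech_pow_Rmult.
      have Q1 : r ^ m <= s ^ m by apply pow_incr; lra.
      have Q2 : 0 <= r ^ m by apply pow_le; lra.
      have Q3 := pos_INR m.
      have : r * (INR m * r ^ m * (s - r)) <= r * (s * s ^ m) by apply Rmult_le_compat_l; lra.
      have : r * r ^ m * (s - r) <= s * s ^ m * (s - r).
      { apply Rmult_le_compat_r; first lra. apply Rmult_le_compat; lra. }
      nra. }
    apply (Rmult_le_reg_r (s - r)); first lra.
    rewrite (_ : s / (s - r) * s ^ n * (s - r) = s * s ^ n); last by field; lra.
    apply Hg. }
  have := Rabs_pos (a n). nra.
Qed.

Lemma rad1_le a b : (forall n, Rabs (a n) <= Rabs (b n)) -> rad1 b -> rad1 a.
Proof.
  move=> H Hb r Hr. apply: (ex_series_le _ (fun n => Rabs (b n) * r ^ n)); last by apply Hb.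
  move=> n. rewrite /norm /= /abs /= Rabs_pos_eq; last first.
  { apply Rmult_le_pos; [apply Rabs_pos|apply pow_le; lra]. }
  apply Rmult_le_compat_r => //. apply pow_le; lra.
Qed.

Lemma rad1_one : rad1 (fun _ => 1).
Proof.
  move=> r Hr. apply: (ex_series_ext (fun n => r ^ n)).
  - move=> n. rewrite Rabs_R1. Rring.
  - apply ex_series_geom. rewrite Rabs_pos_eq; lra.
Qed.

Lemma rad1_pow p : rad1 (fun n => INR n ^ p).
Proof.
  elim: p => [|p IH]; first exact rad1_one.
  apply: rad1_le (rad1_scal_n _ IH) => n. apply Req_le. by f_equal.
Qed.

Lemma rad1_scal c a : rad1 a -> rad1 (fun n => c * a n).
Proof.
  move=> H r Hr. apply: (ex_series_ext (fun n => Rabs c * (Rabs (a n) * r ^ n))).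
  - move=> n. rewrite Rabs_mult. Rring.
  - apply: (ex_series_scal (Rabs c)). by apply H.
Qed.

Lemma pow_second_order (z h : C) (rho : R) n :
  Cmod z <= rho -> Cmod z + Cmod h <= rho ->
  Cmod (Cpow (z + h) (S (S n)) - Cpow z (S (S n)) - RtoC (INR (S (S n))) * Cpow z (S n) * h)%C
    <= INR (S (S n)) ^ 2 * rho ^ n * Cmod h ^ 2.
Proof.
  move=> H1 H2.
  have Hh := Cmod_ge_0 h. have Hz := Cmod_ge_0 z.
  have Hl : forall m, Cmod (Cpow (z + h) (S m) - Cpow z (S m))%C <= INR (S m) * rho ^ m * Cmod h.
  { elim=> [|m IH].
    - rewrite (_ : (_ - _ = h)%C); last by simpl; ring. simpl. lra.
    - rewrite (_ : (_ - _ = (z + h) * (Cpow (z + h) (S m) - Cpow z (S m)) + h * Cpow z (S m))%C);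
        last by rewrite (Cpow_S _ (S m)) (Cpow_S z (S m)); ring.
      apply: Rle_trans (Cmod_triangle _ _) _. rewrite !Cmod_mult Cmod_pow.
      have T := Cmod_triangle z h.
      have Q : Cmod z ^ S m <= rho ^ S m by apply pow_incr.
      have Q2 : 0 <= rho ^ m by apply pow_le; lra.
      have Q3 : Cmod (z + h) * Cmod (Cpow (z + h) (S m) - Cpow z (S m))%C <= rho * (INR (S m) * rho ^ m * Cmod h).
      { apply Rmult_le_compat => //; try apply Cmod_ge_0. lra. }
      rewrite (S_INR (S m)).
      have Q4 : Cmod h * Cmod z ^ S m <= Cmod h * rho ^ S m by apply Rmult_le_compat_l.
      rewrite -!tech_pow_Rmult in Q4 |- *. lra. }
  elim: n => [|n IH].
  - rewrite (_ : (_ - _ - _ = h * h)%C); last by simpl; rewrite RtoC_plus; ring.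
    rewrite Cmod_mult. simpl. nra.
  - rewrite (_ : (_ - _ - _ = z * (Cpow (z + h) (S (S n)) - Cpow z (S (S n)) - RtoC (INR (S (S n))) * Cpow z (S n) * h)
        + h * (Cpow (z + h) (S (S n)) - Cpow z (S (S n))))%C); last first.
    { rewrite (S_INR (S (S n))) RtoC_plus !(Cpow_S _ (S (S n))) (Cpow_S z (S n)). ring. }
    apply: Rle_trans (Cmod_triangle _ _) _. rewrite !Cmod_mult.
    have Q1 := Hl (S n).
    have Q0 : 0 <= rho ^ n by apply pow_le; lra.
    have Q2 : Cmod h * Cmod (Cpow (z + h) (S (S n)) - Cpow z (S (S n)))%C <= Cmod h * (INR (S (S n)) * rho ^ S n * Cmod h).
    { by apply Rmult_le_compat_l. }
    have Q3 : Cmod z * Cmod (Cpow (z + h) (S (S n)) - Cpow z (S (S n)) - RtoC (INR (S (S n))) * Cpow z (S n) * h)%C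
       <= rho * (INR (S (S n)) ^ 2 * rho ^ n * Cmod h ^ 2).
    { apply Rmult_le_compat => //. apply Cmod_ge_0. }
    rewrite (S_INR (S (S n))) -(tech_pow_Rmult rho n). rewrite -(tech_pow_Rmult rho n) in Q2.
    have Q4 := pos_INR (S (S n)).
    have Q5 : 0 <= rho * rho ^ n * Cmod h ^ 2 by apply Rmult_le_pos; nra.
    nra.
Qed.

Lemma CPS_der a z : rad1 a -> Cmod z < 1 ->
  Cder (CPS a) z (CPS (fun n => INR (S n) * a (S n)) z).
Proof.
  move=> Ha Hz. have Hz0 := Cmod_ge_0 z.
  set rho := (Cmod z + 1) / 2.
  have Hr : Cmod z < rho < 1 by rewrite /rho; lra.
  have R2 : rad1 (fun n => INR n ^ 2 * a n).
  { apply: rad1_le (rad1_scal_n _ (rad1_scal_n _ Ha)) => n. apply Req_le. f_equal. ring. }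
  have R1 := rad1_scal_n _ Ha.
  have Hb := R2 rho ltac:(lra).
  set B := Series (fun n => Rabs (INR n ^ 2 * a n) * rho ^ n).
  have HB : 0 <= B.
  { apply: Series_pos => // n. apply Rmult_le_pos; [apply Rabs_pos|apply pow_le; lra]. }
  exists (rho - Cmod z), (B / rho ^ 2). split; first lra.
  split; first by apply Rmult_le_pos => //; apply Rlt_le, Rinv_0_lt_compat, pow_lt; lra.
  move=> h Hh. have Hh0 := Cmod_ge_0 h.
  have T := Cmod_triangle z h.
  have E1 : cabs (fun n => RtoC (a n) * Cpow (z + h) n)%C by apply CPS_abs => //; lra.
  have E2 : cabs (fun n => RtoC (a n) * Cpow z n)%C by apply CPS_abs => //; lra.
  have E3 : cabs (fun n => RtoC (INR (S n) * a (S n)) * Cpow z n)%C.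
  { have E := CPS_abs _ z R1 Hz. case: (Ceq_dec z (RtoC 0)) => Hz00.
    - apply: (cabs_le _ (fun n => if Nat.eqb n 0 then Rabs (INR 1 * a 1%nat) else 0)).
      + case=> [|n]; first by rewrite Cmod_mult Cmod_R /= Cmod_1; lra.
        rewrite Hz00 Cpow_S Cmult_0_l Cmult_0_r Cmod_0. simpl. lra.
      + apply/ex_series_incr_1. apply: (ex_series_ext (fun _ => 0)) => //. apply ex_series_zero.
    - move/cabs_incr_1: E => E.
      apply: (cabs_ext (fun n => / z * (RtoC (INR (S n) * a (S n)) * Cpow z (S n)))%C).
      + move=> n. rewrite Cpow_S. field. exact Hz00.
      + by apply: cabs_scal. }
  have E3' : cabs (fun n => h * (RtoC (INR (S n) * a (S n)) * Cpow z n))%C by apply: cabs_scal.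
  set d0 := fun n => match n with O => RtoC 0 | S m => (h * (RtoC (INR (S m) * a (S m)) * Cpow z m))%C end.
  have E4 : cabs d0 by apply/cabs_incr_1.
  have E5 : (CPS (fun n => INR (S n) * a (S n))%R z * h)%C = CSeries d0.
  { rewrite (CSeries_incr_1 d0 E4) /= /CPS Cmult_comm -CSeries_scal //. ring. }
  rewrite E5 /CPS -CSeries_minus // -CSeries_minus; [|by apply: cabs_plus => //; apply: (cabs_ext (fun n => RtoC (-1) * (RtoC (a n) * Cpow z n))%C); [move=> n; rewrite RtoC_m1; ring|by apply: cabs_scal]|by []].
  set t := fun n => _.
  have Ht : forall n, Cmod (t n) <= (Cmod h ^ 2 / rho ^ 2) * (Rabs (INR n ^ 2 * a n) * rho ^ n).
  { have Hrp : 0 < rho ^ 2 by apply pow_lt; lra.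
    have Hq : 0 <= Cmod h ^ 2 / rho ^ 2.
    { apply Rmult_le_pos; [nra|by apply Rlt_le, Rinv_0_lt_compat]. }
    case=> [|[|n]].
    - rewrite /t /d0 (_ : (_ - _ - _ = RtoC 0)%C); last by simpl; ring.
      rewrite Cmod_0. apply Rmult_le_pos => //. apply Rmult_le_pos; [apply Rabs_pos|simpl; lra].
    - rewrite /t /d0 (_ : (_ - _ - _ = RtoC 0)%C); last by simpl; rewrite !RtoC_mult; ring.
      rewrite Cmod_0. apply Rmult_le_pos => //. apply Rmult_le_pos; [apply Rabs_pos|simpl; lra].
    - rewrite /t /d0 (_ : (_ - _ - _ = RtoC (a (S (S n))) * (Cpow (z + h) (S (S n)) - Cpow z (S (S n)) - RtoC (INR (S (S n))) * Cpow z (S n) * h))%C); last by rewrite RtoC_mult; ring.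
      rewrite Cmod_mult Cmod_R.
      have Q := pow_second_order z h rho n ltac:(lra) ltac:(lra).
      rewrite Rabs_mult (Rabs_pos_eq (INR (S (S n)) ^ 2)); last by apply pow_le, pos_INR.
      rewrite (_ : Cmod h ^ 2 / rho ^ 2 * (INR (S (S n)) ^ 2 * Rabs (a (S (S n))) * rho ^ S (S n))
         = Rabs (a (S (S n))) * (INR (S (S n)) ^ 2 * rho ^ n * Cmod h ^ 2)); last first.
      { simpl (rho ^ S (S n)). field. lra. }
      apply Rmult_le_compat_l => //. apply Rabs_pos. }
  have Hs : ex_series (fun n => (Cmod h ^ 2 / rho ^ 2) * (Rabs (INR n ^ 2 * a n) * rho ^ n)).
  { by apply: (ex_series_scal (Cmod h ^ 2 / rho ^ 2) (fun n => Rabs (INR n ^ 2 * a n) * rho ^ n)). }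
  have Hct : cabs t by apply: cabs_le Ht Hs.
  apply: Rle_trans (Cmod_CSeries_le _ Hct) _.
  apply: (Rle_trans _ (Series (fun n => (Cmod h ^ 2 / rho ^ 2) * (Rabs (INR n ^ 2 * a n) * rho ^ n)))).
  - apply: Series_le => // n. split; [apply Cmod_ge_0|apply Ht].
  - rewrite Series_scal_l -/B. right. field. lra.
Qed.

Lemma sin_ge_cubic (a : R) : 0 <= a <= PI -> a - a ^ 3 / 6 <= sin a.
Proof.
  move=> Ha. have [H _] := SIN a (proj1 Ha) (proj2 Ha).
  apply: Rle_trans H.
  have F : forall n z, Z.of_nat (fact n) = z -> INR (fact n) = IZR z.
  { move=> n z <-. apply INR_IZR_INZ. }
  have -> : sin_lb a = a - a ^ 3 / 6 + (a ^ 5 / 120 - a ^ 7 / 5040).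
  { rewrite /sin_lb /sin_approx /sum_f_R0 /sin_term.
    rewrite (F (2 * 0 + 1)%nat 1%Z) // (F (2 * 1 + 1)%nat 6%Z) // (F (2 * 2 + 1)%nat 120%Z) //
      (F (2 * 3 + 1)%nat 5040%Z); last by vm_compute.
    simpl. field. }
  have HP := PI_4.
  have H5 : 0 <= a ^ 5 * (42 - a ^ 2) by apply Rmult_le_pos; [apply pow_le; lra|nra].
  have : a ^ 5 / 120 - a ^ 7 / 5040 = a ^ 5 * (42 - a ^ 2) / 5040 by field.
  lra.
Qed.

Lemma cos_ge_sq (a : R) : Rabs (cos a - 1) <= a ^ 2.
Proof.
  have H := cos_2a_sin (a / 2). rewrite (_ : 2 * (a / 2) = a) in H; last field.
  have Hs : sin (a / 2) ^ 2 <= (a / 2) ^ 2.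
  { rewrite -(pow2_abs (sin _)) -(pow2_abs (a / 2)). apply pow_incr. split; first by apply Rabs_pos.
    case: (Rle_dec 0 (a / 2)) => Ha.
    - rewrite (Rabs_pos_eq (a / 2)) //.
      case: (Rle_lt_dec (a / 2) 1) => H1.
      + have HP := PI2_3_2. have := sin_ge_0 (a / 2) Ha ltac:(lra) => Hp. rewrite Rabs_pos_eq //.
        case: Ha => Ha; [by apply Rlt_le, sin_lt_x|]. rewrite -Ha sin_0. lra.
      + have := SIN_bound (a / 2) => Hb. apply Rabs_le. lra.
    - rewrite (Rabs_left (a / 2)); last lra. rewrite -Rabs_Ropp -sin_neg.
      case: (Rle_lt_dec (- (a / 2)) 1) => H1.
      + have HP := PI2_3_2. have := sin_ge_0 (- (a / 2)) ltac:(lra) ltac:(lra) => Hp. rewrite Rabs_pos_eq //.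
        apply Rlt_le, sin_lt_x. lra.
      + have := SIN_bound (- (a / 2)) => Hb. apply Rabs_le. lra. }
  rewrite H. apply Rabs_le. nra.
Qed.

Lemma sin_sub_sq (a : R) : Rabs a <= 1 -> Rabs (sin a - a) <= a ^ 2.
Proof.
  have Hp : forall a, 0 <= a <= 1 -> Rabs (sin a - a) <= a ^ 2.
  { move=> b Hb. have HP := PI2_3_2. have := sin_ge_cubic b ltac:(lra) => H.
    have : sin b <= b.
    { case: (proj1 Hb) => [H0|<-]; [by apply Rlt_le, sin_lt_x|rewrite sin_0; lra]. }
    move=> H2. apply Rabs_le. nra. }
  move=> Ha. case: (Rle_lt_dec 0 a) => H0.
  - apply Hp. rewrite Rabs_pos_eq in Ha; lra.
  - rewrite Rabs_left in Ha => //. have := Hp (- a) ltac:(lra). rewrite sin_neg.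
    rewrite (_ : - sin a - - a = - (sin a - a)); last ring. rewrite Rabs_Ropp.
    by rewrite (_ : (- a) ^ 2 = a ^ 2); last ring.
Qed.

Lemma exp_sub_sq (a : R) : Rabs a <= 1 -> Rabs (exp a - 1 - a) <= 2 * a ^ 2.
Proof.
  move=> Ha. have Ha' := Rabs_le_between a 1. have {Ha'}Ha : -1 <= a <= 1 by apply Ha'.
  have H1 := exp_ineq1_le a.
  have H2 : exp a <= 1 + a + 2 * a ^ 2.
  { case: (Rle_lt_dec a (1 / 2)) => Hc.
    - have H3 := exp_ineq1_le (- a). have H4 : exp a * exp (- a) = 1.
      { rewrite -exp_plus Rplus_opp_r. apply exp_0. }
      have H5 := exp_pos a. have : exp a * (1 - a) <= 1 by nra. move=> H6.
      have : exp a * (1 - a) <= (1 + a + 2 * a ^ 2) * (1 - a) by nra.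
      move=> H7. nra.
    - have H3 := exp_le_3. have H4 := exp_ineq1_le (1 - a).
      have H5 : exp a * exp (1 - a) = exp 1 by rewrite -exp_plus; f_equal; ring.
      have H6 := exp_pos a. have H7 : exp a * (2 - a) <= 3 by nra.
      have H8 : 0 <= (a - 1 / 2) * (- 2 * a ^ 2 + 2 * a + 2) by apply Rmult_le_pos; nra.
      apply (Rmult_le_reg_r (2 - a)); first lra. nra. }
  apply Rabs_le. nra.
Qed.

Lemma Cexp_second_order (h : C) : Cmod h <= 1 -> Cmod (Cexp h - RtoC 1 - h)%C <= 20 * Cmod h ^ 2.
Proof.
  move=> Hh. set a := Re h. set b := Im h.
  have Ha : Rabs a <= 1 by apply: Rle_trans (re_le_Cmod _) Hh.
  have Hb : Rabs b <= 1 by apply: Rle_trans (im_le_Cmod _) Hh.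
  have E1 := exp_sub_sq a Ha. have E2 := cos_ge_sq b. have E3 := sin_sub_sq b Hb.
  apply: Rle_trans (Cmod_le_re_im _) _.
  rewrite (_ : Re (Cexp h - RtoC 1 - h)%C = exp a * cos b - 1 - a); last by rewrite /Cexp /=; rewrite -/a -/b /a /Re; ring.
  rewrite (_ : Im (Cexp h - RtoC 1 - h)%C = exp a * sin b - b); last by rewrite /Cexp /=; rewrite -/a -/b /b /Im; ring.
  have Hm : Cmod h ^ 2 = a ^ 2 + b ^ 2 by apply Cmod2_alt.
  rewrite Hm.
  move/Rabs_le_between: Ha => Ha. move/Rabs_le_between: Hb => Hb.
  move/Rabs_le_between: E1 => E1. move/Rabs_le_between: E2 => E2. move/Rabs_le_between: E3 => E3.
  have H3 : 0 < exp a <= 4 by split; [apply exp_pos|nra].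
  have HA : Rabs (exp a * cos b - 1 - a) <= 2 * a ^ 2 + 4 * b ^ 2.
  { apply Rabs_le. rewrite (_ : exp a * cos b - 1 - a = (exp a - 1 - a) + exp a * (cos b - 1)); last ring. nra. }
  have HB : Rabs (exp a * sin b - b) <= 4 * b ^ 2 + 3 * (a ^ 2 + b ^ 2).
  { apply Rabs_le. rewrite (_ : exp a * sin b - b = exp a * (sin b - b) + (exp a - 1) * b); last ring.
    have : - (3 * (a ^ 2 + b ^ 2)) <= (exp a - 1) * b <= 3 * (a ^ 2 + b ^ 2).
    { have Q : Rabs (exp a - 1) <= 3 * Rabs a.
      { rewrite (_ : exp a - 1 = (exp a - 1 - a) + a); last ring.
        apply: Rle_trans (Rabs_triang _ _) _.
        have Q0 : Rabs (exp a - 1 - a) <= 2 * a ^ 2 by apply Rabs_le.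
        have := pow2_abs a. have : Rabs a <= 1 by apply Rabs_le. have := Rabs_pos a. nra. }
      have Q2 : Rabs ((exp a - 1) * b) <= 3 * (a ^ 2 + b ^ 2).
      { rewrite Rabs_mult. have B0 := Rabs_pos b. have Q3 := Rmult_le_compat_r _ _ _ B0 Q.
        have := pow2_abs a. have := pow2_abs b. have := pow2_ge_0 (Rabs a - Rabs b).
        have := pow2_ge_0 a. have := pow2_ge_0 b. nra. }
      by move/Rabs_le_between: Q2. }
    nra. }
  have := pow2_ge_0 a. have := pow2_ge_0 b. lra.
Qed.

Lemma Cder_Cexp z : Cder Cexp z (Cexp z).
Proof.
  exists 1, (Cmod (Cexp z) * 20). split; first lra.
  have H0 := Cmod_ge_0 (Cexp z). split; first lra.
  move=> h Hh. rewrite Cexp_add.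
  rewrite (_ : (_ - _ - _ = Cexp z * (Cexp h - RtoC 1 - h))%C); last ring.
  rewrite Cmod_mult Rmult_assoc. apply Rmult_le_compat_l => //. apply Cexp_second_order. lra.
Qed.

Lemma segment_disc (w : C) t : 0 <= t <= 1 -> Cmod w < 1 -> Cmod (RtoC 0 + RtoC t * (w - RtoC 0))%C < 1.
Proof.
  move=> Ht Hw. rewrite (_ : (RtoC 0 + RtoC t * (w - RtoC 0) = RtoC t * w)%C); last ring.
  rewrite Cmod_mult Cmod_pos_R; last lra. have := Cmod_ge_0 w. nra.
Qed.

Lemma CPS_0 a : CPS a (RtoC 0) = RtoC (a O).
Proof.
  apply: is_cs_unique. apply/is_cs_Clim. apply/Clim_incr_1.
  apply: (Clim_ext (fun _ => RtoC (a O))); last by apply Clim_const.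
  elim=> [|n IH]; first by simpl; ring.
  change (RtoC (a O) = bigs (fun n => RtoC (a n) * Cpow (RtoC 0) n)%C (S n) + RtoC (a (S n)) * Cpow (RtoC 0) (S n))%C.
  rewrite -IH Cpow_S. ring.
Qed.

Lemma Cexp_series z : is_cs (fun n => Cpow z n / RtoC (INR (fact n)))%C (Cexp z).
Proof.
  have Hz := Cmod_ge_0 z.
  set M := Cmod z + 1. have HM : 0 < M by rewrite /M; lra.
  have HMn : RtoC M <> RtoC 0 by apply RtoC_nz; lra.
  set a := fun n => M ^ n / INR (fact n).
  have Ha0 : forall n, 0 <= a n.
  { move=> n. apply Rmult_le_pos; [apply pow_le; lra|]. apply Rlt_le, Rinv_0_lt_compat, INR_fact_pos. }
  have Ra : rad1 a.
  { move=> r Hr. exists (exp (M * r)). apply: is_series_ext (exp_is_series (M * r)) => n.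
    rewrite Rabs_pos_eq // /a Rpow_mult_distr /Rdiv. Rring. }
  have Hd : forall w, Cmod w < 1 -> Cder (CPS a) w (RtoC M * CPS a w)%C.
  { move=> w Hw. apply: Cder_val (CPS_der _ _ Ra Hw).
    rewrite /CPS -CSeries_scal; last by apply CPS_abs.
    apply: CSeries_ext => n. rewrite Cmult_assoc -RtoC_mult. do 2 f_equal.
    rewrite /a fact_simpl mult_INR -tech_pow_Rmult. field. split; apply Rgt_not_eq.
    - apply INR_fact_pos.
    - apply lt_0_INR; lia. }
  have Hf : forall w, Cmod w < 1 -> Cder (fun w => CPS a w * Cexp (- RtoC M * w))%C w (RtoC 0).
  { move=> w Hw. have H1 := Hd w Hw.
    have H2 : Cder (fun w => Cexp (- RtoC M * w)%C) w (Cexp (- RtoC M * w) * (- RtoC M * RtoC 1))%C.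
    { apply: (Cder_comp Cexp (fun w => - RtoC M * w)%C).
      - apply: Cder_scal. apply Cder_id.
      - apply Cder_Cexp. }
    apply: Cder_val (Cder_mult _ _ _ _ _ H1 H2). ring. }
  set w := (z / RtoC M)%C.
  have Hw : Cmod w < 1.
  { rewrite /w Cmod_div // Cmod_pos_R; last lra. apply (Rmult_lt_reg_r M) => //.
    rewrite /Rdiv Rmult_assoc Rinv_l; [rewrite /M; lra|lra]. }
  have E := Cder_zero_const _ (RtoC 0) w (fun t Ht => Hf _ (segment_disc w t Ht Hw)).
  cbv beta in E. rewrite CPS_0 Cmult_0_r Cexp_0 in E.
  have E2 : (- RtoC M * w = - z)%C by rewrite /w; field.
  rewrite E2 Cexp_opp in E.
  have E3 : CPS a w = Cexp z.
  { have Hn := Cexp_nz z.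
    rewrite (_ : CPS a w = CPS a w * / Cexp z * Cexp z)%C; last by field.
    rewrite E /a /= (_ : 1 / 1 = 1); last field. ring. }
  rewrite -E3. apply: is_cs_ext (cabs_is _ (CPS_abs _ _ Ra Hw)) => n.
  rewrite /w /a RtoC_div; last by apply Rgt_not_eq, INR_fact_pos.
  rewrite RtoC_pow. rewrite /Cdiv Cpow_mult_l Cpow_inv //. field. split.
  - apply RtoC_nz, Rgt_not_eq, INR_fact_pos.
  - by apply Cpow_nz.
Qed.

Lemma Clim_pow q : Cmod q < 1 -> Clim (fun n => Cpow q n) (RtoC 0).
Proof.
  move=> Hq. apply: (Clim_squeeze _ _ (fun n => Cmod q ^ n)).
  - move=> n. rewrite (_ : (_ - RtoC 0 = Cpow q n)%C); last ring. rewrite Cmod_pow. apply Rle_refl.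
  - apply is_lim_seq_geom. rewrite Rabs_pos_eq //. apply Cmod_ge_0.
Qed.

Lemma C_one_minus_nz q : Cmod q < 1 -> (RtoC 1 - q)%C <> RtoC 0.
Proof.
  move=> Hq E. have : q = RtoC 1.
  { rewrite (_ : q = RtoC 1 - (RtoC 1 - q))%C; last ring. rewrite E. ring. }
  move=> E2. rewrite E2 Cmod_1 in Hq. lra.
Qed.

Lemma geom_cs q : Cmod q < 1 -> is_cs (fun n => Cpow q n) (/ (RtoC 1 - q))%C.
Proof.
  move=> Hq. have Hn := C_one_minus_nz _ Hq.
  apply/is_cs_Clim.
  apply: (Clim_ext (fun n => (RtoC 1 - Cpow q n) * / (RtoC 1 - q))%C).
  - elim=> [|n IH] /=; first by ring.
    rewrite -IH. field. exact Hn.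
  - rewrite -{2}(Cmult_1_l (/ (RtoC 1 - q))%C).
    apply: Clim_mult; last by apply Clim_const.
    rewrite -{2}(_ : (RtoC 1 - RtoC 0 = RtoC 1)%C); last ring.
    apply: Clim_minus; [apply Clim_const|by apply Clim_pow].
Qed.

Lemma geom_abs q : Cmod q < 1 -> cabs (fun n => Cpow q n).
Proof.
  move=> Hq. apply: (ex_series_ext (fun n => Cmod q ^ n)) => [n|]; first by rewrite Cmod_pow.
  apply ex_series_geom. rewrite Rabs_pos_eq //. apply Cmod_ge_0.
Qed.

Definition lgc (n : nat) : R := match n with O => 0 | S _ => / INR n end.
Definition lg (z : C) : C := CPS lgc z.

Lemma rad1_lgc : rad1 lgc.
Proof.
  apply: (rad1_le _ (fun _ => 1)); last by apply rad1_one.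
  case=> [|n]; rewrite Rabs_R1 /=; first by rewrite Rabs_R0; lra.
  rewrite -/(INR (S n)). have H : 1 <= INR (S n) by rewrite S_INR; have := pos_INR n; lra.
  rewrite Rabs_pos_eq; last by apply Rlt_le, Rinv_0_lt_compat; lra.
  rewrite -Rinv_1. apply Rinv_le_contravar; lra.
Qed.

Lemma Cexp_lg z : Cmod z < 1 -> Cexp (- lg z)%C = (RtoC 1 - z)%C.
Proof.
  move=> Hz.
  have Hf : forall w, Cmod w < 1 -> Cder (fun w => Cexp (lg w) * (RtoC 1 + RtoC (-1) * w))%C w (RtoC 0).
  { move=> w Hw.
    have H1 : Cder lg w (/ (RtoC 1 - w))%C.
    { apply: Cder_val (CPS_der _ _ rad1_lgc Hw).
      rewrite -(is_cs_unique _ _ (geom_cs _ Hw)). apply: CSeries_ext => n.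
      rewrite /lgc Rinv_r; first ring. apply not_0_INR. lia. }
    have H2 := Cder_comp Cexp lg w _ _ H1 (Cder_Cexp _).
    have H3 : Cder (fun w => RtoC 1 + RtoC (-1) * w)%C w (RtoC 0 + RtoC (-1) * RtoC 1)%C.
    { apply: Cder_plus; first apply Cder_const. apply Cder_scal, Cder_id. }
    apply: Cder_val (Cder_mult _ _ _ _ _ H2 H3).
    have Hn := C_one_minus_nz _ Hw. rewrite RtoC_m1. field. exact Hn. }
  have E := Cder_zero_const _ (RtoC 0) z (fun t Ht => Hf _ (segment_disc z t Ht Hz)).
  cbv beta in E. rewrite /lg CPS_0 /= Cexp_0 in E.
  have Hn := Cexp_nz (lg z). rewrite Cexp_opp.
  have E2 : (Cexp (lg z) * (RtoC 1 - z) = RtoC 1)%C.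
  { rewrite (_ : (RtoC 1 - z = RtoC 1 + RtoC (-1) * z)%C); last by rewrite RtoC_m1; ring.
    rewrite /lg E. ring. }
  apply: eq_sym. rewrite -(Cmult_1_l (RtoC 1 - z)%C) -{1}(Cinv_l _ Hn) -Cmult_assoc E2. ring.
Qed.

Lemma nome_add z w : nome (z + w)%C = (nome z * nome w)%C.
Proof. rewrite /nome -Cexp_add. f_equal. ring. Qed.

Lemma nome_1 : nome (RtoC 1) = RtoC 1.
Proof. rewrite /nome Cmult_1_r. apply Cexp_2PIi. Qed.

Lemma nome_half : nome (RtoC (/ 2)) = RtoC (-1).
Proof.
  rewrite /nome -Cexp_PIi. f_equal. apply C_eq; simpl; field.
Qed.

Lemma Cmod_nome z : Cmod (nome z) = exp (- (2 * PI * Im z)).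
Proof. rewrite /nome Cmod_Cexp. f_equal. simpl. rewrite /Im. ring. Qed.

Lemma nome_nz z : nome z <> RtoC 0.
Proof. apply Cexp_nz. Qed.

Lemma nome_lt_1 z : 0 < Im z -> Cmod (nome z) < 1.
Proof.
  move=> H. rewrite Cmod_nome -exp_0. apply exp_increasing.
  have := PI_RGT_0. nra.
Qed.

Lemma nome_pow z n : nome (RtoC (INR n) * z)%C = Cpow (nome z) n.
Proof. rewrite /nome -Cexp_pow. f_equal. ring. Qed.

Lemma nome_INR n : nome (RtoC (INR n)) = RtoC 1.
Proof. rewrite -(Cmult_1_r (RtoC (INR n))) nome_pow nome_1 Cpow_1_l. done. Qed.

Lemma ex_series_inv_sq : ex_series (fun k => / INR (S k) ^ 2).
Proof.
  apply: (ex_series_bounded _ 2).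
  - move=> n. apply Rlt_le, Rinv_0_lt_compat, pow_lt, lt_0_INR. lia.
  - move=> n. apply: (Rle_trans _ (2 - / INR (S n))); last first.
    { have : 0 < / INR (S n) by apply Rinv_0_lt_compat, lt_0_INR; lia. lra. }
    elim: n => [|n IH]; first by rewrite sum_O /= Rinv_1; lra.
    rewrite sum_Sn /plus /=. rewrite -/(INR (S n)) -/(INR (S (S n))).
    rewrite (S_INR (S n)). set x := INR (S n) in IH |- *.
    have Hx : 0 < x by apply lt_0_INR; lia.
    apply: Rle_trans (Rplus_le_compat_r _ _ _ IH) _.
    have : / x - / (x + 1) - / ((x + 1) ^ 2) = / (x * (x + 1) ^ 2) by field; lra.
    have : 0 < / (x * (x + 1) ^ 2) by apply Rinv_0_lt_compat; apply Rmult_lt_0_compat => //; apply pow_lt; lra.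
    move=> H1 H2. rewrite Rmult_1_r (_ : (x + 1) * (x + 1) = (x + 1) ^ 2); last ring. lra.
Qed.

Lemma half_plane_lower_bound z : 0 < Im z ->
  exists k, 0 < k /\ forall x, k * (1 + Rabs x) <= Cmod (z + RtoC x)%C.
Proof.
  move=> Hz. set y := Im z in Hz. have Hm := Cmod_ge_0 z.
  exists (Rmin (Rmin (y / 2) (/ 4)) (y / (1 + 2 * Cmod z))).
  have Hp : 0 < y / (1 + 2 * Cmod z) by apply Rdiv_lt_0_compat; lra.
  split; first by do 2 apply Rmin_pos => //; lra.
  move=> x. set k := Rmin _ _.
  have K0 : 0 < k by do 2 apply Rmin_pos => //; lra.
  have K1 : k <= y / 2 by apply: Rle_trans (Rmin_l _ _) (Rmin_l _ _).
  have K2 : k <= / 4 by apply: Rle_trans (Rmin_l _ _) (Rmin_r _ _).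
  have K3 : k <= y / (1 + 2 * Cmod z) by apply Rmin_r.
  have Hx := Rabs_pos x.
  have H1 : y <= Cmod (z + RtoC x)%C.
  { have := im_le_Cmod (z + RtoC x)%C. rewrite im_plus im_RtoC Rplus_0_r => H.
    apply: Rle_trans H. rewrite -/y Rabs_pos_eq; lra. }
  case: (Rle_lt_dec (Rabs x) (2 * Cmod z)) => Hc.
  - apply: Rle_trans H1. apply: (Rle_trans _ (y / (1 + 2 * Cmod z) * (1 + 2 * Cmod z))); last by right; field; lra.
    apply Rmult_le_compat => //; try lra.
  - have H2 : Rabs x / 2 <= Cmod (z + RtoC x)%C.
    { have := Cmod_triangle (z + RtoC x)%C (- z)%C.
      rewrite (_ : (z + RtoC x + - z = RtoC x)%C); last ring. rewrite Cmod_R Cmod_opp. lra. }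
    nra.
Qed.

(** * The partial fractions of the cotangent *)

Lemma CSeries_finite (a : nat -> C) n : (forall k, (n <= k)%nat -> a k = RtoC 0) -> CSeries a = bigs a n.
Proof.
  move=> H. apply: is_cs_unique. apply/is_cs_Clim.
  apply: (Clim_ext_loc (fun _ => bigs a n)); last by apply Clim_const.
  exists n => m Hm. rewrite (_ : m = (n + (m - n))%nat); last lia.
  rewrite bigs_add (bigs_zero (fun k => a (n + k)%nat)); first ring.
  move=> k _. apply H. lia.
Qed.

Lemma Im_div_R (w : C) (r : R) : r <> 0 -> Im (w / RtoC r)%C = Im w / r.
Proof.
  move=> H. rewrite /Cdiv -RtoC_inv // im_scal_r. reflexivity.
Qed.

Lemma Re_div_R (w : C) (r : R) : r <> 0 -> Re (w / RtoC r)%C = Re w / r.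
Proof.
  move=> H. rewrite /Cdiv -RtoC_inv // re_scal_r. reflexivity.
Qed.

Definition sfun (w : C) : C := (Cexp (Ci * w) - Cexp (- (Ci * w)))%C.
Definition ctf (z : C) : C := ((nome z + RtoC 1) / (nome z - RtoC 1))%C.

Lemma nome_sub1_nz z : 0 < Im z -> (nome z - RtoC 1)%C <> RtoC 0.
Proof.
  move=> H E. apply (C_one_minus_nz (nome z)); first by apply nome_lt_1.
  rewrite (_ : (RtoC 1 - nome z = - (nome z - RtoC 1))%C); last ring. rewrite E. ring.
Qed.

Lemma RtoC_2 : RtoC 2 = (RtoC 1 + RtoC 1)%C.
Proof. apply C_eq; simpl; ring. Qed.

Lemma C2_nz : RtoC 2 <> RtoC 0.
Proof. apply RtoC_nz. lra. Qed.

Lemma ctf_double z : 0 < Im z ->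
  (ctf (z / RtoC 2) + ctf ((z + RtoC 1) / RtoC 2) = RtoC 2 * ctf z)%C.
Proof.
  move=> Hz. have H2 := C2_nz.
  have E1 : nome z = (nome (z / RtoC 2) * nome (z / RtoC 2))%C.
  { rewrite -nome_add. f_equal. rewrite RtoC_2. field. }
  have E2 : nome ((z + RtoC 1) / RtoC 2)%C = (- nome (z / RtoC 2))%C.
  { rewrite (_ : ((z + RtoC 1) / RtoC 2 = z / RtoC 2 + RtoC (/ 2))%C); last by rewrite RtoC_inv; [field|lra].
    rewrite nome_add nome_half RtoC_m1. ring. }
  have H3 := nome_sub1_nz (z / RtoC 2)%C ltac:(rewrite Im_div_R; lra).
  have H4 := nome_sub1_nz ((z + RtoC 1) / RtoC 2)%C ltac:(rewrite Im_div_R ?im_plus ?im_RtoC; lra).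
  rewrite E2 in H4.
  rewrite /ctf E1 E2. set p := nome _ in H3 H4 |- *.
  have E5 : (p * p - RtoC 1 = - (p - RtoC 1) * (- p - RtoC 1))%C by ring.
  rewrite E5 RtoC_2. field; repeat split => //.
Qed.

Lemma ctf_period z : ctf (z + RtoC 1)%C = ctf z.
Proof. by rewrite /ctf nome_add nome_1 Cmult_1_r. Qed.

Lemma INR_pow2_pos j : 0 < INR (2 ^ j).
Proof. apply lt_0_INR. have := Nat.pow_nonzero 2 j. lia. Qed.

Lemma ctf_iter z j : 0 < Im z ->
  bigs (fun k => ctf ((z + RtoC (INR k)) / RtoC (INR (2 ^ j)))%C) (2 ^ j) = (RtoC (INR (2 ^ j)) * ctf z)%C.
Proof.
  move=> Hz. elim: j => [|j IH].
  - rewrite /= (_ : ((z + RtoC 0) / RtoC 1)%C = z); first ring. field.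
  - rewrite (_ : (2 ^ S j)%nat = (2 ^ j + 2 ^ j)%nat); last by simpl; lia.
    rewrite bigs_add -bigs_plus plus_INR.
    have HN := INR_pow2_pos j. set N := INR (2 ^ j) in IH HN |- *.
    have HNn : RtoC N <> RtoC 0 by apply RtoC_nz; lra.
    transitivity (bigs (fun k => RtoC 2 * ctf ((z + RtoC (INR k)) / RtoC N))%C (2 ^ j)).
    + apply: bigs_ext => k _. rewrite -ctf_double; last first.
      { rewrite Im_div_R; last lra. rewrite im_plus im_RtoC Rplus_0_r. by apply Rdiv_lt_0_compat. }
      have H2 := C2_nz. rewrite RtoC_2 in H2.
      f_equal; f_equal.
      * rewrite RtoC_plus RtoC_2. field. split => //. rewrite (_ : (RtoC N + RtoC N = (RtoC 1 + RtoC 1) * RtoC N)%C); last ring. by apply Cmult_neq_0.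
      * rewrite plus_INR -/N !RtoC_plus ?RtoC_2. field. split => //. rewrite (_ : (RtoC N + RtoC N = (RtoC 1 + RtoC 1) * RtoC N)%C); last ring. by apply Cmult_neq_0.
    + rewrite bigs_scal IH RtoC_plus RtoC_2. ring.
Qed.

Lemma ctf_pairs z j : 0 < Im z ->
  bigs (fun k => ctf ((z + RtoC (INR k)) / RtoC (2 * INR (2 ^ j))) + ctf ((z - RtoC 1 - RtoC (INR k)) / RtoC (2 * INR (2 ^ j))))%C (2 ^ j)
   = (RtoC (2 * INR (2 ^ j)) * ctf z)%C.
Proof.
  move=> Hz. have HN := INR_pow2_pos j.
  have E : INR (2 ^ S j) = 2 * INR (2 ^ j) by rewrite (_ : (2 ^ S j)%nat = (2 * 2 ^ j)%nat) // mult_INR.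
  rewrite -E -ctf_iter // E.
  rewrite (_ : (2 ^ S j)%nat = (2 ^ j + 2 ^ j)%nat); last by simpl; lia.
  rewrite bigs_add bigs_plus. f_equal.
  rewrite [in RHS]bigs_rev. apply: bigs_ext => k Hk.
  rewrite -(ctf_period ((z - RtoC 1 - _) / _)%C). f_equal.
  rewrite plus_INR minus_INR; last lia. rewrite minus_INR; last lia.
  rewrite !(RtoC_plus, RtoC_minus, RtoC_mult). rewrite (_ : INR 1 = 1) // ?RtoC_2. field.
  have H2 := C2_nz. rewrite RtoC_2 in H2.
  repeat (apply Cmult_neq_0 || split); try (apply RtoC_nz; lra).
Qed.

Lemma nome_sq_exp (w : C) : Cexp (Ci * (RtoC PI * w))%C <> RtoC 0 /\
   nome w = (Cexp (Ci * (RtoC PI * w)) * Cexp (Ci * (RtoC PI * w)))%C /\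
   Cexp (- (Ci * (RtoC PI * w)))%C = (/ Cexp (Ci * (RtoC PI * w)))%C.
Proof.
  split; first by apply Cexp_nz. split; last by apply Cexp_opp.
  rewrite -Cexp_add /nome. f_equal. rewrite RtoC_2. ring.
Qed.

Lemma ctf_add a b : 0 < Im a -> 0 < Im b ->
  (ctf a + ctf b)%C = (RtoC 2 * sfun (RtoC PI * (a + b)) / (sfun (RtoC PI * a) * sfun (RtoC PI * b)))%C
  /\ sfun (RtoC PI * a)%C <> RtoC 0 /\ sfun (RtoC PI * b)%C <> RtoC 0.
Proof.
  move=> Ha Hb.
  have [A1 [A2 A3]] := nome_sq_exp a. have [B1 [B2 B3]] := nome_sq_exp b.
  have H1 := nome_sub1_nz _ Ha. have H2 := nome_sub1_nz _ Hb.
  rewrite /ctf. rewrite A2 in H1 |- *. rewrite B2 in H2 |- *.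
  have E : Cexp (Ci * (RtoC PI * (a + b)))%C = (Cexp (Ci * (RtoC PI * a)) * Cexp (Ci * (RtoC PI * b)))%C.
  { rewrite -Cexp_add. f_equal. ring. }
  have E' : Cexp (- (Ci * (RtoC PI * (a + b))))%C = (/ (Cexp (Ci * (RtoC PI * a)) * Cexp (Ci * (RtoC PI * b))))%C.
  { by rewrite Cexp_opp E. }
  rewrite /sfun E E' A3 B3.
  set A := Cexp _ in A1 H1 |- *. set B := Cexp _ in B1 H2 |- *.
  have K1 : (A - / A)%C <> RtoC 0.
  { rewrite (_ : (A - / A = (A * A - RtoC 1) * / A)%C); last by field.
    apply Cmult_neq_0 => //. by apply Cinv_neq_0_compat || (move=> E0; apply C1_nz; rewrite -(Cinv_l A) // E0; ring). }
  have K2 : (B - / B)%C <> RtoC 0.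
  { rewrite (_ : (B - / B = (B * B - RtoC 1) * / B)%C); last by field.
    apply Cmult_neq_0 => //. by apply Cinv_neq_0_compat || (move=> E0; apply C1_nz; rewrite -(Cinv_l B) // E0; ring). }
  split; last by split.
  rewrite (_ : (A - / A = (A * A - RtoC 1) * / A)%C); last by field.
  rewrite (_ : (B - / B = (B * B - RtoC 1) * / B)%C); last by field.
  rewrite RtoC_2. field. do ! split => //.
Qed.

Lemma sfun_upper w : Cmod w <= 1 -> Cmod (sfun w) <= 42 * Cmod w.
Proof.
  move=> Hw. have E : Cmod (Ci * w)%C = Cmod w by rewrite Cmod_mult Cmod_Ci Rmult_1_l.
  have H1 := Cexp_second_order (Ci * w)%C ltac:(lra).
  have H2 := Cexp_second_order (- (Ci * w))%C ltac:(rewrite Cmod_opp; lra).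
  rewrite Cmod_opp in H2. rewrite E in H1 H2.
  rewrite /sfun (_ : (_ - _ = (Cexp (Ci * w) - RtoC 1 - Ci * w) - (Cexp (- (Ci * w)) - RtoC 1 - - (Ci * w)) + RtoC 2 * (Ci * w))%C); last by rewrite RtoC_2; ring.
  have T1 := Cmod_triangle ((Cexp (Ci * w) - RtoC 1 - Ci * w) - (Cexp (- (Ci * w)) - RtoC 1 - - (Ci * w)))%C (RtoC 2 * (Ci * w))%C.
  have T2 := Cmod_triangle (Cexp (Ci * w) - RtoC 1 - Ci * w)%C (- (Cexp (- (Ci * w)) - RtoC 1 - - (Ci * w)))%C.
  rewrite Cmod_opp in T2. rewrite (Cmod_mult (RtoC 2)) E Cmod_pos_R in T1; last lra.
  rewrite /Cminus in T1 T2 H1 H2 |- *.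
  have := Cmod_ge_0 w. nra.
Qed.

Lemma sfun_limit_bound w : Cmod w <= 1 -> Cmod (sfun w - RtoC 2 * (Ci * w))%C <= 40 * Cmod w ^ 2.
Proof.
  move=> Hw. have E : Cmod (Ci * w)%C = Cmod w by rewrite Cmod_mult Cmod_Ci Rmult_1_l.
  have H1 := Cexp_second_order (Ci * w)%C ltac:(lra).
  have H2 := Cexp_second_order (- (Ci * w))%C ltac:(rewrite Cmod_opp; lra).
  rewrite Cmod_opp in H2. rewrite E in H1 H2.
  rewrite /sfun (_ : (_ - _ = (Cexp (Ci * w) - RtoC 1 - Ci * w) - (Cexp (- (Ci * w)) - RtoC 1 - - (Ci * w)))%C); last by rewrite RtoC_2; ring.
  have T2 := Cmod_triangle (Cexp (Ci * w) - RtoC 1 - Ci * w)%C (- (Cexp (- (Ci * w)) - RtoC 1 - - (Ci * w)))%C.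
  rewrite Cmod_opp in T2.
  rewrite /Cminus in T2 H1 H2 |- *. lra.
Qed.

Lemma sin_quarter a : Rabs a <= 209 / 100 -> (a / 4) ^ 2 <= sin a ^ 2.
Proof.
  have Hp : forall a, 0 <= a <= 209 / 100 -> a / 4 <= sin a.
  { move=> b Hb. have HP := PI2_3_2. have := sin_ge_cubic b ltac:(lra). nra. }
  move=> Ha. case: (Rle_lt_dec 0 a) => H0.
  - rewrite Rabs_pos_eq in Ha => //. apply pow_incr. have := Hp a ltac:(lra). lra.
  - rewrite Rabs_left in Ha => //. have := Hp (- a) ltac:(lra). rewrite sin_neg. nra.
Qed.

Lemma sfun_lower w : Rabs (Re w) <= 209 / 100 -> Cmod w / 2 <= Cmod (sfun w).
Proof.
  move=> Hw. set a := Re w in Hw. set b := Im w.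
  have E : Cmod (sfun w) ^ 2 = (exp b - exp (- b)) ^ 2 + 4 * sin a ^ 2.
  { rewrite Cmod2_alt /sfun /Cexp.
    rewrite (_ : Re (Ci * w)%C = - b); last by simpl; rewrite /b /Im; ring.
    rewrite (_ : Im (Ci * w)%C = a); last by simpl; rewrite /a /Re; ring.
    rewrite (_ : Re (- (Ci * w))%C = b); last by simpl; rewrite /b /Im; ring.
    rewrite (_ : Im (- (Ci * w))%C = - a); last by simpl; rewrite /a /Re; ring.
    rewrite cos_neg sin_neg. simpl Re. simpl Im.
    have H1 : exp b * exp (- b) = 1 by rewrite -exp_plus Rplus_opp_r exp_0.
    have H2 := sin2_cos2 a. rewrite /Rsqr in H2.
    rewrite (_ : _ + _ = (exp b ^ 2 + exp (- b) ^ 2) * (sin a * sin a + cos a * cos a) + 2 * (exp b * exp (- b)) * (2 * (sin a * sin a) - (sin a * sin a + cos a * cos a))); last ring.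
    rewrite H2 H1. rewrite (_ : (exp b - exp (- b)) ^ 2 = exp b ^ 2 + exp (- b) ^ 2 - 2 * (exp b * exp (- b))); last ring.
    rewrite H1. ring. }
  have Hb : b ^ 2 <= (exp b - exp (- b)) ^ 2.
  { have Hq : forall b, 0 <= b -> b <= exp b - exp (- b).
    { move=> x Hx. have H1 := exp_ineq1_le x. have H2 : exp (- x) <= 1.
      { rewrite -exp_0. case: Hx => [Hx|<-]; [apply Rlt_le, exp_increasing; lra|rewrite Ropp_0; lra]. }
      lra. }
    case: (Rle_lt_dec 0 b) => H0.
    - apply pow_incr. split => //. by apply Hq.
    - have := Hq (- b) ltac:(lra). rewrite Ropp_involutive. nra. }
  have Hs := sin_quarter a Hw.
  have Hm : Cmod w ^ 2 = a ^ 2 + b ^ 2 by apply Cmod2_alt.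
  have H0 := Cmod_ge_0 (sfun w). have H00 := Cmod_ge_0 w.
  have Ha2 := pow2_ge_0 a. have Hb2 := pow2_ge_0 b.
  have : (Cmod w / 2) ^ 2 <= Cmod (sfun w) ^ 2 by nra.
  move=> H. apply: Rsqr_incr_0 => //; last lra. rewrite /Rsqr. nra.
Qed.

Lemma sfun_scaled_lim w (N : nat -> R) :
  (forall j, 0 < N j) -> is_lim_seq (fun j => / N j) 0 ->
  Clim (fun j => RtoC (N j) * sfun (w / RtoC (N j)))%C (RtoC 2 * (Ci * w))%C.
Proof.
  move=> HN HL.
  have Hm := Cmod_ge_0 w.
  have HL2 : is_lim_seq (fun j => 40 * Cmod w ^ 2 * / N j) 0.
  { rewrite -(Rmult_0_r (40 * Cmod w ^ 2)). apply: is_lim_seq_mult' => //. apply is_lim_seq_const. }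
  have Hev : eventually (fun j => Cmod w * / N j <= 1).
  { have H3 : is_lim_seq (fun j => Cmod w * / N j) 0.
    { rewrite -(Rmult_0_r (Cmod w)). apply: is_lim_seq_mult' => //. apply is_lim_seq_const. }
    move/is_lim_seq_Reals/(_ 1 ltac:(lra)): H3 => [n0 H3]. exists n0 => n Hn.
    have := H3 n Hn. rewrite /R_dist /Rdist Rminus_0_r => /Rabs_def2. lra. }
  have Hd : eventually (fun j => Cmod (RtoC (N j) * sfun (w / RtoC (N j)) - RtoC 2 * (Ci * w))%C <= 40 * Cmod w ^ 2 * / N j).
  { apply: filter_imp Hev => j Hj. have Hn := HN j.
    have HNn : RtoC (N j) <> RtoC 0 by apply RtoC_nz; lra.
    have E : Cmod (w / RtoC (N j))%C = Cmod w * / N j by rewrite Cmod_div // Cmod_pos_R //; lra.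
    have H1 := sfun_limit_bound (w / RtoC (N j))%C ltac:(lra).
    rewrite (_ : (_ - _ = RtoC (N j) * (sfun (w / RtoC (N j)) - RtoC 2 * (Ci * (w / RtoC (N j)))))%C); last by field.
    rewrite Cmod_mult Cmod_pos_R; last lra. rewrite E in H1.
    apply: Rle_trans (Rmult_le_compat_l _ _ _ (Rlt_le _ _ Hn) H1) _. right. field. lra. }
  move: Hd => [j0 Hd].
  have Hsub : Clim (fun j => RtoC (N (j + j0)%nat) * sfun (w / RtoC (N (j + j0)%nat)))%C (RtoC 2 * (Ci * w))%C.
  { apply: (Clim_squeeze _ _ (fun j => 40 * Cmod w ^ 2 * / N (j + j0)%nat)).
    - move=> j. apply Hd. lia.
    - by apply (is_lim_seq_incr_n (fun j => 40 * Cmod w ^ 2 * / N j) j0). }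
  move: Hsub => [H1 H2]. split.
  - by apply (is_lim_seq_incr_n (fun j => Re (RtoC (N j) * sfun (w / RtoC (N j)))%C) j0).
  - by apply (is_lim_seq_incr_n (fun j => Im (RtoC (N j) * sfun (w / RtoC (N j)))%C) j0).
Qed.

Definition pairT (z : C) (k : nat) : C :=
  ((RtoC 2 * z - RtoC 1) / ((z + RtoC (INR k)) * (z - RtoC 1 - RtoC (INR k))))%C.

Lemma shift_nz z r : 0 < Im z -> (z + RtoC r)%C <> RtoC 0.
Proof.
  move=> H E. have : Im (z + RtoC r)%C = 0 by rewrite E.
  rewrite im_plus im_RtoC. lra.
Qed.

Lemma shift_nz' z r : 0 < Im z -> (z - RtoC 1 - RtoC r)%C <> RtoC 0.
Proof.
  move=> H. rewrite (_ : (z - RtoC 1 - RtoC r = z + RtoC (- 1 - r))%C).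
  - by apply shift_nz.
  - rewrite RtoC_minus RtoC_m1. ring.
Qed.

Lemma pair_shift_bound z : 0 < Im z -> exists K, 0 < K /\ forall k : nat,
   K * INR (S k) <= Cmod (z + RtoC (INR k))%C /\ K * INR (S k) <= Cmod (z - RtoC 1 - RtoC (INR k))%C.
Proof.
  move=> Hz. have [K [HK H]] := half_plane_lower_bound z Hz. exists K. split => // k.
  have Hk := pos_INR k. split.
  - have := H (INR k). rewrite Rabs_pos_eq // S_INR. lra.
  - have := H (- 1 - INR k). rewrite Rabs_left; last lra. rewrite S_INR.
    rewrite (_ : (z - RtoC 1 - RtoC (INR k) = z + RtoC (- 1 - INR k))%C); last by rewrite RtoC_minus RtoC_m1; ring.
    lra.
Qed.

Lemma is_lim_seq_inv_pow2 : is_lim_seq (fun j => / (2 * INR (2 ^ j))) 0.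
Proof.
  apply: (is_lim_seq_le_le (fun _ => 0) _ (fun j => / 2 * (/ 2) ^ j)).
  - move=> j. have H := INR_pow2_pos j. split; first by apply Rlt_le, Rinv_0_lt_compat; lra.
    rewrite pow_INR (_ : INR 2 = 2) // Rinv_mult pow_inv. apply Rle_refl.
  - apply is_lim_seq_const.
  - rewrite -(Rmult_0_r (/ 2)). apply: is_lim_seq_mult'; first by apply is_lim_seq_const.
    apply is_lim_seq_geom. rewrite Rabs_pos_eq; lra.
Qed.

Lemma cot_expansion z : 0 < Im z ->
  cabs (pairT z) /\ CSeries (pairT z) = (RtoC PI * Ci * ctf z)%C.
Proof.
  move=> Hz. have HPI := PI_RGT_0. have HP4 := PI_4.
  set N := fun j => 2 * INR (2 ^ j).
  have HN : forall j, 0 < N j by move=> j; have := INR_pow2_pos j; rewrite /N; lra.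
  have HL : is_lim_seq (fun j => / N j) 0 by apply is_lim_seq_inv_pow2.
  set A := fun (w : C) j => (RtoC (N j) * sfun (RtoC PI * w / RtoC (N j)))%C.
  set a := fun (j k : nat) => if Nat.ltb k (2 ^ j) then
     (RtoC 2 * RtoC PI * Ci * A (RtoC 2 * z - RtoC 1) j / (A (z + RtoC (INR k)) j * A (z - RtoC 1 - RtoC (INR k)) j))%C else RtoC 0.
  have HA : forall w, Clim (A w) (RtoC 2 * (Ci * (RtoC PI * w)))%C.
  { move=> w. by apply sfun_scaled_lim. }
  have HPIn : RtoC PI <> RtoC 0 by apply RtoC_nz; lra.
  have H2n := C2_nz. have Hin := Ci_nz.
  have HAn : forall w, w <> RtoC 0 -> (RtoC 2 * (Ci * (RtoC PI * w)))%C <> RtoC 0.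
  { move=> w Hw. by repeat apply Cmult_neq_0 => //. }
  have Ha : forall j, CSeries (a j) = (RtoC PI * Ci * ctf z)%C.
  { move=> j. rewrite (CSeries_finite _ (2 ^ j)); last first.
    { move=> k Hk. rewrite /a. by rewrite (proj2 (Nat.ltb_ge _ _) Hk). }
    have HNj := HN j. have HNn : RtoC (N j) <> RtoC 0 by apply RtoC_nz; lra.
    transitivity (bigs (fun k => (RtoC PI * Ci / RtoC (N j)) * (ctf ((z + RtoC (INR k)) / RtoC (2 * INR (2 ^ j))) + ctf ((z - RtoC 1 - RtoC (INR k)) / RtoC (2 * INR (2 ^ j)))))%C (2 ^ j)).
    - apply: bigs_ext => k Hk. rewrite /a (proj2 (Nat.ltb_lt _ _) Hk).
      set u := ((z + RtoC (INR k)) / RtoC (2 * INR (2 ^ j)))%C. set v := ((z - RtoC 1 - RtoC (INR k)) / RtoC (2 * INR (2 ^ j)))%C.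
      have Hu : 0 < Im u.
      { rewrite /u Im_div_R; last by rewrite -/(N j); lra. rewrite im_plus im_RtoC. apply Rdiv_lt_0_compat; [lra|apply HN]. }
      have Hv : 0 < Im v.
      { rewrite /v Im_div_R; last by rewrite -/(N j); lra. rewrite /Cminus !im_plus !im_opp !im_RtoC. apply Rdiv_lt_0_compat; [lra|apply HN]. }
      have [-> [K1 K2]] := ctf_add u v Hu Hv.
      have E1 : A (RtoC 2 * z - RtoC 1)%C j = (RtoC (N j) * sfun (RtoC PI * (u + v)))%C.
      { rewrite /A. do 2 f_equal. rewrite /u /v -/(N j) RtoC_2. field. exact HNn. }
      have E2 : A (z + RtoC (INR k))%C j = (RtoC (N j) * sfun (RtoC PI * u))%C.
      { rewrite /A. do 2 f_equal. rewrite /u -/(N j). field. exact HNn. }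
      have E3 : A (z - RtoC 1 - RtoC (INR k))%C j = (RtoC (N j) * sfun (RtoC PI * v))%C.
      { rewrite /A. do 2 f_equal. rewrite /v -/(N j). field. exact HNn. }
      rewrite E1 E2 E3. field. repeat split => //.
    - rewrite bigs_scal ctf_pairs // -/(N j). field. exact HNn. }
  have [K [HK HKk]] := pair_shift_bound z Hz.
  set B := 2 * PI * (42 * PI * Cmod (RtoC 2 * z - RtoC 1)) / ((PI * K / 2) ^ 2).
  have Hm := Cmod_ge_0 z. have Hm2 := Cmod_ge_0 (RtoC 2 * z - RtoC 1)%C.
  have HB : 0 <= B.
  { apply Rmult_le_pos; first by have := Rmult_le_pos _ _ (Rlt_le _ _ HPI) Hm2; nra.
    apply Rlt_le, Rinv_0_lt_compat, pow_lt. nra. }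
  have Hb : ex_series (fun k => B * / INR (S k) ^ 2).
  { apply: (ex_series_scal B (fun k => / INR (S k) ^ 2)). apply ex_series_inv_sq. }
  have Hl : forall k, Clim (fun j => a j k) (pairT z k).
  { move=> k.
    apply: (Clim_ext_loc (fun j => (RtoC 2 * RtoC PI * Ci * A (RtoC 2 * z - RtoC 1) j / (A (z + RtoC (INR k)) j * A (z - RtoC 1 - RtoC (INR k)) j))%C)).
    - exists k => j Hj. rewrite /a. rewrite (proj2 (Nat.ltb_lt k (2 ^ j))) //.
      have := Nat.pow_gt_lin_r 2 j. lia.
    - have N1 := shift_nz z (INR k) Hz. have N2 := shift_nz' z (INR k) Hz.
      rewrite (_ : pairT z k = (RtoC 2 * RtoC PI * Ci * (RtoC 2 * (Ci * (RtoC PI * (RtoC 2 * z - RtoC 1)))) *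
         / ((RtoC 2 * (Ci * (RtoC PI * (z + RtoC (INR k))))) * (RtoC 2 * (Ci * (RtoC PI * (z - RtoC 1 - RtoC (INR k)))))))%C).
      + apply: Clim_mult.
        * by apply: Clim_scal.
        * apply: Clim_inv; first by apply Cmult_neq_0; apply HAn.
          by apply: Clim_mult.
      + rewrite /pairT. field. repeat split => //. }
  have Hd : eventually (fun j => forall k, Cmod (a j k) <= B * / INR (S k) ^ 2).
  { have H3 : is_lim_seq (fun j => (Cmod z * 50 + PI * Cmod (RtoC 2 * z - RtoC 1)) * / N j) 0.
    { rewrite -(Rmult_0_r (Cmod z * 50 + PI * Cmod (RtoC 2 * z - RtoC 1))). apply: is_lim_seq_mult' => //. apply is_lim_seq_const. }
    move/is_lim_seq_Reals/(_ 1 ltac:(lra)): H3 => [n0 H3]. exists n0 => j Hj k.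
    have {H3} := H3 j Hj. rewrite /R_dist /Rdist Rminus_0_r => /Rabs_def2 [H3 _].
    have HNj := HN j. have HNn : RtoC (N j) <> RtoC 0 by apply RtoC_nz; lra.
    have H4 : Cmod z * 50 + PI * Cmod (RtoC 2 * z - RtoC 1)%C < N j.
    { apply (Rmult_lt_reg_r (/ N j)); first by apply Rinv_0_lt_compat. rewrite Rinv_r; lra. }
    have HSk : 0 < INR (S k) by apply lt_0_INR; lia.
    have Hrhs : 0 <= B * / INR (S k) ^ 2.
    { apply Rmult_le_pos => //. apply Rlt_le, Rinv_0_lt_compat, pow_lt => //. }
    rewrite /a. case: (Nat.ltb_spec k (2 ^ j)) => Hkj; last by rewrite Cmod_0.
    have Hk1 : INR k + 1 <= N j / 2.
    { rewrite /N -S_INR. have := le_INR (S k) (2 ^ j) ltac:(lia). lra. }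
    have Hk0 := pos_INR k.
    have Hlow : forall w, Rabs (Re w) <= Cmod z + N j / 2 -> PI * Cmod w / 2 <= Cmod (A w j).
    { move=> w Hw. rewrite /A Cmod_mult Cmod_pos_R; last lra.
      have := sfun_lower (RtoC PI * w / RtoC (N j))%C.
      rewrite Re_div_R; last lra. rewrite re_scal_l Cmod_div // Cmod_mult !Cmod_pos_R; try lra.
      move=> H. have H5 : Rabs (PI * Re w / N j) <= 209 / 100.
      { rewrite (_ : PI * Re w / N j = (PI / N j) * Re w); last by field; lra.
        rewrite Rabs_mult (Rabs_pos_eq (PI / N j)); last by apply Rlt_le, Rdiv_lt_0_compat.
        apply: (Rle_trans _ (PI / N j * (N j * (52 / 100)))).
        - apply Rmult_le_compat_l; [by apply Rlt_le, Rdiv_lt_0_compat|].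
          have := Rmult_le_pos _ _ (Rlt_le _ _ HPI) Hm2. lra.
        - rewrite (_ : PI / N j * (N j * (52 / 100)) = PI * (52 / 100)); [lra|field; lra]. }
      have H6 := Rmult_le_compat_l _ _ _ (Rlt_le _ _ HNj) (H H5).
      apply: Rle_trans H6. right. field. lra. }
    have Hup : Cmod (A (RtoC 2 * z - RtoC 1)%C j) <= 42 * PI * Cmod (RtoC 2 * z - RtoC 1)%C.
    { rewrite /A Cmod_mult Cmod_pos_R; last lra.
      have E : Cmod (RtoC PI * (RtoC 2 * z - RtoC 1) / RtoC (N j))%C = PI * Cmod (RtoC 2 * z - RtoC 1)%C / N j.
      { rewrite Cmod_div // Cmod_mult !Cmod_pos_R; lra. }
      have H1 : Cmod (RtoC PI * (RtoC 2 * z - RtoC 1) / RtoC (N j))%C <= 1.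
      { rewrite E. apply (Rmult_le_reg_r (N j)) => //. rewrite /Rdiv Rmult_assoc Rinv_l; lra. }
      have := Rmult_le_compat_l _ _ _ (Rlt_le _ _ HNj) (sfun_upper _ H1). rewrite E.
      move=> H. apply: Rle_trans H _. right. field. lra. }
    have [Q1 Q2] := HKk k.
    have L1 := Hlow (z + RtoC (INR k))%C. have L2 := Hlow (z - RtoC 1 - RtoC (INR k))%C.
    have {L1}L1 : PI * K / 2 * INR (S k) <= Cmod (A (z + RtoC (INR k))%C j).
    { apply: Rle_trans (L1 _); first by nra. rewrite re_plus re_RtoC.
      apply: Rle_trans (Rabs_triang _ _) _. rewrite (Rabs_pos_eq (INR k)) //. have := re_le_Cmod z. lra. }
    have {L2}L2 : PI * K / 2 * INR (S k) <= Cmod (A (z - RtoC 1 - RtoC (INR k))%C j).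
    { apply: Rle_trans (L2 _); first by nra. rewrite /Cminus !re_plus !re_opp !re_RtoC Rplus_assoc.
      apply: Rle_trans (Rabs_triang _ _) _. rewrite (Rabs_left (- (1) + - INR k)); last lra. have := re_le_Cmod z. lra. }
    have P0 : 0 < PI * K / 2 * INR (S k) by apply Rmult_lt_0_compat => //; nra.
    have NZ1 : A (z + RtoC (INR k))%C j <> RtoC 0 by apply/Cmod_gt_0; lra.
    have NZ2 : A (z - RtoC 1 - RtoC (INR k))%C j <> RtoC 0 by apply/Cmod_gt_0; lra.
    rewrite Cmod_div; last by apply Cmult_neq_0.
    have E2PI : Cmod (RtoC 2 * RtoC PI * Ci)%C = 2 * PI.
    { rewrite !Cmod_mult Cmod_Ci !Cmod_pos_R; lra. }
    rewrite (Cmod_mult (RtoC 2 * RtoC PI * Ci)%C) E2PI (Cmod_mult (A _ _)).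
    rewrite (_ : B * / INR (S k) ^ 2 = 2 * PI * (42 * PI * Cmod (RtoC 2 * z - RtoC 1)%C) / (PI * K / 2 * INR (S k) * (PI * K / 2 * INR (S k)))); last first.
    { rewrite /B. field. repeat split; lra. }
    apply Rmult_le_compat.
    - apply Rmult_le_pos; [lra|apply Cmod_ge_0].
    - apply Rlt_le, Rinv_0_lt_compat, Rmult_lt_0_compat; lra.
    - apply Rmult_le_compat_l => //. lra.
    - apply Rinv_le_contravar; first by apply Rmult_lt_0_compat.
      apply Rmult_le_compat; lra. }
  have [H1 H2] := tannery a (pairT z) _ Hb Hl Hd.
  split => //. apply: Clim_unique H2 _.
  apply: (Clim_ext (fun _ => RtoC PI * Ci * ctf z)%C); last by apply Clim_const.
  move=> j. by rewrite Ha.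
Qed.

(** * Lipschitz's formula *)

Lemma fubini_prod (a : nat -> nat -> C) (u v : nat -> R) :
  ex_series u -> ex_series v -> (forall i k, Cmod (a i k) <= u i * v k) ->
  (forall i, cabs (a i)) /\ ex_series (fun i => Series (fun k => Cmod (a i k))).
Proof.
  move=> Hu Hv H.
  have H1 : forall i, cabs (a i).
  { move=> i. apply: (cabs_le _ (fun k => u i * v k)) => //. by apply: (ex_series_scal (u i) v). }
  split => //.
  apply: (ex_series_le _ (fun i => u i * Series v)); last first.
  { apply: (ex_series_ext (fun i => Series v * u i)) => [i|]; first Rring. by apply: (ex_series_scal (Series v) u). }
  move=> i. rewrite /norm /= /abs /= Rabs_pos_eq; last by apply: (Series_pos _ _ (H1 i)) => k; apply Cmod_ge_0.
  rewrite -Series_scal_l. apply: Series_le.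
  - move=> n. split; [apply Cmod_ge_0|apply H].
  - by apply: (ex_series_scal (u i) v).
Qed.

Lemma ps_unique_R (a b : nat -> R) d : 0 < d ->
  ex_series (fun n => Rabs (a n * d ^ n)) -> ex_series (fun n => Rabs (b n * d ^ n)) ->
  (forall h, Rabs h < d -> Series (fun n => a n * h ^ n) = Series (fun n => b n * h ^ n)) ->
  forall n, a n = b n.
Proof.
  move=> Hd Ha Hb H n.
  have Hr : forall u, ex_series (fun n => Rabs (u n * d ^ n)) -> Rbar_lt 0 (CV_radius u).
  { move=> u Hu. apply: (Rbar_lt_le_trans _ d) => //.
    apply (proj1 (CV_radius_bounded u)).
    exists (Series (fun n => Rabs (u n * d ^ n))) => k.
    apply: (Series_pos_ge_term (fun n => Rabs (u n * d ^ n))) => // i. apply Rabs_pos. }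
  apply: PSeries_ext_recip; try by apply Hr.
  exists (mkposreal _ Hd) => h Hh. apply: H.
  move: Hh. rewrite /ball /= /AbsRing_ball /abs /minus /plus /opp /=. by rewrite Ropp_0 Rplus_0_r.
Qed.

Lemma ps_unique_C (a b : nat -> C) d : 0 < d ->
  (forall h, Rabs h <= d -> cabs (fun n => RtoC (h ^ n) * a n)%C /\ cabs (fun n => RtoC (h ^ n) * b n)%C /\
     CSeries (fun n => RtoC (h ^ n) * a n)%C = CSeries (fun n => RtoC (h ^ n) * b n)%C) ->
  forall n, a n = b n.
Proof.
  move=> Hd H n.
  have [Ha [Hb _]] := H d ltac:(rewrite Rabs_pos_eq; lra).
  have Hpr : forall (pr : C -> R), (forall r z, pr (RtoC r * z)%C = r * pr z) -> (forall z, Rabs (pr z) <= Cmod z) ->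
     (forall u, pr (CSeries u) = Series (fun n => pr (u n))) -> pr (a n) = pr (b n).
  { move=> pr Hm Hle Hs.
    have Hx : forall u, cabs (fun n => RtoC (d ^ n) * u n)%C -> ex_series (fun n => Rabs (pr (u n) * d ^ n)).
    { move=> u Hu. apply: (ex_series_le _ (fun n => Cmod (RtoC (d ^ n) * u n)%C)) => // k.
      rewrite /norm /= /abs /= Rabs_Rabsolu Rmult_comm -Hm. apply Hle. }
    apply: (ps_unique_R (fun n => pr (a n)) (fun n => pr (b n)) d) => //; try by apply Hx.
    move=> h Hh. have [_ [_ E]] := H h (Rlt_le _ _ Hh).
    transitivity (pr (CSeries (fun n => RtoC (h ^ n) * a n)%C)).
    - rewrite Hs. apply: Series_ext => k. rewrite Hm. ring.
    - rewrite E Hs. apply: Series_ext => k. rewrite Hm. ring. }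
  apply: C_eq; apply: Hpr.
  - by move=> r z; rewrite re_scal_l.
  - apply re_le_Cmod.
  - move=> u. by rewrite CSeries_eq.
  - by move=> r z; rewrite im_scal_l.
  - apply im_le_Cmod.
  - move=> u. by rewrite CSeries_eq.
Qed.

Definition Sm (m : nat) (z : C) : C :=
  CSeries (fun k => / Cpow (z + RtoC (INR k)) m + / Cpow (z - RtoC 1 - RtoC (INR k)) m)%C.

Lemma Cmod_ge_Im (z : C) : 0 < Im z -> Im z <= Cmod z.
Proof. move=> H. apply: Rle_trans (im_le_Cmod z). rewrite Rabs_pos_eq; lra. Qed.

Lemma inv_pow_bound (w : C) y K m n : 0 < y -> 0 < K -> y <= Cmod w -> K * INR (S n) <= Cmod w ->
  Cmod (/ Cpow w (m + 2))%C <= / y ^ m * (/ K ^ 2 * / INR (S n) ^ 2).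
Proof.
  move=> Hy HK H1 H2. have Hn : 0 < INR (S n) by apply lt_0_INR; lia.
  have Hw : w <> RtoC 0 by apply/Cmod_gt_0; lra.
  rewrite Cmod_inv; last by apply Cpow_nz. rewrite Cmod_pow.
  have Hym : 0 < y ^ m by apply pow_lt.
  have HKn : 0 < K * INR (S n) by apply Rmult_lt_0_compat.
  rewrite -!Rinv_mult. apply Rinv_le_contravar.
  - apply Rmult_lt_0_compat => //. apply Rmult_lt_0_compat; by apply pow_lt.
  - rewrite pow_add -Rpow_mult_distr. apply Rmult_le_compat; try (apply pow_le; lra).
    + apply pow_incr. lra.
    + apply pow_incr. lra.
Qed.

Lemma Sm_term_bound z : 0 < Im z -> exists K, 0 < K /\ forall m k,
   Cmod (/ Cpow (z + RtoC (INR k)) (m + 2))%C <= / Im z ^ m * (K * / INR (S k) ^ 2) /\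
   Cmod (/ Cpow (z - RtoC 1 - RtoC (INR k)) (m + 2))%C <= / Im z ^ m * (K * / INR (S k) ^ 2).
Proof.
  move=> Hz. have [K [HK H]] := pair_shift_bound z Hz.
  exists (/ K ^ 2). split; first by apply Rinv_0_lt_compat, pow_lt.
  move=> m k. have [H1 H2] := H k. split; apply inv_pow_bound => //.
  - have := Cmod_ge_Im (z + RtoC (INR k))%C. rewrite im_plus im_RtoC Rplus_0_r. by apply.
  - have := Cmod_ge_Im (z - RtoC 1 - RtoC (INR k))%C. rewrite /Cminus !im_plus !im_opp !im_RtoC !Ropp_0 !Rplus_0_r. by apply.
Qed.

Lemma Sm_abs_l z m : 0 < Im z -> cabs (fun k => / Cpow (z + RtoC (INR k)) (m + 2))%C.
Proof.
  move=> Hz. have [K [HK H]] := Sm_term_bound z Hz.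
  apply: cabs_le (fun k => proj1 (H m k)) _.
  apply: (ex_series_scal (/ Im z ^ m) (fun k => K * / INR (S k) ^ 2)).
  apply: (ex_series_scal K (fun k => / INR (S k) ^ 2)). apply ex_series_inv_sq.
Qed.

Lemma Sm_abs_r z m : 0 < Im z -> cabs (fun k => / Cpow (z - RtoC 1 - RtoC (INR k)) (m + 2))%C.
Proof.
  move=> Hz. have [K [HK H]] := Sm_term_bound z Hz.
  apply: cabs_le (fun k => proj2 (H m k)) _.
  apply: (ex_series_scal (/ Im z ^ m) (fun k => K * / INR (S k) ^ 2)).
  apply: (ex_series_scal K (fun k => / INR (S k) ^ 2)). apply ex_series_inv_sq.
Qed.

Lemma Cpow_opp_even_odd (x : C) n : Cpow (- x) n = (Cpow (- RtoC 1) n * Cpow x n)%C.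
Proof. rewrite -Cpow_mult_l. f_equal. ring. Qed.

Lemma inv_shift_series (w : C) h : w <> RtoC 0 -> (w + h)%C <> RtoC 0 -> Cmod h < Cmod w ->
  is_cs (fun m => Cpow (- h) (S m) * / Cpow w (m + 2))%C (/ (w + h) - / w)%C.
Proof.
  move=> Hw Hwh Hlt.
  have Hr : Cmod (- h / w)%C < 1.
  { rewrite Cmod_div // Cmod_opp. apply (Rmult_lt_reg_r (Cmod w)); first by have := Cmod_ge_0 h; lra.
    rewrite /Rdiv Rmult_assoc Rinv_l; have := Cmod_ge_0 h; lra. }
  have H := is_cs_scal (- h * / (w * w))%C _ _ (geom_cs _ Hr).
  rewrite (_ : (/ (w + h) - / w)%C = (- h * / (w * w) * / (RtoC 1 - - h / w))%C).
  - apply: is_cs_ext H => m. rewrite /Cdiv Cpow_mult_l Cpow_inv // Cpow_add_r Cpow_S.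
    have Hm : Cpow w m <> RtoC 0 by apply Cpow_nz.
    simpl (Cpow w 2). field. repeat split => //.
  - field. repeat split => //. by rewrite (_ : (w - - h = w + h)%C); last ring.
Qed.

Lemma ctf_geom z : 0 < Im z -> ctf z = (RtoC 1 - RtoC 2 * CSeries (fun n => Cpow (nome z) n))%C.
Proof.
  move=> Hz. have Hq := nome_lt_1 z Hz. rewrite (is_cs_unique _ _ (geom_cs _ Hq)).
  have H1 := nome_sub1_nz z Hz. have H2 := C_one_minus_nz _ Hq.
  rewrite /ctf RtoC_2. field. by split.
Qed.

Lemma pairT_split z k : 0 < Im z ->
  pairT z k = (/ (z + RtoC (INR k)) + / (z - RtoC 1 - RtoC (INR k)))%C.
Proof.
  move=> Hz. rewrite /pairT RtoC_2. field. split; [by apply shift_nz'|by apply shift_nz].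
Qed.

Definition npow (p n : nat) : R := INR n ^ p.

Definition two_pi_i : C := (RtoC 2 * RtoC PI * Ci)%C.

Lemma lipschitz_lhs z h : 0 < Im z -> Rabs h <= Im z / 2 ->
  cabs (fun m => RtoC (h ^ S m) * (Cpow (- RtoC 1) (S m) * Sm (m + 2) z))%C /\
  CSeries (fun m => RtoC (h ^ S m) * (Cpow (- RtoC 1) (S m) * Sm (m + 2) z))%C
    = (RtoC PI * Ci * (ctf (z + RtoC h) - ctf z))%C.
Proof.
  move=> Hz Hh. have Hh0 := Rabs_pos h.
  have Hzh : 0 < Im (z + RtoC h)%C by rewrite im_plus im_RtoC Rplus_0_r.
  have [C1 C2] := cot_expansion z Hz. have [C3 C4] := cot_expansion _ Hzh.
  set a := fun k m => (RtoC (h ^ S m) * (Cpow (- RtoC 1) (S m) * (/ Cpow (z + RtoC (INR k)) (m + 2) + / Cpow (z - RtoC 1 - RtoC (INR k)) (m + 2))))%C.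
  have [K [HK HB]] := Sm_term_bound z Hz.
  have Hb : forall k m, Cmod (a k m) <= / INR (S k) ^ 2 * (2 * K * Rabs h * (/ 2) ^ m).
  { move=> k m. rewrite /a !Cmod_mult Cmod_pow Cmod_opp Cmod_1 pow1 Rmult_1_l Cmod_R.
    have [B1 B2] := HB m k. have T := Cmod_triangle (/ Cpow (z + RtoC (INR k)) (m + 2))%C (/ Cpow (z - RtoC 1 - RtoC (INR k)) (m + 2))%C.
    have Hym : 0 < Im z ^ m by apply pow_lt.
    have E1 : Rabs (h ^ S m) * / Im z ^ m <= Rabs h * (/ 2) ^ m.
    { rewrite -RPow_abs -tech_pow_Rmult Rmult_assoc -pow_inv -Rpow_mult_distr. apply Rmult_le_compat_l => //.
      apply pow_incr. split.
      - apply Rmult_le_pos => //. by apply Rlt_le, Rinv_0_lt_compat.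
      - apply (Rmult_le_reg_r (Im z)) => //. rewrite Rmult_assoc Rinv_l; lra. }
    apply: (Rle_trans _ (Rabs (h ^ S m) * (2 * (/ Im z ^ m * (K * / INR (S k) ^ 2))))).
    - apply Rmult_le_compat_l; [apply Rabs_pos|lra].
    - have HS : 0 < / INR (S k) ^ 2 by apply Rinv_0_lt_compat, pow_lt, lt_0_INR; lia.
      have := Rmult_le_compat_r (2 * K * / INR (S k) ^ 2) _ _ ltac:(nra) E1. lra. }
  have Hv : ex_series (fun m => 2 * K * Rabs h * (/ 2) ^ m).
  { apply: (ex_series_scal (2 * K * Rabs h) (fun m => (/ 2) ^ m)). apply ex_series_geom. rewrite Rabs_pos_eq; lra. }
  have [F1 F2] := fubini_prod a _ _ ex_series_inv_sq Hv Hb.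
  have [G1 [G2 [G3 [G4 G5]]]] := fubini a F1 F2.
  have Ecol : forall m, CSeries (fun k => a k m) = (RtoC (h ^ S m) * (Cpow (- RtoC 1) (S m) * Sm (m + 2) z))%C.
  { move=> m. rewrite /a /Sm. rewrite -CSeries_scal; last by apply: cabs_plus; [apply Sm_abs_l|apply Sm_abs_r].
    rewrite -CSeries_scal //. apply: cabs_scal. by apply: cabs_plus; [apply Sm_abs_l|apply Sm_abs_r]. }
  split; first by apply: cabs_ext Ecol G4.
  rewrite -(CSeries_ext _ _ Ecol) -G5.
  rewrite (_ : (RtoC PI * Ci * (ctf (z + RtoC h) - ctf z))%C = (RtoC PI * Ci * ctf (z + RtoC h) - RtoC PI * Ci * ctf z)%C); last ring.
  rewrite -C2 -C4 -CSeries_minus //. apply: CSeries_ext => k.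
  apply: is_cs_unique. rewrite !pairT_split //.
  rewrite (_ : (_ - _)%C = ((/ ((z + RtoC (INR k)) + RtoC h) - / (z + RtoC (INR k))) + (/ ((z - RtoC 1 - RtoC (INR k)) + RtoC h) - / (z - RtoC 1 - RtoC (INR k))))%C); last first.
  { rewrite (_ : (z + RtoC h + RtoC (INR k) = z + RtoC (INR k) + RtoC h)%C); last ring.
    rewrite (_ : (z + RtoC h - RtoC 1 - RtoC (INR k) = z - RtoC 1 - RtoC (INR k) + RtoC h)%C); last ring. ring. }
  have Hlt : forall w, Im w = Im z -> is_cs (fun m => Cpow (- RtoC h) (S m) * / Cpow w (m + 2))%C (/ (w + RtoC h) - / w)%C.
  { move=> w Hw. apply inv_shift_series.
    - apply/Cmod_gt_0. have := Cmod_ge_Im w. lra.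
    - apply/Cmod_gt_0. have := Cmod_ge_Im (w + RtoC h)%C. rewrite im_plus im_RtoC. lra.
    - rewrite Cmod_R. have := Cmod_ge_Im w. lra. }
  have I1 := Hlt (z + RtoC (INR k))%C ltac:(rewrite im_plus im_RtoC; ring).
  have I2 := Hlt (z - RtoC 1 - RtoC (INR k))%C ltac:(rewrite /Cminus !im_plus !im_opp !im_RtoC; ring).
  apply: is_cs_ext (is_cs_plus _ _ _ _ I1 I2) => m.
  rewrite /a (Cpow_opp_even_odd (RtoC h)) RtoC_pow. ring.
Qed.

Lemma lipschitz_rhs z h : 0 < Im z -> Rabs h <= Im z / 2 ->
  cabs (fun m => RtoC (h ^ S m) * (Cpow two_pi_i (S m) / RtoC (INR (fact (S m))) * CPS (npow (S m)) (nome z)))%C /\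
  CSeries (fun m => RtoC (h ^ S m) * (Cpow two_pi_i (S m) / RtoC (INR (fact (S m))) * CPS (npow (S m)) (nome z)))%C
    = (CSeries (fun n => Cpow (nome (z + RtoC h)) n) - CSeries (fun n => Cpow (nome z) n))%C.
Proof.
  move=> Hz Hh. have Hh0 := Rabs_pos h. have HPI := PI_RGT_0.
  have Hzh : 0 < Im (z + RtoC h)%C by rewrite im_plus im_RtoC Rplus_0_r.
  set q := nome z. have Hq : Cmod q < 1 by apply nome_lt_1.
  have Hq0 := Cmod_ge_0 q.
  set x := fun n => (RtoC h * two_pi_i * RtoC (INR n))%C.
  set a := fun n m => (Cpow q n * (Cpow (x n) (S m) / RtoC (INR (fact (S m)))))%C.
  have Hx : forall n, Cmod (x n) = 2 * PI * Rabs h * INR n.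
  { move=> n. rewrite /x /two_pi_i !Cmod_mult Cmod_Ci !Cmod_R (Rabs_pos_eq 2) ?(Rabs_pos_eq PI) ?(Rabs_pos_eq (INR n)); try lra.
    apply pos_INR. }
  have F1 : forall n, cabs (a n).
  { move=> n. apply: cabs_scal. by apply/(cabs_incr_1 (fun m => Cpow (x n) m / RtoC (INR (fact m)))%C); apply Cexps_abs. }
  have F1b : forall n, Series (fun m => Cmod (a n m)) <= (Cmod q * exp (2 * PI * Rabs h)) ^ n.
  { move=> n. rewrite Rpow_mult_distr.
    have E : exp (2 * PI * Rabs h) ^ n = exp (Cmod (x n)).
    { rewrite Hx. elim: n => [|n IH]; first by rewrite /= Rmult_0_r exp_0.
      rewrite -tech_pow_Rmult IH -exp_plus S_INR. f_equal. ring. }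
    rewrite E.
    have Hs := exp_is_series (Cmod (x n)).
    have Hs2 := is_series_unique _ _ Hs.
    rewrite -Hs2 (Series_incr_1 _ (ex_intro _ _ Hs)) /=.
    apply: (Rle_trans _ (Cmod q ^ n * Series (fun k => Cmod (x n) * Cmod (x n) ^ k / INR (fact k + k * fact k)))).
    - rewrite -Series_scal_l. right. apply: Series_ext => m. rewrite /a Cmod_mult Cmod_pow Cmod_exp_term //.
    - apply Rmult_le_compat_l; first by apply pow_le. lra. }
  have Hgeo : Cmod q * exp (2 * PI * Rabs h) < 1.
  { rewrite /q Cmod_nome -exp_plus -exp_0. apply exp_increasing. nra. }
  have F2 : ex_series (fun n => Series (fun m => Cmod (a n m))).
  { apply: (ex_series_le _ (fun n => (Cmod q * exp (2 * PI * Rabs h)) ^ n)).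
    - move=> n. rewrite /norm /= /abs /= Rabs_pos_eq; first by apply F1b.
      apply: (Series_pos _ _ (F1 n)) => m. apply Cmod_ge_0.
    - apply ex_series_geom. rewrite Rabs_pos_eq //. apply Rmult_le_pos => //. apply Rlt_le, exp_pos. }
  have [G1 [G2 [G3 [G4 G5]]]] := fubini a F1 F2.
  have Ecol : forall m, CSeries (fun n => a n m) = (RtoC (h ^ S m) * (Cpow two_pi_i (S m) / RtoC (INR (fact (S m))) * CPS (npow (S m)) q))%C.
  { move=> m. rewrite Cmult_assoc /CPS -CSeries_scal; last by apply CPS_abs => //; apply rad1_pow.
    apply: CSeries_ext => n. rewrite /a /x /npow !Cpow_mult_l !RtoC_pow. field. apply RtoC_nz, Rgt_not_eq, INR_fact_pos. }
  split; first by apply: cabs_ext Ecol G4.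
  rewrite -(CSeries_ext _ _ Ecol) -G5 -CSeries_minus; try by apply geom_abs, nome_lt_1.
  apply: CSeries_ext => n.
  have E : nome (z + RtoC h)%C = (q * Cexp (RtoC h * two_pi_i))%C.
  { rewrite nome_add. f_equal. rewrite /nome /two_pi_i. f_equal. ring. }
  rewrite E Cpow_mult_l -Cexp_pow.
  rewrite (_ : (_ - _)%C = (Cpow q n * (Cexp (x n) - RtoC 1))%C); last first.
  { rewrite (_ : (RtoC (INR n) * (RtoC h * two_pi_i))%C = x n); last by rewrite /x; ring. rewrite -/q. ring. }
  apply: is_cs_unique. apply: is_cs_scal.
  have := proj1 (is_cs_incr_1 _ _) (Cexp_series (x n)). rewrite (_ : (Cpow (x n) 0 / RtoC (INR (fact 0)))%C = RtoC 1) //.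
  simpl. field.
Qed.

Theorem lipschitz m z : 0 < Im z ->
  Sm (m + 2) z = (Cpow (- two_pi_i) (m + 2) / RtoC (INR (fact (S m))) * CPS (npow (S m)) (nome z))%C.
Proof.
  move=> Hz.
  set A := fun n => match n with O => RtoC 0 | S m => (Cpow (- RtoC 1) (S m) * Sm (m + 2) z)%C end.
  set B0 := fun m => (Cpow two_pi_i (S m) / RtoC (INR (fact (S m))) * CPS (npow (S m)) (nome z))%C.
  set B := fun n => match n with O => RtoC 0 | S m => (- two_pi_i * B0 m)%C end.
  have H : A (S m) = B (S m).
  { apply: (ps_unique_C A B (Im z / 2)); first lra.
    move=> h Hh.
    have [L1 L2] := lipschitz_lhs z h Hz Hh. have [R1 R2] := lipschitz_rhs z h Hz Hh.
    have R1' : cabs (fun m => RtoC (h ^ S m) * B (S m))%C.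
    { apply: (cabs_ext (fun m => - two_pi_i * (RtoC (h ^ S m) * B0 m))%C) => [k|]; first by rewrite /B; ring.
      by apply: cabs_scal. }
    have E1 : cabs (fun n => RtoC (h ^ n) * A n)%C by apply/cabs_incr_1.
    have E2 : cabs (fun n => RtoC (h ^ n) * B n)%C by apply/cabs_incr_1.
    do 2 split => //.
    rewrite (CSeries_incr_1 _ E1) (CSeries_incr_1 _ E2).
    rewrite (_ : A O = RtoC 0) // (_ : B O = RtoC 0) // !Cmult_0_r !Cplus_0_l.
    rewrite L2 (CSeries_ext _ (fun m => - two_pi_i * (RtoC (h ^ S m) * B0 m))%C); last by move=> k; rewrite /B; ring.
    rewrite CSeries_scal // R2 !ctf_geom //; last by rewrite im_plus im_RtoC Rplus_0_r.
    rewrite /two_pi_i. ring. }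
  rewrite /A /B /B0 in H.
  have Hs : (Cpow (- RtoC 1) (S m) * Cpow (- RtoC 1) (S m) = RtoC 1)%C.
  { rewrite -Cpow_mult_l (_ : (- RtoC 1 * - RtoC 1 = RtoC 1)%C); last ring. apply Cpow_1_l. }
  rewrite -(Cmult_1_l (Sm _ _)) -Hs -Cmult_assoc H.
  rewrite (Cpow_opp_even_odd two_pi_i) (_ : (m + 2 = S (S m))%nat); last lia.
  rewrite (Cpow_S (- RtoC 1)%C (S m)) (Cpow_S two_pi_i (S m)). rewrite /Cdiv. ring.
Qed.

Lemma npow_abs p q : Cmod q < 1 -> cabs (fun n => RtoC (npow p n) * Cpow q n)%C.
Proof. move=> H. apply CPS_abs => //. apply rad1_pow. Qed.

Lemma npow_shift p q : Cmod q < 1 ->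
  CPS (npow (S p)) q = (q * CSeries (fun n => RtoC (INR (S n) ^ S p) * Cpow q n))%C /\
  cabs (fun n => RtoC (INR (S n) ^ S p) * Cpow q n)%C.
Proof.
  move=> Hq. have Ha := npow_abs (S p) q Hq.
  have Hc : cabs (fun n => RtoC (INR (S n) ^ S p) * Cpow q n)%C.
  { apply: (cabs_le _ (fun n => 2 ^ S p * (Rabs (INR n ^ S p) * Cmod q ^ n) + Cmod q ^ n)).
    - move=> n. rewrite Cmod_mult Cmod_pow Cmod_R.
      have Hn := pos_INR n. have Hq0 : 0 <= Cmod q ^ n by apply pow_le, Cmod_ge_0.
      rewrite !Rabs_pos_eq; try (apply pow_le; try apply pos_INR).
      case: n Hn Hq0 => [|n] Hn Hq0; first by rewrite /= pow1; have := pow_le 2 (S p) ltac:(lra); simpl; lra.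
      have H1 : 1 <= INR (S n) by rewrite S_INR; have := pos_INR n; lra.
      have : INR (S (S n)) ^ S p <= (2 * INR (S n)) ^ S p.
      { apply pow_incr. rewrite (S_INR (S n)). lra. }
      rewrite Rpow_mult_distr. nra.
    - apply: (ex_series_plus (fun n => 2 ^ S p * (Rabs (INR n ^ S p) * Cmod q ^ n))).
      + apply: (ex_series_scal (2 ^ S p) (fun n => Rabs (INR n ^ S p) * Cmod q ^ n)).
        apply rad1_pow. split => //. apply Cmod_ge_0.
      + apply ex_series_geom. rewrite Rabs_pos_eq //. apply Cmod_ge_0. }
  split => //. rewrite /CPS (CSeries_incr_1 _ Ha) -CSeries_scal //.
  rewrite {1}/npow (_ : INR 0 ^ S p = 0); last by simpl; ring.
  rewrite Cmult_0_l Cplus_0_l. apply: CSeries_ext => n. rewrite /npow Cpow_S. ring.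
Qed.

Lemma npow_closed q : Cmod q < 1 ->
  CPS (npow 1) q = (q / ((RtoC 1 - q) * (RtoC 1 - q)))%C /\
  CPS (npow 3) q = (q * (RtoC 1 + RtoC 4 * q + q * q) / Cpow (RtoC 1 - q) 4)%C.
Proof.
  move=> Hq. have Hn := C_one_minus_nz _ Hq.
  have E0 : CPS (npow 0) q = (/ (RtoC 1 - q))%C.
  { rewrite -(is_cs_unique _ _ (geom_cs _ Hq)). apply: CSeries_ext => n. rewrite /npow /=. ring. }
  have A0 := npow_abs 0 q Hq. have A1 := npow_abs 1 q Hq. have A2 := npow_abs 2 q Hq. have A3 := npow_abs 3 q Hq.
  have E1 : CPS (npow 1) q = (q * (CPS (npow 0) q + CPS (npow 1) q))%C.
  { rewrite {1}(proj1 (npow_shift 0 q Hq)). f_equal. rewrite /CPS -CSeries_plus //. apply: CSeries_ext => n.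
    rewrite S_INR /npow (_ : (INR n + 1) ^ 1 = INR n ^ 0 + INR n ^ 1); last ring. rewrite RtoC_plus. ring. }
  have B1 := cabs_scal (RtoC 2) _ A1. have B2 := cabs_scal (RtoC 3) _ A1. have B3 := cabs_scal (RtoC 3) _ A2.
  have E2 : CPS (npow 2) q = (q * (CPS (npow 0) q + (RtoC 2 * CPS (npow 1) q + CPS (npow 2) q)))%C.
  { rewrite {1}(proj1 (npow_shift 1 q Hq)). f_equal. rewrite /CPS -CSeries_scal // -!CSeries_plus //; last by apply: cabs_plus.
    apply: CSeries_ext => n.
    rewrite S_INR /npow (_ : (INR n + 1) ^ 2 = INR n ^ 0 + (2 * INR n ^ 1 + INR n ^ 2)); last ring. rewrite !RtoC_plus RtoC_mult. ring. }
  have E3 : CPS (npow 3) q = (q * (CPS (npow 0) q + (RtoC 3 * CPS (npow 1) q + (RtoC 3 * CPS (npow 2) q + CPS (npow 3) q))))%C.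
  { rewrite {1}(proj1 (npow_shift 2 q Hq)). f_equal. rewrite /CPS -!CSeries_scal // -!CSeries_plus //; try by repeat apply: cabs_plus.
    apply: CSeries_ext => n.
    rewrite S_INR /npow (_ : (INR n + 1) ^ 3 = INR n ^ 0 + (3 * INR n ^ 1 + (3 * INR n ^ 2 + INR n ^ 3))); last ring. rewrite !RtoC_plus !RtoC_mult. ring. }
  have sol : forall x r : C, (x = q * (r + x))%C -> x = (q * r / (RtoC 1 - q))%C.
  { move=> x r E. have E' : (x * (RtoC 1 - q) = q * r)%C by rewrite {1}E; ring_simplify; rewrite {2}E; ring.
    rewrite -E'. field. exact Hn. }
  have F1 := sol _ _ E1. rewrite E0 in F1.
  have F1' : CPS (npow 1) q = (q / ((RtoC 1 - q) * (RtoC 1 - q)))%C by rewrite F1; field.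
  split => //.
  have F2 : CPS (npow 2) q = (q * (RtoC 1 + q) / Cpow (RtoC 1 - q) 3)%C.
  { rewrite Cplus_assoc in E2. rewrite (sol _ _ E2) E0 F1' RtoC_2. simpl (Cpow _ 3). field. exact Hn. }
  have C3 : RtoC 3 = (RtoC 1 + RtoC 1 + RtoC 1)%C by apply C_eq; simpl; ring.
  have C4 : RtoC 4 = (RtoC 1 + RtoC 1 + RtoC 1 + RtoC 1)%C by apply C_eq; simpl; ring.
  rewrite !Cplus_assoc in E3. rewrite (sol _ _ E3) E0 F1' F2 C3 C4. simpl. field. exact Hn.
Qed.

Lemma lim_opp (u : nat -> R) (l : R) : is_lim_seq u l -> is_lim_seq (fun n => - u n) (- l).
Proof. move=> H. exact (proj1 (is_lim_seq_opp u (Finite l)) H). Qed.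

Lemma is_series_zero : is_series (fun _ : nat => 0) 0.
Proof.
  have H : is_lim_seq (sum_n (fun _ : nat => 0)) 0.
  { apply: (is_lim_seq_ext (fun _ => 0)); last by apply is_lim_seq_const.
    move=> n. rewrite sum_n_const. ring. }
  exact H.
Qed.

Definition zhalf (n : nat) : C := (RtoC (/ 2) + Ci * RtoC (/ INR (S n)))%C.

Lemma Im_zhalf n : Im (zhalf n) = / INR (S n).
Proof. rewrite /zhalf /Im. simpl. ring. Qed.

Lemma Re_zhalf n : Re (zhalf n) = / 2.
Proof. rewrite /zhalf /Re. simpl. ring. Qed.

Lemma zhalf_pos n : 0 < Im (zhalf n).
Proof. rewrite Im_zhalf. apply Rinv_0_lt_compat, lt_0_INR. lia. Qed.

Lemma is_lim_inv_S : is_lim_seq (fun n => / INR (S n)) 0.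
Proof.
  apply (is_lim_seq_incr_1 (fun n => / INR n)).
  apply: (is_lim_seq_inv INR p_infty) => //. apply is_lim_seq_INR.
Qed.

Lemma nome_zhalf_lim : Clim (fun n => nome (zhalf n)) (RtoC (-1)).
Proof.
  apply: (Clim_ext (fun n => RtoC (- exp (- (2 * PI * / INR (S n)))))).
  - move=> n. rewrite /zhalf nome_add nome_half /nome.
    rewrite (_ : (RtoC 2 * RtoC PI * Ci * (Ci * RtoC (/ INR (S n))))%C = RtoC (- (2 * PI * / INR (S n)))).
    + rewrite Cexp_RtoC -RtoC_mult. f_equal. ring.
    + apply C_eq; simpl; ring.
  - split; last by apply: (is_lim_seq_ext (fun _ => 0)) => //; apply is_lim_seq_const.
    apply: (lim_opp (fun n => exp (- (2 * PI * / INR (S n)))) 1).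
    rewrite -exp_0. apply: (is_lim_seq_continuous exp (fun n => - (2 * PI * / INR (S n))) 0).
    + apply derivable_continuous_pt, derivable_pt_exp.
    + rewrite (_ : 0 = - (2 * PI * 0)); last by ring.
      apply: lim_opp. apply: is_lim_seq_mult'; [apply is_lim_seq_const|apply is_lim_inv_S].
Qed.

Lemma zhalf_lim : Clim zhalf (RtoC (/ 2)).
Proof.
  rewrite -(Cplus_0_r (RtoC (/ 2))). apply: Clim_plus; first by apply Clim_const.
  rewrite (_ : RtoC 0 = (Ci * RtoC 0)%C); last ring. apply: Clim_scal.
  split; [exact is_lim_inv_S|apply is_lim_seq_const].
Qed.

Lemma Clim_Cpow u l m : Clim u l -> Clim (fun n => Cpow (u n) m) (Cpow l m).
Proof.
  move=> H. elim: m => [|m IH]; first by apply Clim_const.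
  by apply: Clim_mult.
Qed.

Lemma Sm_half_limit m :
  Clim (fun n => Sm (m + 2) (zhalf n))
    (CSeries (fun k => / Cpow (RtoC (INR k + / 2)) (m + 2) + / Cpow (RtoC (- (INR k + / 2))) (m + 2))%C).
Proof.
  have Hk : forall k, 0 < INR k + / 2 by move=> k; have := pos_INR k; lra.
  apply: (proj2 (tannery (fun n k => / Cpow (zhalf n + RtoC (INR k)) (m + 2) + / Cpow (zhalf n - RtoC 1 - RtoC (INR k)) (m + 2))%C
     _ (fun k => 2 * 2 ^ (m + 2) * / INR (S k) ^ 2) _ _ _)).
  - apply: (ex_series_scal (2 * 2 ^ (m + 2)) (fun k => / INR (S k) ^ 2)). apply ex_series_inv_sq.
  - move=> k. have H := Hk k.
    apply: Clim_plus; apply: Clim_inv; try (apply Cpow_nz, RtoC_nz; lra); apply: Clim_Cpow.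
    + rewrite Rplus_comm RtoC_plus. apply: Clim_plus; [apply zhalf_lim|apply Clim_const].
    + rewrite (_ : RtoC (- (INR k + / 2)) = (RtoC (/ 2) - RtoC 1 - RtoC (INR k))%C); last by apply C_eq; simpl; field.
      repeat apply: Clim_minus; [apply zhalf_lim|apply Clim_const|apply Clim_const].
  - exists O => n _ k.
    have H1 : 1 <= INR (S k) by rewrite S_INR; have := pos_INR k; lra.
    have Hw : forall w, INR (S k) / 2 <= Cmod w -> Cmod (/ Cpow w (m + 2))%C <= 2 ^ (m + 2) * / INR (S k) ^ 2.
    { move=> w Hw. have Hwn : w <> RtoC 0 by apply/Cmod_gt_0; lra.
      rewrite Cmod_inv; last by apply Cpow_nz. rewrite Cmod_pow.
      apply: (Rle_trans _ (/ (INR (S k) / 2) ^ (m + 2))).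
      - apply Rinv_le_contravar; first by apply pow_lt; lra. apply pow_incr. lra.
      - rewrite /Rdiv Rpow_mult_distr Rinv_mult pow_inv Rinv_inv Rmult_comm.
        apply Rmult_le_compat_l; first by apply pow_le; lra.
        apply Rinv_le_contravar; first by apply pow_lt; lra.
        apply Rle_pow => //. lia. }
    have R1 : INR (S k) / 2 <= Cmod (zhalf n + RtoC (INR k))%C.
    { apply: Rle_trans (re_le_Cmod _). rewrite re_plus Re_zhalf re_RtoC Rabs_pos_eq; rewrite ?S_INR; have := pos_INR k; lra. }
    have R2 : INR (S k) / 2 <= Cmod (zhalf n - RtoC 1 - RtoC (INR k))%C.
    { apply: Rle_trans (re_le_Cmod _). rewrite (_ : Re (zhalf n - RtoC 1 - RtoC (INR k)) = / 2 - 1 - INR k); last by rewrite /zhalf /Re; simpl; ring.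
      rewrite Rabs_left; rewrite ?S_INR; have := pos_INR k; lra. }
    apply: Rle_trans (Cmod_triangle _ _) _. have := Hw _ R1. have := Hw _ R2. lra.
Qed.

Lemma zeta_split (m : nat) : (2 <= m)%nat ->
  ex_series (fun k => / INR (S k) ^ m) /\ ex_series (fun k => / (INR k + / 2) ^ m) /\
  Series (fun k => / (INR k + / 2) ^ m) = (2 ^ m - 1) * Series (fun k => / INR (S k) ^ m).
Proof.
  move=> Hm.
  have Hpos : forall k, 1 <= INR (S k) by move=> k; rewrite S_INR; have := pos_INR k; lra.
  have E1 : ex_series (fun k => / INR (S k) ^ m).
  { apply: (ex_series_le _ (fun k => / INR (S k) ^ 2)); last by apply ex_series_inv_sq.
    move=> k. have H := Hpos k. rewrite /norm /= /abs /= -/(INR (S k)) Rabs_pos_eq; last by apply Rlt_le, Rinv_0_lt_compat, pow_lt; lra.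
    apply Rinv_le_contravar; first by apply (pow_lt _ 2); lra. by apply (Rle_pow _ 2). }
  have E2 : ex_series (fun k => / (INR k + / 2) ^ m).
  { apply: (ex_series_le _ (fun k => 2 ^ m * / INR (S k) ^ m)); last by apply: (ex_series_scal (2 ^ m) (fun k => / INR (S k) ^ m)).
    move=> k. have H := Hpos k. have Hk := pos_INR k. rewrite /norm /= /abs /= -/(INR (S k)) Rabs_pos_eq; last by apply Rlt_le, Rinv_0_lt_compat, pow_lt; lra.
    rewrite (_ : 2 ^ m * / INR (S k) ^ m = / (INR (S k) * / 2) ^ m); last by rewrite Rpow_mult_distr Rinv_mult pow_inv Rinv_inv; ring.
    apply Rinv_le_contravar; first by apply pow_lt; lra.
    apply pow_incr. rewrite S_INR. lra. }
  split => //. split => //.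
  set u := fun k => / INR (S k) ^ m. set o := fun k => / (INR k + / 2) ^ m.
  have H2m : 0 < 2 ^ m by apply pow_lt; lra.
  have Ho : forall k, u (2 * k)%nat = / 2 ^ m * o k.
  { move=> k. rewrite /u /o -Rinv_mult -Rpow_mult_distr. do 2 f_equal. rewrite S_INR mult_INR. simpl. field. }
  have He : forall k, u (2 * k + 1)%nat = / 2 ^ m * u k.
  { move=> k. rewrite /u -Rinv_mult -Rpow_mult_distr. do 2 f_equal. rewrite !S_INR plus_INR mult_INR. simpl. ring. }
  have Hsum : forall n, sum_n u (2 * n + 1) = sum_n (fun k => / 2 ^ m * o k + / 2 ^ m * u k) n.
  { elim=> [|n IH].
    - rewrite (_ : (2 * 0 + 1)%nat = 1%nat) // sum_Sn !sum_O -Ho -He //.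
    - rewrite (_ : (2 * S n + 1)%nat = S (S (2 * n + 1))); last lia.
      rewrite !sum_Sn IH -Ho -He.
      rewrite (_ : S (S (2 * n + 1)) = (2 * S n + 1)%nat); last lia.
      rewrite (_ : S (2 * n + 1) = (2 * S n)%nat); last lia.
      exact (Rplus_assoc _ _ _). }
  have L1 : is_lim_seq (fun n => sum_n u (2 * n + 1)) (Series u).
  { apply: (is_lim_seq_subseq (sum_n u) _ (fun n => (2 * n + 1)%nat)); last by apply: Series_correct E1.
    move=> P [N HN]. exists N => n Hn. apply HN. lia. }
  have S1 : ex_series (fun k => / 2 ^ m * o k) by apply: (ex_series_scal (/ 2 ^ m) o).
  have S2 : ex_series (fun k => / 2 ^ m * u k) by apply: (ex_series_scal (/ 2 ^ m) u).
  have L2 : is_lim_seq (fun n => sum_n u (2 * n + 1)) (Series (fun k => / 2 ^ m * o k + / 2 ^ m * u k)).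
  { apply: (is_lim_seq_ext (sum_n (fun k => / 2 ^ m * o k + / 2 ^ m * u k))) => [n|]; first by rewrite Hsum.
    by apply: Series_correct; apply: (ex_series_plus (fun k => / 2 ^ m * o k)). }
  have E := is_lim_seq_unique _ _ L1. rewrite (is_lim_seq_unique _ _ L2) in E.
  rewrite Series_plus // !Series_scal_l in E.
  have E' : / 2 ^ m * Series o + / 2 ^ m * Series u = Series u by congruence.
  have : Series o = 2 ^ m * (/ 2 ^ m * Series o) by field; lra.
  move=> ->. rewrite (_ : / 2 ^ m * Series o = Series u - / 2 ^ m * Series u); last lra. field. lra.
Qed.

Lemma RtoC_Series (u : nat -> R) : ex_series u -> is_cs (fun n => RtoC (u n)) (RtoC (Series u)).
Proof.
  move=> H. split; first by apply: Series_correct H.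
  exact is_series_zero.
Qed.

Definition zeta2 : R := Series (fun k => / INR (S k) ^ 2).
Definition zeta4 : R := Series (fun k => / INR (S k) ^ 4).

Lemma Sm_half_even m : Nat.Even m ->
  CSeries (fun k => / Cpow (RtoC (INR k + / 2)) (m + 2) + / Cpow (RtoC (- (INR k + / 2))) (m + 2))%C
   = RtoC (2 * ((2 ^ (m + 2) - 1) * Series (fun k => / INR (S k) ^ (m + 2)))).
Proof.
  move=> [p Hp]. have [E1 [E2 E3]] := zeta_split (m + 2) ltac:(lia).
  rewrite -E3 -Series_scal_l. apply: is_cs_unique.
  apply: is_cs_ext (RtoC_Series _ _); last by apply: (ex_series_scal 2 (fun k => / (INR k + / 2) ^ (m + 2))).
  move=> k. have Hk := pos_INR k.
  rewrite -!RtoC_pow -!RtoC_inv; try (apply pow_nonzero; lra).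
  rewrite (_ : (- (INR k + / 2)) ^ (m + 2) = (INR k + / 2) ^ (m + 2)); last first.
  { rewrite (_ : (m + 2 = 2 * (p + 1))%nat); last lia. rewrite !pow_mult. f_equal. ring. }
  rewrite -RtoC_plus. f_equal. ring.
Qed.

Lemma zeta2_eq : zeta2 = PI ^ 2 / 6.
Proof.
  have H1 := Sm_half_limit 0. rewrite (Sm_half_even 0) in H1; last by exists O.
  have H2 : Clim (fun n => Sm (0 + 2) (zhalf n)) (Cpow (- two_pi_i) 2 / RtoC (INR (fact 1)) * (RtoC (-1) / ((RtoC 1 - RtoC (-1)) * (RtoC 1 - RtoC (-1)))))%C.
  { apply: (Clim_ext (fun n => (Cpow (- two_pi_i) 2 / RtoC (INR (fact 1)) * (nome (zhalf n) / ((RtoC 1 - nome (zhalf n)) * (RtoC 1 - nome (zhalf n)))))%C)).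
    - move=> n. rewrite lipschitz; last by apply zhalf_pos.
      by rewrite (proj1 (npow_closed _ (nome_lt_1 _ (zhalf_pos n)))).
    - have HN := nome_zhalf_lim.
      apply: Clim_scal. apply: Clim_mult => //. apply: Clim_inv.
      + rewrite -RtoC_minus -RtoC_mult. apply RtoC_nz. lra.
      + apply: Clim_mult; apply: Clim_minus => //; apply Clim_const. }
  have E := Clim_unique _ _ _ H1 H2.
  have {}E := f_equal Re E. rewrite re_RtoC in E.
  rewrite (_ : (Cpow (- two_pi_i) 2 / RtoC (INR (fact 1)) * (RtoC (-1) / ((RtoC 1 - RtoC (-1)) * (RtoC 1 - RtoC (-1)))))%C = RtoC (PI ^ 2)) in E.
  - rewrite re_RtoC in E. rewrite /zeta2. simpl (0 + 2)%nat in E. lra.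
  - rewrite (_ : Cpow (- two_pi_i) 2 = RtoC (- 4 * PI ^ 2)); last by rewrite /two_pi_i; apply C_eq; simpl; ring.
    rewrite (_ : INR (fact 1) = 1) // -RtoC_minus -RtoC_mult -!RtoC_div; try lra. rewrite -RtoC_mult. f_equal. field.
Qed.

Lemma zeta4_eq : zeta4 = PI ^ 4 / 90.
Proof.
  have H1 := Sm_half_limit 2. rewrite (Sm_half_even 2) in H1; last by exists 1%nat.
  have H2 : Clim (fun n => Sm (2 + 2) (zhalf n)) (Cpow (- two_pi_i) 4 / RtoC (INR (fact 3)) * (RtoC (-1) * (RtoC 1 + RtoC 4 * RtoC (-1) + RtoC (-1) * RtoC (-1)) / Cpow (RtoC 1 - RtoC (-1)) 4))%C.
  { apply: (Clim_ext (fun n => (Cpow (- two_pi_i) 4 / RtoC (INR (fact 3)) * (nome (zhalf n) * (RtoC 1 + RtoC 4 * nome (zhalf n) + nome (zhalf n) * nome (zhalf n)) / Cpow (RtoC 1 - nome (zhalf n)) 4))%C)).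
    - move=> n. rewrite lipschitz; last by apply zhalf_pos.
      by rewrite (proj2 (npow_closed _ (nome_lt_1 _ (zhalf_pos n)))).
    - have HN := nome_zhalf_lim.
      apply: Clim_scal. apply: Clim_mult.
      + apply: Clim_mult => //. repeat apply: Clim_plus; [apply Clim_const|by apply: Clim_scal|by apply: Clim_mult].
      + apply: Clim_inv.
        * rewrite -RtoC_minus. apply Cpow_nz, RtoC_nz. lra.
        * apply: Clim_Cpow. apply: Clim_minus => //; apply Clim_const. }
  have E := Clim_unique _ _ _ H1 H2.
  have {}E := f_equal Re E. rewrite re_RtoC in E.
  rewrite (_ : (Cpow (- two_pi_i) 4 / RtoC (INR (fact 3)) * (RtoC (-1) * (RtoC 1 + RtoC 4 * RtoC (-1) + RtoC (-1) * RtoC (-1)) / Cpow (RtoC 1 - RtoC (-1)) 4))%C = RtoC (PI ^ 4 / 3)) in E.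
  - rewrite re_RtoC in E. rewrite /zeta4. simpl (2 + 2)%nat in E. lra.
  - rewrite (_ : Cpow (- two_pi_i) 4 = RtoC (16 * PI ^ 4)); last by rewrite /two_pi_i; apply C_eq; simpl; ring.
    rewrite (_ : INR (fact 3) = 6); last by simpl; ring.
    rewrite -RtoC_minus -!RtoC_mult -!RtoC_plus -RtoC_pow -!RtoC_mult -!RtoC_div; try lra. rewrite -RtoC_mult. f_equal. field.
Qed.

Fixpoint rsum (f : nat -> R) (n : nat) : R := match n with O => 0 | S m => rsum f m + f m end.

Definition dsum (w : nat -> nat -> R) (N : nat) : R :=
  rsum (fun i => if Nat.eqb (N mod S i) 0 then w (S i) N else 0) N.

Lemma bigs_RtoC f n : bigs (fun k => RtoC (f k)) n = RtoC (rsum f n).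
Proof. elim: n => [|n IH] //=. by rewrite IH RtoC_plus. Qed.

Lemma rsum_abs_le f B n : (forall k, (k < n)%nat -> Rabs (f k) <= B) -> Rabs (rsum f n) <= INR n * B.
Proof.
  elim: n => [|n IH] H; first by rewrite /= Rabs_R0; lra.
  rewrite S_INR /=. apply: Rle_trans (Rabs_triang _ _) _.
  have := IH (fun k Hk => H k ltac:(lia)). have := H n ltac:(lia). lra.
Qed.

Lemma bigs_last (h : nat -> C) n : (forall k, (k < n)%nat -> h k = RtoC 0) -> bigs h (S n) = h n.
Proof. move=> H /=. rewrite bigs_zero //. ring. Qed.

Lemma bigs_sparse (g : nat -> C) D M : (0 < D)%nat -> g O = RtoC 0 ->
  (forall N, (N mod D)%nat <> O -> g N = RtoC 0) ->
  bigs g (D * M + 1) = bigs (fun m => g (D * S m)%nat) M.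
Proof.
  move=> HD H0 Hg. elim: M => [|M IH].
  - rewrite Nat.mul_0_r /= H0. ring.
  - rewrite (_ : (D * S M + 1 = (D * M + 1) + S (D - 1))%nat); last lia.
    rewrite bigs_add IH bigs_last.
    + simpl. do 2 f_equal. lia.
    + move=> k Hk. apply Hg. rewrite (_ : (D * M + 1 + k = (k + 1) + M * D)%nat); last lia.
      rewrite Nat.Div0.mod_add Nat.mod_small; lia.
Qed.

Lemma sparse_cs (g : nat -> C) D l : (0 < D)%nat -> g O = RtoC 0 ->
  (forall N, (N mod D)%nat <> O -> g N = RtoC 0) -> is_cs g l -> is_cs (fun m => g (D * S m)%nat) l.
Proof.
  move=> HD H0 Hg /is_cs_Clim H. apply/is_cs_Clim.
  apply: (Clim_ext (fun M => bigs g (D * M + 1))) => [M|]; first by apply bigs_sparse.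
  apply: (Clim_subseq (bigs g) l (fun M => (D * M + 1)%nat)) => //.
  move=> P [N HN]. exists N => n Hn. apply HN. nia.
Qed.

Lemma sparse_abs (g : nat -> C) D : (0 < D)%nat -> g O = RtoC 0 ->
  (forall N, (N mod D)%nat <> O -> g N = RtoC 0) -> cabs g ->
  cabs (fun m => g (D * S m)%nat) /\
  Series (fun m => Cmod (g (D * S m)%nat)) = Series (fun N => Cmod (g N)).
Proof.
  move=> HD H0 Hg Ha.
  have H00 : RtoC (Cmod (g O)) = RtoC 0 by rewrite H0 Cmod_0.
  have [H _] := sparse_cs (fun N => RtoC (Cmod (g N))) D _ HD H00
     (fun N HN => f_equal RtoC (eq_trans (f_equal Cmod (Hg N HN)) Cmod_0)) (RtoC_Series _ Ha).
  split; first by exists (Series (fun N => Cmod (g N))).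
  by apply: is_series_unique.
Qed.

Lemma divisor_series (w : nat -> nat -> R) p q : Cmod q < 1 ->
  (forall d N, (1 <= d <= N)%nat -> Rabs (w d N) <= INR N ^ p) ->
  let a := fun i m => (RtoC (w (S i) (S i * S m)%nat) * Cpow q (S i * S m))%C in
  rad1 (dsum w) /\ (forall i, cabs (a i)) /\ ex_series (fun i => Series (fun m => Cmod (a i m))) /\
  CPS (dsum w) q = CSeries (fun i => CSeries (a i)).
Proof.
  move=> Hq Hw a. have Hq0 := Cmod_ge_0 q.
  have Hd : forall N, Rabs (dsum w N) <= INR N ^ S p.
  { move=> N. rewrite -tech_pow_Rmult. apply rsum_abs_le => k Hk. case: Nat.eqb.
    - apply Hw. lia.
    - rewrite Rabs_R0. apply pow_le, pos_INR. }
  have Hrad : rad1 (dsum w).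
  { apply: (rad1_le _ (fun n => INR n ^ S p)); last by apply rad1_pow.
    move=> n. rewrite (Rabs_pos_eq (INR n ^ S p)); [apply Hd|apply pow_le, pos_INR]. }
  split => //.
  set A := fun N i => match N with O => RtoC 0 | S _ => if Nat.eqb (N mod S i) 0 then (RtoC (w (S i) N) * Cpow q N)%C else RtoC 0 end.
  have A0 : forall N i, (N <= i)%nat -> A N i = RtoC 0.
  { move=> [|N] i Hi //. rewrite /A Nat.mod_small //. lia. }
  have AN : forall N, CSeries (A N) = (RtoC (dsum w N) * Cpow q N)%C.
  { move=> N. rewrite (CSeries_finite _ N); last by apply A0.
    rewrite /dsum -bigs_RtoC Cmult_comm -bigs_scal. apply: bigs_ext => k Hk.
    case: N Hk => [|N] Hk; first lia. rewrite /A. case: Nat.eqb; ring. }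
  have Ab : forall N i, Cmod (A N i) <= INR N ^ p * Cmod q ^ N.
  { move=> N i. case: (le_lt_dec N i) => Hi.
    - rewrite A0 // Cmod_0. apply Rmult_le_pos; apply pow_le => //. apply pos_INR.
    - case: N Hi => [|N] Hi; first lia. rewrite /A. case: Nat.eqb.
      + rewrite Cmod_mult Cmod_R Cmod_pow. apply Rmult_le_compat_r; [by apply pow_le|]. apply Hw. lia.
      + rewrite Cmod_0. apply Rmult_le_pos; apply pow_le => //. apply pos_INR. }
  have F1 : forall N, cabs (A N).
  { move=> N. apply/(ex_series_incr_n _ N). apply: (ex_series_ext (fun _ => 0)); last by apply ex_series_zero.
    move=> k. rewrite A0; last lia. by rewrite Cmod_0. }
  have F2b : forall N, Series (fun i => Cmod (A N i)) <= INR N ^ S p * Cmod q ^ N.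
  { move=> N.
    have -> : Series (fun i => Cmod (A N i)) = rsum (fun i => Cmod (A N i)) N.
    { have E := CSeries_finite (fun i => RtoC (Cmod (A N i))) N (fun k Hk => f_equal RtoC (eq_trans (f_equal Cmod (A0 N k Hk)) Cmod_0)).
      rewrite (is_cs_unique _ _ (RtoC_Series _ (F1 N))) bigs_RtoC in E. by apply RtoC_inj in E. }
    apply: Rle_trans (Rle_abs _) _. rewrite -tech_pow_Rmult Rmult_assoc. apply rsum_abs_le => k Hk.
    rewrite Rabs_pos_eq; [apply Ab|apply Cmod_ge_0]. }
  have F2 : ex_series (fun N => Series (fun i => Cmod (A N i))).
  { apply: (ex_series_le _ (fun N => INR N ^ S p * Cmod q ^ N)).
    - move=> N. rewrite /norm /= /abs /= Rabs_pos_eq; first by apply F2b.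
      apply: (Series_pos _ _ (F1 N)) => i. apply Cmod_ge_0.
    - apply: (ex_series_ext (fun N => Rabs (INR N ^ S p) * Cmod q ^ N)); last by apply rad1_pow.
      move=> N. rewrite Rabs_pos_eq //. apply pow_le, pos_INR. }
  have [G1 [G2 [G3 [G4 G5]]]] := fubini A F1 F2.
  have Asp : forall i N, (N mod S i)%nat <> O -> A N i = RtoC 0.
  { move=> i [|N] HN //. rewrite /A. by rewrite (proj2 (Nat.eqb_neq _ _) HN). }
  have Aa : forall i m, A (S i * S m)%nat i = a i m.
  { move=> i m. rewrite /A /a. have -> : ((S i * S m) mod S i)%nat = O by rewrite Nat.mul_comm Nat.Div0.mod_mul.
    rewrite Nat.eqb_refl. simpl (S i * S m)%nat. done. }
  have Hi : forall i, cabs (a i) /\ Series (fun m => Cmod (a i m)) = Series (fun N => Cmod (A N i)).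
  { move=> i. have [K1 K2] := sparse_abs (fun N => A N i) (S i) ltac:(lia) ltac:(done) (Asp i) (G2 i).
    split.
    - by apply: cabs_ext (Aa i) K1.
    - rewrite -K2. apply: Series_ext => m. by rewrite Aa. }
  split; first by move=> i; apply Hi.
  split.
  - apply: ex_series_ext G3 => i. by rewrite (proj2 (Hi i)).
  - rewrite /CPS -(CSeries_ext _ _ AN) G5. apply: CSeries_ext => i.
    symmetry. apply: is_cs_unique.
    apply: is_cs_ext (sparse_cs (fun N => A N i) (S i) _ ltac:(lia) ltac:(done) (Asp i) (cabs_is _ (G2 i))).
    apply Aa.
Qed.

(** * Eisenstein series of weights 4 and 2 *)

Definition sig (k : nat) : nat -> R := dsum (fun d _ => INR d ^ k).
Definition zs (p : nat) : R := Series (fun k => / INR (S k) ^ p).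
Definition cc (i : nat) : C := RtoC (INR (S i)).

Lemma cc_pos i : 0 < INR (S i).
Proof. apply lt_0_INR. lia. Qed.

Lemma cc_nz i : cc i <> RtoC 0.
Proof. apply RtoC_nz. have := cc_pos i. lra. Qed.

Lemma Im_cc i tau : Im (cc i * tau)%C = INR (S i) * Im tau.
Proof. by rewrite im_scal_l. Qed.

Lemma Im_cc_pos i tau : 0 < Im tau -> 0 < Im (cc i * tau)%C.
Proof. move=> H. rewrite Im_cc. apply Rmult_lt_0_compat => //. apply cc_pos. Qed.

Lemma Cmod_pow_lt_1 q n : Cmod q < 1 -> (0 < n)%nat -> Cmod (Cpow q n) < 1.
Proof.
  move=> H Hn. rewrite Cmod_pow. have H0 := Cmod_ge_0 q.
  case: n Hn => [|n] Hn; first lia. rewrite -tech_pow_Rmult.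
  have : Cmod q ^ n <= 1 by rewrite -(pow1 n); apply pow_incr; lra.
  have : 0 <= Cmod q ^ n by apply pow_le. nra.
Qed.

Lemma Eis_series m tau : 0 < Im tau ->
  cabs (fun i => Sm (m + 2) (cc i * tau)%C) /\
  CSeries (fun i => Sm (m + 2) (cc i * tau)%C) =
    (Cpow (- two_pi_i) (m + 2) / RtoC (INR (fact (S m))) * CPS (sig (S m)) (nome tau))%C.
Proof.
  move=> Ht. set q := nome tau. have Hq : Cmod q < 1 by apply nome_lt_1.
  have [R1 [F1 [F2 F3]]] := divisor_series (fun d _ => INR d ^ S m) (S m) q Hq
    ltac:(move=> d N HdN; rewrite Rabs_pos_eq; [apply pow_incr; split; [apply pos_INR|apply le_INR; lia]|apply pow_le, pos_INR]).
  have [G1 [G2 [G3 [G4 G5]]]] := fubini _ F1 F2.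
  have E : forall k, CSeries (fun i => RtoC (INR (S i) ^ S m) * Cpow q (S i * S k))%C = CPS (npow (S m)) (Cpow q (S k)).
  { move=> k. have Hqk := Cmod_pow_lt_1 q (S k) Hq ltac:(lia).
    rewrite /CPS (CSeries_incr_1 (fun n => RtoC (npow (S m) n) * _)%C); last by apply CPS_abs => //; apply rad1_pow.
    rewrite {1}/npow (_ : INR 0 ^ S m = 0); last by simpl; ring.
    rewrite Cmult_0_l Cplus_0_l. apply: CSeries_ext => n. by rewrite /npow -Cpow_mult_r Nat.mul_comm. }
  have ES : forall k, Sm (m + 2) (cc k * tau)%C = (Cpow (- two_pi_i) (m + 2) / RtoC (INR (fact (S m))) * CSeries (fun i => RtoC (INR (S i) ^ S m) * Cpow q (S i * S k)))%C.
  { move=> k. rewrite E lipschitz; last by apply Im_cc_pos. by rewrite /cc nome_pow. }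
  split.
  - apply: cabs_ext (fun k => eq_sym (ES k)) _. by apply: cabs_scal.
  - rewrite (CSeries_ext _ _ ES) CSeries_scal // /sig F3 G5. done.
Qed.

Definition a2 (m : nat) (tau : C) (i k : nat) : C :=
  (/ Cpow (cc i * tau + cc k) (m + 2) + / Cpow (cc i * tau - cc k) (m + 2))%C.

Lemma lattice_bound tau : 0 < Im tau -> exists K, 0 < K /\ forall i x,
  K * (INR (S i) + Rabs x) <= Cmod (cc i * tau + RtoC x)%C.
Proof.
  move=> Ht. have [K [HK H]] := half_plane_lower_bound tau Ht. exists K. split => // i x.
  have Hc := cc_pos i.
  rewrite (_ : (cc i * tau + RtoC x)%C = (cc i * (tau + RtoC (x / INR (S i))))%C); last first.
  { rewrite RtoC_div; last lra. rewrite -/(cc i). field. apply cc_nz. }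
  rewrite Cmod_mult Cmod_pos_R; last lra.
  apply: Rle_trans (Rmult_le_compat_l _ _ _ (Rlt_le _ _ Hc) (H _)).
  rewrite Rabs_mult (Rabs_pos_eq (/ _)); last by apply Rlt_le, Rinv_0_lt_compat.
  right. field. lra.
Qed.

Lemma lattice_nz tau i x : 0 < Im tau -> (cc i * tau + RtoC x)%C <> RtoC 0.
Proof. move=> H. by apply shift_nz, Im_cc_pos. Qed.

Lemma lattice_nz' tau i x : 0 < Im tau -> (cc i * tau - RtoC x)%C <> RtoC 0.
Proof.
  move=> H. rewrite (_ : (cc i * tau - RtoC x = cc i * tau + RtoC (- x))%C); last by rewrite RtoC_opp; ring.
  by apply lattice_nz.
Qed.

Lemma a2_bound tau : 0 < Im tau -> exists K, 0 < K /\ forall m i k,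
   Cmod (a2 m tau i k) <= 2 * / (K * (INR (S i) + INR (S k))) ^ (m + 2).
Proof.
  move=> Ht. have [K [HK H]] := lattice_bound tau Ht. exists K. split => // m i k.
  have Hi := cc_pos i. have Hk := cc_pos k.
  have Hw : forall x, Rabs x = INR (S k) -> Cmod (/ Cpow (cc i * tau + RtoC x) (m + 2))%C <= / (K * (INR (S i) + INR (S k))) ^ (m + 2).
  { move=> x Hx. have Hn := lattice_nz tau i x Ht. rewrite Cmod_inv; last by apply Cpow_nz. rewrite Cmod_pow.
    have HH := H i x. rewrite Hx in HH.
    have HP : 0 < K * (INR (S i) + INR (S k)) by apply Rmult_lt_0_compat; lra.
    apply Rinv_le_contravar; first by apply pow_lt. apply pow_incr. lra. }
  rewrite /a2. apply: Rle_trans (Cmod_triangle _ _) _.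
  rewrite (_ : (cc i * tau - cc k)%C = (cc i * tau + RtoC (- INR (S k)))%C); last by rewrite RtoC_opp.
  have := Hw (INR (S k)) ltac:(rewrite Rabs_pos_eq; lra). have := Hw (- INR (S k)) ltac:(rewrite Rabs_Ropp Rabs_pos_eq; lra).
  rewrite -/(cc k). lra.
Qed.

Lemma inv_pow_sum_le K x y n : 0 < K -> 1 <= x -> 1 <= y -> (2 <= n)%nat ->
  / (K * (x + y)) ^ n <= / K ^ n * / x ^ 2 /\ / (K * (x + y)) ^ n <= / K ^ n * / y ^ 2.
Proof.
  move=> HK Hx Hy Hn.
  have HKn : 0 < K ^ n by apply pow_lt.
  have Hq : forall u, 1 <= u -> u <= x + y -> / (K * (x + y)) ^ n <= / K ^ n * / u ^ 2.
  { move=> u Hu Hle. rewrite Rpow_mult_distr Rinv_mult. apply Rmult_le_compat_l; first by apply Rlt_le, Rinv_0_lt_compat.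
    apply Rinv_le_contravar; first by apply pow_lt; lra.
    apply: (Rle_trans _ (u ^ n)); first by apply Rle_pow. apply pow_incr. lra. }
  split; apply Hq; lra.
Qed.

Lemma one_le_S i : 1 <= INR (S i).
Proof. rewrite S_INR. have := pos_INR i. lra. Qed.

Lemma a2_abs_col m tau k : 0 < Im tau -> cabs (fun i => a2 m tau i k).
Proof.
  move=> Ht. have [K [HK H]] := a2_bound tau Ht.
  apply: (cabs_le _ (fun i => 2 * / K ^ (m + 2) * / INR (S i) ^ 2)).
  - move=> i. apply: Rle_trans (H m i k) _.
    have [H2 _] := inv_pow_sum_le K _ _ (m + 2) HK (one_le_S i) (one_le_S k) ltac:(lia). lra.
  - apply: (ex_series_scal (2 * / K ^ (m + 2)) (fun k => / INR (S k) ^ 2)). apply ex_series_inv_sq.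
Qed.

Lemma Sm_center m w : 0 < Im w ->
  Sm (m + 2) w = (/ Cpow w (m + 2) + CSeries (fun k => / Cpow (w + cc k) (m + 2) + / Cpow (w - cc k) (m + 2)))%C.
Proof.
  move=> Hw. have H1 := Sm_abs_l w m Hw. have H2 := Sm_abs_r w m Hw.
  have E : forall k, (/ Cpow (w - RtoC 1 - RtoC (INR k)) (m + 2) = / Cpow (w - cc k) (m + 2))%C.
  { move=> k. do 2 f_equal. rewrite /cc S_INR RtoC_plus. ring. }
  have H3 : cabs (fun k => / Cpow (w + cc k) (m + 2))%C by move/cabs_incr_1: H1.
  have H4 : cabs (fun k => / Cpow (w - cc k) (m + 2))%C by apply: cabs_ext E H2.
  rewrite /Sm CSeries_plus // CSeries_plus // (CSeries_incr_1 _ H1) (CSeries_ext _ _ E).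
  rewrite -Cplus_assoc. f_equal. do 2 f_equal. simpl. ring.
Qed.

Lemma inv_cc_series p : (2 <= p)%nat -> forall w, w <> RtoC 0 ->
  cabs (fun i => / Cpow (cc i * w) p)%C /\
  CSeries (fun i => / Cpow (cc i * w) p)%C = (RtoC (zs p) * / Cpow w p)%C.
Proof.
  move=> Hp w Hw. have [E1 _] := zeta_split p Hp.
  have Ew := RtoC_Series _ E1.
  have E : forall i, (/ Cpow w p * RtoC (/ INR (S i) ^ p))%C = (/ Cpow (cc i * w) p)%C.
  { move=> i. have Hi := cc_pos i. rewrite RtoC_inv; last by apply pow_nonzero; lra.
    rewrite RtoC_pow Cpow_mult_l. rewrite -/(cc i). field. split; apply Cpow_nz => //. apply cc_nz. }
  split.
  - apply: cabs_ext E _. apply: cabs_scal. apply: (ex_series_ext (fun k => / INR (S k) ^ p)) => // k.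
    rewrite Cmod_pos_R //. apply Rlt_le, Rinv_0_lt_compat, pow_lt, cc_pos.
  - apply: is_cs_unique. rewrite Cmult_comm. apply: is_cs_ext E _. by apply: is_cs_scal.
Qed.

Lemma Im_nz_C tau : 0 < Im tau -> tau <> RtoC 0.
Proof. move=> H E. rewrite E im_RtoC in H. lra. Qed.

Lemma Eis_center m tau : 0 < Im tau ->
  cabs (fun i => CSeries (a2 m tau i)) /\
  CSeries (fun i => Sm (m + 2) (cc i * tau)%C) =
   (RtoC (zs (m + 2)) * / Cpow tau (m + 2) + CSeries (fun i => CSeries (a2 m tau i)))%C.
Proof.
  move=> Ht. have [A1 _] := Eis_series m tau Ht.
  have [B1 B2] := inv_cc_series (m + 2) ltac:(lia) tau (Im_nz_C _ Ht).
  have E : forall i, Sm (m + 2) (cc i * tau)%C = (/ Cpow (cc i * tau) (m + 2) + CSeries (a2 m tau i))%C.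
  { move=> i. by apply Sm_center, Im_cc_pos. }
  have A2 : cabs (fun i => CSeries (a2 m tau i)).
  { apply: (cabs_ext (fun i => Sm (m + 2) (cc i * tau) + RtoC (-1) * / Cpow (cc i * tau) (m + 2))%C).
    - move=> i. rewrite E RtoC_m1. ring.
    - apply: cabs_plus => //. by apply: cabs_scal. }
  split => //. by rewrite (CSeries_ext _ _ E) CSeries_plus // B2.
Qed.

Definition inv_tau (tau : C) : C := (- / tau)%C.

Lemma Im_inv_tau tau : Im (inv_tau tau) = Im tau / Cmod tau ^ 2.
Proof.
  rewrite Cmod2_alt /inv_tau im_opp. rewrite /Cinv /Im /Re /=. lra.
Qed.

Lemma Im_inv_tau_pos tau : 0 < Im tau -> 0 < Im (inv_tau tau).
Proof.
  move=> H. rewrite Im_inv_tau. apply Rdiv_lt_0_compat => //. apply pow_lt, Cmod_gt_0. by apply Im_nz_C.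
Qed.

Lemma a2_inv m tau i k : 0 < Im tau -> Nat.Even m ->
  a2 m (inv_tau tau) i k = (Cpow tau (m + 2) * a2 m tau k i)%C.
Proof.
  move=> Ht [p Hp]. have H0 := Im_nz_C _ Ht.
  have N1 := lattice_nz tau k (INR (S i)) Ht. have N2 := lattice_nz' tau k (INR (S i)) Ht.
  rewrite -/(cc i) in N1 N2.
  rewrite /a2 /inv_tau.
  rewrite (_ : (cc i * - / tau + cc k = (cc k * tau - cc i) * / tau)%C); last by field.
  rewrite (_ : (cc i * - / tau - cc k = (- RtoC 1) * ((cc k * tau + cc i) * / tau))%C); last by field.
  rewrite !Cpow_mult_l !Cpow_inv //.
  rewrite (_ : Cpow (- RtoC 1) (m + 2) = RtoC 1); last first.
  { rewrite (_ : (m + 2 = 2 * (p + 1))%nat); last lia. rewrite Cpow_mult_r.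
    rewrite (_ : Cpow (- RtoC 1) 2 = RtoC 1); [apply Cpow_1_l|simpl; ring]. }
  field. repeat split; apply Cpow_nz => //.
Qed.

Definition E4 (tau : C) : C := (RtoC 1 + RtoC 240 * CPS (sig 3) (nome tau))%C.

Lemma E4_G4 tau : 0 < Im tau ->
  (RtoC (PI ^ 4 / 90) * E4 tau)%C = (RtoC zeta4 + RtoC zeta4 * / Cpow tau 4 + CSeries (fun i => CSeries (a2 2 tau i)))%C.
Proof.
  move=> Ht. have [_ A] := Eis_series 2 tau Ht. have [_ B] := Eis_center 2 tau Ht.
  rewrite B in A. simpl (2 + 2)%nat in A. rewrite (_ : zs 4 = zeta4) // in A.
  rewrite -Cplus_assoc A zeta4_eq /E4.
  rewrite (_ : Cpow (- two_pi_i) 4 = RtoC (16 * PI ^ 4)); last by rewrite /two_pi_i; apply C_eq; simpl; ring.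
  rewrite (_ : INR (fact 3) = 6); last by simpl; ring.
  rewrite -RtoC_div; last lra. rewrite Cmult_plus_distr_l Cmult_1_r Cmult_assoc -RtoC_mult. do 3 f_equal. field.
Qed.

Lemma E4_modular tau : 0 < Im tau -> E4 (inv_tau tau) = (Cpow tau 4 * E4 tau)%C.
Proof.
  move=> Ht. have Ht' := Im_inv_tau_pos _ Ht. have H0 := Im_nz_C _ Ht.
  have HP : RtoC (PI ^ 4 / 90) <> RtoC 0.
  { apply RtoC_nz. have := pow_lt _ 4 PI_RGT_0. lra. }
  have [K [HK Hb]] := a2_bound tau Ht.
  have Hb2 : forall i k, Cmod (a2 2 tau i k) <= (2 * / K ^ 4 * / INR (S i) ^ 2) * / INR (S k) ^ 2.
  { move=> i k. apply: Rle_trans (Hb 2%nat i k) _. have H1 := one_le_S i. have H2 := one_le_S k.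
    set x := INR (S i) in H1 |- *. set y := INR (S k) in H2 |- *.
    rewrite (_ : 2 * / K ^ 4 * / x ^ 2 * / y ^ 2 = 2 * / (K ^ 4 * (x ^ 2 * y ^ 2))); last by field; lra.
    apply Rmult_le_compat_l; first lra. rewrite Rpow_mult_distr.
    have HK4 : 0 < K ^ 4 by apply pow_lt.
    apply Rinv_le_contravar.
    - repeat apply Rmult_lt_0_compat => //; lra.
    - apply Rmult_le_compat_l; first by apply Rlt_le. rewrite -Rpow_mult_distr (_ : (x + y) ^ (2 + 2) = ((x + y) ^ 2) ^ 2); last by simpl; ring.
      apply pow_incr. nra. }
  have Hu : ex_series (fun i => 2 * / K ^ 4 * / INR (S i) ^ 2).
  { apply: (ex_series_scal (2 * / K ^ 4) (fun k => / INR (S k) ^ 2)). apply ex_series_inv_sq. }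
  have [F1 F2] := fubini_prod _ _ _ Hu ex_series_inv_sq Hb2.
  have [G1 [G2 [G3 [G4 G5]]]] := fubini _ F1 F2.
  have EU : CSeries (fun i => CSeries (a2 2 (inv_tau tau) i)) = (Cpow tau 4 * CSeries (fun i => CSeries (a2 2 tau i)))%C.
  { rewrite G5 -CSeries_scal //. apply: CSeries_ext => i. rewrite -CSeries_scal //.
    apply: CSeries_ext => k. apply a2_inv => //. by exists 1%nat. }
  have E1 := E4_G4 tau Ht. have E2 := E4_G4 _ Ht'. rewrite EU in E2.
  have E3 : (RtoC (PI ^ 4 / 90) * E4 (inv_tau tau) = RtoC (PI ^ 4 / 90) * (Cpow tau 4 * E4 tau))%C.
  { rewrite (_ : (RtoC (PI ^ 4 / 90) * (Cpow tau 4 * E4 tau) = Cpow tau 4 * (RtoC (PI ^ 4 / 90) * E4 tau))%C); last ring.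
    rewrite E2 E1. rewrite /inv_tau.
    rewrite (_ : (- / tau = (- RtoC 1) * / tau)%C); last ring. rewrite Cpow_mult_l Cpow_inv //.
    rewrite (_ : Cpow (- RtoC 1) 4 = RtoC 1); last by simpl; ring.
    have Hp : Cpow tau 4 <> RtoC 0 by apply Cpow_nz.
    field. exact H0. }
  rewrite -(Cmult_1_l (E4 _)) -(Cinv_l _ HP) -Cmult_assoc E3. field. exact HP.
Qed.

Definition E2 (tau : C) : C := (RtoC 1 - RtoC 24 * CPS (sig 1) (nome tau))%C.

Definition half_tel (tau : C) (i k : nat) : C :=
  (/ (cc i * tau + cc k - RtoC (/ 2)) - / (cc i * tau + cc k + RtoC (/ 2))
   + (/ (cc i * tau - cc k - RtoC (/ 2)) - / (cc i * tau - cc k + RtoC (/ 2))))%C.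

Definition beta0 (tau : C) (i : nat) : C :=
  (/ (cc i * tau + RtoC (/ 2)) - / (cc i * tau - RtoC (/ 2)))%C.

Definition gamma (tau : C) (K : nat) (i : nat) : C :=
  (/ (cc i * tau - RtoC (INR K + / 2)) - / (cc i * tau + RtoC (INR K + / 2)))%C.

Lemma half_tel_sum tau i K : bigs (half_tel tau i) K = (beta0 tau i + gamma tau K i)%C.
Proof.
  elim: K => [|K IH].
  - rewrite /= /beta0 /gamma /= Rplus_0_l. ring.
  - rewrite /= IH /half_tel /gamma. set w := (cc i * tau)%C.
    have E1 : (w + cc K - RtoC (/ 2) = w + RtoC (INR K + / 2))%C.
    { rewrite /cc S_INR !RtoC_plus (_ : RtoC 1 = (RtoC (/ 2) + RtoC (/ 2))%C); first ring. rewrite -RtoC_plus. f_equal. field. }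
    have E2 : (w - cc K + RtoC (/ 2) = w - RtoC (INR K + / 2))%C.
    { rewrite /cc S_INR !RtoC_plus (_ : RtoC 1 = (RtoC (/ 2) + RtoC (/ 2))%C); first ring. rewrite -RtoC_plus. f_equal. field. }
    have E3 : (w + cc K + RtoC (/ 2) = w + RtoC (INR (S K) + / 2))%C by rewrite /cc RtoC_plus; ring.
    have E4 : (w - cc K - RtoC (/ 2) = w - RtoC (INR (S K) + / 2))%C by rewrite /cc RtoC_plus; ring.
    rewrite -/(cc K) in E1 E2. rewrite E1 E2 E3 E4. ring.
Qed.

Lemma gamma_series tau K : 0 < Im tau ->
  is_cs (gamma tau K) (/ tau * (RtoC PI * Ci * ctf (RtoC (INR K + / 2) * inv_tau tau) - / (RtoC (INR K + / 2) * inv_tau tau)))%C.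
Proof.
  move=> Ht. have H0 := Im_nz_C _ Ht. have Hti := Im_inv_tau_pos _ Ht.
  set X := INR K + / 2. have HX : 0 < X by rewrite /X; have := pos_INR K; lra.
  have HXn : RtoC X <> RtoC 0 by apply RtoC_nz; lra.
  set z := (RtoC X * inv_tau tau)%C.
  have Hz : 0 < Im z by rewrite /z im_scal_l; apply Rmult_lt_0_compat.
  have [C1 C2] := cot_expansion z Hz.
  have Hzn := Im_nz_C _ Hz.
  have Hs : is_cs (fun i => / (z + cc i) + / (z - cc i))%C (RtoC PI * Ci * ctf z - / z)%C.
  { rewrite -C2. apply/is_cs_Clim.
    apply: (Clim_ext (fun n => bigs (pairT z) n - / z + / (z + RtoC (INR n)))%C).
    - elim=> [|n IH]; first by simpl; rewrite (_ : (z + RtoC 0 = z)%C); ring.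
      simpl bigs. rewrite -IH pairT_split //. rewrite -/(INR (S n)) -/(cc n).
      rewrite (_ : (z - RtoC 1 - RtoC (INR n) = z - cc n)%C); first ring. rewrite /cc S_INR RtoC_plus. ring.
    - rewrite -(Cplus_0_r (CSeries _ - _)%C). apply: Clim_plus.
      + apply: Clim_minus; [by apply: cabs_Clim|apply Clim_const].
      + have [K0 [HK0 HB]] := pair_shift_bound z Hz.
        apply: (Clim_squeeze _ _ (fun n => / K0 * / INR (S n))).
        * move=> n. rewrite (_ : (/ (z + RtoC (INR n)) - RtoC 0 = / (z + RtoC (INR n)))%C); last ring.
          rewrite Cmod_inv; last by apply shift_nz. rewrite -Rinv_mult. have [H1 _] := HB n.
          apply Rinv_le_contravar => //. apply Rmult_lt_0_compat => //. apply cc_pos.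
        * rewrite -(Rmult_0_r (/ K0)). apply: is_lim_seq_mult'; [apply is_lim_seq_const|apply is_lim_inv_S]. }
  apply: is_cs_ext (is_cs_scal (/ tau)%C _ _ Hs) => i.
  have N1 := lattice_nz tau i X Ht. have N2 := lattice_nz' tau i X Ht.
  have E1 : (z + cc i = (cc i * tau - RtoC X) / tau)%C by rewrite /z /inv_tau; field.
  have E2 : (z - cc i = - ((cc i * tau + RtoC X) / tau))%C by rewrite /z /inv_tau; field.
  rewrite /gamma E1 E2 -/X. field. repeat split => //.
Qed.

Lemma gamma_limit tau : 0 < Im tau ->
  Clim (fun K => CSeries (gamma tau K)) (- (RtoC PI * Ci) / tau)%C.
Proof.
  move=> Ht. have H0 := Im_nz_C _ Ht. have Hti := Im_inv_tau_pos _ Ht. have HPI := PI_RGT_0.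
  have Hzp : forall K, 0 < Im (RtoC (INR K + / 2) * inv_tau tau)%C.
  { move=> K. rewrite im_scal_l. apply Rmult_lt_0_compat => //. have := pos_INR K. lra. }
  apply: (Clim_ext (fun K => / tau * (RtoC PI * Ci * ((nome (RtoC (INR K + / 2) * inv_tau tau) + RtoC 1) / (nome (RtoC (INR K + / 2) * inv_tau tau) - RtoC 1)) - / (RtoC (INR K + / 2) * inv_tau tau)))%C).
  - move=> K. by rewrite (is_cs_unique _ _ (gamma_series tau K Ht)).
  - rewrite (_ : (- (RtoC PI * Ci) / tau = / tau * (RtoC PI * Ci * ((RtoC 0 + RtoC 1) / (RtoC 0 - RtoC 1)) - RtoC 0))%C); last first.
    { rewrite (_ : ((RtoC 0 + RtoC 1) / (RtoC 0 - RtoC 1) = - RtoC 1)%C); first by field.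
      rewrite (_ : (RtoC 0 - RtoC 1 = - RtoC 1)%C); last ring. field. }
    have Hinv : is_lim_seq (fun K => / (INR K + / 2)) 0.
    { apply: (is_lim_seq_inv (fun K => INR K + / 2) p_infty) => //.
      apply: (is_lim_seq_plus _ _ p_infty (/ 2)) => //; [apply is_lim_seq_INR|apply is_lim_seq_const]. }
    have HN : Clim (fun K => nome (RtoC (INR K + / 2) * inv_tau tau)) (RtoC 0).
    { apply: (Clim_squeeze _ _ (fun K => exp (- (2 * PI * Im (inv_tau tau))) ^ K)).
      - move=> K. rewrite (_ : (nome (RtoC (INR K + / 2) * inv_tau tau) - RtoC 0)%C = nome (RtoC (INR K + / 2) * inv_tau tau)); last ring.
        rewrite RtoC_plus Cmult_plus_distr_r nome_add nome_pow Cmod_mult Cmod_pow Cmod_nome.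
        have H1 : Cmod (nome (RtoC (/ 2) * inv_tau tau)) <= 1.
        { apply Rlt_le, nome_lt_1. rewrite im_scal_l. lra. }
        have : 0 <= exp (- (2 * PI * Im (inv_tau tau))) ^ K by apply pow_le, Rlt_le, exp_pos. nra.
      - apply is_lim_seq_geom. rewrite Rabs_pos_eq; last by apply Rlt_le, exp_pos.
        rewrite -exp_0. apply exp_increasing. have := Rmult_lt_0_compat _ _ HPI Hti. nra. }
    apply: Clim_scal. apply: Clim_minus.
    + apply: Clim_scal. apply: Clim_mult.
      * apply: Clim_plus => //. apply Clim_const.
      * apply: Clim_inv; first by rewrite (_ : (RtoC 0 - RtoC 1 = - RtoC 1)%C); [move=> E; apply C1_nz; rewrite (_ : RtoC 1 = (- - RtoC 1)%C); [rewrite E; ring|ring]|ring].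
        apply: Clim_minus => //. apply Clim_const.
    + have Hmt := Cmod_ge_0 (/ inv_tau tau)%C.
      have Hin := Im_nz_C _ Hti.
      apply: (Clim_squeeze _ _ (fun K => Cmod (/ inv_tau tau)%C * / (INR K + / 2))).
      * move=> K. have HK : 0 < INR K + / 2 by have := pos_INR K; lra.
        have HKn : RtoC (INR K + / 2) <> RtoC 0 by apply RtoC_nz; lra.
        rewrite (_ : (/ (RtoC (INR K + / 2) * inv_tau tau) - RtoC 0)%C = (/ inv_tau tau * / RtoC (INR K + / 2))%C); last by field.
        rewrite Cmod_mult (Cmod_inv (RtoC _)) // Cmod_pos_R; lra.
      * rewrite -(Rmult_0_r (Cmod (/ inv_tau tau)%C)). apply: is_lim_seq_mult' => //. apply is_lim_seq_const.
Qed.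

Lemma e_bound tau : 0 < Im tau -> exists B, 0 <= B /\ forall i k,
  Cmod (a2 0 tau i k - half_tel tau i k)%C <= B * / INR (S i) ^ 2 * / INR (S k) ^ 2.
Proof.
  move=> Ht. have [K [HK H]] := lattice_bound tau Ht.
  have HK4 : 0 < K ^ 4 by apply pow_lt.
  exists (2 * / K ^ 4). split; first by apply Rmult_le_pos; [lra|by apply Rlt_le, Rinv_0_lt_compat].
  move=> i k. have H1 := one_le_S i. have H2 := one_le_S k.
  have Hw : forall s, Rabs s = INR (S k) ->
     Cmod (/ Cpow (cc i * tau + RtoC s) 2 - (/ (cc i * tau + RtoC s - RtoC (/ 2)) - / (cc i * tau + RtoC s + RtoC (/ 2))))%C <= / K ^ 4 * / INR (S i) ^ 2 * / INR (S k) ^ 2.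
  { move=> s Hs. set w := (cc i * tau + RtoC s)%C. set h := RtoC (/ 2).
    have E1 : (w - h = cc i * tau + RtoC (s - / 2))%C by rewrite /w /h RtoC_minus; ring.
    have E2 : (w + h = cc i * tau + RtoC (s + / 2))%C by rewrite /w /h RtoC_plus; ring.
    have N0 : w <> RtoC 0 by apply lattice_nz.
    have N1 : (w - h)%C <> RtoC 0 by rewrite E1; apply lattice_nz.
    have N2 : (w + h)%C <> RtoC 0 by rewrite E2; apply lattice_nz.
    have Hq : RtoC (/ 4) = (h * h)%C by rewrite /h -RtoC_mult; f_equal; field.
    have HH : (h + h = RtoC 1)%C by rewrite /h -RtoC_plus; f_equal; field.
    have -> : (/ Cpow w 2 - (/ (w - h) - / (w + h)) = - (RtoC (/ 4) / (w * w * ((w - h) * (w + h)))))%C.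
    { transitivity (((w - h) * (w + h) - w * w * (h + h)) / (w * w * ((w - h) * (w + h))))%C.
      - simpl (Cpow w 2). field. repeat split => //.
      - rewrite HH Hq. field. repeat split => //. }
    set x := INR (S i) in H1 |- *. set y := INR (S k) in H2 Hs |- *.
    have B0 : K * (x + y) <= Cmod w by rewrite /w -Hs; apply H.
    have B1 : K * ((x + y) / 2) <= Cmod (w - h)%C.
    { rewrite E1. apply: Rle_trans (H i _). apply Rmult_le_compat_l; first lra. rewrite -/x.
      have := Rabs_triang (s - / 2) (/ 2). rewrite (_ : s - / 2 + / 2 = s); last ring. rewrite Hs (Rabs_pos_eq (/ 2)); lra. }
    have B2 : K * ((x + y) / 2) <= Cmod (w + h)%C.
    { rewrite E2. apply: Rle_trans (H i _). apply Rmult_le_compat_l; first lra. rewrite -/x.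
      have := Rabs_triang (s + / 2) (- / 2). rewrite (_ : s + / 2 + - / 2 = s); last ring. rewrite Hs Rabs_Ropp (Rabs_pos_eq (/ 2)); lra. }
    rewrite Cmod_opp Cmod_div; last by repeat apply Cmult_neq_0.
    rewrite !Cmod_mult Cmod_pos_R; last lra.
    rewrite (_ : / K ^ 4 * / x ^ 2 * / y ^ 2 = / 4 * / (K ^ 4 * (x ^ 2 * y ^ 2) / 4)); last by field; lra.
    apply Rmult_le_compat_l; first lra.
    have P0 : 0 < K * (x + y) by apply Rmult_lt_0_compat; lra.
    have P1 : 0 < K * ((x + y) / 2) by apply Rmult_lt_0_compat; lra.
    have P2 : 0 < x ^ 2 * y ^ 2 by apply Rmult_lt_0_compat; apply pow_lt; lra.
    apply Rinv_le_contravar; first by apply Rmult_lt_0_compat; [apply Rmult_lt_0_compat|lra].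
    apply: (Rle_trans _ ((K * (x + y)) * (K * (x + y)) * ((K * ((x + y) / 2)) * (K * ((x + y) / 2))))).
    - rewrite (_ : _ * _ * (_ * _) = K ^ 4 * ((x + y) ^ 4) / 4); last by field.
      apply Rmult_le_compat_r; first lra. apply Rmult_le_compat_l; first lra.
      rewrite -Rpow_mult_distr (_ : (x + y) ^ 4 = ((x + y) ^ 2) ^ 2); last ring. apply pow_incr. nra.
    - apply Rmult_le_compat; [nra|nra| |]; apply Rmult_le_compat; lra. }
  have W1 := Hw (INR (S k)) ltac:(rewrite Rabs_pos_eq; lra).
  have W2 := Hw (- INR (S k)) ltac:(rewrite Rabs_Ropp Rabs_pos_eq; lra).
  rewrite (_ : (cc i * tau + RtoC (- INR (S k)))%C = (cc i * tau - cc k)%C) in W2; last by rewrite RtoC_opp.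
  rewrite -/(cc k) in W1.
  rewrite /a2 /half_tel. simpl (0 + 2)%nat.
  have T := Cmod_triangle (/ Cpow (cc i * tau + cc k) 2 - (/ (cc i * tau + cc k - RtoC (/ 2)) - / (cc i * tau + cc k + RtoC (/ 2))))%C
     (/ Cpow (cc i * tau - cc k) 2 - (/ (cc i * tau - cc k - RtoC (/ 2)) - / (cc i * tau - cc k + RtoC (/ 2))))%C.
  rewrite (_ : (_ - (_ + _))%C = (/ Cpow (cc i * tau + cc k) 2 - (/ (cc i * tau + cc k - RtoC (/ 2)) - / (cc i * tau + cc k + RtoC (/ 2))) + (/ Cpow (cc i * tau - cc k) 2 - (/ (cc i * tau - cc k - RtoC (/ 2)) - / (cc i * tau - cc k + RtoC (/ 2)))))%C); last ring.
  lra.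
Qed.

Lemma beta0_abs tau : 0 < Im tau -> cabs (beta0 tau).
Proof.
  move=> Ht. have [K [HK H]] := lattice_bound tau Ht.
  apply: (cabs_le _ (fun i => / K ^ 2 * / INR (S i) ^ 2)); last first.
  { apply: (ex_series_scal (/ K ^ 2) (fun k => / INR (S k) ^ 2)). apply ex_series_inv_sq. }
  move=> i. have H1 := one_le_S i.
  have N1 := lattice_nz tau i (/ 2) Ht. have N2 := lattice_nz' tau i (/ 2) Ht.
  have HH : (RtoC (/ 2) + RtoC (/ 2) = RtoC 1)%C by rewrite -RtoC_plus; f_equal; field.
  rewrite /beta0. rewrite (_ : (_ - _)%C = (- ((RtoC (/ 2) + RtoC (/ 2)) * / ((cc i * tau + RtoC (/ 2)) * (cc i * tau - RtoC (/ 2)))))%C); last by field.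
  rewrite HH Cmult_1_l Cmod_opp Cmod_inv; last by apply Cmult_neq_0.
  rewrite Cmod_mult -Rinv_mult -Rpow_mult_distr.
  have B1 := H i (/ 2). have B2 := H i (- / 2). rewrite Rabs_Ropp in B2. rewrite Rabs_pos_eq in B1 B2; try lra.
  rewrite (_ : (cc i * tau + RtoC (- / 2))%C = (cc i * tau - RtoC (/ 2))%C) in B2; last by rewrite RtoC_opp.
  have P0 : 0 < K * INR (S i) by apply Rmult_lt_0_compat; lra.
  apply Rinv_le_contravar; first by apply pow_lt.
  simpl. rewrite Rmult_1_r. rewrite -/(INR (S i)). apply Rmult_le_compat; nra.
Qed.

Lemma half_tel_row tau i : 0 < Im tau -> is_cs (half_tel tau i) (beta0 tau i).
Proof.
  move=> Ht. apply/is_cs_Clim.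
  apply: (Clim_ext (fun K => beta0 tau i + gamma tau K i)%C) => [K|]; first by rewrite half_tel_sum.
  rewrite -{2}(Cplus_0_r (beta0 tau i)). apply: Clim_plus; first by apply Clim_const.
  have [K0 [HK H]] := lattice_bound tau Ht.
  apply: (Clim_squeeze _ _ (fun K => 4 * / K0 * / INR (S K))).
  - move=> K. rewrite (_ : (gamma tau K i - RtoC 0)%C = gamma tau K i); last ring.
    have HX : 0 < INR K + / 2 by have := pos_INR K; lra.
    have H1 := one_le_S i. have H2 := one_le_S K.
    have Hb : forall x, Rabs x = INR K + / 2 -> Cmod (/ (cc i * tau + RtoC x))%C <= / K0 * / INR (S K).
    { move=> x Hx. rewrite Cmod_inv; last by apply lattice_nz. rewrite -Rinv_mult.
      have HB := H i x. rewrite Hx in HB. rewrite S_INR in H2 |- *.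
      apply Rinv_le_contravar; first by apply Rmult_lt_0_compat; lra.
      apply: Rle_trans HB. apply Rmult_le_compat_l; lra. }
    have B1 := Hb (INR K + / 2) ltac:(rewrite Rabs_pos_eq; lra).
    have B2 := Hb (- (INR K + / 2)) ltac:(rewrite Rabs_Ropp Rabs_pos_eq; lra).
    rewrite (_ : (cc i * tau + RtoC (- (INR K + / 2)))%C = (cc i * tau - RtoC (INR K + / 2))%C) in B2; last by rewrite RtoC_opp.
    rewrite /gamma /Cminus. apply: Rle_trans (Cmod_triangle _ _) _. rewrite Cmod_opp.
    have HP : 0 < / K0 * / INR (S K) by apply Rmult_lt_0_compat; apply Rinv_0_lt_compat; lra.
    rewrite /Cminus in B2. lra.
  - rewrite -(Rmult_0_r (4 * / K0)). apply: is_lim_seq_mult'; [apply is_lim_seq_const|apply is_lim_inv_S].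
Qed.

(* The double series converges only conditionally; subtracting the telescoping series [half_tel] makes it absolutely convergent, and the boundary term is what the telescoping series leaves. *)
Lemma weight_two_exchange tau : 0 < Im tau ->
  cabs (fun k => CSeries (fun i => a2 0 tau i k)) ->
  CSeries (fun k => CSeries (fun i => a2 0 tau i k)) =
  (CSeries (fun i => CSeries (a2 0 tau i)) - RtoC PI * Ci / tau)%C.
Proof.
  move=> Ht HV. have H0 := Im_nz_C _ Ht.
  set e := fun i k => (a2 0 tau i k - half_tel tau i k)%C.
  have [B [HB Hb]] := e_bound tau Ht.
  have Hu : ex_series (fun i => B * / INR (S i) ^ 2).
  { apply: (ex_series_scal B (fun k => / INR (S k) ^ 2)). apply ex_series_inv_sq. }
  have [F1 F2] := fubini_prod e _ _ Hu ex_series_inv_sq Hb.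
  have [G1 [G2 [G3 [G4 G5]]]] := fubini _ F1 F2.
  have Hbeta := beta0_abs tau Ht.
  have ER : forall i, CSeries (a2 0 tau i) = (CSeries (e i) + beta0 tau i)%C.
  { move=> i. apply: is_cs_unique.
    apply: is_cs_ext (is_cs_plus _ _ _ _ (cabs_is _ (F1 i)) (half_tel_row tau i Ht)) => k. rewrite /e. ring. }
  rewrite (CSeries_ext _ _ ER) CSeries_plus // G5.
  apply: Clim_unique (cabs_Clim _ HV) _.
  have Hta : forall k, cabs (fun i => half_tel tau i k).
  { move=> k. apply: (cabs_ext (fun i => a2 0 tau i k + RtoC (-1) * e i k)%C).
    - move=> i. rewrite /e RtoC_m1. ring.
    - apply: cabs_plus; [by apply a2_abs_col|]. apply: cabs_scal. apply G2. }
  have Hga : forall K, cabs (gamma tau K).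
  { move=> K. apply: (cabs_ext (fun i => bigs (half_tel tau i) K + RtoC (-1) * beta0 tau i)%C).
    - move=> i. rewrite half_tel_sum RtoC_m1. ring.
    - apply: cabs_plus; [by apply: cabs_sum_n|by apply: cabs_scal]. }
  apply: (Clim_ext (fun K => bigs (fun k => CSeries (fun i => e i k)) K + (CSeries (beta0 tau) + CSeries (gamma tau K)))%C).
  { move=> K. rewrite -CSeries_plus // (CSeries_ext (fun i => beta0 tau i + gamma tau K i)%C (fun i => bigs (half_tel tau i) K)); last by move=> i; rewrite half_tel_sum.
    rewrite CSeries_bigs // -bigs_plus. apply: bigs_ext => k _.
    rewrite -CSeries_plus //. apply: CSeries_ext => i. rewrite /e. ring. }
  rewrite (_ : (_ - RtoC PI * Ci / tau)%C = (CSeries (fun k => CSeries (fun i => e i k)) + (CSeries (beta0 tau) + (- (RtoC PI * Ci) / tau)))%C); last by field.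
  apply: Clim_plus; first by apply: cabs_Clim.
  apply: Clim_plus; [apply Clim_const|by apply gamma_limit].
Qed.

Lemma E2_G2 tau : 0 < Im tau ->
  (RtoC (PI ^ 2 / 6) * E2 tau)%C = (RtoC (PI ^ 2 / 6) + RtoC (PI ^ 2 / 6) * / Cpow tau 2 + CSeries (fun i => CSeries (a2 0 tau i)))%C.
Proof.
  move=> Ht. have [_ A] := Eis_series 0 tau Ht. have [_ B] := Eis_center 0 tau Ht.
  rewrite B in A. simpl (0 + 2)%nat in A. rewrite (_ : zs 2 = PI ^ 2 / 6) in A; last by rewrite -zeta2_eq.
  rewrite -Cplus_assoc A /E2.
  rewrite (_ : Cpow (- two_pi_i) 2 = RtoC (- 4 * PI ^ 2)); last by rewrite /two_pi_i; apply C_eq; simpl; ring.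
  rewrite (_ : INR (fact 1) = 1); last by simpl; ring.
  rewrite -RtoC_div; last lra.
  rewrite (_ : - 4 * PI ^ 2 / 1 = - (PI ^ 2 / 6 * 24)); last by field.
  rewrite RtoC_opp RtoC_mult. ring.
Qed.

Lemma E2_quasimodular tau : 0 < Im tau ->
  E2 (inv_tau tau) = (Cpow tau 2 * E2 tau - RtoC 6 * Ci * tau / RtoC PI)%C.
Proof.
  move=> Ht. have Ht' := Im_inv_tau_pos _ Ht. have H0 := Im_nz_C _ Ht.
  have HPI := PI_RGT_0. have HPn : RtoC PI <> RtoC 0 by apply RtoC_nz; lra.
  have HP : RtoC (PI ^ 2 / 6) <> RtoC 0.
  { apply RtoC_nz. have := pow_lt _ 2 HPI. lra. }
  have E : forall i, CSeries (a2 0 (inv_tau tau) i) = (Cpow tau 2 * CSeries (fun k => a2 0 tau k i))%C.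
  { move=> i. rewrite -CSeries_scal; last by apply a2_abs_col. apply: CSeries_ext => k. apply a2_inv => //. by exists O. }
  have Hp : Cpow tau 2 <> RtoC 0 by apply Cpow_nz.
  have HV : cabs (fun k => CSeries (fun i => a2 0 tau i k)).
  { have [A _] := Eis_center 0 _ Ht'.
    apply: (cabs_ext (fun i => / Cpow tau 2 * CSeries (a2 0 (inv_tau tau) i))%C).
    - move=> i. rewrite E. field. exact H0.
    - by apply: cabs_scal. }
  have X1 := E2_G2 tau Ht. have X2 := E2_G2 _ Ht'.
  rewrite (CSeries_ext _ _ E) CSeries_scal // weight_two_exchange // in X2.
  set V := CSeries _ in X1 X2.
  have X3 : (RtoC (PI ^ 2 / 6) * E2 (inv_tau tau) = RtoC (PI ^ 2 / 6) * (Cpow tau 2 * E2 tau - RtoC 6 * Ci * tau / RtoC PI))%C.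
  { rewrite X2.
    transitivity (Cpow tau 2 * (RtoC (PI ^ 2 / 6) * E2 tau) - (RtoC (PI ^ 2 / 6) * RtoC 6) * Ci * tau / RtoC PI)%C; last by field.
    rewrite X1 -RtoC_mult (_ : PI ^ 2 / 6 * 6 = PI * PI); last by field.
    rewrite RtoC_mult /inv_tau.
    rewrite (_ : (- / tau = (- RtoC 1) * / tau)%C); last ring. rewrite Cpow_mult_l Cpow_inv //.
    rewrite (_ : Cpow (- RtoC 1) 2 = RtoC 1); last by simpl; ring.
    simpl (Cpow tau 2). field. repeat split => //. }
  rewrite -(Cmult_1_l (E2 _)) -(Cinv_l _ HP) -Cmult_assoc X3. field. by split.
Qed.

(** * Modularity of j *)

Definition lam : nat -> R := dsum (fun d N => INR d / INR N).

Lemma lam_bound d N : (1 <= d <= N)%nat -> Rabs (INR d / INR N) <= INR N ^ 0.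
Proof.
  move=> H. have H1 : 0 < INR d by apply lt_0_INR; lia. have H2 : INR d <= INR N by apply le_INR; lia.
  rewrite Rabs_pos_eq; last by apply Rlt_le, Rdiv_lt_0_compat; lra.
  rewrite pow_O. apply (Rmult_le_reg_r (INR N)); first lra. rewrite /Rdiv Rmult_assoc Rinv_l; lra.
Qed.

Lemma rad1_lam : rad1 lam.
Proof.
  have Hq : Cmod (RtoC 0) < 1 by rewrite Cmod_0; lra.
  exact (proj1 (divisor_series _ 0 (RtoC 0) Hq lam_bound)).
Qed.

Lemma lam_series q : Cmod q < 1 ->
  cabs (fun i => lg (Cpow q (S i))) /\ CPS lam q = CSeries (fun i => lg (Cpow q (S i))).
Proof.
  move=> Hq. have [R1 [F1 [F2 F3]]] := divisor_series _ 0 q Hq lam_bound.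
  have E : forall i, CSeries (fun m => RtoC (INR (S i) / INR (S i * S m)) * Cpow q (S i * S m))%C = lg (Cpow q (S i)).
  { move=> i. have Hqi := Cmod_pow_lt_1 q (S i) Hq ltac:(lia).
    rewrite /lg /CPS (CSeries_incr_1 (fun n => RtoC (lgc n) * _)%C); last by apply CPS_abs => //; apply rad1_lgc.
    rewrite Cmult_0_l Cplus_0_l. apply: CSeries_ext => m. rewrite Cpow_mult_r. do 2 f_equal.
    rewrite mult_INR /lgc. field. have := cc_pos i. have := cc_pos m. lra. }
  have [G1 _] := fubini _ F1 F2.
  split; first by apply: cabs_ext E G1.
  by rewrite F3 (CSeries_ext _ _ E).
Qed.

Lemma Clim_Cexp u l : Clim u l -> Clim (fun n => Cexp (u n)) (Cexp l).
Proof.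
  move=> [H1 H2].
  have He : is_lim_seq (fun n => exp (Re (u n))) (exp (Re l)).
  { apply: (is_lim_seq_continuous exp) => //. apply derivable_continuous_pt, derivable_pt_exp. }
  have Hc : is_lim_seq (fun n => cos (Im (u n))) (cos (Im l)).
  { apply: (is_lim_seq_continuous cos) => //. apply continuity_cos. }
  have Hs : is_lim_seq (fun n => sin (Im (u n))) (sin (Im l)).
  { apply: (is_lim_seq_continuous sin) => //. apply continuity_sin. }
  split; rewrite /Cexp /=; by apply: is_lim_seq_mult'.
Qed.

Lemma CLim_seq_unique u l : Clim u l -> CLim_seq u = l.
Proof.
  move=> [H1 H2]. rewrite /CLim_seq (is_lim_seq_unique _ _ H1) (is_lim_seq_unique _ _ H2). by destruct l.
Qed.

Lemma eta_product q : Cmod q < 1 ->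
  CInfProd (fun n => Cpow (RtoC 1 - Cpow q (S n)) 24) = Cexp (- RtoC 24 * CPS lam q)%C.
Proof.
  move=> Hq. have [A E] := lam_series q Hq.
  have E1 : forall n, Cpow (RtoC 1 - Cpow q (S n)) 24 = Cexp (- RtoC 24 * lg (Cpow q (S n)))%C.
  { move=> n. rewrite -Cexp_lg; last by apply Cmod_pow_lt_1 => //; lia.
    rewrite -Cexp_pow. f_equal. rewrite (_ : INR 24 = 24); last by simpl; ring. ring. }
  have E2 : forall n, Cprod_n (fun n => Cpow (RtoC 1 - Cpow q (S n)) 24) n = Cexp (- RtoC 24 * bigs (fun i => lg (Cpow q (S i))) (S n))%C.
  { elim=> [|n IH].
    - rewrite [LHS]E1. f_equal. simpl. ring.
    - transitivity (Cprod_n (fun n => Cpow (RtoC 1 - Cpow q (S n)) 24) n * Cpow (RtoC 1 - Cpow q (S (S n))) 24)%C => //.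
      rewrite IH E1 -Cexp_add. f_equal.
      set F := fun i => _. rewrite (_ : bigs F (S (S n)) = (bigs F (S n) + lg (Cpow q (S (S n))))%C) //. ring. }
  apply: CLim_seq_unique. apply: (Clim_ext (fun n => Cexp (- RtoC 24 * bigs (fun i => lg (Cpow q (S i))) (S n)))%C) => [n|].
  { by rewrite E2. }
  apply: Clim_Cexp. apply: Clim_scal. apply/(Clim_incr_1 (bigs _)). rewrite E. by apply: cabs_Clim.
Qed.

Definition logDelta (tau : C) : C := (two_pi_i * tau - RtoC 24 * CPS lam (nome tau))%C.

Lemma rsum_ext f g n : (forall k, (k < n)%nat -> f k = g k) -> rsum f n = rsum g n.
Proof.
  elim: n => [|n IH] //= H. rewrite IH; last by move=> k Hk; apply H; lia. by rewrite H.
Qed.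

Lemma rsum_scal c f n : rsum (fun k => c * f k) n = c * rsum f n.
Proof. elim: n => [|n IH] /=; first ring. rewrite IH. ring. Qed.

Lemma sig1_lam N : sig 1 N = INR N * lam N.
Proof.
  rewrite /sig /lam /dsum -rsum_scal. apply: rsum_ext => k Hk.
  have HN : 0 < INR N by apply lt_0_INR; lia.
  case: Nat.eqb; last ring. field. lra.
Qed.

Lemma Cder_nome tau : Cder nome tau (nome tau * two_pi_i)%C.
Proof.
  apply: (Cder_val _ _ (Cexp (two_pi_i * tau) * (two_pi_i * RtoC 1))%C); first by rewrite /nome -/two_pi_i; ring.
  apply: (Cder_comp Cexp (fun w => two_pi_i * w)%C).
  - apply Cder_scal, Cder_id.
  - apply Cder_Cexp.
Qed.

Lemma Cder_logDelta tau : 0 < Im tau -> Cder logDelta tau (two_pi_i * E2 tau)%C.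
Proof.
  move=> Ht. have Hq := nome_lt_1 tau Ht. set q := nome tau in Hq.
  have H1 := Cder_comp (CPS lam) nome tau _ _ (Cder_nome tau) (CPS_der _ _ rad1_lam Hq).
  have H2 := Cder_plus _ _ _ _ _ (Cder_scal two_pi_i _ _ _ (Cder_id tau)) (Cder_scal (- RtoC 24)%C _ _ _ H1).
  apply: Cder_ext (Cder_val _ _ _ _ _ H2).
  - move=> w. rewrite /logDelta. ring.
  - rewrite /E2 -/q.
    have E : CPS (sig 1) q = (q * CPS (fun n => INR (S n) * lam (S n))%R q)%C.
    { have Hs : cabs (fun n => RtoC (sig 1 n) * Cpow q n)%C.
      { apply CPS_abs => //. apply: rad1_le (rad1_scal_n _ rad1_lam) => n. by rewrite sig1_lam; apply Rle_refl. }
      have Hn : q <> RtoC 0 by apply nome_nz.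
      rewrite /CPS (CSeries_incr_1 _ Hs) (_ : sig 1 0 = 0) // Cmult_0_l Cplus_0_l.
      have Hs' := proj1 (cabs_incr_1 _) Hs.
      rewrite -CSeries_scal.
      - apply: CSeries_ext => n. rewrite sig1_lam Cpow_S. ring.
      - apply: (cabs_ext (fun n => / q * (RtoC (sig 1 (S n)) * Cpow q (S n)))%C) => [n|]; last by apply: cabs_scal.
        rewrite sig1_lam Cpow_S. field. exact Hn. }
    rewrite E. ring.
Qed.

Lemma Cder_pow f z l n : Cder f z l -> Cder (fun w => Cpow (f w) (S n)) z (RtoC (INR (S n)) * Cpow (f z) n * l)%C.
Proof.
  move=> H. elim: n => [|n IH].
  - apply: Cder_ext (Cder_val _ _ _ _ _ H); [by move=> w; simpl; ring|simpl; ring].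
  - have H2 := Cder_mult _ _ _ _ _ H IH.
    apply: Cder_val H2. rewrite (S_INR (S n)) RtoC_plus (Cpow_S _ n). ring.
Qed.

Lemma Ci_sq : (Ci * Ci)%C = (- RtoC 1)%C.
Proof. apply C_eq; simpl; ring. Qed.

Lemma Delta_modular tau : 0 < Im tau ->
  Cexp (logDelta (inv_tau tau)) = (Cpow tau 12 * Cexp (logDelta tau))%C.
Proof.
  move=> Ht. have HPI := PI_RGT_0. have HPn : RtoC PI <> RtoC 0 by apply RtoC_nz; lra.
  set W := fun w => (Cexp (logDelta (inv_tau w) + - RtoC 1 * logDelta w) * Cpow (/ w) 12)%C.
  have HW : forall w, 0 < Im w -> Cder W w (RtoC 0).
  { move=> w Hw. have H0 := Im_nz_C _ Hw.
    have D1 : Cder inv_tau w (/ (w * w))%C.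
    { apply: Cder_ext (Cder_val _ _ _ _ _ (Cder_scal (- RtoC 1)%C _ _ _ (Cder_inv w H0))).
      - move=> x. rewrite /inv_tau. ring.
      - ring. }
    have D2 := Cder_comp logDelta inv_tau w _ _ D1 (Cder_logDelta _ (Im_inv_tau_pos _ Hw)).
    have D3 := Cder_plus _ _ _ _ _ D2 (Cder_scal (- RtoC 1)%C _ _ _ (Cder_logDelta _ Hw)).
    have D4 := Cder_comp Cexp _ w _ _ D3 (Cder_Cexp _).
    have D5 := Cder_pow _ _ _ 11 (Cder_inv w H0).
    apply: Cder_val (Cder_mult _ _ _ _ _ D4 D5).
    rewrite E2_quasimodular //.
    set X := Cexp _.
    have E : (two_pi_i * (Cpow w 2 * E2 w - RtoC 6 * Ci * w / RtoC PI) * / (w * w) + - RtoC 1 * (two_pi_i * E2 w) = RtoC 12 * / w)%C.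
    { transitivity (- (Ci * Ci) * (RtoC 2 * RtoC 6) * / w)%C.
      - rewrite /two_pi_i. simpl (Cpow w 2). field. by split.
      - rewrite Ci_sq -RtoC_mult (_ : 2 * 6 = 12); last ring. ring. }
    rewrite E (_ : INR 12 = 12); last by simpl; ring.
    rewrite (Cpow_S (/ w)%C 11). field. exact H0. }
  have HI : 0 < Im Ci by simpl; lra.
  have EW := Cder_zero_const W Ci tau.
  rewrite /W in EW.
  have Hii : inv_tau Ci = Ci.
  { rewrite /inv_tau. apply C_eq; simpl; field. }
  rewrite Hii in EW.
  have Hp : Cpow (/ Ci) 12 = RtoC 1.
  { rewrite Ci_inv (_ : 12%nat = (2 * 6)%nat) // Cpow_mult_r (_ : Cpow (- Ci) 2 = (- RtoC 1)%C); last by simpl; rewrite Cmult_1_r; transitivity (Ci * Ci)%C; [ring|apply Ci_sq].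
    simpl. ring. }
  have Hseg : forall t, 0 <= t <= 1 -> 0 < Im (Ci + RtoC t * (tau - Ci))%C.
  { move=> t Ht0. rewrite im_plus im_scal_l. rewrite /Cminus im_plus im_opp. nra. }
  have {}EW := EW (fun t Ht0 => HW _ (Hseg t Ht0)).
  have H1 : (Cexp (logDelta (inv_tau tau) + - RtoC 1 * logDelta tau) * Cpow (/ tau) 12 = RtoC 1)%C.
  { rewrite EW. rewrite Hp Cmult_1_r (_ : (logDelta Ci + - RtoC 1 * logDelta Ci)%C = RtoC 0); [exact Cexp_0|ring].
  }
  have H0 := Im_nz_C _ Ht. have Ht12 : Cpow tau 12 <> RtoC 0 by apply Cpow_nz.
  rewrite Cpow_inv // in H1.
  rewrite (_ : logDelta (inv_tau tau) = ((logDelta (inv_tau tau) + - RtoC 1 * logDelta tau) + logDelta tau)%C); last ring.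
  rewrite Cexp_add. f_equal.
  set X := Cexp _ in H1 |- *.
  transitivity (X * / Cpow tau 12 * Cpow tau 12)%C; [field; exact H0|rewrite H1; ring].
Qed.

Lemma list_sum_rsum (f : nat -> nat) (P : nat -> bool) n :
  INR (list_sum (map f (filter P (seq 1 n)))) = rsum (fun i => if P (S i) then INR (f (S i)) else 0) n.
Proof.
  elim: n => [|n IH] //. rewrite seq_S filter_app map_app list_sum_app plus_INR IH.
  simpl rsum. f_equal. rewrite (_ : (1 + n)%nat = S n) //. simpl. case: (P (S n)) => //=. by rewrite Nat.add_0_r.
Qed.

Lemma sigma3_sig N : INR (sigma3 N) = sig 3 N.
Proof.
  rewrite /sigma3 list_sum_rsum /sig /dsum. apply: rsum_ext => k _. case: Nat.eqb => //. by rewrite pow_INR.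
Qed.

Lemma rad1_sig k : rad1 (sig k).
Proof.
  have Hq : Cmod (RtoC 0) < 1 by rewrite Cmod_0; lra.
  apply: (proj1 (divisor_series (fun d _ => INR d ^ k) k (RtoC 0) Hq _)).
  move=> d N HdN; rewrite Rabs_pos_eq; [apply pow_incr; split; [apply pos_INR|apply le_INR; lia]|apply pow_le, pos_INR].
Qed.

Lemma j_invariant_eq tau : 0 < Im tau ->
  j_invariant tau = (Cpow (E4 tau) 3 / Cexp (logDelta tau))%C.
Proof.
  move=> Ht. have Hq := nome_lt_1 tau Ht.
  rewrite /j_invariant eta_product // /logDelta.
  have -> : Cexp (two_pi_i * tau - RtoC 24 * CPS lam (nome tau))%C = (nome tau * Cexp (- RtoC 24 * CPS lam (nome tau)))%C.
  { rewrite /nome -Cexp_add. f_equal. rewrite /two_pi_i. ring. }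
  have -> // : CSeries (fun n => RtoC (INR (sigma3 (S n))) * Cpow (nome tau) (S n))%C = CPS (sig 3) (nome tau).
  rewrite /CPS (CSeries_incr_1 (fun n => RtoC (sig 3 n) * _)%C); last by apply CPS_abs => //; apply rad1_sig.
  rewrite (_ : sig 3 0 = 0) // Cmult_0_l Cplus_0_l. apply: CSeries_ext => n. by rewrite sigma3_sig.
Qed.

Theorem j_modular tau : 0 < Im tau -> j_invariant (inv_tau tau) = j_invariant tau.
Proof.
  move=> Ht. have Ht' := Im_inv_tau_pos _ Ht. have H0 := Im_nz_C _ Ht.
  rewrite !j_invariant_eq // E4_modular // Delta_modular //.
  have Ht12 : Cpow tau 12 <> RtoC 0 by apply Cpow_nz.
  have HD := Cexp_nz (logDelta tau).
  rewrite Cpow_mult_l -Cpow_mult_r (_ : (4 * 3 = 12)%nat) //. field. by split.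
Qed.

(** * Recursion for the coefficients *)

Lemma rad1_radius a x : rad1 a -> Rabs x < 1 -> Rbar_lt (Rabs x) (CV_radius a).
Proof.
  move=> H Hx. have Hx0 := Rabs_pos x.
  apply: (Rbar_lt_le_trans _ ((Rabs x + 1) / 2)); first by simpl; lra.
  apply (proj1 (CV_radius_bounded a)).
  have He := H ((Rabs x + 1) / 2) ltac:(lra).
  exists (Series (fun n => Rabs (a n) * ((Rabs x + 1) / 2) ^ n)) => k.
  rewrite Rabs_mult (Rabs_pos_eq (_ ^ _)); last by apply pow_le; lra.
  apply: (Series_pos_ge_term (fun n => Rabs (a n) * ((Rabs x + 1) / 2) ^ n)) => // i.
  apply Rmult_le_pos; [apply Rabs_pos|apply pow_le; lra].
Qed.

Lemma rad1_of_bounded a : (forall r, 0 < r < 1 -> exists B, forall n, Rabs (a n) * r ^ n <= B) -> rad1 a.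
Proof.
  move=> H r Hr. set s := (r + 1) / 2. have Hs : r < s < 1 by rewrite /s; lra.
  have [B HB] := H s ltac:(lra).
  have HB0 : 0 <= B by apply: Rle_trans (HB O); apply Rmult_le_pos; [apply Rabs_pos|simpl; lra].
  apply: (ex_series_le _ (fun n => B * (r / s) ^ n)); last first.
  { apply: (ex_series_scal B (fun n => (r / s) ^ n)). apply ex_series_geom.
    rewrite Rabs_pos_eq; last by apply Rmult_le_pos; [lra|apply Rlt_le, Rinv_0_lt_compat; lra].
    apply (Rmult_lt_reg_r s); first lra. rewrite /Rdiv Rmult_assoc Rinv_l; lra. }
  move=> n. rewrite /norm /= /abs /= Rabs_pos_eq; last by apply Rmult_le_pos; [apply Rabs_pos|apply pow_le; lra].
  have Hsn : 0 < s ^ n by apply pow_lt; lra.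
  rewrite (_ : r ^ n = s ^ n * (r / s) ^ n); last by rewrite -Rpow_mult_distr; f_equal; field; lra.
  rewrite -Rmult_assoc. apply Rmult_le_compat_r => //. apply pow_le.
  apply Rmult_le_pos; [lra|apply Rlt_le, Rinv_0_lt_compat; lra].
Qed.

Lemma CPS_RtoC a x : rad1 a -> Rabs x < 1 -> CPS a (RtoC x) = RtoC (PSeries a x).
Proof.
  move=> H Hx. apply: is_cs_unique.
  have He : ex_series (fun n => a n * x ^ n).
  { apply: ex_series_Rabs. apply: (ex_series_ext (fun n => Rabs (a n) * Rabs x ^ n)).
    - move=> n. by rewrite Rabs_mult RPow_abs.
    - apply H. split => //. apply Rabs_pos. }
  apply: is_cs_ext (RtoC_Series _ He) => n. by rewrite RtoC_mult RtoC_pow.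
Qed.

Lemma nome_real x : 0 < Rabs x < 1 -> exists tau, 0 < Im tau /\ nome tau = RtoC x.
Proof.
  move=> [H0 H1]. have HPI := PI_RGT_0.
  have Hl : ln (Rabs x) < 0 by rewrite -ln_1; apply ln_increasing.
  set y := - ln (Rabs x) / (2 * PI).
  have Hy : 0 < y by apply Rdiv_lt_0_compat; lra.
  have E : nome (Ci * RtoC y)%C = RtoC (Rabs x).
  { rewrite /nome (_ : (RtoC 2 * RtoC PI * Ci * (Ci * RtoC y))%C = RtoC (ln (Rabs x))).
    - by rewrite Cexp_RtoC exp_ln.
    - apply C_eq; simpl; rewrite /y; field; lra. }
  case: (Rle_lt_dec 0 x) => Hx.
  - exists (Ci * RtoC y)%C. split; first by simpl; lra. by rewrite E Rabs_pos_eq.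
  - exists (RtoC (/ 2) + Ci * RtoC y)%C. split; first by simpl; lra.
    rewrite nome_add nome_half E -RtoC_mult Rabs_left //. f_equal. ring.
Qed.

Lemma rad1_PS_mult a b : rad1 a -> rad1 b -> rad1 (PS_mult a b).
Proof.
  move=> Ha Hb r Hr.
  have Ha' : rad1 (fun n => Rabs (a n)) by apply: (rad1_le _ a) => // n; rewrite Rabs_Rabsolu; apply Rle_refl.
  have Hb' : rad1 (fun n => Rabs (b n)) by apply: (rad1_le _ b) => // n; rewrite Rabs_Rabsolu; apply Rle_refl.
  have Hr1 : Rabs r < 1 by rewrite Rabs_pos_eq; lra.
  have H := ex_pseries_mult _ _ _ (rad1_radius _ _ Ha' Hr1) (rad1_radius _ _ Hb' Hr1).
  move/ex_pseries_R: H => H.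
  apply: (ex_series_le _ (fun n => PS_mult (fun n => Rabs (a n)) (fun n => Rabs (b n)) n * r ^ n)) => // n.
  have Hrn : 0 <= r ^ n by apply pow_le; lra.
  rewrite /norm /= /abs /= Rabs_pos_eq; last by apply Rmult_le_pos => //; apply Rabs_pos.
  apply Rmult_le_compat_r => //. apply: Rle_trans (Rsum_abs _ _) _. right. apply sum_eq => i _. apply Rabs_mult.
Qed.

Definition e4c (n : nat) : R := match n with O => 1 | S _ => 240 * sig 3 n end.

Lemma rad1_e4c : rad1 e4c.
Proof.
  have H := rad1_scal 240 _ (rad1_sig 3).
  move=> r Hr. apply/ex_series_incr_1. apply: (ex_series_ext (fun n => Rabs (240 * sig 3 (S n)) * r ^ S n)) => // .
  by apply (ex_series_incr_1 (fun n => Rabs (240 * sig 3 n) * r ^ n)); apply H.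
Qed.

Lemma E4_e4c tau : 0 < Im tau -> E4 tau = CPS e4c (nome tau).
Proof.
  move=> Ht. have Hq := nome_lt_1 tau Ht.
  have A1 := CPS_abs _ _ rad1_e4c Hq. have A2 := CPS_abs _ _ (rad1_sig 3) Hq.
  rewrite /E4 /CPS (CSeries_incr_1 _ A1) (CSeries_incr_1 _ A2).
  rewrite (_ : sig 3 0 = 0) // (_ : e4c 0 = 1) //.
  have -> : CSeries (fun n => RtoC (e4c (S n)) * Cpow (nome tau) (S n))%C = (RtoC 240 * CSeries (fun n => RtoC (sig 3 (S n)) * Cpow (nome tau) (S n)))%C.
  { rewrite -CSeries_scal; last by apply (proj1 (cabs_incr_1 _) A2).
    apply: CSeries_ext => n. rewrite /e4c RtoC_mult. ring. }
  change (Cpow (nome tau) 0) with (RtoC 1). ring.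
Qed.

Section Coefs.
Variable c : nat -> Z.
Hypothesis Hc : j_fourier_coefficients c.

Definition cf (n : nat) : R := match n with O => 1 | S m => IZR (c m) end.

Lemma rad1_c : rad1 (fun n => IZR (c n)).
Proof.
  apply: rad1_of_bounded => r Hr.
  have [tau [Ht E]] := nome_real r ltac:(rewrite Rabs_pos_eq; lra).
  have H := Hc tau Ht. rewrite E in H. move/is_series_C_cs: H => [H1 _].
  have H2 : is_series (fun n => IZR (c n) * r ^ n) (Re (j_invariant tau - / RtoC r)%C).
  { apply: is_series_ext H1 => n. by rewrite -RtoC_pow -RtoC_mult. }
  have H3 := ex_series_lim_0 _ (ex_intro _ _ H2).
  have [B HB] := @filterlim_bounded R_AbsRing R_NormedModule (fun n => IZR (c n) * r ^ n) (ex_intro (fun x : R => filterlim (fun n => IZR (c n) * r ^ n) eventually (locally x)) 0 H3).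
  exists B => n. have := HB n. rewrite /norm /= /abs /= Rabs_mult (Rabs_pos_eq (r ^ n)) //. apply pow_le; lra.
Qed.

Lemma rad1_cf : rad1 cf.
Proof.
  move=> r Hr. apply/ex_series_incr_1.
  apply: (ex_series_ext (fun n => r * (Rabs (IZR (c n)) * r ^ n))) => [n|].
  - rewrite /cf /=. Rring.
  - apply: (ex_series_scal r (fun n => Rabs (IZR (c n)) * r ^ n)). by apply rad1_c.
Qed.

Lemma j_series tau : 0 < Im tau -> j_invariant tau = (/ nome tau + CPS (fun n => IZR (c n)) (nome tau))%C.
Proof.
  move=> Ht. have H := Hc tau Ht. move/is_series_C_cs/is_cs_unique: H => H.
  rewrite /CPS H. ring.
Qed.

Lemma cf_identity tau : 0 < Im tau ->
  CPS cf (nome tau) = (Cpow (CPS e4c (nome tau)) 3 * Cexp (RtoC 24 * CPS lam (nome tau)))%C.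
Proof.
  move=> Ht. have Hq := nome_lt_1 tau Ht. have Hn := nome_nz tau.
  have A := CPS_abs _ _ rad1_cf Hq. have A' := CPS_abs _ _ rad1_c Hq.
  rewrite /CPS (CSeries_incr_1 _ A).
  rewrite (CSeries_ext _ (fun n => nome tau * (RtoC (IZR (c n)) * Cpow (nome tau) n))%C); last by move=> n; rewrite /cf Cpow_S; ring.
  rewrite CSeries_scal //.
  have H := j_series tau Ht. rewrite j_invariant_eq // E4_e4c // in H.
  rewrite -/(CPS (fun n => IZR (c n)) (nome tau)) -/(CPS e4c _) -/(CPS lam _).
  have E : Cexp (logDelta tau) = (nome tau * / Cexp (RtoC 24 * CPS lam (nome tau)))%C.
  { rewrite -Cexp_opp /nome -Cexp_add. f_equal. }
  rewrite E in H. have HX := Cexp_nz (RtoC 24 * CPS lam (nome tau))%C.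
  set X := Cexp _ in H HX |- *. set F := CPS e4c _ in H |- *. set G := CPS _ _ in H |- *.
  rewrite (_ : (Cpow F 3 * X = nome tau * (Cpow F 3 / (nome tau * / X)))%C); last by field; split.
  rewrite H. simpl. field. exact Hn.
Qed.

(* [u24 n] is the coefficient of x^n in prod (1 - x^k)^(-24), from the recursion given by the logarithmic derivative; [ulist] lists them last one first. *)
Fixpoint dotR (k : nat) (l : list R) : R :=
  match l with nil => 0 | cons x t => sig 1 (S k) * x + dotR (S k) t end.
Fixpoint ulist (n : nat) : list R :=
  match n with O => cons 1 nil | S m => cons (24 / INR (S m) * dotR 0 (ulist m)) (ulist m) end.
Definition u24 (n : nat) : R := hd 0 (ulist n).

Lemma dotR_sum n : forall k, dotR k (ulist n) = sum_f_R0 (fun i => sig 1 (S (k + i)) * u24 (n - i)) n.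
Proof.
  elim: n => [|n IH] k.
  - cbn [sum_f_R0 ulist dotR]. rewrite Nat.add_0_r Nat.sub_0_r. change (u24 0) with 1. ring.
  - transitivity (sig 1 (S k) * u24 (S n) + dotR (S k) (ulist n)) => //.
    rewrite IH. rewrite (decomp_sum _ (S n)); last lia. simpl pred.
    rewrite Nat.add_0_r. f_equal. apply sum_eq => i Hi. by rewrite (_ : (k + S i = S k + i)%nat); last lia.
Qed.

Lemma u24_rec n : INR (S n) * u24 (S n) = 24 * sum_f_R0 (fun i => sig 1 (S i) * u24 (n - i)) n.
Proof.
  have H := cc_pos n. 
  transitivity (INR (S n) * (24 / INR (S n) * sum_f_R0 (fun i => sig 1 (S i) * u24 (n - i)) n)); last by field; lra.
  f_equal. by rewrite -[sum_f_R0 _ _](dotR_sum n 0).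
Qed.

Lemma rsum_nonneg f n : (forall k, 0 <= f k) -> 0 <= rsum f n.
Proof. move=> H. elim: n => [|n IH] /=; first lra. have := H n. lra. Qed.

Lemma sig_nonneg k N : 0 <= sig k N.
Proof.
  apply rsum_nonneg => i. case: Nat.eqb; [|lra]. apply pow_le, pos_INR.
Qed.

Lemma u24_nonneg n : 0 <= u24 n.
Proof.
  elim/lt_wf_ind: n => n IH. case: n IH => [|n] IH; first by rewrite /u24 /=; lra.
  have H := u24_rec n. have Hp := cc_pos n.
  have : 0 <= sum_f_R0 (fun i => sig 1 (S i) * u24 (n - i)) n.
  { apply cond_pos_sum => i. apply Rmult_le_pos; [apply sig_nonneg|]. apply IH. lia. }
  move=> HS. apply (Rmult_le_reg_l (INR (S n))) => //. lra.
Qed.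

Lemma rad1_u24 : rad1 u24.
Proof.
  apply: rad1_of_bounded => r Hr.
  have Hs : ex_series (fun i => sig 1 (S i) * r ^ S i).
  { have := rad1_sig 1 r ltac:(lra). move/(ex_series_incr_1 (fun n => Rabs (sig 1 n) * r ^ n)).
    apply: ex_series_ext => n. rewrite Rabs_pos_eq //. apply sig_nonneg. }
  set T := 24 * Series (fun i => sig 1 (S i) * r ^ S i).
  have Hpos : forall i, 0 <= sig 1 (S i) * r ^ S i.
  { move=> i. apply Rmult_le_pos; [apply sig_nonneg|apply pow_le; lra]. }
  have [N0 HN0] : exists N0 : nat, T <= INR N0.
  { exists (Z.to_nat (up T)). rewrite INR_IZR_INZ. have [H1 _] := archimed T.
    apply: (Rle_trans _ (IZR (up T))); first lra. apply IZR_le. lia. }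
  set B := sum_f_R0 (fun j => u24 j * r ^ j) N0.
  have Hu0 : forall j, 0 <= u24 j * r ^ j by move=> j; apply Rmult_le_pos; [apply u24_nonneg|apply pow_le; lra].
  have HB0 : forall j, (j <= N0)%nat -> u24 j * r ^ j <= B.
  { move=> j Hj. rewrite /B. elim: N0 Hj {HN0 B} => [|n IH] Hj.
    - have -> : j = O by lia. simpl. lra.
    - rewrite tech5. case: (Nat.eq_dec j (S n)) => [->|Hne].
      + have := cond_pos_sum (fun j => u24 j * r ^ j) n (fun i => Hu0 i). lra.
      + have := IH ltac:(lia). have := Hu0 (S n). lra. }
  have HB : 0 <= B by apply: Rle_trans (Hu0 O) (HB0 O _); lia.
  exists B => n. rewrite Rabs_pos_eq; last apply u24_nonneg.
  elim/lt_wf_ind: n => n IH. case: (le_lt_dec n N0) => Hn; first by apply HB0.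
  case: n IH Hn => [|n] IH Hn; first lia.
  have Hp := cc_pos n. apply (Rmult_le_reg_l (INR (S n))) => //.
  rewrite -Rmult_assoc u24_rec.
  have E : sum_f_R0 (fun i => sig 1 (S i) * u24 (n - i)) n * r ^ S n <= B * Series (fun i => sig 1 (S i) * r ^ S i).
  { rewrite Rmult_comm scal_sum.
    apply: (Rle_trans _ (sum_f_R0 (fun i => (sig 1 (S i) * r ^ S i) * B) n)).
    - apply sum_Rle => i Hi. rewrite (_ : (S n = S i + (n - i))%nat); last lia. rewrite pow_add.
      rewrite (_ : S i + (n - i) - i = S (n - i))%nat || idtac.
      have := IH (n - i)%nat ltac:(lia). have := Hpos i. nra.
    - rewrite -scal_sum. apply Rmult_le_compat_l => //. rewrite -sum_n_Reals. by apply Series_pos_ge_sum. }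
  have HSn : T <= INR (S n) by apply: Rle_trans HN0 _; apply le_INR; lia.
  rewrite /T in HSn. nra.
Qed.

Lemma u24_exp x : Rabs x < 1 -> PSeries u24 x = exp (24 * PSeries lam x).
Proof.
  set s := fun n => sig 1 (S n).
  have Rs : rad1 s.
  { apply: (rad1_le _ (fun n => INR (S n) * lam (S n))) => [n|]; first by rewrite /s sig1_lam; apply Rle_refl.
    move=> r Hr. case: (Req_dec r 0) => [->|Hr0].
    - apply/ex_series_incr_1. apply: (ex_series_ext (fun _ => 0)); last by apply ex_series_zero.
      move=> n. simpl. Rring.
    - have := rad1_scal_n _ rad1_lam r Hr. move/(ex_series_incr_1 (fun n => Rabs (INR n * lam n) * r ^ n)) => H.
      apply: (ex_series_ext (fun n => / r * (Rabs (INR (S n) * lam (S n)) * r ^ S n))).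
      + move=> n. rewrite -tech_pow_Rmult. match goal with |- @eq _ ?a ?b => change (@eq R a b) end. field. exact Hr0.
      + by apply: (ex_series_scal (/ r)). }
  have D1 : forall x, Rabs x < 1 -> is_derive (PSeries u24) x (24 * PSeries s x * PSeries u24 x).
  { move=> y Hy. have H := is_derive_PSeries u24 y (rad1_radius _ _ rad1_u24 Hy).
    rewrite Rmult_assoc -PSeries_mult; try by apply rad1_radius => //; apply rad1_u24.
    rewrite -PSeries_scal. rewrite (PSeries_ext _ (PS_derive u24)) // => n.
    rewrite /PS_scal /PS_mult /PS_derive u24_rec. done. }
  have D2 : forall x, Rabs x < 1 -> is_derive (PSeries lam) x (PSeries s x).
  { move=> y Hy. have H := is_derive_PSeries lam y (rad1_radius _ _ rad1_lam Hy).
    rewrite (PSeries_ext s (PS_derive lam)) // => n. by rewrite /s sig1_lam. }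
  set f := fun x => PSeries u24 x * exp (- (24 * PSeries lam x)).
  have Df : forall x, Rabs x < 1 -> is_derive f x 0.
  { move=> y Hy.
    have H3 : is_derive (fun x => exp (- (24 * PSeries lam x))) y (- (24 * PSeries s y) * exp (- (24 * PSeries lam y))).
    { apply: (is_derive_comp exp (fun x => - (24 * PSeries lam x))); first by apply is_derive_exp.
      apply: (is_derive_opp (fun x => 24 * PSeries lam x)). apply: is_derive_scal. by apply D2. }
    have H4 := is_derive_mult (PSeries u24) (fun x => exp (- (24 * PSeries lam x))) y _ _ (D1 y Hy) H3 Rmult_comm.
    apply: (eq_ind _ (fun l => is_derive f y l) H4 0 _). rewrite /plus /mult /=. Rring. }
  move=> Hx.
  have Hf0 : f 0 = 1.
  { rewrite /f !PSeries_0 (_ : lam 0 = 0) // Rmult_0_r Ropp_0 exp_0 /u24 /=. ring. }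
  have Hfx : f x = 1.
  { rewrite -Hf0. case: (Rtotal_order x 0) => [Hlt|[->|Hgt]] //.
    - apply: (eq_is_derive f) => // t Ht. apply Df. apply Rabs_def2 in Hx. apply Rabs_def1; lra.
    - symmetry. apply: (eq_is_derive f) => // t Ht. apply Df. apply Rabs_def2 in Hx. apply Rabs_def1; lra. }
  rewrite /f exp_Ropp in Hfx. have HE := exp_pos (24 * PSeries lam x).
  apply (Rmult_eq_reg_r (/ exp (24 * PSeries lam x))); last by apply Rinv_neq_0_compat; lra.
  rewrite Hfx Rinv_r //. lra.
Qed.

Lemma cf_coeffs n : cf n = PS_mult (PS_mult e4c (PS_mult e4c e4c)) u24 n.
Proof.
  have Hr : forall a, rad1 a -> forall x, Rabs x < 1 -> Rbar_lt (Rabs x) (CV_radius a) by move=> a Ha x; apply rad1_radius.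
  have Re := rad1_e4c. have Ru := rad1_u24.
  have H1 : Rbar_lt 0 1 by simpl; lra.
  have Hle : forall a, rad1 a -> Rbar_le 1 (CV_radius a).
  { move=> a Ha. case E : (CV_radius a) => [r| |] //=.
    - apply Rnot_lt_le => Hlt. have := rad1_radius a (Rmax r 0) Ha. rewrite E Rabs_pos_eq; last by apply Rmax_r.
      move=> HH. have := HH (Rmax_lub_lt _ _ _ Hlt Rlt_0_1). simpl. have := Rmax_l r 0. lra.
    - have := rad1_radius a 0 Ha. rewrite E Rabs_R0. move=> HH. by apply HH; lra. }
  have Lt : forall a x, Rabs x < 1 -> Rbar_le 1 (CV_radius a) -> Rbar_lt (Rabs x) (CV_radius a).
  { move=> a x Hx Ha. by apply: Rbar_lt_le_trans Ha. }
  have Le := Hle _ Re. have Lu := Hle _ Ru. have Lc := Hle _ rad1_cf.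
  have R2 := rad1_PS_mult _ _ Re Re. have R3 := rad1_PS_mult _ _ Re R2.
  have Lee := Hle _ R2. have Leee := Hle _ R3. have Lall := Hle _ (rad1_PS_mult _ _ R3 Ru).
  apply: PSeries_ext_recip.
  - by apply: Rbar_lt_le_trans Lc.
  - by apply: Rbar_lt_le_trans Lall.
  - exists (mkposreal _ Rlt_0_1) => x Hx.
    have {}Hx : Rabs x < 1.
    { move: Hx. rewrite /ball /= /AbsRing_ball /abs /minus /plus /opp /=. by rewrite Ropp_0 Rplus_0_r. }
    rewrite !PSeries_mult; try by apply Lt.
    rewrite u24_exp //.
    case: (Req_dec x 0) => [->|Hx0].
    + rewrite !PSeries_0 (_ : lam 0 = 0) // Rmult_0_r exp_0 /=. ring.
    + have [tau [Ht E]] := nome_real x (conj (Rabs_pos_lt _ Hx0) Hx).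
      have := cf_identity tau Ht. rewrite E !CPS_RtoC //; try apply rad1_cf; try apply rad1_lam.
      rewrite -RtoC_mult Cexp_RtoC -RtoC_pow -RtoC_mult => HH. apply RtoC_inj in HH. rewrite HH. ring.
Qed.

Lemma e4c_nonneg n : 0 <= e4c n.
Proof. case: n => [|n]; rewrite /e4c; first lra. have := sig_nonneg 3 (S n). lra. Qed.

Lemma PS_mult_nonneg a b n : (forall n, 0 <= a n) -> (forall n, 0 <= b n) -> 0 <= PS_mult a b n.
Proof. move=> Ha Hb. apply cond_pos_sum => k. by apply Rmult_le_pos. Qed.

Lemma c_nonneg n : 0 <= IZR (c n).
Proof.
  rewrite -/(cf (S n)) cf_coeffs.
  apply PS_mult_nonneg => k; [|apply u24_nonneg].
  apply PS_mult_nonneg => m; [apply e4c_nonneg|]. apply PS_mult_nonneg => p; apply e4c_nonneg.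
Qed.
End Coefs.

(** * The main term and the error term *)

Lemma ex_series_le_pos (a b : nat -> R) : (forall n, 0 <= a n <= b n) -> ex_series b -> ex_series a.
Proof.
  move=> H Hb. apply: (ex_series_le _ b) => // n.
  rewrite /norm /= /abs /= Rabs_pos_eq; apply H.
Qed.

Lemma nome_R_neq_1 x : 0 < Rabs x < 1 -> nome (RtoC x) <> RtoC 1.
Proof.
  move=> Hx E. have HPI := PI_RGT_0.
  have H1 : cos (2 * (PI * x)) = 1.
  { have := f_equal Re E. rewrite /nome /Cexp /=.
    rewrite (_ : ((2 * PI - 0 * 0) * 0 - (2 * 0 + 0 * PI) * 1) * x - ((2 * PI - 0 * 0) * 1 + (2 * 0 + 0 * PI) * 0) * 0 = 0); last ring.
    rewrite (_ : ((2 * PI - 0 * 0) * 0 - (2 * 0 + 0 * PI) * 1) * 0 + ((2 * PI - 0 * 0) * 1 + (2 * 0 + 0 * PI) * 0) * x = 2 * (PI * x)); last ring.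
    rewrite exp_0 /Re /=. lra. }
  rewrite cos_2a_sin in H1.
  have H2 : sin (PI * x) = 0 by nra.
  case: (Rle_lt_dec 0 x) => H0.
  - rewrite Rabs_pos_eq // in Hx. have := sin_gt_0 (PI * x) ltac:(nra) ltac:(nra). lra.
  - rewrite Rabs_left // in Hx. have := sin_gt_0 (PI * - x) ltac:(nra) ltac:(nra).
    rewrite (_ : PI * - x = - (PI * x)); last ring. rewrite sin_neg. lra.
Qed.

Lemma Cmod_nome_R x : Cmod (nome (RtoC x)) = 1.
Proof. rewrite Cmod_nome im_RtoC Rmult_0_r Ropp_0. apply exp_0. Qed.

Lemma nome_diff_INR m n : nome (RtoC (INR m - INR n)) = RtoC 1.
Proof.
  have E : (nome (RtoC (INR m - INR n)) * nome (RtoC (INR n)))%C = RtoC 1.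
  { rewrite -nome_add -RtoC_plus (_ : INR m - INR n + INR n = INR m); [apply nome_INR|ring]. }
  by rewrite nome_INR Cmult_1_r in E.
Qed.

Lemma geom_bigs w n : (bigs (fun k => Cpow w k) n * (w - RtoC 1) = Cpow w n - RtoC 1)%C.
Proof. elim: n => [|n IH] /=; first by ring. rewrite Cmult_plus_distr_r IH. ring. Qed.

Lemma Cmod_bigs_bound a B n : 0 <= B -> (forall k, Cmod (a k) <= B) -> Cmod (bigs a n) <= INR n * B.
Proof.
  move=> HB H. elim: n => [|n IH]; first by rewrite /= Cmod_0; lra.
  rewrite S_INR /=. apply: Rle_trans (Cmod_triangle _ _) _. have := H n. lra.
Qed.

Lemma root_average n m N : (n < N)%nat -> (m < N)%nat ->
  bigs (fun k => nome (RtoC ((INR m - INR n) * (INR k / INR N)))) N = (RtoC (INR N) * (if Nat.eqb m n then RtoC 1 else RtoC 0))%C.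
Proof.
  move=> Hn Hm. have HN : 0 < INR N by apply lt_0_INR; lia.
  set w := nome (RtoC ((INR m - INR n) / INR N)).
  rewrite (bigs_ext _ (fun k => Cpow w k)); last first.
  { move=> k _. rewrite /w -nome_pow -RtoC_mult. do 2 f_equal. field. lra. }
  have Hg := geom_bigs w N.
  have Hw : Cpow w N = RtoC 1.
  { rewrite /w -nome_pow -RtoC_mult (_ : INR N * ((INR m - INR n) / INR N) = INR m - INR n); [apply nome_diff_INR|field; lra]. }
  case: (Nat.eqb_spec m n) => E.
  - have -> : w = RtoC 1 by rewrite /w E Rminus_diag /Rdiv Rmult_0_l /nome Cmult_0_r Cexp_0.
    clear. elim: N => [|N IH]; first by simpl; ring. rewrite S_INR RtoC_plus /= IH Cpow_1_l. ring.
  - have Hw1 : w <> RtoC 1.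
    { apply nome_R_neq_1. rewrite Rabs_mult (Rabs_pos_eq (/ _)); last by apply Rlt_le, Rinv_0_lt_compat.
      have H1 : INR m - INR n <> 0 by move=> H; apply E, INR_eq; lra.
      split; first by apply Rmult_lt_0_compat; [by apply Rabs_pos_lt|by apply Rinv_0_lt_compat].
      apply (Rmult_lt_reg_r (INR N)) => //. rewrite Rmult_assoc Rinv_l; last lra.
      have := lt_INR _ _ Hn. have := lt_INR _ _ Hm. have := pos_INR m. have := pos_INR n. move=> *. rewrite Rmult_1_r Rmult_1_l. apply Rabs_def1; lra. }
    rewrite Hw (_ : (RtoC 1 - RtoC 1 = RtoC 0)%C) in Hg; last ring.
    have Hn1 : (w - RtoC 1)%C <> RtoC 0 by move=> E0; apply Hw1, Ceq_minus.
    rewrite Cmult_0_r. rewrite (_ : bigs _ N = bigs (fun k => Cpow w k) N * (w - RtoC 1) * / (w - RtoC 1))%C; last by field.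
    rewrite Hg. ring.
Qed.

Lemma coefficient_estimate a y B : rad1 a -> 0 < y -> 0 <= B ->
  (forall x, Rabs x <= / 2 -> Cmod (CPS a (nome (RtoC x + Ci * RtoC y))) <= B) ->
  forall n, Rabs (a n) <= B * exp (2 * PI * y) ^ n.
Proof.
  move=> Ha Hy HB H n. have HPI := PI_RGT_0.
  have Him : forall x, Im (RtoC x + Ci * RtoC y)%C = y by move=> x; rewrite /Im; simpl; ring.
  set q := nome (Ci * RtoC y)%C.
  have Hqm : Cmod q = exp (- (2 * PI * y)).
  { rewrite Cmod_nome. do 3 f_equal. rewrite /Im. simpl. ring. }
  have Hq : Cmod q < 1 by rewrite Hqm -exp_0; apply exp_increasing; nra.
  have HA : forall x, 0 <= x < 1 -> Cmod (CPS a (nome (RtoC x + Ci * RtoC y))) <= B.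
  { move=> x Hx. case: (Rle_lt_dec x (/ 2)) => Hx2.
    - apply H. rewrite Rabs_pos_eq; lra.
    - rewrite (_ : nome (RtoC x + Ci * RtoC y)%C = nome (RtoC (x - 1) + Ci * RtoC y)%C).
      + apply H. rewrite Rabs_left; lra.
      + rewrite (_ : (RtoC x + Ci * RtoC y = (RtoC (x - 1) + Ci * RtoC y) + RtoC 1)%C); last by rewrite RtoC_minus; ring.
        rewrite nome_add nome_1. ring. }
  set D := fun N m => (/ RtoC (INR (S N)) * bigs (fun k => nome (RtoC ((INR m - INR n) * (INR k / INR (S N))))) (S N))%C.
  set t := fun m => (RtoC (a m) * Cpow q m)%C.
  have Ht : cabs t by apply CPS_abs.
  have HD1 : forall N m, Cmod (D N m) <= 1.
  { move=> N m. have HS := cc_pos N. rewrite /D Cmod_mult Cmod_inv; last by apply RtoC_nz; lra.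
    rewrite Cmod_pos_R; last lra.
    have := Cmod_bigs_bound (fun k => nome (RtoC ((INR m - INR n) * (INR k / INR (S N))))) 1 (S N) ltac:(lra) (fun k => Req_le _ _ (Cmod_nome_R _)).
    move=> HB1. apply (Rmult_le_reg_l (INR (S N))) => //. rewrite -Rmult_assoc Rinv_r; lra. }
  have Hlim : Clim (fun N => CSeries (fun m => t m * D N m)%C) (CSeries (fun m => t m * (if Nat.eqb m n then RtoC 1 else RtoC 0))%C).
  { apply: (proj2 (tannery _ _ _ Ht _ _)).
    - move=> m. apply: (Clim_ext_loc (fun _ => t m * (if Nat.eqb m n then RtoC 1 else RtoC 0))%C); last by apply Clim_const.
      exists (m + n)%nat => N HN. f_equal. rewrite /D root_average; try lia. field. apply RtoC_nz. have := cc_pos N. lra.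
    - exists O => N _ m. rewrite Cmod_mult. have := HD1 N m. have := Cmod_ge_0 (t m). nra. }
  rewrite (CSeries_finite _ (S n)) in Hlim; last first.
  { move=> k Hk. rewrite (proj2 (Nat.eqb_neq k n)); [ring|lia]. }
  rewrite bigs_last in Hlim; last first.
  { move=> k Hk. rewrite (proj2 (Nat.eqb_neq k n)); [ring|lia]. }
  rewrite Nat.eqb_refl Cmult_1_r in Hlim.
  have Hbd : forall N, Cmod (CSeries (fun m => t m * D N m)%C) <= B.
  { move=> N. have HS := cc_pos N. have HSn : RtoC (INR (S N)) <> RtoC 0 by apply RtoC_nz; lra.
    set b := fun m k => (RtoC (a m) * Cpow (nome (RtoC (INR k / INR (S N)) + Ci * RtoC y)) m * nome (RtoC (- INR n * (INR k / INR (S N)))))%C.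
    have Eb : forall m, (RtoC (INR (S N)) * (t m * D N m))%C = bigs (b m) (S N).
    { move=> m. rewrite /D. transitivity (t m * bigs (fun k => nome (RtoC ((INR m - INR n) * (INR k / INR (S N))))) (S N))%C; first by field.
      rewrite -bigs_scal. apply: bigs_ext => k _. rewrite /t /b nome_add Cpow_mult_l -nome_pow -/q.
      rewrite (_ : RtoC ((INR m - INR n) * (INR k / INR (S N))) = (RtoC (INR m) * RtoC (INR k / INR (S N)) + RtoC (- INR n * (INR k / INR (S N))))%C).
      - rewrite nome_add. ring.
      - rewrite -RtoC_mult -RtoC_plus. f_equal. ring. }
    have Hbc : forall k, cabs (fun m => b m k).
    { move=> k. apply: (cabs_ext (fun m => nome (RtoC (- INR n * (INR k / INR (S N)))) * (RtoC (a m) * Cpow (nome (RtoC (INR k / INR (S N)) + Ci * RtoC y)) m))%C); first by move=> m; rewrite /b; ring.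
      apply: cabs_scal. apply CPS_abs => //. apply nome_lt_1. by rewrite Him. }
    have Htd : cabs (fun m => t m * D N m)%C.
    { apply: (cabs_le _ (fun m => Cmod (t m))) => // m. rewrite Cmod_mult. have := HD1 N m. have := Cmod_ge_0 (t m). nra. }
    have E : (RtoC (INR (S N)) * CSeries (fun m => t m * D N m))%C = bigs (fun k => CSeries (fun m => b m k)) (S N).
    { rewrite -CSeries_scal // -CSeries_bigs //. by apply: CSeries_ext. }
    have HB1 : Cmod (bigs (fun k => CSeries (fun m => b m k)) (S N)) <= INR (S N) * B.
    { rewrite (bigs_ext _ (fun k => if Nat.ltb k (S N) then CSeries (fun m => b m k) else RtoC 0)); last first.
      { move=> k Hk. by rewrite (proj2 (Nat.ltb_lt _ _) Hk). }
      apply Cmod_bigs_bound => // k. case: Nat.ltb_spec => Hk; last by rewrite Cmod_0.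
      rewrite (CSeries_ext _ (fun m => nome (RtoC (- INR n * (INR k / INR (S N)))) * (RtoC (a m) * Cpow (nome (RtoC (INR k / INR (S N)) + Ci * RtoC y)) m))%C); last by move=> m; rewrite /b; ring.
      rewrite CSeries_scal; last by apply CPS_abs => //; apply nome_lt_1; rewrite Him.
      rewrite Cmod_mult Cmod_nome_R Rmult_1_l. apply HA.
      have Hk0 := pos_INR k. have Hk1 := lt_INR _ _ Hk. split.
      - apply Rmult_le_pos => //. by apply Rlt_le, Rinv_0_lt_compat.
      - apply (Rmult_lt_reg_r (INR (S N))) => //. rewrite /Rdiv Rmult_assoc Rinv_l; lra. }
    rewrite -E Cmod_mult Cmod_pos_R in HB1; last lra. by apply (Rmult_le_reg_l (INR (S N))). }
  have HF : Cmod (t n) <= B.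
  { apply: (is_lim_seq_le _ _ (Finite _) (Finite _) _ (Clim_Cmod _ _ Hlim) (is_lim_seq_const B)). apply Hbd. }
  rewrite /t Cmod_mult Cmod_R Cmod_pow Hqm in HF.
  have Hen : 0 < exp (2 * PI * y) ^ n by apply pow_lt, exp_pos.
  have Hone : exp (- (2 * PI * y)) ^ n * exp (2 * PI * y) ^ n = 1.
  { rewrite -Rpow_mult_distr -exp_plus Rplus_opp_l exp_0. apply pow1. }
  have := Rmult_le_compat_r _ _ _ (Rlt_le _ _ Hen) HF. rewrite Rmult_assoc Hone. lra.
Qed.

(* [Mt n] is (2 PI / sqrt n) I_1(4 PI sqrt n) - 4 PI^2. *)
Definition mterm (n m : nat) : R :=
  (4 * PI ^ 2) ^ (m + 2) * INR n ^ S m / (INR (fact (S (S m))) * INR (fact (S m))).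
Definition Mt (n : nat) : R := Series (mterm n).

Definition gfun (w : C) : C := (Cexp (two_pi_i * w) - RtoC 1 - two_pi_i * w)%C.
Definition Phi (tau : C) : C :=
  CSeries (fun k => gfun (/ (tau + RtoC (INR k))) + gfun (/ (tau - RtoC 1 - RtoC (INR k))))%C.

Lemma gfun_series w : is_cs (fun m => Cpow (two_pi_i * w) (m + 2) / RtoC (INR (fact (m + 2))))%C (gfun w).
Proof.
  have H := Cexp_series (two_pi_i * w)%C. move/is_cs_incr_1/is_cs_incr_1: H => H.
  rewrite (_ : gfun w = (Cexp (two_pi_i * w) - Cpow (two_pi_i * w) 0 / RtoC (INR (fact 0)) - Cpow (two_pi_i * w) 1 / RtoC (INR (fact 1)))%C).
  - apply: is_cs_ext H => m. by rewrite (_ : (m + 2 = S (S m))%nat); last lia.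
  - rewrite /gfun. simpl. field.
Qed.

Lemma Cmod_two_pi_i : Cmod two_pi_i = 2 * PI.
Proof. rewrite /two_pi_i !Cmod_mult Cmod_Ci !Cmod_pos_R; have := PI_RGT_0; lra. Qed.

Lemma mterm_pos n m : 0 <= mterm n m.
Proof.
  apply Rmult_le_pos.
  - apply Rmult_le_pos; apply pow_le; [have := pow2_ge_0 PI; lra|apply pos_INR].
  - apply Rlt_le, Rinv_0_lt_compat, Rmult_lt_0_compat; apply INR_fact_pos.
Qed.

Lemma fact_ge_1 m : 1 <= INR (fact m).
Proof. have := le_INR 1 (fact m) (lt_O_fact m). by []. Qed.

Lemma exp_shift_ex x : 0 <= x -> ex_series (fun m => x ^ m / INR (fact (m + 2))).
Proof.
  move=> Hx. apply: (ex_series_le _ (fun m => x ^ m / INR (fact m))); last by exists (exp x); apply exp_is_series.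
  move=> m. have Hm : 0 <= x ^ m by apply pow_le.
  rewrite /norm /= /abs /= Rabs_pos_eq; last by apply Rmult_le_pos => //; apply Rlt_le, Rinv_0_lt_compat, INR_fact_pos.
  apply Rmult_le_compat_l => //. apply Rinv_le_contravar; first by apply INR_fact_pos.
  apply le_INR, fact_le. lia.
Qed.

Lemma ex_mterm n : ex_series (mterm n).
Proof.
  have H0 : 0 <= 4 * PI ^ 2 by have := pow2_ge_0 PI; lra.
  have Hn := pos_INR n.
  apply: (ex_series_le _ (fun m => ((4 * PI ^ 2) ^ 2 * INR n) * ((4 * PI ^ 2 * INR n) ^ m / INR (fact (m + 2))))); last first.
  { apply: (ex_series_scal ((4 * PI ^ 2) ^ 2 * INR n)). apply exp_shift_ex. by apply Rmult_le_pos. }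
  move=> m. rewrite /norm /= /abs /= Rabs_pos_eq; last by apply mterm_pos.
  rewrite /mterm (_ : S (S m) = (m + 2)%nat); last lia.
  have F1 := INR_fact_pos (m + 2). have F2 := fact_ge_1 (S m).
  set P := 4 * PI ^ 2 in H0 |- *.
  rewrite (_ : _ * (P * 1) * INR n * ((P * INR n) ^ m / INR (fact (m + 2))) = P ^ (m + 2) * INR n ^ S m * / INR (fact (m + 2))); last first.
  { rewrite Rpow_mult_distr pow_add. simpl. field. lra. }
  apply Rmult_le_compat_l; first by apply Rmult_le_pos; apply pow_le.
  apply Rinv_le_contravar => //. nra.
Qed.

Lemma Phi_expansion tau : 0 < Im tau ->
  cabs (fun n => RtoC (Mt n) * Cpow (nome tau) n)%C /\ Phi tau = CPS Mt (nome tau) /\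
  cabs (fun k => gfun (/ (tau + RtoC (INR k))) + gfun (/ (tau - RtoC 1 - RtoC (INR k))))%C.
Proof.
  move=> Ht. have HPI := PI_RGT_0. set q := nome tau. have Hq : Cmod q < 1 by apply nome_lt_1.
  have [K [HK HB]] := Sm_term_bound tau Ht.
  set y := Im tau in Ht HB.
  set a := fun k m => (Cpow two_pi_i (m + 2) / RtoC (INR (fact (m + 2))) * (/ Cpow (tau + RtoC (INR k)) (m + 2) + / Cpow (tau - RtoC 1 - RtoC (INR k)) (m + 2)))%C.
  have Hy0 : 0 <= 2 * PI / y by apply Rlt_le, Rdiv_lt_0_compat; lra.
  have Hw : forall m, Cmod (Cpow two_pi_i (m + 2) / RtoC (INR (fact (m + 2))))%C * / y ^ m = (2 * PI) ^ 2 * ((2 * PI / y) ^ m / INR (fact (m + 2))).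
  { move=> m. have F := INR_fact_pos (m + 2). have Hym : y ^ m <> 0 by apply pow_nonzero; lra.
    rewrite Cmod_div; last by apply RtoC_nz; lra. rewrite Cmod_pow Cmod_two_pi_i Cmod_pos_R; last lra.
    rewrite pow_add (_ : (2 * PI / y) ^ m = (2 * PI) ^ m * / y ^ m); last by rewrite /Rdiv Rpow_mult_distr pow_inv. field. split => //. lra. }
  have Hb : forall k m, Cmod (a k m) <= / INR (S k) ^ 2 * ((2 * PI) ^ 2 * 2 * K * ((2 * PI / y) ^ m / INR (fact (m + 2)))).
  { move=> k m. rewrite /a Cmod_mult. have [B1 B2] := HB m k.
    have T := Cmod_triangle (/ Cpow (tau + RtoC (INR k)) (m + 2))%C (/ Cpow (tau - RtoC 1 - RtoC (INR k)) (m + 2))%C.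
    apply: Rle_trans (Rmult_le_compat_l _ _ (/ y ^ m * (2 * K * / INR (S k) ^ 2)) (Cmod_ge_0 _) _) _; first lra.
    rewrite -Rmult_assoc Hw. right. ring. }
  have Hv : ex_series (fun m => (2 * PI) ^ 2 * 2 * K * ((2 * PI / y) ^ m / INR (fact (m + 2)))).
  { apply: (ex_series_scal ((2 * PI) ^ 2 * 2 * K)). by apply exp_shift_ex. }
  have [F1 F2] := fubini_prod a _ _ ex_series_inv_sq Hv Hb.
  have [G1 [G2 [G3 [G4 G5]]]] := fubini a F1 F2.
  have Erow : forall k, CSeries (a k) = (gfun (/ (tau + RtoC (INR k))) + gfun (/ (tau - RtoC 1 - RtoC (INR k))))%C.
  { move=> k. apply: is_cs_unique.
    apply: is_cs_ext (is_cs_plus _ _ _ _ (gfun_series (/ (tau + RtoC (INR k)))) (gfun_series (/ (tau - RtoC 1 - RtoC (INR k))))) => m.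
    have N1 := shift_nz tau (INR k) Ht. have N2 := shift_nz' tau (INR k) Ht.
    rewrite /a !Cpow_mult_l !Cpow_inv // /Cdiv. ring. }
  set b := fun m n => (RtoC (mterm n m) * Cpow q n)%C.
  have H4p : (two_pi_i * - two_pi_i)%C = RtoC (4 * PI ^ 2).
  { rewrite /two_pi_i. apply C_eq; simpl; ring. }
  have Eb : forall m n, b m n = (RtoC ((4 * PI ^ 2) ^ (m + 2) / (INR (fact (m + 2)) * INR (fact (S m)))) * (RtoC (npow (S m) n) * Cpow q n))%C.
  { move=> m n. rewrite /b /mterm /npow (_ : S (S m) = (m + 2)%nat); last lia. rewrite Cmult_assoc -RtoC_mult. do 2 f_equal.
    have := INR_fact_pos (m + 2). have := INR_fact_pos (S m). move=> *. field. lra. }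
  have Hcf : forall m z, 0 < Im z -> (RtoC ((4 * PI ^ 2) ^ (m + 2) / (INR (fact (m + 2)) * INR (fact (S m)))) * CPS (npow (S m)) (nome z))%C = (Cpow two_pi_i (m + 2) / RtoC (INR (fact (m + 2))) * Sm (m + 2) z)%C.
  { move=> m z Hz. rewrite lipschitz // RtoC_div; last by apply Rgt_not_eq, Rmult_gt_0_compat; apply INR_fact_pos.
    rewrite RtoC_pow -H4p Cpow_mult_l RtoC_mult. field. split; apply RtoC_nz, Rgt_not_eq, INR_fact_pos. }
  have Bf1 : forall m, cabs (b m).
  { move=> m. apply: (cabs_ext _ _ (fun n => eq_sym (Eb m n))). apply: cabs_scal. by apply npow_abs. }
  have Ecol : forall m, CSeries (fun k => a k m) = CSeries (b m).
  { move=> m. rewrite (CSeries_ext _ _ (Eb m)) CSeries_scal; last by apply npow_abs.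
    rewrite -/(CPS (npow (S m)) q) Hcf // /Sm -CSeries_scal //. by apply: cabs_plus; [apply Sm_abs_l|apply Sm_abs_r]. }
  have Hiy : 0 < Im (Ci * RtoC y)%C by rewrite /Im /=; lra.
  have Enq : nome (Ci * RtoC y)%C = RtoC (Cmod q).
  { rewrite /q Cmod_nome /nome -Cexp_RtoC. f_equal. rewrite -/y. apply C_eq; simpl; ring. }
  have [K' [HK' HB']] := Sm_term_bound _ Hiy.
  have Ey : Im (Ci * RtoC y)%C = y by rewrite /Im /=; ring. rewrite Ey in HB'.
  have Bf2 : ex_series (fun m => Series (fun n => Cmod (b m n))).
  { apply: (ex_series_le_pos _ (fun m => ((2 * PI) ^ 2 * 2 * K' * Series (fun k => / INR (S k) ^ 2)) * ((2 * PI / y) ^ m / INR (fact (m + 2))))); last first.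
    { apply: (ex_series_scal ((2 * PI) ^ 2 * 2 * K' * Series (fun k => / INR (S k) ^ 2))). by apply exp_shift_ex. }
    move=> m. split; first by apply: (Series_pos _ _ (Bf1 m)) => n; apply Cmod_ge_0.
    have E1 : RtoC (Series (fun n => Cmod (b m n))) = (Cpow two_pi_i (m + 2) / RtoC (INR (fact (m + 2))) * Sm (m + 2) (Ci * RtoC y))%C.
    { rewrite -Hcf // Enq. rewrite /CPS -CSeries_scal; last by apply npow_abs; rewrite Cmod_pos_R //; apply Cmod_ge_0.
      symmetry. apply: is_cs_unique. apply: is_cs_ext (RtoC_Series _ (Bf1 m)) => n.
      rewrite Cmult_assoc -RtoC_mult -RtoC_pow -RtoC_mult /b Cmod_mult Cmod_pow Cmod_pos_R; last by apply mterm_pos.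
      f_equal. f_equal. rewrite /mterm /npow (_ : S (S m) = (m + 2)%nat); last lia.
      have := INR_fact_pos (m + 2). have := INR_fact_pos (S m). move=> *. field. lra. }
    have E2 : Series (fun n => Cmod (b m n)) = Cmod (Cpow two_pi_i (m + 2) / RtoC (INR (fact (m + 2))) * Sm (m + 2) (Ci * RtoC y))%C.
    { rewrite -E1 Cmod_pos_R //. apply: (Series_pos _ _ (Bf1 m)) => n. apply Cmod_ge_0. }
    rewrite E2 Cmod_mult.
    have HS : Cmod (Sm (m + 2) (Ci * RtoC y)%C) <= / y ^ m * (2 * K' * Series (fun k => / INR (S k) ^ 2)).
    { have Hc1 := Sm_abs_l _ m Hiy. have Hc2 := Sm_abs_r _ m Hiy.
      apply: Rle_trans (Cmod_CSeries_le _ (cabs_plus _ _ Hc1 Hc2)) _.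
      rewrite -!Series_scal_l. apply: Series_le.
      - move=> k. split; first by apply Cmod_ge_0. have [B1 B2] := HB' m k. apply: Rle_trans (Cmod_triangle _ _) _. lra.
      - apply: (ex_series_scal (/ y ^ m) (fun k => 2 * K' * / INR (S k) ^ 2)). apply: (ex_series_scal (2 * K') (fun k => / INR (S k) ^ 2)). apply ex_series_inv_sq. }
    apply: Rle_trans (Rmult_le_compat_l _ _ _ (Cmod_ge_0 _) HS) _.
    rewrite -Rmult_assoc Hw. right. ring. }
  have [I1 [I2 [I3 [I4 I5]]]] := fubini b Bf1 Bf2.
  have EM : forall n, CSeries (fun m => b m n) = (RtoC (Mt n) * Cpow q n)%C.
  { move=> n. rewrite /b Cmult_comm. rewrite -(is_cs_unique _ _ (is_cs_scal (Cpow q n) _ _ (RtoC_Series _ (ex_mterm n)))).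
    apply: CSeries_ext => m. ring. }
  split; first by apply: cabs_ext EM I4.
  split; last by apply: cabs_ext Erow G1.
  rewrite /Phi -(CSeries_ext _ _ Erow) G5 (CSeries_ext _ _ Ecol) I5 /CPS. by apply: CSeries_ext.
Qed.

Lemma rad1_Mt : rad1 Mt.
Proof.
  move=> r Hr. case: (Req_dec r 0) => [->|Hr0].
  - apply/ex_series_incr_1. apply: (ex_series_ext (fun _ => 0)); last by apply ex_series_zero.
    move=> n. simpl. Rring.
  - have [tau [Ht E]] := nome_real r ltac:(rewrite Rabs_pos_eq; lra).
    have [H _] := Phi_expansion tau Ht. rewrite E in H.
    apply: ex_series_ext H => n. rewrite Cmod_mult Cmod_pow !Cmod_R (Rabs_pos_eq r) //. lra.
Qed.

Lemma exp_le_3_pow n x : x <= INR n -> exp x <= 3 ^ n.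
Proof.
  move=> Hx. apply: (Rle_trans _ (exp (INR n))).
  - case: Hx => [H| ->]; [by apply Rlt_le, exp_increasing|lra].
  - elim: n {Hx} => [|n IH]; first by rewrite /= exp_0; lra.
    rewrite S_INR exp_plus. simpl. have := exp_le_3. have := exp_pos (INR n). have := exp_pos 1. nra.
Qed.

Lemma exp_ge_2_pow n x : INR n <= x -> 2 ^ n <= exp x.
Proof.
  move=> Hx. apply: (Rle_trans _ (exp (INR n))).
  - elim: n {Hx} => [|n IH]; first by rewrite /= exp_0; lra.
    rewrite S_INR exp_plus. simpl. have := exp_ineq1_le 1. have := exp_pos (INR n). nra.
  - case: Hx => [H| ->]; [by apply Rlt_le, exp_increasing|lra].
Qed.

Lemma exp_mono x y : x <= y -> exp x <= exp y.
Proof. case=> [H| ->]; [by apply Rlt_le, exp_increasing|lra]. Qed.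

Lemma INR_le_pow2 n : INR n <= 2 ^ n.
Proof.
  elim: n => [|n IH]; first by simpl; lra. rewrite S_INR -tech_pow_Rmult.
  have := pow_R1_Rle 2 n ltac:(lra). lra.
Qed.

Section Bound.
Variable c : nat -> Z.
Hypothesis Hc : j_fourier_coefficients c.

Definition csum (Y : R) : R := Series (fun m => IZR (c m) * exp (- (2 * PI * Y)) ^ m).

Lemma exp_neg_lt_1 Y : 0 < Y -> 0 < exp (- (2 * PI * Y)) < 1.
Proof.
  move=> H. have HPI := PI_RGT_0. split; first by apply exp_pos. rewrite -exp_0. apply exp_increasing. nra.
Qed.

Lemma csum_ex Y : 0 < Y -> ex_series (fun m => IZR (c m) * exp (- (2 * PI * Y)) ^ m).
Proof.
  move=> H. have He := exp_neg_lt_1 Y H.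
  have := rad1_c c Hc _ (conj (Rlt_le _ _ (proj1 He)) (proj2 He)).
  apply: ex_series_ext => m. rewrite Rabs_pos_eq //. by apply c_nonneg.
Qed.

Lemma csum_term_nonneg Y m : 0 <= IZR (c m) * exp (- (2 * PI * Y)) ^ m.
Proof. apply Rmult_le_pos; [by apply c_nonneg|apply pow_le, Rlt_le, exp_pos]. Qed.

Lemma csum_antitone Y Y' : 0 < Y -> Y <= Y' -> csum Y' <= csum Y.
Proof.
  move=> H H'. have HPI := PI_RGT_0. apply: Series_le; last by apply csum_ex.
  move=> m. split; first by apply csum_term_nonneg.
  apply Rmult_le_compat_l; first by apply c_nonneg. apply pow_incr. split; first by apply Rlt_le, exp_pos.
  apply exp_mono. nra.
Qed.

Lemma Im_iR Y : Im (Ci * RtoC Y)%C = Y.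
Proof. rewrite /Im /=. ring. Qed.

Lemma nome_iR Y : nome (Ci * RtoC Y)%C = RtoC (exp (- (2 * PI * Y))).
Proof.
  rewrite /nome -Cexp_RtoC. f_equal. apply C_eq; simpl; ring.
Qed.

Lemma j_iR Y : 0 < Y -> j_invariant (Ci * RtoC Y)%C = RtoC (exp (2 * PI * Y) + csum Y).
Proof.
  move=> H. have He := exp_neg_lt_1 Y H.
  rewrite (j_series c Hc) ?Im_iR // nome_iR CPS_RtoC; [|by apply rad1_c|by rewrite Rabs_pos_eq; lra].
  rewrite RtoC_plus -RtoC_inv; last lra. f_equal. f_equal. rewrite exp_Ropp Rinv_inv //.
Qed.

Lemma csum_bound Y : 0 < Y -> csum Y <= exp (2 * PI / Y) + csum 1.
Proof.
  move=> H. have HPI := PI_RGT_0.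
  case: (Rle_lt_dec 1 Y) => H1.
  - have := csum_antitone 1 Y ltac:(lra) H1. have := exp_pos (2 * PI / Y). lra.
  - have Hi : 0 < / Y by apply Rinv_0_lt_compat.
    have E := j_modular (Ci * RtoC Y)%C. rewrite Im_iR in E. have {}E := E H.
    rewrite (_ : inv_tau (Ci * RtoC Y) = (Ci * RtoC (/ Y))%C) in E; last first.
    { rewrite /inv_tau. apply C_eq; simpl; field; lra. }
    rewrite !j_iR // in E. apply RtoC_inj in E.
    have H2 := csum_antitone 1 (/ Y) ltac:(lra) ltac:(rewrite -Rinv_1; apply Rinv_le_contravar; lra).
    have H3 := exp_pos (2 * PI * Y). rewrite /Rdiv. lra.
Qed.

Lemma PS_geom_bound a C b x : 0 <= C -> 0 <= b -> 0 <= x -> b * x < 1 ->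
  (forall n, 0 <= a n) -> (forall n, a (S n) <= C * b ^ S n) -> a O = 0 -> ex_series (fun n => a n * x ^ n) ->
  Series (fun n => a n * x ^ n) <= C * (b * x) / (1 - b * x).
Proof.
  move=> HC Hb Hx Hbx Ha Hab Ha0 He.
  rewrite Series_incr_1 // Ha0 Rmult_0_l Rplus_0_l.
  apply: (Rle_trans _ (Series (fun n => C * (b * x) * (b * x) ^ n))).
  - apply: Series_le.
    + move=> n. split; first by apply Rmult_le_pos => //; apply pow_le.
      have := Rmult_le_compat_r (x ^ S n) _ _ (pow_le _ _ Hx) (Hab n).
      rewrite Rmult_assoc -Rpow_mult_distr (Rmult_assoc C) tech_pow_Rmult. by [].
    + apply: (ex_series_scal (C * (b * x)) (fun n => (b * x) ^ n)). apply ex_series_geom. rewrite Rabs_pos_eq //. nra.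
  - rewrite Series_scal_l Series_geom; last by rewrite Rabs_pos_eq //; nra. right. field. lra.
Qed.

Lemma csum_1_bound : csum 1 <= 2 * 10 ^ 10.
Proof.
  have HP4 := PI_4. have HP3 := PI2_3_2. have HPI := PI_RGT_0.
  set x := exp (- (2 * PI * 1)).
  have Hx := exp_neg_lt_1 1 ltac:(lra). rewrite -/x in Hx.
  have Hx64 : x <= / 64.
  { rewrite /x exp_Ropp. apply Rinv_le_contravar; first lra.
    have := exp_ge_2_pow 6 (2 * PI * 1) ltac:(simpl; lra). simpl. lra. }
  have Hxl : / 6561 <= x.
  { rewrite /x exp_Ropp. apply Rinv_le_contravar; first by apply exp_pos.
    have := exp_le_3_pow 8 (2 * PI * 1) ltac:(simpl; lra). simpl. lra. }
  have Hxa : Rabs x < 1 by rewrite Rabs_pos_eq; lra.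
  have Hex : forall a, rad1 a -> (forall n, 0 <= a n) -> ex_series (fun n => a n * x ^ n).
  { move=> a Ha Hp. apply: ex_series_ext (Ha x ltac:(lra)) => n. by rewrite Rabs_pos_eq. }
  have Hi : 0 < Im (Ci * RtoC 1)%C by rewrite Im_iR; lra.
  have E := cf_identity c Hc _ Hi. rewrite nome_iR -/x in E.
  rewrite !CPS_RtoC // in E; try apply rad1_e4c; try apply rad1_lam; try by apply rad1_cf.
  rewrite -RtoC_mult Cexp_RtoC -RtoC_pow -RtoC_mult in E. apply RtoC_inj in E.
  have Ecf : PSeries (cf c) x = 1 + x * csum 1.
  { rewrite /PSeries Series_incr_1; last first.
    { apply: Hex; first by apply rad1_cf. case=> [|n]; [simpl; lra|by apply c_nonneg]. }
    rewrite /csum -Series_scal_l -/x. simpl (cf c 0 * x ^ 0). rewrite Rmult_1_l. f_equal. apply: Series_ext => n.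
    rewrite /cf -tech_pow_Rmult. ring. }
  have Hsig : forall n, 240 * sig 3 (S n) <= 240 * 16 ^ S n.
  { move=> n. apply Rmult_le_compat_l; first lra.
    apply: Rle_trans (Rle_abs _) _. apply: Rle_trans (rsum_abs_le _ (INR (S n) ^ 3) (S n) _) _.
    - move=> k Hk. case: Nat.eqb; last by rewrite Rabs_R0; apply pow_le, pos_INR.
      rewrite Rabs_pos_eq; last by apply pow_le, pos_INR. apply pow_incr. split; [apply pos_INR|apply le_INR; lia].
    - rewrite (_ : 16 = 2 ^ 4); last by simpl; ring. rewrite -pow_mult Nat.mul_comm pow_mult.
      rewrite tech_pow_Rmult. apply pow_incr. split; [apply pos_INR|apply INR_le_pow2]. }
  have He4 : PSeries e4c x <= 81.
  { rewrite /PSeries Series_incr_1; last by apply: Hex; [apply rad1_e4c|apply e4c_nonneg].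
    simpl (e4c 0 * x ^ 0).
    set a := fun n => match n with O => 0 | S _ => e4c n end.
    have Hea : ex_series (fun n => a n * x ^ n).
    { apply/ex_series_incr_1. apply: (ex_series_ext (fun n => e4c (S n) * x ^ S n)) => //.
      apply (ex_series_incr_1 (fun n => e4c n * x ^ n)). apply: Hex; [apply rad1_e4c|apply e4c_nonneg]. }
    have HB := PS_geom_bound a 240 16 x ltac:(lra) ltac:(lra) ltac:(lra) ltac:(lra) ltac:(by case=> [|n]; [simpl; lra|apply e4c_nonneg]) Hsig ltac:(done) Hea.
    rewrite Series_incr_1 // in HB. simpl (a O * x ^ 0) in HB.
    have : 240 * (16 * x) / (1 - 16 * x) <= 80.
    { apply (Rmult_le_reg_r (1 - 16 * x)); first lra. rewrite /Rdiv Rmult_assoc Rinv_l; lra. }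
    move=> HH. change (Series (fun k => a (S k) * x ^ S k)) with (Series (fun k => e4c (S k) * x ^ S k)) in HB. lra. }
  have Hlam0 : forall n, 0 <= lam n.
  { move=> n. apply rsum_nonneg => k. case: Nat.eqb; last lra. apply Rmult_le_pos; first apply pos_INR.
    case: n => [|n]; [rewrite Rinv_0; lra|apply Rlt_le, Rinv_0_lt_compat, cc_pos]. }
  have Hlam : PSeries lam x <= / 30.
  { have HB := PS_geom_bound lam 1 2 x ltac:(lra) ltac:(lra) ltac:(lra) ltac:(lra) Hlam0.
    apply: Rle_trans (HB _ _ _) _ => //.
    - move=> n. rewrite Rmult_1_l. apply: Rle_trans (INR_le_pow2 _).
      apply: Rle_trans (Rle_abs _) _. rewrite -(Rmult_1_r (INR (S n))). apply rsum_abs_le => k Hk.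
      case: Nat.eqb; last by rewrite Rabs_R0; lra. have := lam_bound (S k) (S n) ltac:(lia). by rewrite pow_O.
    - apply: Hex => //. apply rad1_lam.
    - apply (Rmult_le_reg_r (1 - 2 * x)); first lra. rewrite /Rdiv Rmult_assoc Rinv_l; lra. }
  have He40 : 0 <= PSeries e4c x.
  { apply: Series_pos; last by apply: Hex; [apply rad1_e4c|apply e4c_nonneg].
    move=> n. apply Rmult_le_pos; [apply e4c_nonneg|apply pow_le; lra]. }
  have Hexp : exp (24 * PSeries lam x) <= 3.
  { have := exp_le_3_pow 1 (24 * PSeries lam x) ltac:(simpl; lra). simpl. lra. }
  have Hcube : PSeries e4c x ^ 3 <= 81 ^ 3 by apply pow_incr.
  have Hep := exp_pos (24 * PSeries lam x).
  have Hfin : 1 + x * csum 1 <= 81 ^ 3 * 3.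
  { rewrite -Ecf E. apply Rmult_le_compat => //; [by apply pow_le|lra]. }
  have Hc1 : 0 <= csum 1.
  { apply: Series_pos; [apply csum_term_nonneg|apply csum_ex; lra]. }
  have : / 6561 * csum 1 <= x * csum 1 by apply Rmult_le_compat_r.
  simpl in Hfin |- *. lra.
Qed.

Lemma gfun_bound w : Cmod (gfun w) <= (2 * PI * Cmod w) ^ 2 * exp (2 * PI * Cmod w).
Proof.
  set z := (two_pi_i * w)%C. have Hz : Cmod z = 2 * PI * Cmod w by rewrite /z Cmod_mult Cmod_two_pi_i.
  have Hz0 := Cmod_ge_0 z.
  have Ea : forall m, Cmod (Cpow z (m + 2) / RtoC (INR (fact (m + 2))))%C = Cmod z ^ (m + 2) / INR (fact (m + 2)) by move=> m; apply Cmod_exp_term.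
  have Hle : forall m, 0 <= Cmod z ^ (m + 2) / INR (fact (m + 2)) <= Cmod z ^ 2 * (Cmod z ^ m / INR (fact m)).
  { move=> m. have F1 := INR_fact_pos m. have F2 := INR_fact_pos (m + 2). split.
    - apply Rmult_le_pos; [by apply pow_le|by apply Rlt_le, Rinv_0_lt_compat].
    - rewrite pow_add (Rmult_comm (Cmod z ^ m)) /Rdiv Rmult_assoc. apply Rmult_le_compat_l; first by apply pow_le.
      apply Rmult_le_compat_l; first by apply pow_le. apply Rinv_le_contravar => //. apply le_INR, fact_le. lia. }
  have Hs := exp_is_series (Cmod z).
  have Hex : ex_series (fun m => Cmod z ^ 2 * (Cmod z ^ m / INR (fact m))).
  { apply: (ex_series_scal (Cmod z ^ 2)). by exists (exp (Cmod z)). }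
  have Habs : cabs (fun m => Cpow z (m + 2) / RtoC (INR (fact (m + 2))))%C.
  { apply: (ex_series_ext (fun m => Cmod z ^ (m + 2) / INR (fact (m + 2)))) => [m|]; first by rewrite Ea.
    by apply: ex_series_le_pos Hle Hex. }
  rewrite -(is_cs_unique _ _ (gfun_series w)) -/z.
  apply: Rle_trans (Cmod_CSeries_le _ Habs) _.
  rewrite -Hz -(is_series_unique _ _ Hs) -Series_scal_l. apply: Series_le => // m. rewrite Ea. apply Hle.
Qed.

Lemma gfun_shift_bound tau s d : / 2 <= d -> d <= Rabs (Re tau + s) ->
  Cmod (gfun (/ (tau + RtoC s))) <= (2 * PI) ^ 2 * exp (4 * PI) * / d ^ 2.
Proof.
  move=> Hd Hs. have HPI := PI_RGT_0.
  have Hm : d <= Cmod (tau + RtoC s)%C by apply: Rle_trans Hs _; apply: Rle_trans (re_le_Cmod _); rewrite re_plus re_RtoC; lra.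
  have Hn : (tau + RtoC s)%C <> RtoC 0 by apply/Cmod_gt_0; lra.
  apply: Rle_trans (gfun_bound _) _. rewrite Cmod_inv //.
  have Hi : / Cmod (tau + RtoC s)%C <= / d by apply Rinv_le_contravar; lra.
  have Hi2 : / d <= 2 by rewrite -(Rinv_inv 2); apply Rinv_le_contravar; lra.
  have Hi0 : 0 < / Cmod (tau + RtoC s)%C by apply Rinv_0_lt_compat; lra.
  rewrite Rpow_mult_distr -pow_inv (_ : (2 * PI) ^ 2 * exp (4 * PI) * (/ d) ^ 2 = ((2 * PI) ^ 2 * (/ d) ^ 2) * exp (4 * PI)); last ring.
  have H2p : 0 <= (2 * PI) ^ 2 by apply pow2_ge_0.
  apply Rmult_le_compat.
  - apply Rmult_le_pos => //. apply pow2_ge_0.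
  - apply Rlt_le, exp_pos.
  - apply Rmult_le_compat_l => //. apply pow_incr. lra.
  - apply exp_mono. nra.
Qed.

Lemma Phi_rest tau : 0 < Im tau -> Rabs (Re tau) <= / 2 -> Cmod (Phi tau - gfun (/ tau))%C <= 10 ^ 11.
Proof.
  move=> Ht Hx. have HPI := PI_RGT_0. have HP4 := PI_4.
  have [_ [_ A]] := Phi_expansion tau Ht.
  set E := (2 * PI) ^ 2 * exp (4 * PI).
  have HE : 0 <= E <= 64 * 3 ^ 16.
  { have H1 := exp_le_3_pow 16 (4 * PI) ltac:(simpl; lra). have H2 := exp_pos (4 * PI).
    have H3 : 0 <= (2 * PI) ^ 2 <= 64 by split; [apply pow2_ge_0|nra].
    split; first by apply Rmult_le_pos; lra. apply Rmult_le_compat; lra. }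
  move/Rabs_le_between: Hx => Hx.
  have Hd : forall d, 0 < d -> 0 < / d ^ 2 by move=> d Hd; apply Rinv_0_lt_compat, pow_lt.
  have B1 : Cmod (gfun (/ (tau - RtoC 1 - RtoC (INR 0)))) <= E * 4.
  { rewrite (_ : (tau - RtoC 1 - RtoC (INR 0) = tau + RtoC (-1))%C); last by rewrite RtoC_m1 /=; ring.
    apply: Rle_trans (gfun_shift_bound tau (-1) (/ 2) _ _) _; [lra|rewrite Rabs_left; lra|]. right. rewrite -/E. field. }
  have B2 : forall k, Cmod (gfun (/ (tau + RtoC (INR (S k)))) + gfun (/ (tau - RtoC 1 - RtoC (INR (S k)))))%C <= E * 8 * / INR (S k) ^ 2.
  { move=> k. have H1 := one_le_S k.
    have G1 := gfun_shift_bound tau (INR (S k)) (INR (S k) / 2) ltac:(lra) ltac:(rewrite Rabs_pos_eq; lra).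
    have G2 := gfun_shift_bound tau (- 1 - INR (S k)) (INR (S k) / 2) ltac:(lra) ltac:(rewrite Rabs_left; lra).
    rewrite (_ : (tau + RtoC (- 1 - INR (S k)) = tau - RtoC 1 - RtoC (INR (S k)))%C) in G2; last by rewrite RtoC_minus RtoC_m1; ring.
    apply: Rle_trans (Cmod_triangle _ _) _. rewrite -/E in G1 G2.
    have : E * / (INR (S k) / 2) ^ 2 = E * 4 * / INR (S k) ^ 2 by field; lra. lra. }
  have Hex : ex_series (fun k => E * 8 * / INR (S k) ^ 2).
  { apply: (ex_series_scal (E * 8) (fun k => / INR (S k) ^ 2)). apply ex_series_inv_sq. }
  have A2 := cabs_le _ _ B2 Hex.
  have B3 : Cmod (CSeries (fun k => gfun (/ (tau + RtoC (INR (S k)))) + gfun (/ (tau - RtoC 1 - RtoC (INR (S k)))))%C) <= E * 8 * (PI ^ 2 / 6).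
  { apply: Rle_trans (Cmod_CSeries_le _ A2) _. rewrite -zeta2_eq /zeta2 -Series_scal_l. apply: Series_le => // k.
    split; [apply Cmod_ge_0|apply B2]. }
  rewrite /Phi (CSeries_incr_1 _ A) (_ : (tau + RtoC (INR 0) = tau)%C); last by simpl; ring.
  set Z := CSeries _ in B3 |- *. set g1 := gfun (/ (tau - _ - _))%C in B1 |- *.
  rewrite (_ : (_ - _)%C = (g1 + Z)%C); last ring.
  apply: Rle_trans (Cmod_triangle _ _) _.
  have HP2 : PI ^ 2 / 6 <= 16 / 6 by nra.
  have : E * 8 * (PI ^ 2 / 6) <= E * 8 * (16 / 6) by apply Rmult_le_compat_l; lra.
  simpl in HE |- *. lra.
Qed.

Lemma c_minus_main n : (1 <= n)%nat ->
  Rabs (IZR (c n) - Mt n) <= exp (2 * PI * sqrt (INR n)) * (10 ^ 4 * exp (PI / 2 * sqrt (INR n)) + 10 ^ 12).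
Proof.
  move=> Hn. have HPI := PI_RGT_0. have HP4 := PI_4.
  have HnR : 1 <= INR n by have := le_INR _ _ Hn; simpl; lra.
  set s := sqrt (INR n).
  have Hs2 : s * s = INR n by apply sqrt_sqrt; lra.
  have Hs : 1 <= s by rewrite -sqrt_1; apply sqrt_le_1; lra.
  set y := / s. have Hy : 0 < y <= 1 by split; [apply Rinv_0_lt_compat; lra|rewrite /y -Rinv_1; apply Rinv_le_contravar; lra].
  have Rc := rad1_c c Hc. have RM := rad1_Mt.
  set a := fun n => IZR (c n) + -1 * Mt n.
  have Ra : rad1 a.
  { move=> r Hr. apply: (ex_series_le_pos _ (fun n => Rabs (IZR (c n)) * r ^ n + Rabs (Mt n) * r ^ n)).
    - move=> k. have Hrk : 0 <= r ^ k by apply pow_le; lra. split; first by apply Rmult_le_pos => //; apply Rabs_pos.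
      rewrite -Rmult_plus_distr_r. apply Rmult_le_compat_r => //. apply: Rle_trans (Rabs_triang _ _) _.
      rewrite Rabs_mult (Rabs_left (-1)); lra.
    - apply: (ex_series_plus (fun n => Rabs (IZR (c n)) * r ^ n)); [by apply Rc|by apply RM]. }
  set B := 10 ^ 4 * exp (PI / 2 * s) + 10 ^ 12.
  have HB : 0 <= B by have := exp_pos (PI / 2 * s); rewrite /B; simpl; lra.
  have Hest : forall x, Rabs x <= / 2 -> Cmod (CPS a (nome (RtoC x + Ci * RtoC y))) <= B.
  { move=> x Hx. set tau := (RtoC x + Ci * RtoC y)%C.
    have Hre : Re tau = x by rewrite /tau /Re /=; ring. have Him : Im tau = y by rewrite /tau /Im /=; ring.
    have Ht : 0 < Im tau by lra. have Ht' := Im_inv_tau_pos _ Ht. have H0 := Im_nz_C _ Ht.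
    have Hq := nome_lt_1 tau Ht.
    have [_ [EP _]] := Phi_expansion tau Ht.
    have Hrest := Phi_rest tau Ht ltac:(by rewrite Hre).
    have Ecps : CPS a (nome tau) = (CPS (fun n => IZR (c n)) (nome tau) - CPS Mt (nome tau))%C.
    { rewrite /CPS -CSeries_minus; try by apply CPS_abs. apply: CSeries_ext => k. rewrite /a RtoC_plus RtoC_mult RtoC_m1. ring. }
    have Ej := j_series c Hc tau Ht. have Ej' := j_series c Hc _ Ht'. rewrite j_modular // Ej in Ej'.
    set q' := nome (inv_tau tau) in Ej'.
    have Eq' : (/ q')%C = Cexp (two_pi_i * / tau).
    { rewrite /q' /nome -Cexp_opp. f_equal. rewrite /inv_tau /two_pi_i. ring. }
    have E2 : CPS a (nome tau) = (CPS (fun n => IZR (c n)) q' + RtoC 1 + two_pi_i * / tau - / nome tau - (Phi tau - gfun (/ tau)))%C.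
    { rewrite Ecps -EP /gfun -Eq'.
      rewrite (_ : CPS (fun n => IZR (c n)) (nome tau) = (/ q' + CPS (fun n => IZR (c n)) q' - / nome tau)%C); last by rewrite -Ej'; ring.
      ring. }
    set Y := Im (inv_tau tau) in Ht'.
    have Hm2 : Cmod tau ^ 2 = x ^ 2 + y ^ 2 by rewrite Cmod2_alt Hre Him.
    have HY : / Y = (x ^ 2 + y ^ 2) * s.
    { rewrite /Y Im_inv_tau Him Hm2 /y. field. split; [lra|nra]. }
    have HYs : 2 * PI / Y <= PI / 2 * s + 2 * PI.
    { rewrite /Rdiv HY. move/Rabs_le_between: Hx => Hx. have Hx2 : x ^ 2 <= / 4 by nra.
      have Hys : y ^ 2 * s = y by rewrite /y; field; lra.
      have : x ^ 2 * s <= / 4 * s by apply Rmult_le_compat_r; lra.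
      move=> H1. have : (x ^ 2 + y ^ 2) * s <= / 4 * s + 1 by rewrite Rmult_plus_distr_r Hys; lra.
      move=> H2. have := Rmult_le_compat_l (2 * PI) _ _ ltac:(lra) H2. lra. }
    have K1 : Cmod (CPS (fun n => IZR (c n)) q') <= 6561 * exp (PI / 2 * s) + 2 * 10 ^ 10.
    { apply: Rle_trans (Cmod_CSeries_le _ _) _; first by apply CPS_abs => //; apply nome_lt_1.
      rewrite (Series_ext _ (fun m => IZR (c m) * exp (- (2 * PI * Y)) ^ m)); last first.
      { move=> m. rewrite Cmod_mult Cmod_pow Cmod_pos_R; last by apply c_nonneg. by rewrite /q' Cmod_nome. }
      apply: Rle_trans (csum_bound Y Ht') _. have H1 := csum_1_bound.
      have : exp (2 * PI / Y) <= exp (PI / 2 * s) * 6561.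
      { apply: (Rle_trans _ (exp (PI / 2 * s + 2 * PI))); first by apply exp_mono.
        rewrite exp_plus. apply Rmult_le_compat_l; first by apply Rlt_le, exp_pos.
        have := exp_le_3_pow 8 (2 * PI) ltac:(simpl; lra). simpl. lra. }
      lra. }
    have K2 : Cmod (two_pi_i * / tau)%C <= 4 * exp (PI / 2 * s).
    { rewrite Cmod_mult Cmod_two_pi_i Cmod_inv //.
      have H1 : y <= Cmod tau by have := Cmod_ge_Im tau Ht; rewrite Him.
      have H2 : / Cmod tau <= s by rewrite -(Rinv_inv s); apply Rinv_le_contravar; rewrite -/y; lra.
      have H3 := exp_ineq1_le (PI / 2 * s).
      have := Rmult_le_compat_l (2 * PI) _ _ ltac:(lra) H2. lra. }
    have K3 : Cmod (/ nome tau)%C <= 6561.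
    { rewrite Cmod_inv; last by apply nome_nz. rewrite Cmod_nome -exp_Ropp Ropp_involutive Him.
      have := exp_le_3_pow 8 (2 * PI * y) ltac:(simpl; nra). simpl. lra. }
    rewrite E2. set Z := (Phi tau - _)%C in Hrest |- *.
    have T1 := Cmod_triangle (CPS (fun n => IZR (c n)) q' + RtoC 1 + two_pi_i * / tau - / nome tau)%C (- Z)%C.
    have T2 := Cmod_triangle (CPS (fun n => IZR (c n)) q' + RtoC 1 + two_pi_i * / tau)%C (- / nome tau)%C.
    have T3 := Cmod_triangle (CPS (fun n => IZR (c n)) q' + RtoC 1)%C (two_pi_i * / tau)%C.
    have T4 := Cmod_triangle (CPS (fun n => IZR (c n)) q') (RtoC 1).
    rewrite Cmod_opp in T1. rewrite Cmod_opp in T2. rewrite Cmod_1 in T4.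
    rewrite /Cminus in T1 |- *. rewrite /Cminus in T2.
    have := exp_pos (PI / 2 * s). rewrite /B. simpl in Hrest, K1 |- *. lra. }
  have HF := coefficient_estimate a y B Ra (proj1 Hy) HB Hest n.
  rewrite (_ : IZR (c n) - Mt n = a n); last by rewrite /a; ring.
  apply: Rle_trans HF _. rewrite Rmult_comm. apply Rmult_le_compat_r => //. right.
  have Epow : forall x k, exp x ^ k = exp (INR k * x).
  { move=> x. elim=> [|k IH]; first by rewrite /= Rmult_0_l exp_0.
    rewrite -tech_pow_Rmult IH -exp_plus S_INR. f_equal. ring. }
  rewrite Epow. f_equal. rewrite -Hs2 /y. field. lra.
Qed.
End Bound.

(** * Quotients of Bessel functions *)

(* [Gb (z ^ 2 / 4)] is 2 I_1(z) / z. *)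
Definition bc (k : nat) : R := / (INR (fact k) * INR (fact (S k))).
Definition Gb (t : R) : R := PSeries bc t.

Lemma bc_pos k : 0 < bc k.
Proof. apply Rinv_0_lt_compat, Rmult_lt_0_compat; apply INR_fact_pos. Qed.

Lemma bc_rec k : INR (S k) * INR (S (S k)) * bc (S k) = bc k.
Proof.
  rewrite /bc. rewrite (fact_simpl (S k)) (fact_simpl k) !mult_INR.
  have := INR_fact_pos k. have := cc_pos k. have := cc_pos (S k). move=> *. field. lra.
Qed.

Lemma bc_radius : CV_radius bc = p_infty.
Proof.
  apply CV_radius_infinite_DAlembert.
  - move=> n. apply Rgt_not_eq, bc_pos.
  - apply: (is_lim_seq_le_le (fun _ => 0) _ (fun n => / INR (S n))); [|apply is_lim_seq_const|apply is_lim_inv_S].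
    move=> n. have H1 := one_le_S n. have H2 := one_le_S (S n). have H3 := bc_pos (S n).
    rewrite -(bc_rec n) (_ : bc (S n) / (INR (S n) * INR (S (S n)) * bc (S n)) = / (INR (S n) * INR (S (S n)))); last by field; lra.
    rewrite Rabs_pos_eq; last by apply Rlt_le, Rinv_0_lt_compat; nra.
    split; first by apply Rlt_le, Rinv_0_lt_compat; nra. apply Rinv_le_contravar; nra.
Qed.

Lemma PSeries_pos_R (a : nat -> R) t : CV_radius a = p_infty -> (forall k, 0 <= a k) -> 0 <= t -> a O <= PSeries a t.
Proof.
  move=> Hr Ha Ht.
  have He : ex_series (fun k => a k * t ^ k).
  { apply/ex_pseries_R. apply: CV_radius_inside. by rewrite Hr. }
  have := Series_pos_ge_term (fun k => a k * t ^ k) O (fun k => Rmult_le_pos _ _ (Ha k) (pow_le _ k Ht)) He.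
  by rewrite /PSeries /= Rmult_1_r.
Qed.

Definition G1 (t : R) : R := PSeries (PS_derive bc) t.
Definition G2 (t : R) : R := PSeries (PS_derive (PS_derive bc)) t.

Lemma is_derive_Gb t : is_derive Gb t (G1 t).
Proof. apply is_derive_PSeries. by rewrite bc_radius. Qed.

Lemma is_derive_G1 t : is_derive G1 t (G2 t).
Proof. apply is_derive_PSeries. by rewrite CV_radius_derive bc_radius. Qed.

Lemma Gb_ode t : t * G2 t + 2 * G1 t = Gb t.
Proof.
  have Hr : forall a x, CV_radius a = p_infty -> ex_pseries a x.
  { move=> a x H. apply: CV_radius_inside. by rewrite H. }
  have R1 : CV_radius (PS_derive bc) = p_infty by rewrite CV_radius_derive bc_radius.
  have R2 : CV_radius (PS_derive (PS_derive bc)) = p_infty by rewrite CV_radius_derive R1.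
  rewrite /Gb /G1 /G2 -PSeries_incr_1 -PSeries_scal -PSeries_plus.
  - apply: PSeries_ext => k. transitivity (INR (S k) * INR (S (S k)) * bc (S k)); last by apply bc_rec.
    case: k => [|k].
    + change (0 + 2 * (INR 1 * bc 1) = INR 1 * INR 2 * bc 1). rewrite (_ : INR 2 = 2) //. ring.
    + change (INR (S k) * (INR (S (S k)) * bc (S (S k))) + 2 * (INR (S (S k)) * bc (S (S k))) = INR (S (S k)) * INR (S (S (S k))) * bc (S (S k))).
      rewrite (S_INR (S (S k))) (S_INR (S k)). ring.
  - by apply ex_pseries_incr_1, Hr.
  - apply ex_pseries_scal; first by apply Rmult_comm. by apply Hr.
Qed.

Definition gz (z : R) : R := Gb (z ^ 2 / 4).

Lemma gz_ge_1 z : 1 <= gz z.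
Proof.
  have := PSeries_pos_R bc (z ^ 2 / 4) bc_radius (fun k => Rlt_le _ _ (bc_pos k)) ltac:(have := pow2_ge_0 z; lra).
  rewrite /gz /Gb {1}/bc /= Rmult_1_r Rinv_1. done.
Qed.

Lemma G1_pos t : 0 <= t -> 0 <= G1 t.
Proof.
  move=> Ht.
  have := PSeries_pos_R (PS_derive bc) t ltac:(by rewrite CV_radius_derive bc_radius) (fun k => Rmult_le_pos _ _ (pos_INR _) (Rlt_le _ _ (bc_pos _))) Ht.
  have := bc_pos 1. change (PS_derive bc 0) with (1 * bc 1). rewrite /G1. lra.
Qed.

(* Truncated asymptotic expansion of 2 I_1(z) / z = C e^z z^(-3/2) (1 - 3/(8 z) - ...); replacing the coefficient [q6] of z^(-6) by [b] makes it a sub- or supersolution of the Bessel equation. *)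
Definition q4 : R := - (4725 / 32768).
Definition q5 : R := - (72765 / 262144).
Definition q6 : R := - (2837835 / 4194304).
Definition Qb (b z : R) : R :=
  1 - (3 / 8) / z - (15 / 128) / z ^ 2 - (105 / 1024) / z ^ 3 + q4 / z ^ 4 + q5 / z ^ 5 + b / z ^ 6.
Definition Qb' (b z : R) : R :=
  (3 / 8) / z ^ 2 + (15 / 64) / z ^ 3 + (315 / 1024) / z ^ 4 - 4 * q4 / z ^ 5 - 5 * q5 / z ^ 6 - 6 * b / z ^ 7.
Definition Eb (z : R) : R := exp (z - 3 / 2 * ln z).
Definition gb (b z : R) : R := Eb z * Qb b z.
Definition Db (b z : R) : R := Qb b z * (1 - 3 / (2 * z)) + Qb' b z.
Definition rb (b z : R) : R := (12 * (q6 - b)) / z ^ 7 + (165 / 4 * b) / z ^ 8.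

Lemma is_derive_Eb z : 0 < z -> is_derive Eb z (Eb z * (1 - 3 / (2 * z))).
Proof. move=> Hz. rewrite /Eb. auto_derive => //. rewrite (_ : z + - (3 / 2 * ln z) = z - 3 / 2 * ln z) //. field. lra. Qed.

Lemma is_derive_gb b z : 0 < z -> is_derive (gb b) z (Eb z * Db b z).
Proof.
  move=> Hz.
  have H2 : is_derive (Qb b) z (Qb' b z).
  { rewrite /Qb /Qb'. auto_derive; first by repeat split; try apply Rmult_integral_contrapositive_currified; lra || (repeat apply Rmult_integral_contrapositive_currified; lra). field. lra. }
  have H := is_derive_mult Eb (Qb b) z _ _ (is_derive_Eb z Hz) H2 Rmult_comm.
  apply: (eq_ind _ (fun l => is_derive (gb b) z l) H). rewrite /plus /mult /Db /=. Rring.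
Qed.

Definition Kb (b z : R) : R := z ^ 3 * (Eb z * Db b z).

Lemma is_derive_Kb b z : 0 < z -> is_derive (Kb b) z (z ^ 3 * (gb b z + Eb z * rb b z)).
Proof.
  move=> Hz.
  have H2 : is_derive (fun z => z ^ 3 * Db b z) z (z ^ 3 * (Qb b z + rb b z) - z ^ 3 * Db b z * (1 - 3 / (2 * z))).
  { rewrite /Db /Qb /Qb'. auto_derive; first by repeat split; try apply Rmult_integral_contrapositive_currified; lra || (repeat apply Rmult_integral_contrapositive_currified; lra).
    rewrite /rb /q4 /q5 /q6. field. lra. }
  have H := is_derive_mult Eb (fun z => z ^ 3 * Db b z) z _ _ (is_derive_Eb z Hz) H2 Rmult_comm.
  apply: (is_derive_ext (fun z => mult (Eb z) (z ^ 3 * Db b z))); first by move=> t; rewrite /Kb /mult /=; Rring.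
  apply: (eq_ind _ (fun l => is_derive _ z l) H). rewrite /plus /mult /gb /=. Rring.
Qed.

Definition Hz3 (z : R) : R := z ^ 4 / 2 * G1 (z ^ 2 / 4).

Lemma is_derive_gz z : is_derive gz z (z / 2 * G1 (z ^ 2 / 4)).
Proof.
  have H : is_derive (fun z => z ^ 2 / 4) z (z / 2) by auto_derive => //; field.
  exact (is_derive_comp Gb (fun z => z ^ 2 / 4) z _ _ (is_derive_Gb _) H).
Qed.

Lemma is_derive_Hz3 z : is_derive Hz3 z (z ^ 3 * gz z).
Proof.
  have H : is_derive (fun z => z ^ 2 / 4) z (z / 2) by auto_derive => //; field.
  have H1 := is_derive_comp G1 (fun z => z ^ 2 / 4) z _ _ (is_derive_G1 _) H.
  have H2 : is_derive (fun z => z ^ 4 / 2) z (2 * z ^ 3) by auto_derive => //; field.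
  have H3 := is_derive_mult _ _ z _ _ H2 H1 Rmult_comm.
  apply: (eq_ind _ (fun l => is_derive Hz3 z l) H3). rewrite /gz -Gb_ode /plus /mult /scal /= /mult /=.
  match goal with |- @eq _ ?a ?b => change (@eq R a b) end. field.
Qed.

Definition Vb (b z : R) : R := Hz3 z * gb b z - gz z * Kb b z.

Lemma is_derive_Vb b z : 0 < z -> is_derive (Vb b) z (- (z ^ 3 * gz z * (Eb z * rb b z))).
Proof.
  move=> Hz.
  have A := is_derive_mult _ _ z _ _ (is_derive_Hz3 z) (is_derive_gb b z Hz) Rmult_comm.
  have B := is_derive_mult _ _ z _ _ (is_derive_gz z) (is_derive_Kb b z Hz) Rmult_comm.
  have C := is_derive_minus _ _ z _ _ A B.
  apply: (eq_ind _ (fun l => is_derive (Vb b) z l) C). rewrite /minus /plus /opp /mult /Hz3 /Kb /=.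
  match goal with |- @eq _ ?a ?b => change (@eq R a b) end. field.
Qed.

Lemma derive_le (f f' : R -> R) a b : a <= b -> (forall x, a <= x <= b -> is_derive f x (f' x)) ->
  (forall x, a <= x <= b -> f' x <= 0) -> f b <= f a.
Proof.
  move=> Hab Hd Hn.
  have [x [Hx E]] := MVT_gen f a b f'
    ltac:(rewrite Rmin_left // Rmax_right // => x Hx; apply Hd; lra)
    ltac:(rewrite Rmin_left // Rmax_right // => x Hx; apply/continuity_pt_filterlim; apply: (ex_derive_continuous f); exists (f' x); by apply Hd).
  rewrite Rmin_left // Rmax_right // in Hx. have := Hn x Hx. nra.
Qed.

Lemma ratio_derive b z : 0 < z -> gb b z <> 0 ->
  is_derive (fun z => gz z / gb b z) z (Vb b z / (z ^ 3 * gb b z ^ 2)).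
Proof.
  move=> Hz Hn. have H := is_derive_div gz (gb b) z _ _ (is_derive_gz z) (is_derive_gb b z Hz) Hn.
  apply: (eq_ind _ (fun l => is_derive _ z l) H). rewrite /Vb /Hz3 /Kb. match goal with |- @eq _ ?a ?b => change (@eq R a b) end. field. split => //. lra.
Qed.

Lemma Eb_pos z : 0 < Eb z.
Proof. apply exp_pos. Qed.

Lemma Vb_anti b z1 z : 0 < z1 -> z1 <= z -> (forall x, z1 <= x -> 0 <= rb b x) -> Vb b z <= Vb b z1.
Proof.
  move=> H1 H Hr. apply: (derive_le (Vb b) (fun z => - (z ^ 3 * gz z * (Eb z * rb b z)))) => // x Hx.
  - apply is_derive_Vb. lra.
  - have := gz_ge_1 x. have := Eb_pos x. have := Hr x ltac:(lra). have Hx3 : 0 < x ^ 3 by apply pow_lt; lra.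
    move=> A B C. have : 0 <= x ^ 3 * gz x * (Eb x * rb b x) by repeat apply Rmult_le_pos; lra. lra.
Qed.

Lemma Vb_mono b z1 z : 0 < z1 -> z1 <= z -> (forall x, z1 <= x -> rb b x <= 0) -> Vb b z1 <= Vb b z.
Proof.
  move=> H1 H Hr.
  have : - Vb b z <= - Vb b z1; last lra.
  apply: (derive_le (fun z => - Vb b z) (fun z => - - (z ^ 3 * gz z * (Eb z * rb b z)))) => // x Hx.
  - apply: (is_derive_opp (Vb b)). apply is_derive_Vb. lra.
  - have := gz_ge_1 x. have := Eb_pos x. have := Hr x ltac:(lra). have Hx3 : 0 < x ^ 3 by apply pow_lt; lra.
    move=> A B C. have : 0 <= x ^ 3 * gz x * (Eb x * - rb b x) by repeat apply Rmult_le_pos; lra. lra.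
Qed.

(* Chosen so that [Qb bU] vanishes at 4, which gives the Wronskian [Vb] its sign at the left end. *)
Definition bU : R := - (4096 * (1 - 3 / 8 / 4 - 15 / 128 / 16 - 105 / 1024 / 64 + q4 / 256 + q5 / 1024)).
Definition bL : R := 4096.

Lemma Qb_shift b z : 4 <= z -> Qb b z - b / z ^ 6 >= Qb b 4 - b / 4096 /\ Qb b z - b / z ^ 6 <= 1.
Proof.
  move=> Hz. have Hi : 0 < / z <= / 4 by split; [apply Rinv_0_lt_compat; lra|apply Rinv_le_contravar; lra].
  have Hp : forall k, 0 <= / z ^ k <= / 4 ^ k.
  { move=> k. rewrite -!pow_inv. split; [apply pow_le; lra|apply pow_incr; lra]. }
  have := Hp 2%nat. have := Hp 3%nat. have := Hp 4%nat. have := Hp 5%nat. rewrite /Qb /q4 /q5 /Rdiv.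
  simpl. lra.
Qed.

Lemma Eb_Qb_zero : Qb bU 4 = 0.
Proof. rewrite /Qb /bU /q4 /q5. field. Qed.

Lemma rbU_nonneg x : 4 <= x -> 0 <= rb bU x.
Proof.
  move=> Hx. have Hx8 : 0 < / x ^ 8 by apply Rinv_0_lt_compat, pow_lt; lra.
  rewrite (_ : rb bU x = (12 * (q6 - bU) * x + 165 / 4 * bU) * / x ^ 8); last by rewrite /rb; field; lra.
  apply Rmult_le_pos; last lra. rewrite /bU /q4 /q5 /q6. lra.
Qed.

Lemma rbL_nonpos x : 4 <= x -> rb bL x <= 0.
Proof.
  move=> Hx. have Hx8 : 0 < / x ^ 8 by apply Rinv_0_lt_compat, pow_lt; lra.
  rewrite (_ : rb bL x = - ((12 * (bL - q6) * x - 165 / 4 * bL) * / x ^ 8)); last by rewrite /rb; field; lra.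
  have : 0 <= (12 * (bL - q6) * x - 165 / 4 * bL) * / x ^ 8 by apply Rmult_le_pos; [rewrite /bL /q6; lra|lra]. lra.
Qed.

Lemma QbU_pos z : 4 < z -> 0 < Qb bU z.
Proof.
  move=> Hz. have [H _] := Qb_shift bU z ltac:(lra). rewrite Eb_Qb_zero in H.
  have Hb : bU < 0 by rewrite /bU /q4 /q5; lra.
  have H6 : / z ^ 6 < / 4096.
  { apply Rinv_lt_contravar; first by apply Rmult_lt_0_compat; [lra|apply pow_lt; lra].
    rewrite (_ : 4096 = 4 ^ 6); last ring. simpl; have : 16 < z * z by nra. move=> H16. have : 256 < (z * z) * (z * z) by nra. move=> H256. rewrite !Rmult_1_r (_ : z * (z * (z * (z * (z * z)))) = (z * z) * ((z * z) * (z * z))); last ring. nra. }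
  rewrite /Rdiv in H |- *. nra.
Qed.

Lemma QbL_bounds z : 4 <= z -> 8 / 10 <= Qb bL z <= 2.
Proof.
  move=> Hz. have [H1 H2] := Qb_shift bL z Hz.
  have H4 : Qb bL 4 - bL / 4096 >= 8 / 10 by rewrite /Qb /bL /q4 /q5; lra.
  have H6 : 0 <= / z ^ 6 <= / 4096.
  { split; first by apply Rlt_le, Rinv_0_lt_compat, pow_lt; lra.
    rewrite (_ : 4096 = 4 ^ 6); last ring. apply Rinv_le_contravar; first by apply pow_lt; lra. apply pow_incr; lra. }
  rewrite /bL /Rdiv in H1 H2 H4 |- *. lra.
Qed.

Lemma gz_ratio_upper z z' : 4 < z -> z <= z' -> gz z' / gz z <= gb bU z' / gb bU z.
Proof.
  move=> Hz Hzz.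
  have Hp : forall x, 4 < x -> 0 < gb bU x by move=> x Hx; apply Rmult_lt_0_compat; [apply Eb_pos|by apply QbU_pos].
  have HV4 : Vb bU 4 <= 0.
  { rewrite /Vb {1}/gb Eb_Qb_zero /Kb /Db Eb_Qb_zero. have H1 := gz_ge_1 4. have H2 := Eb_pos 4.
    have H3 : 0 <= Qb' bU 4 by rewrite /Qb' /bU /q4 /q5; lra.
    have : 0 <= gz 4 * (Eb 4 * Qb' bU 4) by repeat apply Rmult_le_pos; lra. lra. }
  have H : gz z' / gb bU z' <= gz z / gb bU z.
  { apply: (derive_le (fun z => gz z / gb bU z) (fun z => Vb bU z / (z ^ 3 * gb bU z ^ 2))) => // x Hx.
    - apply ratio_derive; [lra|]. have := Hp x ltac:(lra). lra.
    - have HV := Vb_anti bU 4 x ltac:(lra) ltac:(lra) rbU_nonneg. have Hg := Hp x ltac:(lra).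
      have : 0 < / (x ^ 3 * gb bU x ^ 2) by apply Rinv_0_lt_compat, Rmult_lt_0_compat; apply pow_lt; lra.
      rewrite /Rdiv. nra. }
  have P1 := Hp z Hz. have P2 := Hp z' ltac:(lra). have P3 := gz_ge_1 z.
  apply (Rmult_le_reg_r (gz z / gb bU z')); first by apply Rdiv_lt_0_compat; lra.
  rewrite (_ : gz z' / gz z * (gz z / gb bU z') = gz z' / gb bU z'); last by field; lra.
  rewrite (_ : gb bU z' / gb bU z * (gz z / gb bU z') = gz z / gb bU z) //. field. lra.
Qed.

Lemma gbL_pos x : 4 <= x -> 0 < gb bL x.
Proof. move=> Hx. apply Rmult_lt_0_compat; [apply Eb_pos|]. have := QbL_bounds x Hx. lra. Qed.

Lemma gz_gbL_mono z z' : 4 <= z -> z <= z' -> gz z / gb bL z <= gz z' / gb bL z'.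
Proof.
  move=> Hz Hzz.
  have HV4 : 0 <= Vb bL 4.
  { rewrite /Vb. have H1 := gz_ge_1 4. have H2 := Eb_pos 4. have H3 := gbL_pos 4 ltac:(lra).
    have H4 : Db bL 4 <= 0 by rewrite /Db /Qb /Qb' /bL /q4 /q5; lra.
    have H5 : 0 <= Hz3 4 by rewrite /Hz3; have := G1_pos (4 ^ 2 / 4) ltac:(lra); lra.
    have : 0 <= Hz3 4 * gb bL 4 by apply Rmult_le_pos; lra.
    have : 0 <= gz 4 * (4 ^ 3 * (Eb 4 * - Db bL 4)) by repeat apply Rmult_le_pos; lra.
    rewrite /Kb. lra. }
  have : - (gz z' / gb bL z') <= - (gz z / gb bL z); last lra.
  apply: (derive_le (fun z => - (gz z / gb bL z)) (fun z => - (Vb bL z / (z ^ 3 * gb bL z ^ 2)))) => // x Hx.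
  - apply: (is_derive_opp (fun z => gz z / gb bL z)). apply ratio_derive; [lra|]. have := gbL_pos x ltac:(lra). lra.
  - have HV := Vb_mono bL 4 x ltac:(lra) ltac:(lra) rbL_nonpos. have Hg := gbL_pos x ltac:(lra).
    have : 0 < / (x ^ 3 * gb bL x ^ 2) by apply Rinv_0_lt_compat, Rmult_lt_0_compat; apply pow_lt; lra.
    rewrite /Rdiv. nra.
Qed.

Lemma gz_ratio_lower z z' : 4 <= z -> z <= z' -> gb bL z' / gb bL z <= gz z' / gz z.
Proof.
  move=> Hz Hzz. have H := gz_gbL_mono z z' Hz Hzz.
  have P1 := gbL_pos z Hz. have P2 := gbL_pos z' ltac:(lra). have P3 := gz_ge_1 z.
  apply (Rmult_le_reg_r (gz z / gb bL z')); first by apply Rdiv_lt_0_compat; lra.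
  rewrite (_ : gz z' / gz z * (gz z / gb bL z') = gz z' / gb bL z'); last by field; lra.
  rewrite (_ : gb bL z' / gb bL z * (gz z / gb bL z') = gz z / gb bL z) //. field. lra.
Qed.

Lemma gz_lower_bound z : 4 <= z -> Eb z / 210 <= gz z.
Proof.
  move=> Hz. have H := gz_gbL_mono 4 z ltac:(lra) Hz. have P1 := gbL_pos z Hz. have P0 := gbL_pos 4 ltac:(lra).
  have HQ := QbL_bounds z Hz. have HQ4 := QbL_bounds 4 ltac:(lra). have HE := Eb_pos z.
  have HE4 : Eb 4 <= 81.
  { rewrite /Eb. have Hl : 0 <= ln 4 by rewrite -ln_1; apply ln_le; lra.
    have := exp_le_3_pow 4 (4 - 3 / 2 * ln 4) ltac:(simpl; lra). simpl. lra. }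
  have Hg4 : gb bL 4 <= 162 by rewrite /gb; have := Eb_pos 4; nra.
  have H1 := gz_ge_1 4.
  have H2 : / 162 <= gz 4 / gb bL 4.
  { apply: (Rle_trans _ (/ gb bL 4)); first by apply Rinv_le_contravar.
    rewrite -{1}(Rmult_1_l (/ gb bL 4)). apply Rmult_le_compat_r => //. by apply Rlt_le, Rinv_0_lt_compat. }
  have H3 : / 162 * gb bL z <= gz z.
  { have := Rmult_le_compat_r _ _ _ (Rlt_le _ _ P1) (Rle_trans _ _ _ H2 H).
    by rewrite (_ : gz z / gb bL z * gb bL z = gz z); last by field; lra. }
  rewrite /gb in H3. have : / 162 * (Eb z * (8 / 10)) <= / 162 * (Eb z * Qb bL z).
  { apply Rmult_le_compat_l; first lra. apply Rmult_le_compat_l; lra. }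
  lra.
Qed.

Lemma Mt_gz n : (1 <= n)%nat -> Mt n + 4 * PI ^ 2 = 4 * PI ^ 2 * gz (4 * PI * sqrt (INR n)).
Proof.
  move=> Hn. have HnR := pos_INR n.
  have E : (4 * PI * sqrt (INR n)) ^ 2 / 4 = 4 * PI ^ 2 * INR n.
  { rewrite !Rpow_mult_distr pow2_sqrt //. field. }
  rewrite /gz E /Gb /PSeries.
  have Hex : ex_series (fun k => bc k * (4 * PI ^ 2 * INR n) ^ k).
  { apply/ex_pseries_R. apply: CV_radius_inside. by rewrite bc_radius. }
  rewrite Series_incr_1 // /bc Rmult_plus_distr_l -Series_scal_l Rplus_comm. f_equal.
  - simpl. rewrite !Rmult_1_r Rinv_1. ring.
  - apply: Series_ext => m. rewrite /mterm (Rpow_mult_distr (4 * PI ^ 2) (INR n)) (_ : (m + 2)%nat = S (S m)); last lia.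
    rewrite -!(tech_pow_Rmult (4 * PI ^ 2)).
    have := INR_fact_pos (S m). have := INR_fact_pos (S (S m)). move=> *. field. lra.
Qed.

(** * Checking polynomial inequalities by computation *)

(* The same polynomial program is run over the reals, over intervals and over Q[PI]. *)
Record ops (A : Type) := Ops { o_add : A -> A -> A; o_mul : A -> A -> A; o_cst : Z -> positive -> A; o_pi : A }.
Arguments o_add {A}. Arguments o_mul {A}. Arguments o_cst {A}. Arguments o_pi {A}.

Section Prog.
Context {A : Type} (Op : ops A) (T : list A -> list A).

Fixpoint padd (a b : list A) : list A :=
  match a, b with
  | nil, _ => b
  | _, nil => a
  | cons x a', cons y b' => cons (o_add Op x y) (padd a' b')
  end.
Definition pscal (c : A) (l : list A) : list A := map (o_mul Op c) l.
Fixpoint pmul (a b : list A) : list A :=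
  match a with
  | nil => nil
  | cons x a' => T (padd (pscal x b) (cons (o_cst Op 0 1) (pmul a' b)))
  end.
Fixpoint pcomp (cs P : list A) : list A :=
  match cs with nil => nil | cons c cs' => padd (cons c nil) (pmul P (pcomp cs' P)) end.
Fixpoint phexp (e : A) (k : positive) (m : nat) (X : list A) : list A :=
  match m with
  | O => cons e nil
  | S m' => padd (cons (o_cst Op 1 1) nil) (pscal (o_cst Op 1 k) (pmul X (phexp e (Pos.succ k) m' X)))
  end.

Definition rat (p : Z * positive) : A := o_cst Op (fst p) (snd p).
Fixpoint ppi (l : list (Z * positive)) : A :=
  match l with nil => o_cst Op 0 1 | cons c l' => o_add Op (rat c) (o_mul Op (o_pi Op) (ppi l')) end.
End Prog.

Definition Rops : ops R := Ops R Rplus Rmult (fun n d => IZR n / IZR (Zpos d)) PI.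
(* (a, b) stands for the interval [a / 2^64, b / 2^64]. *)
Definition ibits : Z := 64.
Definition imul (x y : Z * Z) : Z * Z :=
  let p1 := (fst x * fst y)%Z in let p2 := (fst x * snd y)%Z in
  let p3 := (snd x * fst y)%Z in let p4 := (snd x * snd y)%Z in
  (Z.shiftr (Z.min (Z.min p1 p2) (Z.min p3 p4)) ibits,
   (Z.shiftr (Z.max (Z.max p1 p2) (Z.max p3 p4)) ibits + 1)%Z).
Definition icst (n : Z) (d : positive) : Z * Z :=
  let q := (Z.shiftl n ibits / Zpos d)%Z in (q, (q + 1)%Z).
Definition pi_lo : Z := 57952155664616982738%Z.
Definition pi_hi : Z := (pi_lo + 3)%Z.
Definition Iops : ops (Z * Z) :=
  Ops (Z * Z) (fun x y => (fst x + fst y, snd x + snd y)%Z) imul icst (pi_lo, pi_hi).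

Definition icontains (x : Z * Z) (r : R) : Prop := IZR (fst x) <= r * 2 ^ 64 <= IZR (snd x).

(* A list of rationals stands for a polynomial in PI. *)
Fixpoint qadd (a b : list Q) : list Q :=
  match a, b with
  | nil, _ => b
  | _, nil => a
  | cons x a', cons y b' => cons (Qred (x + y)) (qadd a' b')
  end.
Fixpoint qmul (a b : list Q) : list Q :=
  match a with nil => nil | cons x a' => qadd (map (fun y => Qred (x * y)) b) (cons (0#1)%Q (qmul a' b)) end.
Fixpoint qeval (l : list Q) : R := match l with nil => 0 | cons x l' => Q2R x + PI * qeval l' end.
Definition Qops : ops (list Q) := Ops (list Q) qadd qmul (fun n d => cons (Qred (Qmake n d)) nil) (cons (0#1)%Q (cons (1#1)%Q nil)).
Definition qrel (l : list Q) (r : R) : Prop := r = qeval l.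

(* [Some k] compares the first [k] coefficients only. *)
Definition dec (o : option nat) : option nat := match o with Some (S k) => Some k | _ => o end.
Fixpoint lrel {A} (rel : A -> R -> Prop) (o : option nat) (a : list A) (r : list R) : Prop :=
  match o with
  | Some O => True
  | _ => match a, r with
         | nil, nil => True
         | cons x a', cons y r' => rel x y /\ lrel rel (dec o) a' r'
         | _, _ => False
         end
  end.

Section Relation.
Context {A : Type} (Op : ops A) (T : list A -> list A) (T' : list R -> list R) (rel : A -> R -> Prop) (ok : option nat -> Prop).
Hypothesis rel_add : forall x y r s, rel x r -> rel y s -> rel (o_add Op x y) (r + s).
Hypothesis rel_mul : forall x y r s, rel x r -> rel y s -> rel (o_mul Op x y) (r * s).
Hypothesis rel_cst : forall n d, rel (o_cst Op n d) (IZR n / IZR (Zpos d)).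
Hypothesis rel_pi : rel (o_pi Op) PI.
Hypothesis ok_dec : forall o, ok o -> ok (dec o).
Hypothesis relT : forall o l r, ok o -> lrel rel o l r -> lrel rel o (T l) (T' r).

Lemma lrel_0 a r : lrel rel (Some O) a r.
Proof. by case: a. Qed.

Lemma lrel_nil o : lrel rel o nil nil.
Proof. by case: o => [[|k]|]. Qed.

Lemma lrel_cons o x a y r : rel x y -> lrel rel (dec o) a r -> lrel rel o (cons x a) (cons y r).
Proof. by case: o => [[|k]|]. Qed.

Lemma lrel_dec a : forall o r, lrel rel o a r -> lrel rel (dec o) a r.
Proof.
  elim: a => [|x a IH] [[|[|k]]|] [|y r] //= [H1 H2]; split => //. by apply (IH (Some (S k))).
Qed.

Lemma lrel_padd a : forall o b r s, lrel rel o a r -> lrel rel o b s -> lrel rel o (padd Op a b) (padd Rops r s).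
Proof.
  elim: a => [|x a IH] o b r s; case: o => [[|k]|]; try (by move=> *; apply lrel_0); case: r => [|u r] // [H1 H2];
  case: b => [|y b]; case: s => [|v s] //= [H3 H4]; split; try (by apply rel_add); by apply IH.
Qed.

Lemma lrel_pscal c d : rel c d -> forall a o r, lrel rel o a r -> lrel rel o (pscal Op c a) (pscal Rops d r).
Proof.
  move=> Hc. elim=> [|x a IH] [[|k]|] [|u r] //= [H1 H2]; (split; [by apply rel_mul|by apply IH]).
Qed.

Lemma lrel_pmul a : forall o b r s, ok o -> lrel rel o a r -> lrel rel o b s -> lrel rel o (pmul Op T a b) (pmul Rops T' r s).
Proof.
  elim: a => [|x a IH] o b r s Ho Ha Hb.
  - case: o Ho Ha {Hb} => [[|k]|] Ho; try (by move=> *; apply lrel_0); by case: r.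
  - have [->|[u [r' [Er [H1 H2]]]]] : o = Some O \/ exists u r', r = cons u r' /\ rel x u /\ lrel rel (dec o) a r'.
    { case: o Ha {Ho Hb} => [[|k]|]; try (by left); case: r => [|u r'] // H; right; by exists u, r'. }
    + by apply lrel_0.
    + rewrite Er.
      change (lrel rel o (T (padd Op (pscal Op x b) (cons (o_cst Op 0 1) (pmul Op T a b)))) (T' (padd Rops (pscal Rops u s) (cons (o_cst Rops 0 1) (pmul Rops T' r' s))))).
      apply relT => //. apply lrel_padd; first by apply lrel_pscal.
      apply lrel_cons; first by apply rel_cst. apply IH => //; [by apply ok_dec|by apply lrel_dec].
Qed.

Lemma lrel_pcomp o cs P ds S : ok o -> lrel rel o P S -> Forall2 rel cs ds -> lrel rel o (pcomp Op T cs P) (pcomp Rops T' ds S).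
Proof.
  move=> Ho HP H. elim: H => [|c d cs' ds' H1 H2 IH]; first by apply lrel_nil.
  change (lrel rel o (padd Op (cons c nil) (pmul Op T P (pcomp Op T cs' P))) (padd Rops (cons d nil) (pmul Rops T' S (pcomp Rops T' ds' S)))).
  apply lrel_padd; first by apply lrel_cons => //; apply lrel_nil.
  by apply lrel_pmul.
Qed.

Lemma lrel_phexp o e d : rel e d -> forall m p X S, ok o -> lrel rel o X S -> lrel rel o (phexp Op T e p m X) (phexp Rops T' d p m S).
Proof.
  move=> He. elim=> [|m IH] p X S Ho HX; first by apply lrel_cons => //; apply lrel_nil.
  change (lrel rel o (padd Op (cons (o_cst Op 1 1) nil) (pscal Op (o_cst Op 1 p) (pmul Op T X (phexp Op T e (Pos.succ p) m X)))) (padd Rops (cons (o_cst Rops 1 1) nil) (pscal Rops (o_cst Rops 1 p) (pmul Rops T' S (phexp Rops T' d (Pos.succ p) m S))))).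
  apply lrel_padd; first by apply lrel_cons; [apply rel_cst|apply lrel_nil].
  apply lrel_pscal; first by apply rel_cst. apply lrel_pmul => //. by apply IH.
Qed.

Lemma rel_rat p : rel (rat Op p) (rat Rops p).
Proof. apply rel_cst. Qed.

Lemma rel_ppi l : rel (ppi Op l) (ppi Rops l).
Proof.
  elim: l => [|c l IH] /=; first by apply rel_cst.
  apply rel_add; first by apply rel_rat. by apply rel_mul.
Qed.

Lemma rel_map_rat l : Forall2 rel (map (rat Op) l) (map (rat Rops) l).
Proof. elim: l => [|c l IH]; constructor => //. apply rel_rat. Qed.

Lemma lrel_map_ppi l : forall o, lrel rel o (map (ppi Op) l) (map (ppi Rops) l).
Proof. elim: l => [|c l IH] o; [by apply lrel_nil|apply lrel_cons => //; apply rel_ppi]. Qed.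
End Relation.

Fixpoint peval (l : list R) (x : R) : R := match l with nil => 0 | cons c l' => c + x * peval l' x end.

Lemma peval_padd a : forall b x, peval (padd Rops a b) x = peval a x + peval b x.
Proof.
  elim: a => [|c a IH] [|d b] x /=; try ring. rewrite IH. ring.
Qed.

Lemma peval_pscal c a x : peval (pscal Rops c a) x = c * peval a x.
Proof. elim: a => [|d a IH] /=; first ring. rewrite IH. ring. Qed.

Section Eval.
Variables (T : list R -> list R) (x : R).
Hypothesis HT : forall l, peval (T l) x = peval l x.

Lemma peval_pmul a b : peval (pmul Rops T a b) x = peval a x * peval b x.
Proof.
  elim: a => [|c a IH]; first by rewrite /=; ring.
  change (peval (T (padd Rops (pscal Rops c b) (cons (o_cst Rops 0 1) (pmul Rops T a b)))) x = peval (cons c a) x * peval b x).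
  rewrite HT peval_padd peval_pscal /= IH. field.
Qed.

Lemma peval_pcomp cs P : peval (pcomp Rops T cs P) x = peval cs (peval P x).
Proof.
  elim: cs => [|c cs IH] //.
  change (peval (padd Rops (cons c nil) (pmul Rops T P (pcomp Rops T cs P))) x = c + peval P x * peval cs (peval P x)).
  rewrite peval_padd peval_pmul IH /=. ring.
Qed.

Fixpoint Rh (e : R) (k : positive) (m : nat) (X : R) : R :=
  match m with O => e | S m' => 1 + / IZR (Zpos k) * (X * Rh e (Pos.succ k) m' X) end.

Lemma peval_phexp e m : forall k X, peval (phexp Rops T e k m X) x = Rh e k m (peval X x).
Proof.
  elim: m => [|m IH] k X; first by simpl; ring.
  change (peval (padd Rops (cons (o_cst Rops 1 1) nil) (pscal Rops (o_cst Rops 1 k) (pmul Rops T X (phexp Rops T e (Pos.succ k) m X)))) x = 1 + / IZR (Zpos k) * (peval X x * Rh e (Pos.succ k) m (peval X x))).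
  rewrite peval_padd peval_pscal peval_pmul IH /= /Rdiv Rinv_1 !Rmult_1_l !Rmult_0_r. ring.
Qed.
End Eval.

Lemma Rh_sum e X m : forall k, X ^ k / INR (fact k) * Rh e (Pos.of_succ_nat k) m X =
  rsum (fun j => X ^ (k + j) / INR (fact (k + j))) m + e * (X ^ (k + m) / INR (fact (k + m))).
Proof.
  elim: m => [|m IH] k /=; first by rewrite Nat.add_0_r; ring.
  have E : forall n, rsum (fun j => X ^ (k + j) / INR (fact (k + j))) (S n) = X ^ k / INR (fact k) + rsum (fun j => X ^ (S k + j) / INR (fact (S k + j))) n.
  { elim=> [|n IHn]; first by rewrite /= Nat.add_0_r; ring.
    change (rsum (fun j => X ^ (k + j) / INR (fact (k + j))) (S n) + X ^ (k + S n) / INR (fact (k + S n)) = X ^ k / INR (fact k) + (rsum (fun j => X ^ (S k + j) / INR (fact (S k + j))) n + X ^ (S k + n) / INR (fact (S k + n)))).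
    rewrite IHn (_ : (k + S n = S k + n)%nat); [ring|lia]. }
  change (X ^ k / INR (fact k) * (1 + / IZR (Zpos (Pos.of_succ_nat k)) * (X * Rh e (Pos.of_succ_nat (S k)) m X)) = rsum (fun j => X ^ (k + j) / INR (fact (k + j))) (S m) + e * (X ^ (k + S m) / INR (fact (k + S m)))).
  rewrite E (_ : (k + S m = S k + m)%nat); last lia.
  rewrite Rplus_assoc -IH.
  have -> : IZR (Zpos (Pos.of_succ_nat k)) = INR (S k) by rewrite INR_IZR_INZ; f_equal; lia.
  rewrite fact_simpl mult_INR -tech_pow_Rmult. field.
  have := cc_pos k. have := INR_fact_pos k. lra.
Qed.

Lemma exp_Rh X m : 0 <= X <= 1 -> Rh 1 1 m X <= exp X <= Rh 3 1 m X.
Proof.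
  move=> HX. case: m => [|m].
  - simpl. have H1 := exp_ineq1_le X. have := exp_le_3_pow 1 X ltac:(simpl; lra). simpl. lra.
  - have Hs := exp_is_series X. have Hex := ex_intro (is_series _) _ Hs.
    have Hpos : forall k, 0 <= X ^ k / INR (fact k).
    { move=> k. apply Rmult_le_pos; [apply pow_le; lra|apply Rlt_le, Rinv_0_lt_compat, INR_fact_pos]. }
    have Hsplit := Series_incr_n (fun k => X ^ k / INR (fact k)) (S m) (Nat.lt_0_succ _) Hex.
    rewrite (is_series_unique _ _ Hs) in Hsplit. simpl pred in Hsplit.
    set tl := Series _ in Hsplit.
    have Htex : ex_series (fun k => X ^ (S m + k) / INR (fact (S m + k))) by exact (proj1 (ex_series_incr_n (fun k => X ^ k / INR (fact k)) (S m)) Hex).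
    have T1 : X ^ (S m) / INR (fact (S m)) <= tl.
    { have := Series_pos_ge_term (fun k => X ^ (S m + k) / INR (fact (S m + k))) O (fun k => Hpos _) Htex. by rewrite Nat.add_0_r. }
    have T2 : tl <= X ^ (S m) / INR (fact (S m)) * exp X.
    { rewrite -(is_series_unique _ _ Hs) -Series_scal_l. apply: Series_le; last by apply: (ex_series_scal (X ^ S m / INR (fact (S m)))).
      move=> k. split; first by apply Hpos. rewrite pow_add.
      rewrite (_ : X ^ S m / INR (fact (S m)) * (X ^ k / INR (fact k)) = X ^ S m * X ^ k * / (INR (fact (S m)) * INR (fact k))); last by field; have := INR_fact_pos k; have := INR_fact_pos (S m); lra.
      apply Rmult_le_compat_l; first by apply Rmult_le_pos; apply pow_le; lra.
      apply Rinv_le_contravar; first by apply Rmult_lt_0_compat; apply INR_fact_pos.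
      rewrite -mult_INR. apply le_INR.
      elim: k => [|k IH]; first by rewrite Nat.add_0_r; simpl; lia.
      rewrite Nat.add_succ_r (fact_simpl (S m + k)) (fact_simpl k).
      have H := Nat.mul_le_mono (S k) (S (S m + k)) _ _ ltac:(lia) IH. lia. }
    have He : exp X <= 3 by have := exp_le_3_pow 1 X ltac:(simpl; lra); simpl; lra.
    have E := fun e => Rh_sum e X (S m) 0. simpl (Pos.of_succ_nat 0) in E.
    have E' : forall e, Rh e 1 (S m) X = sum_f_R0 (fun k => X ^ k / INR (fact k)) m + e * (X ^ S m / INR (fact (S m))).
    { move=> e. have := E e. rewrite (_ : X ^ 0 / INR (fact 0) = 1); last by simpl; field.
      rewrite Rmult_1_l => ->. f_equal.
      change (0 + S m)%nat with (S m). clear. elim: m => [|m IH]; first by simpl; ring.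
      change (rsum (fun j => X ^ (0 + j) / INR (fact (0 + j))) (S m) + X ^ S m / INR (fact (S m)) = sum_f_R0 (fun k => X ^ k / INR (fact k)) m + X ^ S m / INR (fact (S m))). by rewrite IH. }
    rewrite !E' Hsplit. have HP := Hpos (S m). split; first lra.
    have : X ^ S m / INR (fact (S m)) * exp X <= X ^ S m / INR (fact (S m)) * 3 by apply Rmult_le_compat_l. lra.
Qed.

Lemma two64_pos : 0 < 2 ^ 64.
Proof. apply pow_lt. lra. Qed.

Lemma IZR_shift : IZR (2 ^ ibits) = 2 ^ 64.
Proof. rewrite /ibits -(pow_IZR 2 64). done. Qed.

Lemma shiftr_bounds z : IZR (Z.shiftr z ibits) * 2 ^ 64 <= IZR z <= IZR (Z.shiftr z ibits + 1) * 2 ^ 64.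
Proof.
  rewrite Z.shiftr_div_pow2 //. rewrite -IZR_shift -!mult_IZR. split; apply IZR_le.
  - rewrite Z.mul_comm. by apply Z.mul_div_le.
  - have := Z.mul_succ_div_gt z (2 ^ ibits) ltac:(done). lia.
Qed.

Lemma mul_interval a b c d x y : a <= x <= b -> c <= y <= d ->
  Rmin (Rmin (a * c) (a * d)) (Rmin (b * c) (b * d)) <= x * y <= Rmax (Rmax (a * c) (a * d)) (Rmax (b * c) (b * d)).
Proof.
  move=> Hx Hy.
  have L : forall m, m <= a * c -> m <= a * d -> m <= b * c -> m <= b * d -> m <= x * y.
  { move=> m H1 H2 H3 H4. have Q1 : m <= x * c by case: (Rle_lt_dec 0 c) => ?; nra.
    have Q2 : m <= x * d by case: (Rle_lt_dec 0 d) => ?; nra.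
    case: (Rle_lt_dec 0 x) => ?; nra. }
  have U : forall m, a * c <= m -> a * d <= m -> b * c <= m -> b * d <= m -> x * y <= m.
  { move=> m H1 H2 H3 H4. have Q1 : x * c <= m by case: (Rle_lt_dec 0 c) => ?; nra.
    have Q2 : x * d <= m by case: (Rle_lt_dec 0 d) => ?; nra.
    case: (Rle_lt_dec 0 x) => ?; nra. }
  split.
  - apply L.
    + apply: Rle_trans (Rmin_l _ _) (Rmin_l _ _).
    + apply: Rle_trans (Rmin_l _ _) (Rmin_r _ _).
    + apply: Rle_trans (Rmin_r _ _) (Rmin_l _ _).
    + apply: Rle_trans (Rmin_r _ _) (Rmin_r _ _).
  - apply U.
    + apply: Rle_trans (Rmax_l _ _) (Rmax_l _ _).
    + apply: Rle_trans (Rmax_r _ _) (Rmax_l _ _).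
    + apply: Rle_trans (Rmax_l _ _) (Rmax_r _ _).
    + apply: Rle_trans (Rmax_r _ _) (Rmax_r _ _).
Qed.

Lemma IZR_min a b : IZR (Z.min a b) = Rmin (IZR a) (IZR b).
Proof.
  case: (Z.le_ge_cases a b) => H.
  - rewrite Z.min_l // Rmin_left //. by apply IZR_le.
  - rewrite Z.min_r // Rmin_right //. by apply IZR_le.
Qed.

Lemma IZR_max a b : IZR (Z.max a b) = Rmax (IZR a) (IZR b).
Proof.
  case: (Z.le_ge_cases a b) => H.
  - rewrite Z.max_r // Rmax_right //. by apply IZR_le.
  - rewrite Z.max_l // Rmax_left //. by apply IZR_le.
Qed.

Lemma icontains_mul x y r s : icontains x r -> icontains y s -> icontains (imul x y) (r * s).
Proof.
  move=> Hx Hy. have HS := two64_pos.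
  have [H1 H2] := mul_interval _ _ _ _ _ _ Hx Hy.
  rewrite -!mult_IZR -!IZR_min -!IZR_max in H1 H2.
  rewrite /icontains /imul [fst _]/= [snd _]/=.
  set lo := Z.min _ _ in H1 |- *. set hi := Z.max _ _ in H2 |- *.
  have [L1 _] := shiftr_bounds lo. have [_ U2] := shiftr_bounds hi.
  have E : r * 2 ^ 64 * (s * 2 ^ 64) = (r * s * 2 ^ 64) * 2 ^ 64 by ring.
  rewrite E in H1 H2.
  split; apply (Rmult_le_reg_r (2 ^ 64)) => //.
  - apply: Rle_trans L1 H1.
  - apply: Rle_trans H2 U2.
Qed.

Lemma icontains_add x y r s : icontains x r -> icontains y s -> icontains (o_add Iops x y) (r + s).
Proof. rewrite /icontains /= !plus_IZR. move=> Hx Hy. rewrite Rmult_plus_distr_r. lra. Qed.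

Lemma icontains_cst n d : icontains (icst n d) (IZR n / IZR (Zpos d)).
Proof.
  rewrite /icontains /icst. cbn [fst snd].
  have Hd : 0 < IZR (Zpos d) by apply IZR_lt.
  have E : IZR n / IZR (Zpos d) * 2 ^ 64 = IZR (Z.shiftl n ibits) / IZR (Zpos d).
  { rewrite Z.shiftl_mul_pow2 // mult_IZR IZR_shift. field. lra. }
  rewrite E. set a := Z.shiftl n ibits.
  have H1 := Z.mul_div_le a (Zpos d) ltac:(done). have H2 := Z.mul_succ_div_gt a (Zpos d) ltac:(done).
  split; apply (Rmult_le_reg_r (IZR (Zpos d))) => //; rewrite /Rdiv Rmult_assoc Rinv_l; try lra; rewrite Rmult_1_r -mult_IZR; apply IZR_le; lia.
Qed.

(* Machin: pi / 4 = 2 atan (1/3) + atan (1/7) *)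
Definition machin_term (k : nat) : Q :=
  ((2 * (1 # (3 ^ Pos.of_nat (2 * k + 1))) + (1 # (7 ^ Pos.of_nat (2 * k + 1)))) * (1 # Pos.of_nat (2 * k + 1)))%Q.
Fixpoint machin (n : nat) : Q :=
  match n with
  | O => machin_term O
  | S m => Qred (machin m + (if Nat.even n then machin_term n else - machin_term n))%Q
  end.

Lemma Q2R_machin_term k : Q2R (machin_term k) = PI_2_3_7_tg k.
Proof.
  have P3 : forall p, IZR (Zpos (p ^ Pos.of_nat (2 * k + 1))) = IZR (Zpos p) ^ (2 * k + 1).
  { move=> p. rewrite Pos2Z.inj_pow pow_IZR. do 2 f_equal. lia. }
  rewrite /machin_term Q2R_mult Q2R_plus Q2R_mult /Q2R /PI_2_3_7_tg /Ratan_seq. cbn [Qnum Qden].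
  rewrite !P3 -!pow_inv.
  have -> : IZR (Zpos (Pos.of_nat (2 * k + 1))) = INR (2 * k + 1) by rewrite INR_IZR_INZ; f_equal; lia.
  rewrite /Rdiv !Rinv_1. ring.
Qed.

Lemma machin_sum n : Q2R (machin n) = sum_f_R0 (tg_alt PI_2_3_7_tg) n.
Proof.
  elim: n => [|n IH].
  - change (machin 0) with (machin_term 0). rewrite Q2R_machin_term /tg_alt /=. ring.
  - change (machin (S n)) with (Qred (machin n + (if Nat.even (S n) then machin_term (S n) else - machin_term (S n))))%Q.
    rewrite (Qeq_eqR _ _ (Qred_correct _)) Q2R_plus IH tech5. f_equal. rewrite /tg_alt.
    case E : (Nat.even (S n)).
    + rewrite Q2R_machin_term. move/Nat.even_spec: E => [p ->]. rewrite pow_1_even. ring.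
    + rewrite Q2R_opp Q2R_machin_term. have : Nat.odd (S n) = true by rewrite -Nat.negb_even E.
      move/Nat.odd_spec => [p ->]. rewrite Nat.add_1_r pow_1_odd. ring.
Qed.

Lemma icontains_pi : icontains (pi_lo, pi_hi) PI.
Proof.
  have [H1 H2] := PI_2_3_7_ineq 12.
  rewrite -!machin_sum in H1 H2. have HS := two64_pos.
  have Q1 : (inject_Z pi_lo <= 4 * inject_Z (2 ^ ibits) * machin (S (2 * 12)))%Q by apply Qle_bool_iff; vm_compute.
  have Q2 : (4 * inject_Z (2 ^ ibits) * machin (2 * 12) <= inject_Z pi_hi)%Q by apply Qle_bool_iff; vm_compute.
  apply Qle_Rle in Q1. apply Qle_Rle in Q2. revert H1 H2 Q1 Q2.
  generalize (machin (S (2 * 12))) (machin (2 * 12)) => a b H1 H2.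
  have EZ : forall z, Q2R (inject_Z z) = IZR z by move=> z; rewrite /Q2R /=; field.
  rewrite !(Q2R_mult (4 * inject_Z (2 ^ ibits))) (Q2R_mult 4) !EZ IZR_shift /icontains. cbn [fst snd].
  move: (2 ^ 64) HS => S HS Q1 Q2. have : S * Q2R a <= S * (PI / 4) by apply Rmult_le_compat_l; lra.
  have : S * (PI / 4) <= S * Q2R b by apply Rmult_le_compat_l; lra. lra.
Qed.

Lemma Q2R_Qred q : Q2R (Qred q) = Q2R q.
Proof. apply Qeq_eqR, Qred_correct. Qed.

Lemma qeval_add a : forall b, qeval (qadd a b) = qeval a + qeval b.
Proof.
  elim: a => [|x a IH] [|y b]; try by rewrite /=; ring.
  change (Q2R (Qred (x + y)) + PI * qeval (qadd a b) = Q2R x + PI * qeval a + (Q2R y + PI * qeval b)).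
  rewrite Q2R_Qred Q2R_plus IH. ring.
Qed.

Lemma qeval_scal x b : qeval (map (fun y => Qred (x * y)) b) = Q2R x * qeval b.
Proof.
  elim: b => [|y b IH]; first by rewrite /=; ring.
  change (Q2R (Qred (x * y)) + PI * qeval (map (fun y => Qred (x * y)) b) = Q2R x * (Q2R y + PI * qeval b)).
  rewrite IH Q2R_Qred Q2R_mult. ring.
Qed.

Lemma qeval_mul a b : qeval (qmul a b) = qeval a * qeval b.
Proof.
  elim: a => [|x a IH]; first by rewrite /=; ring.
  change (qeval (qadd (map (fun y => Qred (x * y)) b) (cons (0#1)%Q (qmul a b))) = (Q2R x + PI * qeval a) * qeval b).
  rewrite qeval_add qeval_scal.
  change (qeval (cons (0#1)%Q (qmul a b))) with (Q2R (0#1) + PI * qeval (qmul a b)).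
  rewrite IH RMicromega.Q2R_0. ring.
Qed.

Lemma qrel_cst n d : qrel (o_cst Qops n d) (IZR n / IZR (Zpos d)).
Proof.
  change (IZR n / IZR (Zpos d) = Q2R (Qred (n # d)) + PI * 0). rewrite Q2R_Qred /Q2R. cbn [Qnum Qden]. rewrite /Rdiv. ring.
Qed.

Lemma qrel_pi : qrel (o_pi Qops) PI.
Proof. rewrite /qrel /= /Q2R /=. field. Qed.

Fixpoint iheval (l : list (Z * Z)) (x : Z * Z) : Z * Z :=
  match l with nil => (0, 0)%Z | cons c l' => o_add Iops c (imul x (iheval l' x)) end.

Lemma iheval_correct l r x u : lrel icontains None l r -> icontains x u -> icontains (iheval l x) (peval r u).
Proof.
  move=> H Hx. elim: l r H => [|c l IH] [|y r] //.
  - move=> _. rewrite /icontains Rmult_0_l. cbn [iheval fst snd]. lra.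
  - move=> [H1 H2].
    change (icontains (o_add Iops c (imul x (iheval l x))) (y + u * peval r u)).
    apply icontains_add => //. apply icontains_mul => //. by apply IH.
Qed.

Lemma peval_split k l x : peval l x = peval (firstn k l) x + x ^ k * peval (skipn k l) x.
Proof.
  elim: k l => [|k IH] [|c l]; rewrite ?firstn_nil ?skipn_nil /=; try ring. rewrite (IH l). ring.
Qed.

Lemma lrel_skipn {A} (rel : A -> R -> Prop) m : forall l r, lrel rel None l r -> lrel rel None (skipn m l) (skipn m r).
Proof.
  elim: m => [|m IH] [|x l] [|y r] //. move=> [_ H]. by apply IH.
Qed.

(* Bounds the degree without changing the value at the point at which [hv] evaluates. *)
Fixpoint fold_tail {A} (hv : list A -> A) (N : nat) (l : list A) : list A :=
  match N, l with
  | _, nil => nil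
  | O, _ => cons (hv l) nil
  | S N', cons c l' => cons c (fold_tail hv N' l')
  end.

Lemma peval_fold_tail N x : forall l, peval (fold_tail (fun t => peval t x) N l) x = peval l x.
Proof.
  elim: N => [|N IH] [|c l] //=; [ring|by rewrite IH].
Qed.

Lemma lrel_fold_tail N X x : icontains X x -> forall l r, lrel icontains None l r ->
  lrel icontains None (fold_tail (fun t => iheval t X) N l) (fold_tail (fun t => peval t x) N r).
Proof.
  move=> HX. elim: N => [|N IH] [|c l] [|y r] // H.
  - split => //. by apply iheval_correct.
  - move: H => [H1 H2]. split => //. by apply IH.
Qed.

Lemma lrel_firstn_fold {A} (rel : A -> R -> Prop) (hv : list R -> R) m : forall k N l r, (k <= m)%nat -> (k <= N)%nat ->
  lrel rel (Some k) l r -> lrel rel (Some k) (firstn m l) (fold_tail hv N r).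
Proof.
  elim: m => [|m IH] [|k] [|N] [|c l] [|y r] //= H1 H2; try lia. move=> [H3 H4]. split => //. apply IH => //; lia.
Qed.

(* The coefficients in [PLit] are polynomials in PI, given by their lists of rational coefficients. *)
Inductive pexpr :=
| PLit (l : list (list (Z * positive)))
| PAdd (a b : pexpr)
| PMul (a b : pexpr)
| PComp (cs : list (Z * positive)) (a : pexpr)
| PExp (e : Z) (m : nat) (a : pexpr).

Fixpoint prun {A} (Op : ops A) (T : list A -> list A) (e : pexpr) : list A :=
  match e with
  | PLit l => map (ppi Op) l
  | PAdd a b => padd Op (prun Op T a) (prun Op T b)
  | PMul a b => pmul Op T (prun Op T a) (prun Op T b)
  | PComp cs a => pcomp Op T (map (rat Op) cs) (prun Op T a)
  | PExp e m a => phexp Op T (o_cst Op e 1) 1 m (prun Op T a)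
  end.

Definition plit (l : list (list (Z * positive))) (x : R) : R := peval (map (ppi Rops) l) x.
Definition rlit (cs : list (Z * positive)) (x : R) : R := peval (map (rat Rops) cs) x.

Fixpoint pval (e : pexpr) (x : R) : R :=
  match e with
  | PLit l => plit l x
  | PAdd a b => pval a x + pval b x
  | PMul a b => pval a x * pval b x
  | PComp cs a => rlit cs (pval a x)
  | PExp e m a => Rh (IZR e) 1 m (pval a x)
  end.

Lemma prun_pval T e x : (forall l, peval (T l) x = peval l x) -> peval (prun Rops T e) x = pval e x.
Proof.
  move=> HT. elim: e => [l|a IHa b IHb|a IHa b IHb|cs a IHa|e m a IHa]; cbn [prun pval].
  - done.
  - by rewrite peval_padd IHa IHb.
  - by rewrite peval_pmul // IHa IHb.
  - by rewrite peval_pcomp // IHa.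
  - rewrite peval_phexp // IHa. f_equal. rewrite /o_cst /Rops. field.
Qed.

Lemma lrel_prun {A} (Op : ops A) T T' (rel : A -> R -> Prop) (ok : option nat -> Prop) :
  (forall x y r s, rel x r -> rel y s -> rel (o_add Op x y) (r + s)) ->
  (forall x y r s, rel x r -> rel y s -> rel (o_mul Op x y) (r * s)) ->
  (forall n d, rel (o_cst Op n d) (IZR n / IZR (Zpos d))) ->
  rel (o_pi Op) PI ->
  (forall o, ok o -> ok (dec o)) ->
  (forall o l r, ok o -> lrel rel o l r -> lrel rel o (T l) (T' r)) ->
  forall e o, ok o -> lrel rel o (prun Op T e) (prun Rops T' e).
Proof.
  move=> Ha Hm Hc Hp Hd HT. elim => [l|a IHa b IHb|a IHa b IHb|cs a IHa|e m a IHa] o Ho; cbn [prun].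
  - by apply lrel_map_ppi.
  - apply lrel_padd => //; [by apply IHa|by apply IHb].
  - apply (lrel_pmul Op T T' rel ok) => //; [by apply IHa|by apply IHb].
  - apply (lrel_pcomp Op T T' rel ok) => //; [by apply IHa|by apply rel_map_rat].
  - apply (lrel_phexp Op T T' rel ok) => //. by apply IHa.
Qed.

Definition zero_check (m : nat) (e : pexpr) : bool :=
  forallb (forallb (fun q => Qeq_bool q (0 # 1))) (firstn m (prun Qops (firstn m) e)).
Definition tail_check (m : nat) (X : Z) (e : pexpr) : bool :=
  Z.leb 0 (fst (iheval (skipn m (prun Iops (fold_tail (fun t => iheval t (0%Z, X)) 10) e)) (0%Z, X))).

Lemma peval_zeros l r m x : lrel qrel (Some m) l r ->
  forallb (forallb (fun q => Qeq_bool q (0 # 1))) (firstn m l) = true -> peval (firstn m r) x = 0.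
Proof.
  elim: m l r => [|m IH] [|c l] [|y r] //.
  move=> [H1 H2]. cbn [firstn forallb]. move/andb_prop => [H3 H4]. cbn [peval].
  rewrite (IH l r) // H1.
  have -> : qeval c = 0.
  { elim: c H3 {H1} => [|q c IHc] //. cbn [forallb]. move/andb_prop => [Hq /IHc Hc]. cbn [qeval]. rewrite Hc.
    apply Qeq_bool_eq in Hq. rewrite (Qreals.Qeq_eqR _ _ Hq) RMicromega.Q2R_0. ring. }
  ring.
Qed.

(* The first [m] coefficients are identities between polynomials in [PI], the others are enclosed numerically. *)
Lemma pval_nonneg m X e x : (m <= 10)%nat -> zero_check m e = true -> tail_check m X e = true ->
  0 <= x -> x * 2 ^ 64 <= IZR X -> 0 <= pval e x.
Proof.
  move=> Hm Hz Ht Hx HX. set T := fold_tail (fun t => peval t x) 10.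
  have HT : forall l, peval (T l) x = peval l x by apply peval_fold_tail.
  rewrite -(prun_pval T) // (peval_split m) (peval_zeros (prun Qops (firstn m) e) _ m) //.
  - have HXx : icontains (0%Z, X) x.
    { split; cbn [fst snd] => //. apply Rmult_le_pos => //. apply Rlt_le, two64_pos. }
    rewrite Rplus_0_l. apply Rmult_le_pos; first by apply pow_le.
    move: Ht. rewrite /tail_check. move/Z.leb_le => H1.
    have HR : lrel icontains None (prun Iops (fold_tail (fun t => iheval t (0%Z, X)) 10) e) (prun Rops T e).
    { apply (lrel_prun Iops _ _ icontains (fun o => o = None)) => //.
      - apply icontains_add.
      - apply icontains_mul.
      - apply icontains_cst.
      - apply icontains_pi.
      - by move=> o ->.
      - move=> o l r ->. by apply lrel_fold_tail. }
    have [H3 _] := iheval_correct _ _ _ _ (lrel_skipn _ m _ _ HR) HXx.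
    apply IZR_le in H1. apply (Rmult_le_reg_r (2 ^ 64)); first apply two64_pos. rewrite Rmult_0_l. lra.
  - apply (lrel_prun Qops _ _ qrel (fun o => exists k, o = Some k /\ (k <= m)%nat)); last by exists m.
    + move=> a b r s -> ->. by rewrite /qrel qeval_add.
    + move=> a b r s -> ->. by rewrite /qrel qeval_mul.
    + apply qrel_cst.
    + apply qrel_pi.
    + move=> o [[|k] [-> Hk]]; [exists O|exists k] => //. split => //. lia.
    + move=> o l r [k [-> Hk]]. apply lrel_firstn_fold => //. lia.
Qed.

(* Taylor polynomials in P of (sqrt (1 + P) - 1) / P, (1 + P)^(-3/4) and (1 + P)^(-1/2) *)
Definition root_lo : list (Z * positive) := ((1, 2%positive) :: (-1, 8%positive) :: (1, 16%positive) :: (-5, 128%positive) :: nil)%Z.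
Definition root_hi : list (Z * positive) := root_lo ++ ((7, 256%positive) :: nil)%Z.
Definition tq_lo : list (Z * positive) := ((1, 1%positive) :: (-3, 4%positive) :: (21, 32%positive) :: (-77, 128%positive) :: nil)%Z.
Definition tq_hi : list (Z * positive) := tq_lo ++ ((1155, 2048%positive) :: nil)%Z.
Definition inv_lo : list (Z * positive) := ((1, 1%positive) :: (-1, 2%positive) :: (3, 8%positive) :: (-5, 16%positive) :: nil)%Z.
Definition inv_hi : list (Z * positive) := inv_lo ++ ((35, 128%positive) :: nil)%Z.

Definition eid : pexpr := PLit (nil :: ((1, 1%positive) :: nil) :: nil)%Z.
Definition ecst (z : Z) : pexpr := PLit (((z, 1%positive) :: nil) :: nil)%Z.
Definition ep1 : pexpr := PAdd (ecst 1) eid.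
Definition eneg (e : pexpr) : pexpr := PMul (ecst (-1)) e.
Definition esq (e : pexpr) : pexpr := PMul e e.

Definition X100 : Z := (2 ^ 64 / 100 + 1)%Z.

Lemma pval_eid x : pval eid x = x.
Proof. rewrite /= /plit /=. field. Qed.
Lemma pval_ecst z x : pval (ecst z) x = IZR z.
Proof. rewrite /= /plit /= /rat /=. field. Qed.

Lemma X100_bound P : P <= 1 / 100 -> P * 2 ^ 64 <= IZR X100.
Proof.
  move=> H. have HS := two64_pos. apply: (Rle_trans _ (2 ^ 64 / 100)).
  - apply (Rmult_le_compat_r (2 ^ 64)) in H; lra.
  - rewrite -IZR_shift. rewrite /Rdiv. apply (Rmult_le_reg_r 100); first lra. rewrite Rmult_assoc Rinv_l; last lra.
    rewrite Rmult_1_r -mult_IZR. apply IZR_le. by vm_compute.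
Qed.

Lemma sqrt_bounds P : 0 <= P <= 1 / 100 ->
  1 + P * rlit root_lo P <= sqrt (1 + P) <= 1 + P * rlit root_hi P.
Proof.
  move=> HP. have HX := X100_bound P (proj2 HP). split.
  - have H := pval_nonneg 5 X100 (PAdd ep1 (eneg (esq (PAdd (ecst 1) (PMul eid (PComp root_lo eid)))))) P ltac:(lia) ltac:(by vm_compute) ltac:(by vm_compute) (proj1 HP) HX.
    move: H. rewrite /ep1 /eneg /esq. cbn [pval]. rewrite !pval_ecst !pval_eid => H.
    apply Rsqr_incr_0_var; last by apply sqrt_pos. rewrite Rsqr_sqrt; last lra. rewrite /Rsqr. lra.
  - have H := pval_nonneg 6 X100 (PAdd (esq (PAdd (ecst 1) (PMul eid (PComp root_hi eid)))) (eneg ep1)) P ltac:(lia) ltac:(by vm_compute) ltac:(by vm_compute) (proj1 HP) HX.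
    have H2 := pval_nonneg 0 X100 (PAdd (ecst 1) (PMul eid (PComp root_hi eid))) P ltac:(lia) ltac:(by vm_compute) ltac:(by vm_compute) (proj1 HP) HX.
    move: H H2. rewrite /ep1 /eneg /esq. cbn [pval]. rewrite !pval_ecst !pval_eid. move=> H H2.
    apply Rsqr_incr_0_var => //. rewrite Rsqr_sqrt; last lra. rewrite /Rsqr. lra.
Qed.

Lemma inv_sqrt_bounds P : 0 <= P <= 1 / 100 -> 0 <= rlit inv_lo P /\ rlit inv_lo P <= / sqrt (1 + P) <= rlit inv_hi P.
Proof.
  move=> HP. have HX := X100_bound P (proj2 HP).
  have Hs : 0 < sqrt (1 + P) by apply sqrt_lt_R0; lra.
  have Hss : sqrt (1 + P) * sqrt (1 + P) = 1 + P by apply sqrt_sqrt; lra.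
  have E : forall r, r * r = 1 + P -> 0 < r -> / r * / r * (1 + P) = 1 by move=> r <- Hr; field; lra.
  move: (E _ Hss Hs) => {}E.
  have Hi : 0 < / sqrt (1 + P) by apply Rinv_0_lt_compat.
  have H := pval_nonneg 4 X100 (PAdd (ecst 1) (eneg (PMul (esq (PComp inv_lo eid)) ep1))) P ltac:(lia) ltac:(by vm_compute) ltac:(by vm_compute) (proj1 HP) HX.
  have H' := pval_nonneg 5 X100 (PAdd (PMul (esq (PComp inv_hi eid)) ep1) (ecst (-1))) P ltac:(lia) ltac:(by vm_compute) ltac:(by vm_compute) (proj1 HP) HX.
  have H1 := pval_nonneg 0 X100 (PComp inv_lo eid) P ltac:(lia) ltac:(by vm_compute) ltac:(by vm_compute) (proj1 HP) HX.
  have H1' := pval_nonneg 0 X100 (PComp inv_hi eid) P ltac:(lia) ltac:(by vm_compute) ltac:(by vm_compute) (proj1 HP) HX.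
  move: H H' H1 H1'. rewrite /ep1 /eneg /esq. cbn [pval]. rewrite !pval_ecst !pval_eid.
  set a := rlit inv_lo P. set b := rlit inv_hi P. set i := / sqrt (1 + P) in E Hi |- *. move=> H H' H1 H1'.
  split => //. split; apply Rsqr_incr_0_var; rewrite /Rsqr; try lra; apply (Rmult_le_reg_r (1 + P)); lra.
Qed.

Lemma three_quarter_bounds P y : 0 <= P <= 1 / 100 -> 0 < y -> y ^ 4 * (1 + P) ^ 3 = 1 ->
  0 <= rlit tq_lo P /\ rlit tq_lo P <= y <= rlit tq_hi P.
Proof.
  move=> HP Hy E. have HX := X100_bound P (proj2 HP).
  have H := pval_nonneg 4 X100 (PAdd (ecst 1) (eneg (PMul (esq (esq (PComp tq_lo eid))) (PMul ep1 (esq ep1))))) P ltac:(lia) ltac:(by vm_compute) ltac:(by vm_compute) (proj1 HP) HX.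
  have H' := pval_nonneg 5 X100 (PAdd (PMul (esq (esq (PComp tq_hi eid))) (PMul ep1 (esq ep1))) (ecst (-1))) P ltac:(lia) ltac:(by vm_compute) ltac:(by vm_compute) (proj1 HP) HX.
  have H1 := pval_nonneg 0 X100 (PComp tq_lo eid) P ltac:(lia) ltac:(by vm_compute) ltac:(by vm_compute) (proj1 HP) HX.
  have H1' := pval_nonneg 0 X100 (PComp tq_hi eid) P ltac:(lia) ltac:(by vm_compute) ltac:(by vm_compute) (proj1 HP) HX.
  move: H H' H1 H1'. rewrite /ep1 /eneg /esq. cbn [pval]. rewrite !pval_ecst !pval_eid.
  set a := rlit tq_lo P. set b := rlit tq_hi P. move=> H H' H1 H1'.
  have L : forall p r, 0 <= p -> 0 <= r -> p ^ 4 * (1 + P) ^ 3 <= r ^ 4 * (1 + P) ^ 3 -> p <= r.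
  { move=> p r Hp Hr Hpr. have HP3 : 0 < (1 + P) ^ 3 by apply pow_lt; lra.
    apply Rmult_le_reg_r in Hpr => //. have E2 : forall t, t ^ 4 = Rsqr (Rsqr t) by move=> t; rewrite /Rsqr; ring.
    rewrite !E2 in Hpr. apply Rsqr_incr_0_var => //. apply Rsqr_incr_0_var => //. by apply Rle_0_sqr. }
  split => //. split; apply L; try lra; rewrite E; lra.
Qed.

Definition mon (z : Z) (d : positive) (k : nat) : list (Z * positive) := repeat (0%Z, 1%positive) k ++ ((z, d) :: nil).

(* h, f and g as polynomials in [u = 1 / (4 PI sqrt n)] *)
Definition hl : list (list (Z * positive)) :=
  mon 1 1 0 :: mon 8 1 2 ::
  ((0, 1%positive) :: (0, 1%positive) :: (-12, 1%positive) :: (0, 1%positive) :: (32, 1%positive) :: nil)%Z ::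
  ((0, 1%positive) :: (0, 1%positive) :: (3, 1%positive) :: (0, 1%positive) :: (-128, 1%positive) :: (0, 1%positive) :: (256, 3%positive) :: nil)%Z ::
  ((0, 1%positive) :: (0, 1%positive) :: (3, 1%positive) :: (0, 1%positive) :: (192, 1%positive) :: (0, 1%positive) :: (-640, 1%positive) :: (0, 1%positive) :: (512, 3%positive) :: nil)%Z :: nil.
Definition gl := hl ++ (mon (259593 * 4 ^ 5) 10000 5 :: mon (-78879 * 4 ^ 6) 100000 6 :: nil).
Definition fl := hl ++ (mon (259592 * 4 ^ 5) 10000 5 :: mon (-178935 * 4 ^ 6) 100000 6 :: mon (-183114 * 4 ^ 7) 10000 7 :: mon (-115407 * 4 ^ 8) 10000 8 :: nil).

Definition q05 : list (Z * positive) :=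
  ((1, 1%positive) :: (-3, 8%positive) :: (-15, 128%positive) :: (-105, 1024%positive) :: (-4725, 32768%positive) :: (-72765, 262144%positive) :: nil)%Z.
Definition qU := q05 ++ ((-240649507, 65536%positive)%Z :: nil).
Definition qL := q05 ++ ((4096, 1%positive)%Z :: nil).
Definition z6L : list (Z * positive) := repeat (0%Z, 1%positive) 6 ++ ((4096, 1%positive)%Z :: nil).

Definition eP : pexpr := PLit (nil :: nil :: mon 16 1 2 :: nil).
Definition eX cs : pexpr := PMul (PLit (nil :: mon 16 1 2 :: nil)) (PComp cs eP).
Definition eW cs : pexpr := PMul eid (PComp cs eP).
(* 1 + s * 3 * 10^-4 * (4 PI u)^6 *)
Definition eN (s : Z) : pexpr := PLit (mon 1 1 0 :: nil :: nil :: nil :: nil :: nil :: mon (s * 12288) 10000 6 :: nil).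
Definition eUp : pexpr := PMul (PMul (PExp 3 9 (eX root_hi)) (PComp tq_hi eP)) (PMul (PComp qU (eW inv_lo)) (eN 1)).
Definition eLo : pexpr := PMul (PMul (PExp 1 9 (eX root_lo)) (PComp tq_lo eP))
  (PMul (PAdd (PComp q05 (eW inv_hi)) (PComp z6L (eW inv_lo))) (eN (-1))).
Definition eDup : pexpr := PAdd (PMul (PLit gl) (PComp qU eid)) (eneg eUp).
Definition eDlo : pexpr := PAdd eLo (eneg (PMul (PLit fl) (PComp qL eid))).
Definition Xu : Z := (2 ^ 64 * 10 / 1256 + 1)%Z.

Lemma eDup_nonneg u : 0 <= u -> u * 2 ^ 64 <= IZR Xu -> 0 <= pval eDup u.
Proof. apply (pval_nonneg 5); [lia|by vm_compute|by vm_compute]. Qed.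
Lemma eDlo_nonneg u : 0 <= u -> u * 2 ^ 64 <= IZR Xu -> 0 <= pval eDlo u.
Proof. apply (pval_nonneg 5); [lia|by vm_compute|by vm_compute]. Qed.

(** * The range n >= 100 *)

Lemma Rpower_half s k : 0 < s -> Rpower (s ^ 2) (INR k / 2) = s ^ k.
Proof.
  move=> Hs. rewrite -(Rpower_pow 2) // Rpower_mult -Rpower_pow //. f_equal. simpl (INR 2). field.
Qed.

Lemma fg_poly n : (1 <= n)%nat ->
  f_fun n = plit fl (/ (4 * PI * sqrt (INR n))) /\ g_fun n = plit gl (/ (4 * PI * sqrt (INR n))).
Proof.
  move=> Hn. have H1 : 1 <= INR n by apply (le_INR 1).
  have Hs : 0 < sqrt (INR n) by apply sqrt_lt_R0; lra.
  have HPI := PI_RGT_0.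
  have E : INR n = sqrt (INR n) ^ 2 by rewrite pow2_sqrt //; lra.
  rewrite /f_fun /g_fun /h_fun. set s := sqrt (INR n) in Hs E |- *. rewrite E.
  have R1 := Rpower_half s 1 Hs. have R3 := Rpower_half s 3 Hs. have R5 := Rpower_half s 5 Hs. have R7 := Rpower_half s 7 Hs.
  rewrite (_ : INR 1 = 1) // in R1. rewrite (_ : INR 3 = 3) in R3; last by simpl; ring.
  rewrite (_ : INR 5 = 5) in R5; last by simpl; ring. rewrite (_ : INR 7 = 7) in R7; last by simpl; ring.
  rewrite R1 R3 R5 R7. rewrite /plit /fl /gl /hl /mon.
  rewrite /= /rat /=. have -> : 25.9592 = 259592 / 10000 by lra. have -> : 1.78935 = 178935 / 100000 by lra. have -> : 18.3114 = 183114 / 10000 by lra.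
  have -> : 11.5407 = 115407 / 10000 by lra. have -> : 25.9593 = 259593 / 10000 by lra. have -> : 0.78879 = 78879 / 100000 by lra.
  split; field; lra.
Qed.

Lemma exp_pow_INR x k : exp x ^ k = exp (INR k * x).
Proof.
  elim: k => [|k IH]; first by rewrite /= Rmult_0_l exp_0.
  rewrite -tech_pow_Rmult IH -exp_plus S_INR. f_equal. ring.
Qed.

Lemma exp_785 k : (219 / 100) ^ k <= exp (INR k * (785 / 1000)).
Proof.
  rewrite -exp_pow_INR. apply pow_incr. split; first lra.
  have [H _] := exp_Rh (785 / 1000) 5 ltac:(lra). simpl in H. lra.
Qed.

Lemma pow8_exp_decay s a : 10 <= s -> 8 / 10 <= a -> s ^ 8 * exp (- (a * s)) <= 10 ^ 8 * exp (- (a * 10)).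
Proof.
  move=> Hs Ha.
  have H1 : s / 10 <= exp ((s - 10) / 10) by have := exp_ineq1_le ((s - 10) / 10); lra.
  have H2 : (s / 10) ^ 8 <= exp (8 / 10 * (s - 10)).
  { apply: (Rle_trans _ (exp ((s - 10) / 10) ^ 8)); first by apply pow_incr; lra.
    rewrite exp_pow_INR. right. f_equal. simpl. field. }
  have H3 : exp (8 / 10 * (s - 10)) * exp (- (a * s)) <= exp (- (a * 10)).
  { rewrite -exp_plus. apply exp_mono. nra. }
  have He := exp_pos (- (a * s)).
  have -> : s ^ 8 = 10 ^ 8 * (s / 10) ^ 8 by field.
  rewrite Rmult_assoc. apply Rmult_le_compat_l; first by apply pow_le; lra.
  apply: Rle_trans H3. apply Rmult_le_compat_r; lra.
Qed.

Lemma relative_error c (Hc : j_fourier_coefficients c) n : (100 <= n)%nat ->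
  Rabs (IZR (c n) - 4 * PI ^ 2 * gz (4 * PI * sqrt (INR n))) * sqrt (INR n) ^ 6
    <= / 10 ^ 4 * (4 * PI ^ 2 * gz (4 * PI * sqrt (INR n))).
Proof.
  move=> Hn.
  have H := c_minus_main c Hc n ltac:(lia).
  have HM := Mt_gz n ltac:(lia).
  have Hs : 10 <= sqrt (INR n).
  { rewrite -(sqrt_Rsqr 10); last lra. apply sqrt_le_1_alt. rewrite /Rsqr. apply (le_INR 100) in Hn. simpl in Hn. lra. }
  set s := sqrt (INR n) in Hs H HM |- *. set G := gz _ in HM |- *.
  have HPI : 314 / 100 < PI < 3142 / 1000.
  { have [B1 B2] := icontains_pi. rewrite /pi_lo /pi_hi in B1 B2. cbn [fst snd] in B1, B2. simpl in B1, B2. lra. }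
  set z := 4 * PI * s. have Hz : 4 <= z by rewrite /z; nra.
  have HG := gz_lower_bound z Hz. rewrite -/z -/G in HG.
  have HE : exp (4 * PI * s) / z ^ 2 <= Eb z.
  { rewrite /Eb /Rminus exp_plus. apply Rmult_le_compat_l; first by apply Rlt_le, exp_pos.
    have Hl : 0 <= ln z by rewrite -ln_1; apply ln_le; lra.
    rewrite -{1}(exp_ln z); last lra. rewrite exp_pow_INR -exp_Ropp. apply exp_mono. simpl. lra. }
  set A := exp (2 * PI * s) in H.
  have HA : 40 <= A.
  { have := exp_ineq1_le (2 * PI * s). rewrite -/A. nra. }
  have H1 : Rabs (IZR (c n) - 4 * PI ^ 2 * G) <= A * (10 ^ 4 * exp (PI / 2 * s) + (10 ^ 12 + 1)).
  { have -> : IZR (c n) - 4 * PI ^ 2 * G = (IZR (c n) - Mt n) + - (4 * PI ^ 2) by rewrite -HM; ring.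
    apply: Rle_trans (Rabs_triang _ _) _. rewrite Rabs_Ropp (Rabs_pos_eq (4 * PI ^ 2)); last nra.
    have : 4 * PI ^ 2 <= 40 by nra. lra. }
  have HG6 : exp (4 * PI * s) / z ^ 2 / 6 <= 4 * PI ^ 2 * G.
  { have : 0 < exp (4 * PI * s) / z ^ 2 by apply Rdiv_lt_0_compat; [apply exp_pos|apply pow_lt; lra].
    have : 39 <= 4 * PI ^ 2 by nra. have : 0 <= Eb z / 210 by have := Eb_pos z; lra. nra. }
  set B := exp (4 * PI * s) in HG6 HE.
  have K1 : A * exp (PI / 2 * s) = B * exp (- (3 / 2 * PI * s)) by rewrite /A /B -!exp_plus; f_equal; field.
  have K2 : A = B * exp (- (2 * PI * s)) by rewrite /A /B -!exp_plus; f_equal; ring.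
  have D1 : exp (- (3 / 2 * PI * s)) <= exp (- (471 / 100 * s)) by apply exp_mono; nra.
  have D2 : exp (- (2 * PI * s)) <= exp (- (628 / 100 * s)) by apply exp_mono; nra.
  have F1 := pow8_exp_decay s (471 / 100) Hs ltac:(lra). have F2 := pow8_exp_decay s (628 / 100) Hs ltac:(lra).
  have N1 : exp (- (471 / 100 * 10)) <= / 10 ^ 20.
  { rewrite exp_Ropp. apply Rinv_le_contravar; first by apply pow_lt; lra.
    rewrite (_ : 471 / 100 * 10 = INR 60 * (785 / 1000)); last by rewrite (INR_IZR_INZ 60) /=; field.
    apply: Rle_trans _ (exp_785 60). simpl. lra. }
  have N2 : exp (- (628 / 100 * 10)) <= / (3 / 2 * 10 ^ 27).
  { rewrite exp_Ropp. apply Rinv_le_contravar; first lra.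
    rewrite (_ : 628 / 100 * 10 = INR 80 * (785 / 1000)); last by rewrite (INR_IZR_INZ 80) /=; field.
    apply: Rle_trans _ (exp_785 80). simpl. lra. }
  have HB : 0 < B by apply exp_pos.
  apply: (Rle_trans _ (/ 10 ^ 4 * (B / z ^ 2 / 6))); last by apply Rmult_le_compat_l; [apply Rlt_le, Rinv_0_lt_compat, pow_lt; lra|].
  have Hs6 : 0 < s ^ 6 by apply pow_lt; lra.
  have Hs8 : 0 < s ^ 8 by apply pow_lt; lra.
  set e1 := exp (- (471 / 100 * s)) in D1 F1. set e2 := exp (- (628 / 100 * s)) in D2 F2.
  apply: (Rle_trans _ (B * (10 ^ 4 * e1 + (10 ^ 12 + 1) * e2) * s ^ 6)).
  { apply Rmult_le_compat_r; first lra. apply: Rle_trans H1 _. rewrite Rmult_plus_distr_l (_ : A * (10 ^ 4 * exp (PI / 2 * s)) = 10 ^ 4 * (A * exp (PI / 2 * s))); last ring.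
    rewrite K1 {1}K2. have := Rmult_le_compat_l B _ _ (Rlt_le _ _ HB) D1. have := Rmult_le_compat_l B _ _ (Rlt_le _ _ HB) D2.
    move: (B * e1) (B * e2) => X1 X2. nra. }
  have Hz2 : z ^ 2 <= 158 * s ^ 2.
  { have HP2 : PI ^ 2 <= (3142 / 1000) ^ 2 by apply pow_incr; lra.
    rewrite (_ : z ^ 2 = 16 * PI ^ 2 * s ^ 2); last by rewrite /z; ring.
    apply Rmult_le_compat_r; [apply pow_le|]; lra. }
  have Hz2p : 0 < z ^ 2 by apply pow_lt; lra.
  have Fin : 6 * z ^ 2 * s ^ 6 * (10 ^ 4 * e1 + (10 ^ 12 + 1) * e2) <= / 10 ^ 4.
  { apply: (Rle_trans _ (6 * (158 * s ^ 2) * s ^ 6 * (10 ^ 4 * e1 + (10 ^ 12 + 1) * e2))).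
    - apply Rmult_le_compat_r; first by have := exp_pos (- (471 / 100 * s)); have := exp_pos (- (628 / 100 * s)); rewrite -/e1 -/e2; lra.
      apply Rmult_le_compat_r; lra.
    - have -> : 6 * (158 * s ^ 2) * s ^ 6 * (10 ^ 4 * e1 + (10 ^ 12 + 1) * e2) = 948 * (10 ^ 4 * (s ^ 8 * e1) + (10 ^ 12 + 1) * (s ^ 8 * e2)) by ring.
      lra. }
  have -> : B * (10 ^ 4 * e1 + (10 ^ 12 + 1) * e2) * s ^ 6 = (6 * z ^ 2 * s ^ 6 * (10 ^ 4 * e1 + (10 ^ 12 + 1) * e2)) * (B / z ^ 2 / 6) by field; lra.
  apply Rmult_le_compat_r => //. apply Rlt_le. apply Rdiv_lt_0_compat; last lra. by apply Rdiv_lt_0_compat.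
Qed.

Lemma Qb_rlit v : v <> 0 -> Qb bU (/ v) = rlit qU v /\ Qb bL (/ v) = rlit qL v.
Proof.
  move=> Hv. rewrite /rlit /qU /qL /q05 /= /rat /= /Qb /bU /bL /q4 /q5. split; field; lra.
Qed.

Lemma rlit_qU_anti v w : 0 <= v -> v <= w -> rlit qU w <= rlit qU v.
Proof.
  move=> Hv Hvw. have H := fun k => pow_incr v w k (conj Hv Hvw).
  have E : forall x, rlit qU x = 1 - 3 / 8 * x ^ 1 - 15 / 128 * x ^ 2 - 105 / 1024 * x ^ 3 - 4725 / 32768 * x ^ 4 - 72765 / 262144 * x ^ 5 - 240649507 / 65536 * x ^ 6.
  { move=> x. rewrite /rlit /qU /q05 /= /rat /=. field. }
  rewrite !E. have := H 1%nat. have := H 2%nat. have := H 3%nat. have := H 4%nat. have := H 5%nat. have := H 6%nat.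
  lra.
Qed.

Lemma rlit_qL_anti a v b : 0 <= a -> a <= v -> v <= b -> rlit q05 b + rlit z6L a <= rlit qL v.
Proof.
  move=> Ha Hav Hvb. have H := fun k => pow_incr v b k (conj (Rle_trans _ _ _ Ha Hav) Hvb). have H6 := pow_incr a v 6 (conj Ha Hav).
  have E : forall x, rlit q05 x = 1 - 3 / 8 * x ^ 1 - 15 / 128 * x ^ 2 - 105 / 1024 * x ^ 3 - 4725 / 32768 * x ^ 4 - 72765 / 262144 * x ^ 5.
  { move=> x. rewrite /rlit /q05 /= /rat /=. field. }
  have E6 : rlit z6L a = 4096 * a ^ 6 by rewrite /rlit /z6L /= /rat /=; field.
  have EL : rlit qL v = rlit q05 v + 4096 * v ^ 6 by rewrite /rlit /qL /q05 /= /rat /=; field.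
  rewrite EL E6 !E. have := H 1%nat. have := H 2%nat. have := H 3%nat. have := H 4%nat. have := H 5%nat. lra.
Qed.

Lemma pval_eP u : pval eP u = 16 * PI ^ 2 * u ^ 2.
Proof. rewrite /= /plit /eP /mon /= /rat /=. field. Qed.
Lemma pval_eX cs u : pval (eX cs) u = 16 * PI ^ 2 * u * rlit cs (16 * PI ^ 2 * u ^ 2).
Proof. rewrite -pval_eP. cbn [pval eX]. f_equal. rewrite /plit /mon /= /rat /=. field. Qed.
Lemma pval_eW cs u : pval (eW cs) u = u * rlit cs (16 * PI ^ 2 * u ^ 2).
Proof. rewrite -pval_eP. cbn [pval eW]. by rewrite pval_eid. Qed.
Lemma pval_eN u : pval (eN 1) u = 1 + 3 * (/ 10 ^ 4 * (4 * PI * u) ^ 6) /\ pval (eN (-1)) u = 1 - 3 * (/ 10 ^ 4 * (4 * PI * u) ^ 6).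
Proof. rewrite /= /plit /mon /= /rat /=. split; field. Qed.

Lemma eDup_val u : pval eDup u = plit gl u * rlit qU u +
  -1 * (Rh 3 1 9 (pval (eX root_hi) u) * rlit tq_hi (pval eP u) * (rlit qU (pval (eW inv_lo) u) * pval (eN 1) u)).
Proof.
  change (plit gl u * rlit qU (pval eid u) + pval (ecst (-1)) u * (Rh 3 1 9 (pval (eX root_hi) u) * rlit tq_hi (pval eP u) * (rlit qU (pval (eW inv_lo) u) * pval (eN 1) u)) = plit gl u * rlit qU u +
  -1 * (Rh 3 1 9 (pval (eX root_hi) u) * rlit tq_hi (pval eP u) * (rlit qU (pval (eW inv_lo) u) * pval (eN 1) u))).
  by rewrite pval_eid pval_ecst.
Qed.

Lemma eDlo_val u : pval eDlo u = Rh 1 1 9 (pval (eX root_lo) u) * rlit tq_lo (pval eP u) *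
  ((rlit q05 (pval (eW inv_hi) u) + rlit z6L (pval (eW inv_lo) u)) * pval (eN (-1)) u) + -1 * (plit fl u * rlit qL u).
Proof.
  change (Rh 1 1 9 (pval (eX root_lo) u) * rlit tq_lo (pval eP u) *
  ((rlit q05 (pval (eW inv_hi) u) + rlit z6L (pval (eW inv_lo) u)) * pval (eN (-1)) u) + pval (ecst (-1)) u * (plit fl u * rlit qL (pval eid u)) = Rh 1 1 9 (pval (eX root_lo) u) * rlit tq_lo (pval eP u) *
  ((rlit q05 (pval (eW inv_hi) u) + rlit z6L (pval (eW inv_lo) u)) * pval (eN (-1)) u) + -1 * (plit fl u * rlit qL u)).
  by rewrite pval_eid pval_ecst.
Qed.

Lemma Rh_nonneg e X m : 0 <= e -> 0 <= X -> forall k, 0 <= Rh e k m X.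
Proof.
  move=> He HX. elim: m => [|m IH] k //=. have H1 := IH (Pos.succ k).
  have H2 : 0 < / IZR (Zpos k) by apply Rinv_0_lt_compat, IZR_lt.
  have := Rmult_le_pos _ _ (Rlt_le _ _ H2) (Rmult_le_pos _ _ HX H1). lra.
Qed.

Lemma product_upper rho e E y Y Q1 QN Q0 N g : 0 < e <= E -> 0 < y <= Y -> 0 < Q1 <= QN -> 0 < Q0 -> 0 <= N ->
  rho <= e * y * (Q1 / Q0) -> 0 <= g * Q0 + -1 * (E * Y * (QN * N)) -> rho * N <= g.
Proof.
  move=> He Hy HQ HQ0 HN H1 H2. apply (Rmult_le_reg_r Q0) => //.
  have H3 : rho * Q0 <= e * y * Q1.
  { rewrite (_ : e * y * Q1 = e * y * (Q1 / Q0) * Q0); last by field; lra. apply Rmult_le_compat_r; lra. }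
  have H4 : e * y * Q1 <= E * Y * QN.
  { apply Rmult_le_compat; [nra|lra| |lra]. apply Rmult_le_compat; lra. }
  have := Rmult_le_compat_r N _ _ HN (Rle_trans _ _ _ H3 H4). lra.
Qed.

Lemma product_lower rho e E y Y Q1 QN Q0 N f : 0 <= E <= e -> 0 <= Y <= y -> QN <= Q1 -> 0 < Q1 -> 0 < Q0 -> 0 <= N ->
  e * y * (Q1 / Q0) <= rho -> 0 <= E * Y * (QN * N) + -1 * (f * Q0) -> f <= rho * N.
Proof.
  move=> He Hy HQ HQ1 HQ0 HN H1 H2. apply (Rmult_le_reg_r Q0) => //.
  have H3 : e * y * Q1 <= rho * Q0.
  { rewrite (_ : e * y * Q1 = e * y * (Q1 / Q0) * Q0); last by field; lra. apply Rmult_le_compat_r; lra. }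
  have H4 : E * Y * QN <= e * y * Q1.
  { apply: (Rle_trans _ (E * Y * Q1)); first by apply Rmult_le_compat_l; [nra|lra].
    apply Rmult_le_compat_r; first lra. apply Rmult_le_compat; lra. }
  have := Rmult_le_compat_r N _ _ HN (Rle_trans _ _ _ H4 H3). lra.
Qed.

Lemma asymptotic_range c (Hc : j_fourier_coefficients c) n : (100 <= n)%nat -> f_fun n <= ratio c n <= g_fun n.
Proof.
  move=> Hn. have [-> ->] := fg_poly n ltac:(lia).
  have HR := relative_error c Hc n Hn. have HR' := relative_error c Hc (S n) ltac:(lia).
  have HN : 100 <= INR n by apply (le_INR 100) in Hn; rewrite (INR_IZR_INZ 100) in Hn.
  have HSn : INR (S n) = INR n + 1 by apply S_INR.
  have Hs : 10 <= sqrt (INR n).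
  { rewrite -(sqrt_Rsqr 10); last lra. apply sqrt_le_1_alt. rewrite /Rsqr. lra. }
  have Hss : sqrt (INR n) <= sqrt (INR (S n)) by apply sqrt_le_1_alt; lra.
  have Hsq : sqrt (INR n) ^ 2 = INR n by rewrite pow2_sqrt //; lra.
  have HPI : 314 / 100 < PI < 3142 / 1000.
  { have [B1 B2] := icontains_pi. rewrite /pi_lo /pi_hi in B1 B2. cbn [fst snd] in B1, B2. simpl in B1, B2. lra. }
  have Es : sqrt (INR (S n)) = sqrt (INR n) * sqrt (1 + / INR n).
  { rewrite -sqrt_mult_alt; last lra. f_equal. rewrite HSn. field. lra. }
  set s := sqrt (INR n) in Hs Hss Hsq HR Es |- *. set s' := sqrt (INR (S n)) in Hss HR' Es.
  set u := / (4 * PI * s).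
  have Hu : 0 < u by apply Rinv_0_lt_compat; nra.
  have HP : 16 * PI ^ 2 * u ^ 2 = / INR n by rewrite -Hsq /u; field; lra.
  have Heta : 0 <= / 10 ^ 4 * (4 * PI * u) ^ 6 <= / 10 ^ 10.
  { have -> : 4 * PI * u = / s by rewrite /u; field; lra.
    have H1 : 0 < / s <= / 10 by split; [apply Rinv_0_lt_compat; lra|apply Rinv_le_contravar; lra].
    have := pow_incr (/ s) (/ 10) 6 ltac:(lra). have := pow_le (/ s) 6 ltac:(lra). lra. }
  set P := / INR n in HP Es. set sg := sqrt (1 + P) in Es.
  have HP0 : 0 <= P <= 1 / 100.
  { split; first by apply Rlt_le, Rinv_0_lt_compat; lra. rewrite /P /Rdiv Rmult_1_l. apply Rinv_le_contravar; lra. }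
  have [Sq1 Sq2] := sqrt_bounds P HP0. have [I0 [I1 I2]] := inv_sqrt_bounds P HP0. rewrite -/sg in Sq1 Sq2 I1 I2.
  have Hsg : 1 <= sg by rewrite -sqrt_1; apply sqrt_le_1_alt; lra.
  set y := exp (- (3 / 2 * ln sg)).
  have Hy4 : y ^ 4 * (1 + P) ^ 3 = 1.
  { have -> : 1 + P = sg ^ 2 by rewrite /sg pow2_sqrt //; lra.
    have -> : (sg ^ 2) ^ 3 = exp (ln sg) ^ 6 by rewrite exp_ln; [ring|lra].
    rewrite /y !exp_pow_INR -exp_plus -exp_0. f_equal. simpl. field. }
  have [Y0 [Y1 Y2]] := three_quarter_bounds P y HP0 (exp_pos _) Hy4.
  set z := 4 * PI * s in HR. set z' := 4 * PI * s' in HR'.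
  have Hz : 4 < z by rewrite /z; nra.
  have Ez' : z' = z * sg by rewrite /z' Es /z; ring.
  have Hzz : z <= z' by rewrite Ez'; nra.
  have EE : Eb z' / Eb z = exp (z' - z) * y.
  { rewrite /Eb /y /Rdiv -exp_Ropp -!exp_plus. f_equal. rewrite {2}Ez' ln_mult; [ring|lra|lra]. }
  have Xe : z' - z = z * (sg - 1) by rewrite Ez'; ring.
  have zP : forall t, z * (P * t) = 16 * PI ^ 2 * u * t.
  { move=> t. rewrite -HP /u /z. field. lra. }
  have X1 : pval (eX root_lo) u <= z' - z.
  { rewrite pval_eX HP -zP Xe. apply Rmult_le_compat_l; lra. }
  have X2 : z' - z <= pval (eX root_hi) u.
  { rewrite pval_eX HP -zP Xe. apply Rmult_le_compat_l; lra. }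
  have HuX : u * 2 ^ 64 <= IZR Xu.
  { apply: (Rle_trans _ (2 ^ 64 * 10 / 1256)).
    - rewrite /Rdiv Rmult_assoc Rmult_comm. apply Rmult_le_compat_l; first by apply pow_le; lra.
      rewrite /u (_ : 10 * / 1256 = / (1256 / 10)); last by field. apply Rinv_le_contravar; [lra|nra].
    - rewrite /Xu. rewrite (_ : (2 ^ 64 * 10 / 1256 + 1 = 146868981478579233)%Z). lra. by vm_compute. }
  set eta := / 10 ^ 4 * (4 * PI * u) ^ 6 in Heta.
  have Eeta : eta = / 10 ^ 4 * / s ^ 6 by rewrite /eta -pow_inv; do 2 f_equal; rewrite /u; field; lra.
  have HG : 0 < 4 * PI ^ 2 * gz z by have := gz_ge_1 z; nra.
  have HG' : 0 < 4 * PI ^ 2 * gz z' by have := gz_ge_1 z'; nra.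
  have Ek : 4 * PI ^ 2 * gz z' = gz z' / gz z * (4 * PI ^ 2 * gz z) by field; have := gz_ge_1 z; lra.
  set A := 4 * PI ^ 2 * gz z in HR HG Ek. set A' := 4 * PI ^ 2 * gz z' in HR' HG' Ek.
  have Hs6 : 0 < s ^ 6 by apply pow_lt; lra.
  have Hs6' : s ^ 6 <= s' ^ 6 by apply pow_incr; lra.
  have C1 : Rabs (IZR (c n) - A) <= eta * A.
  { apply (Rmult_le_reg_r (s ^ 6)) => //. apply: Rle_trans HR _. right. rewrite Eeta. field. lra. }
  have C2 : Rabs (IZR (c (S n)) - A') <= eta * A'.
  { apply (Rmult_le_reg_r (s ^ 6)) => //. apply: (Rle_trans _ (Rabs (IZR (c (S n)) - A') * s' ^ 6)).
    - apply Rmult_le_compat_l => //. apply Rabs_pos.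
    - apply: Rle_trans HR' _. right. rewrite Eeta. field. lra. }
  move: C1 C2 => /Rabs_le_between C1 /Rabs_le_between C2.
  have Hcn : 0 < IZR (c n) by nra.
  have RU := gz_ratio_upper z z' Hz Hzz. have RL := gz_ratio_lower z z' ltac:(lra) Hzz.
  set rho := gz z' / gz z in RU RL Ek.
  have Hrho : 0 < rho by rewrite /rho; apply Rdiv_lt_0_compat; have := gz_ge_1 z; have := gz_ge_1 z'; lra.
  have T1 : ratio c n <= rho * (1 + 3 * eta).
  { rewrite /ratio. apply (Rmult_le_reg_r (IZR (c n))) => //. rewrite /Rdiv Rmult_assoc Rinv_l; last lra. rewrite Rmult_1_r.
    apply: (Rle_trans _ ((1 + eta) * (rho * A))); first by rewrite -Ek; lra.
    apply: (Rle_trans _ (rho * (1 + 3 * eta) * ((1 - eta) * A))); last by apply Rmult_le_compat_l; nra.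
    rewrite (_ : rho * (1 + 3 * eta) * ((1 - eta) * A) = (1 + 3 * eta) * (1 - eta) * (rho * A)); last ring.
    apply Rmult_le_compat_r; nra. }
  have T2 : rho * (1 - 3 * eta) <= ratio c n.
  { rewrite /ratio. apply (Rmult_le_reg_r (IZR (c n))) => //. rewrite /Rdiv (Rmult_assoc (IZR (c (S n)))) Rinv_l; last lra. rewrite Rmult_1_r.
    apply: (Rle_trans _ ((1 - eta) * (rho * A))); last by rewrite -Ek; lra.
    apply: (Rle_trans _ (rho * (1 - 3 * eta) * ((1 + eta) * A))); first by apply Rmult_le_compat_l; nra.
    rewrite (_ : rho * (1 - 3 * eta) * ((1 + eta) * A) = (1 - 3 * eta) * (1 + eta) * (rho * A)); last ring.
    apply Rmult_le_compat_r; nra. }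
  have Ezu : z = / u by rewrite /u Rinv_inv.
  have Ezu' : z' = / (u * / sg) by rewrite Ez' Ezu; field; lra.
  have [QU0 QL0] := Qb_rlit u ltac:(lra). rewrite -Ezu in QU0 QL0.
  have Hw : 0 < u * / sg by apply Rmult_lt_0_compat => //; apply Rinv_0_lt_compat; lra.
  have [QU1 QL1] := Qb_rlit (u * / sg) ltac:(lra). rewrite -Ezu' in QU1 QL1.
  have HQ0 := QbU_pos z Hz. have HQ1 := QbU_pos z' ltac:(lra).
  have [HL0 _] := QbL_bounds z ltac:(lra). have [HL1 _] := QbL_bounds z' ltac:(lra).
  have HE := Eb_pos z.
  have EG : forall b, gb b z' / gb b z = Eb z' / Eb z * (Qb b z' / Qb b z) by move=> b; rewrite /gb /Rdiv Rinv_mult; ring.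
  rewrite EG EE in RU. rewrite EG EE in RL.
  have W1 : pval (eW inv_lo) u <= u * / sg by rewrite pval_eW HP; apply Rmult_le_compat_l; lra.
  have W2 : u * / sg <= pval (eW inv_hi) u by rewrite pval_eW HP; apply Rmult_le_compat_l; lra.
  have W0 : 0 <= pval (eW inv_lo) u by rewrite pval_eW HP; apply Rmult_le_pos; lra.
  have Xpos : 0 <= pval (eX root_lo) u.
  { rewrite pval_eX HP. apply Rmult_le_pos; first nra. rewrite /rlit /root_lo /= /rat /=. nra. }
  have Xle : pval (eX root_hi) u <= 1.
  { rewrite pval_eX HP.
    have HuB : u <= 1 / 125.
    { rewrite /u /Rdiv Rmult_1_l. apply Rinv_le_contravar; [lra|nra]. }
    have : rlit root_hi P <= 6 / 10 by rewrite /rlit /root_hi /root_lo /= /rat /=; nra.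
    have : 16 * PI ^ 2 * u <= 158 * / 125 by nra.
    have : 0 <= 16 * PI ^ 2 * u by nra. nra. }
  have [XL _] := exp_Rh (pval (eX root_lo) u) 9 ltac:(lra). have [_ XU] := exp_Rh (pval (eX root_hi) u) 9 ltac:(lra).
  have XX1 := exp_mono _ _ X1. have XX2 := exp_mono _ _ X2.
  have [N1 N2] := pval_eN u. rewrite -/eta in N1 N2.
  have DU := eDup_nonneg u (Rlt_le _ _ Hu) HuX. have DL := eDlo_nonneg u (Rlt_le _ _ Hu) HuX.
  rewrite eDup_val pval_eP HP N1 -QU0 in DU. rewrite eDlo_val pval_eP HP N2 -QL0 in DL.
  have Hexp := exp_pos (z' - z). have Hy := exp_pos (- (3 / 2 * ln sg)). rewrite -/y in Hy.
  have QU2 := rlit_qU_anti _ _ W0 W1. rewrite -QU1 in QU2.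
  have QL2 := rlit_qL_anti _ _ _ W0 W1 W2. rewrite -QL1 in QL2.
  have Rh0 := Rh_nonneg 1 _ 9 ltac:(lra) Xpos 1.
  split.
  - apply: Rle_trans T2.
    apply: (product_lower _ _ _ _ _ _ _ _ _ _ _ _ _ _ _ _ RL DL); lra.
  - apply: (Rle_trans _ _ _ T1).
    apply: (product_upper _ _ _ _ _ _ _ _ _ _ _ _ _ _ _ RU DU); lra.
Qed.

(** * The range n < 100 *)

Fixpoint zsum (f : nat -> Z) (n : nat) : Z := match n with O => 0%Z | S m => (zsum f m + f m)%Z end.
Definition sigz (k : nat) (n : nat) : Z :=
  zsum (fun i => if Z.eqb (Z.of_nat n mod Z.of_nat (S i)) 0 then (Z.of_nat (S i) ^ Z.of_nat k)%Z else 0%Z) n.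

Lemma sigz_correct k n : IZR (sigz k n) = sig k n.
Proof.
  rewrite /sigz /sig /dsum.
  have E : forall f g m, (forall i, IZR (f i) = g i) -> IZR (zsum f m) = rsum g m.
  { move=> f g m H. elim: m => [|m IH] //=. by rewrite plus_IZR IH H. }
  apply E => i.
  have -> : Z.eqb (Z.of_nat n mod Z.of_nat (S i)) 0 = Nat.eqb (n mod S i) 0.
  { rewrite -Nat2Z.inj_mod. case: Nat.eqb_spec => H; case: Z.eqb_spec => H' //; lia. }
  case: (Nat.eqb _ _) => //. by rewrite -pow_IZR -INR_IZR_INZ.
Qed.

Fixpoint dot (a r : list Z) : Z :=
  match a, r with cons x a', cons y r' => (x * y + dot a' r')%Z | _, _ => 0%Z end.
(* [acc] holds the coefficients of the second factor already met, last one first. *)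
Fixpoint conv (a b acc : list Z) : list Z :=
  match b with nil => nil | cons y b' => cons (dot a (cons y acc)) (conv a b' (cons y acc)) end.

Definition reps (l : list Z) (a : nat -> R) : Prop := forall i, (i < length l)%nat -> IZR (nth i l 0%Z) = a i.
Definition rev_reps (r : list Z) (b : nat -> R) : Prop := forall i, (i < length r)%nat -> IZR (nth i r 0%Z) = b (length r - S i)%nat.

Lemma dot_sum a r m : length r = S m -> (S m <= length a)%nat ->
  IZR (dot a r) = sum_f_R0 (fun k => IZR (nth k a 0%Z) * IZR (nth k r 0%Z)) m.
Proof.
  elim: m a r => [|m IH] [|x a] [|y r] // Hr Ha; try (simpl in Ha; lia).
  - case: r Hr => [|y' r] // _. case: a {Ha} => [|? ?]; rewrite /= plus_IZR mult_IZR; ring.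
  - rewrite (decomp_sum _ (S m)); last lia. cbn [dot nth pred]. rewrite plus_IZR mult_IZR (IH a r) //; simpl in Hr, Ha; lia.
Qed.

Lemma dot_correct A r a b m : reps A a -> rev_reps r b -> length r = S m -> (S m <= length A)%nat ->
  IZR (dot A r) = sum_f_R0 (fun k => a k * b (m - k)%nat) m.
Proof.
  move=> HA Hr Hl Hm. rewrite (dot_sum A r m) //. apply sum_eq => i Hi.
  rewrite HA ?Hr; try lia. do 2 f_equal. lia.
Qed.

Lemma rev_reps_cons y r b : rev_reps r b -> IZR y = b (length r) -> rev_reps (cons y r) b.
Proof.
  move=> H Hy [|i] Hi; first by rewrite /= Nat.sub_0_r. simpl in Hi. rewrite /= H; last lia. done.
Qed.

Lemma conv_correct A a b : reps A a -> forall B acc, rev_reps acc b -> (forall i, (i < length B)%nat -> IZR (nth i B 0%Z) = b (length acc + i)%nat) ->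
  (length acc + length B <= length A)%nat ->
  length (conv A B acc) = length B /\ forall i, (i < length B)%nat -> IZR (nth i (conv A B acc) 0%Z) = PS_mult a b (length acc + i)%nat.
Proof.
  move=> HA. elim=> [|y B IH] acc Hacc HB Hl; first by split => // i /=; lia.
  have Hy : IZR y = b (length acc) by have := HB O ltac:(simpl; lia); rewrite Nat.add_0_r.
  have Hr := rev_reps_cons y acc b Hacc Hy.
  have [H1 H2] : length (conv A B (cons y acc)) = length B /\ forall i, (i < length B)%nat -> IZR (nth i (conv A B (cons y acc)) 0%Z) = PS_mult a b (length (cons y acc) + i)%nat.
  { apply IH => //.
    - move=> i Hi. have := HB (S i) ltac:(simpl; lia). simpl. move=> ->. f_equal. lia.
    - simpl in Hl |- *. lia. }
  split; first by rewrite /= H1.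
  move=> [|i] Hi; cbn [conv nth].
  - rewrite Nat.add_0_r (dot_correct A (cons y acc) a b (length acc)) //. simpl in Hl. lia.
  - rewrite H2; last by simpl in Hi; lia. f_equal. simpl. lia.
Qed.

Lemma conv_reps A B a b : reps A a -> reps B b -> (length B <= length A)%nat -> reps (conv A B nil) (PS_mult a b) /\ length (conv A B nil) = length B.
Proof.
  move=> HA HB Hl. have [H1 H2] := conv_correct A a b HA B nil ltac:(by move=> i /=; lia) HB Hl.
  split => // i Hi. rewrite H1 in Hi. by rewrite H2.
Qed.

(* The values of [u24], last one first; the divisions turn out to be exact, which [u24_check] verifies. *)
Fixpoint u24z (s : list Z) (n : nat) : list Z :=
  match n with
  | O => cons 1%Z nil
  | S m => let r := u24z s m in cons (24 * dot s r / Z.of_nat n)%Z r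
  end.
Fixpoint u24_check (s r : list Z) : bool :=
  match r with
  | nil => true
  | cons x nil => Z.eqb x 1
  | cons x r' => (Z.eqb (Z.of_nat (length r') * x) (24 * dot s r') && u24_check s r')%bool
  end.

Lemma u24_check_correct s r : reps s (fun i => sig 1 (S i)) -> (length r <= S (length s))%nat -> u24_check s r = true -> rev_reps r u24.
Proof.
  move=> Hs. elim: r => [|x r IH] Hl; first by move=> _ i /=; lia.
  case: r IH Hl => [|x' r] IH Hl.
  - cbn [u24_check]. move/Z.eqb_eq => -> [|i] Hi; last by simpl in Hi; lia. done.
  - set r' := cons x' r in IH Hl |- *.
    change (u24_check s (cons x r')) with (Z.eqb (Z.of_nat (length r') * x) (24 * dot s r') && u24_check s r')%bool.
    move/andb_prop => [/Z.eqb_eq H1 H2].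
    have Hr := IH ltac:(simpl in Hl |- *; lia) H2.
    apply rev_reps_cons => //.
    have E := f_equal IZR H1. rewrite !mult_IZR in E.
    rewrite (dot_correct s r' _ _ (length r) Hs Hr) // in E; last by simpl in Hl; lia.
    rewrite -u24_rec -INR_IZR_INZ in E. apply Rmult_eq_reg_l in E => //. apply not_0_INR. simpl. lia.
Qed.

Lemma rev_reps_rev r b : rev_reps r b -> reps (rev r) b.
Proof.
  move=> H i Hi. rewrite length_rev in Hi. rewrite rev_nth // H; last lia. f_equal. lia.
Qed.

Definition ncoef : nat := 102.
Definition e4l : list Z := cons 1%Z (map (fun n => (240 * sigz 3 n)%Z) (seq 1 (ncoef - 1))).
Definition s1l : list Z := map (fun n => sigz 1 n) (seq 1 ncoef).
Definition u24l : list Z := u24z s1l (ncoef - 1).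
Definition cl : list Z := conv (conv e4l (conv e4l e4l nil) nil) (rev u24l) nil.

Definition isqrt (n : nat) : Z * Z := let s := Z.sqrt (Z.of_nat n * 2 ^ 128) in (s, s + 1)%Z.
Definition iinv (x : Z * Z) : Z * Z := (2 ^ 128 / snd x, 2 ^ 128 / fst x + 1)%Z.
Definition iu (n : nat) : Z * Z := iinv (imul (imul (icst 4 1) (pi_lo, pi_hi)) (isqrt n)).
Definition range_check (l : list Z) (n : nat) : bool :=
  let x := iu n in
  let a := nth (S n) l 0%Z in let b := nth (S (S n)) l 0%Z in
  (Z.ltb 0 (fst (imul (imul (icst 4 1) (pi_lo, pi_hi)) (isqrt n))) && Z.ltb 0 (snd (imul (imul (icst 4 1) (pi_lo, pi_hi)) (isqrt n))) && Z.ltb 0 a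
   && Z.leb (snd (iheval (map (ppi Iops) fl) x) * a) (b * 2 ^ 64)
   && Z.leb (b * 2 ^ 64) (fst (iheval (map (ppi Iops) gl) x) * a))%bool.

Lemma u24_checked : u24_check s1l u24l = true.
Proof. by vm_compute. Qed.

Lemma range_checked : forallb (range_check cl) (seq 1 99) = true.
Proof. by vm_compute. Qed.

Lemma reps_map f b k N : (forall n, (k <= n)%nat -> IZR (f n) = b (n - k)%nat) -> reps (map f (seq k N)) b.
Proof.
  move=> H i Hi. rewrite length_map length_seq in Hi.
  rewrite (nth_indep _ _ (f 0%nat)); last by rewrite length_map length_seq.
  rewrite map_nth seq_nth // H; last lia. f_equal. lia.
Qed.

Lemma reps_e4l : reps e4l e4c.
Proof.
  move=> [|i] Hi //. simpl in Hi.
  change (IZR (nth i (map (fun n => (240 * sigz 3 n)%Z) (seq 1 (ncoef - 1))) 0%Z) = 240 * sig 3 (S i)).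
  apply (reps_map _ (fun j => 240 * sig 3 (S j))); last by rewrite length_map length_seq; rewrite /ncoef; lia.
  move=> n Hn. rewrite mult_IZR sigz_correct. do 2 f_equal. lia.
Qed.

Lemma length_u24z s n : length (u24z s n) = S n.
Proof. elim: n => [|n IH] //. change (S (length (u24z s n)) = S (S n)). by rewrite IH. Qed.

Lemma reps_cl c (Hc : j_fourier_coefficients c) : reps cl (cf c) /\ length cl = ncoef.
Proof.
  have Le : length e4l = ncoef by rewrite /e4l; cbn [length]; rewrite length_map length_seq.
  have Ls : length s1l = ncoef by rewrite /s1l length_map length_seq.
  have Lu0 : length u24l = ncoef by apply length_u24z.
  have Lu : length (rev u24l) = ncoef by rewrite length_rev.
  have Hs : reps s1l (fun i => sig 1 (S i)).
  { apply reps_map => n Hn. rewrite sigz_correct. f_equal. lia. }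
  have Hu : reps (rev u24l) u24.
  { have Hl : (length u24l <= S (length s1l))%nat by rewrite Lu0 Ls; apply Nat.le_succ_diag_r.
    exact (rev_reps_rev _ _ (u24_check_correct s1l u24l Hs Hl u24_checked)). }
  have [R2 L2] := conv_reps _ _ _ _ reps_e4l reps_e4l (Nat.le_refl _).
  have [R3 L3] := conv_reps _ _ _ _ reps_e4l R2 ltac:(lia).
  have [R4 L4] := conv_reps _ _ _ _ R3 Hu ltac:(lia).
  rewrite /cl. split; last by rewrite L4.
  move=> i Hi. rewrite (cf_coeffs c Hc i). exact (R4 i Hi).
Qed.

Lemma icontains_sqrt n : icontains (isqrt n) (sqrt (INR n)).
Proof.
  rewrite /isqrt /icontains. cbn [fst snd].
  have [H1 H2] := Z.sqrt_spec (Z.of_nat n * 2 ^ 128) ltac:(lia).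
  have H0 := Z.sqrt_nonneg (Z.of_nat n * 2 ^ 128). move: (Z.sqrt _) H0 H1 H2 => t H0 H1 H2.
  have Hn := pos_INR n. have HS := two64_pos. have Hq := sqrt_pos (INR n).
  have E : (sqrt (INR n) * 2 ^ 64) * (sqrt (INR n) * 2 ^ 64) = IZR (Z.of_nat n * 2 ^ 128).
  { rewrite mult_IZR -INR_IZR_INZ -(pow_IZR 2 128) (_ : 2 ^ 128 = 2 ^ 64 * 2 ^ 64); last by rewrite -pow_add.
    rewrite -{3}(sqrt_sqrt (INR n)) //. ring. }
  apply IZR_le in H1. apply IZR_lt in H2. rewrite -E in H1 H2. rewrite mult_IZR in H1. rewrite mult_IZR succ_IZR in H2. rewrite plus_IZR.
  apply IZR_le in H0. have : 0 <= sqrt (INR n) * 2 ^ 64 by nra.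
  move: (sqrt (INR n) * 2 ^ 64) H1 H2 => v H1 H2 Hv. split; nra.
Qed.

Lemma icontains_inv x r : (0 < fst x)%Z -> (0 < snd x)%Z -> icontains x r -> icontains (iinv x) (/ r).
Proof.
  move=> H1 H2. rewrite /icontains /iinv. cbn [fst snd]. move=> [L U].
  have HS := two64_pos. have P1 : 0 < IZR (fst x) by apply IZR_lt. have P2 : 0 < IZR (snd x) by apply IZR_lt.
  have Hr : 0 < r by nra.
  have E : IZR (2 ^ 128) = 2 ^ 64 * 2 ^ 64 by rewrite -(pow_IZR 2 128) -pow_add.
  have D1 := Z.mul_div_le (2 ^ 128) (snd x) H2. have D2 := Z.mul_succ_div_gt (2 ^ 128) (fst x) H1.
  have {}D1 := IZR_le _ _ D1. have {}D2 := IZR_lt _ _ D2.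
  rewrite mult_IZR E in D1. rewrite mult_IZR succ_IZR E in D2. rewrite plus_IZR.
  move: (IZR (2 ^ 128 / snd x)) (IZR (2 ^ 128 / fst x)) D1 D2 => p q D1 D2.
  move: (2 ^ 64) HS L U D1 D2 => M HM L U D1 D2.
  have HM2 : 0 < M * M by nra.
  have Hp : p * r <= M.
  { apply (Rmult_le_reg_r M) => //. case: (Rle_lt_dec 0 p) => Hp; nra. }
  have Hq : M <= (q + 1) * r.
  { apply (Rmult_le_reg_r M) => //. have : 0 < q + 1 by nra. nra. }
  split; apply (Rmult_le_reg_r r) => //; rewrite (_ : / r * M * r = M) //; field; lra.
Qed.

Lemma quotient_bounds F G a b f g : (0 < a)%Z -> (snd F * a <= b * 2 ^ 64)%Z -> (b * 2 ^ 64 <= fst G * a)%Z ->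
  icontains F f -> icontains G g -> f <= IZR b / IZR a <= g.
Proof.
  move=> Ha H1 H2 [_ HF] [HG _]. have HS := two64_pos.
  apply IZR_lt in Ha. apply IZR_le in H1. apply IZR_le in H2. rewrite (mult_IZR (snd F)) (mult_IZR b) in H1. rewrite (mult_IZR (fst G)) (mult_IZR b) in H2.
  change (2 ^ 64)%Z with (2 ^ ibits)%Z in H1, H2. rewrite IZR_shift in H1 H2.
  split; apply (Rmult_le_reg_r (IZR a)) => //; rewrite /Rdiv (Rmult_assoc (IZR b)) Rinv_l ?Rmult_1_r; try lra;
  apply (Rmult_le_reg_r (2 ^ 64)) => //; nra.
Qed.

Lemma small_range c (Hc : j_fourier_coefficients c) n : (1 <= n < 100)%nat -> f_fun n <= ratio c n <= g_fun n.
Proof.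
  move=> Hn. have [-> ->] := fg_poly n ltac:(lia).
  have [Hr Hl] := reps_cl c Hc.
  have := proj1 (forallb_forall (range_check cl) (seq 1 99)) range_checked n ltac:(apply in_seq; lia).
  rewrite /range_check. move/andb_prop => [/andb_prop [/andb_prop [/andb_prop [/Z.ltb_lt A1 /Z.ltb_lt A2] /Z.ltb_lt Hpos] /Z.leb_le H1] /Z.leb_le H2].
  have Ea : IZR (nth (S n) cl 0%Z) = IZR (c n) by apply (Hr (S n)); rewrite Hl /ncoef; lia.
  have Eb' : IZR (nth (S (S n)) cl 0%Z) = IZR (c (S n)) by apply (Hr (S (S n))); rewrite Hl /ncoef; lia.
  have Hx : icontains (iu n) (/ (4 * PI * sqrt (INR n))).
  { apply icontains_inv => //. apply icontains_mul; last by apply icontains_sqrt.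
    apply icontains_mul; last by apply icontains_pi. have := icontains_cst 4 1. by rewrite /Rdiv Rinv_1 Rmult_1_r. }
  have HL : forall l, lrel icontains None (map (ppi Iops) l) (map (ppi Rops) l).
  { move=> l. apply lrel_map_ppi.
    - apply icontains_add.
    - apply icontains_mul.
    - apply icontains_cst.
    - apply icontains_pi. }
  have F := iheval_correct _ _ _ _ (HL fl) Hx. have G := iheval_correct _ _ _ _ (HL gl) Hx.
  rewrite /ratio -Ea -Eb'. exact (quotient_bounds _ _ _ _ _ _ Hpos H1 H2 F G).
Qed.

Theorem theorem2p4 (c : nat -> Z) (Hc : j_fourier_coefficients c)
  (n : nat) (Hn : (1 <= n)%nat) :
  f_fun n <= ratio c n <= g_fun n.
Proof.
  case: (Nat.lt_ge_cases n 100) => H; [exact (small_range c Hc n (conj Hn H))|exact (asymptotic_range c Hc n H)].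
Qed.
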